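(* Let $(a_n)_{n\ge1}$ be a complex sequence with $a_n=O(n^\sigma)$ for some $\sigma\in\mathbb{R}_{>0}$, let $k\in\mathbb{Z}_{>0}$ be even, and let $N\in\{18,20,24\}$. For $\Re(s)>\sigma+1$ define $L_f(s)=\sum_{n=1}^\infty a_nn^{-s}$, and suppose that $$L_f(s)=\prod_{p\nmid N}\left(1-a_pp^{-s}+p^{k-1-2s}\right)^{-1}\prod_{p\mid N,\ p^2\nmid N}\left(1-p^{k/2-1-s}\right)^{-1}$$ (products over primes $p$). Let $\Lambda_f(s)=\Gamma_{\mathbb{C}}(s)L_f(s)$ and suppose $\Lambda_f(s)$ extends to an entire function that is bounded on every vertical strip and satisfies $$\Lambda_f(s)=(-1)^{k/2}N^{\frac k2-s}\Lambda_f(k-s).$$ Then $f(z)=\sum_{n=1}^\infty a_n\exp(2\pi inz)$ is a weight-$k$ modular form on $\Gamma_0(N)$.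
   Context: $\Gamma_{\mathbb{C}}(s)=(2\pi)^{-s}\Gamma(s)$. $f$ is a function on the upper half-plane $\mathcal{H}$. *)

(* Defs.v *)
From Stdlib Require Import Reals ZArith.
From mathcomp Require Import ssreflect ssrfun ssrbool eqtype ssrnat div prime bigop.
From Coquelicot Require Import Coquelicot.

Set Implicit Arguments.
Unset Strict Implicit.
Unset Printing Implicit Defensive.

Definition Cexp (z : C) : C :=
  ((exp (Re z) * cos (Im z))%R, (exp (Re z) * sin (Im z))%R).

(* [cpow x s] is x^s for real x > 0, with the real logarithm. *)
Definition cpow (x : R) (s : C) : C := Cexp (s * RtoC (ln x))%C.

(* Componentwise sum; a junk value if the series diverges. *)
Definition CSeries (u : nat -> C) : C :=
  (Series (fun n => Re (u n)), Series (fun n => Im (u n))).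

(* Euler's integral of t^(s-1) exp(-t) over ]0, +oo[, a correct definition of
   Gamma only for Re s > 0. *)
Definition CGamma (s : C) : C :=
  @RInt_gen C_R_CompleteNormedModule
    (fun t : R => (cpow t (s - 1) * RtoC (exp (- t)))%C)
    (at_right 0%R) (Rbar_locally p_infty).

(* The normalization here is (2 pi)^(-s) Gamma(s), without a factor 2. *)
Definition GammaC (s : C) : C := (cpow (2 * PI)%R (- s) * CGamma s)%C.

Definition holomorphic_at (f : C -> C) (z : C) : Prop :=
  @ex_derive C_AbsRing C_NormedModule f z.

Definition entire (f : C -> C) : Prop := forall z, holomorphic_at f z.

Definition bounded_on_vertical_strips (F : C -> C) : Prop :=
  forall x1 x2 : R, exists M : R,
    forall s : C, (x1 <= Re s <= x2)%R -> (Cmod (F s) <= M)%R.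

(* Sequences (a_n), n >= 1, are functions on nat whose value at 0 is ignored. *)
Definition dirichlet_series (a : nat -> C) (s : C) : C :=
  CSeries (fun n => (a n.+1 * cpow (INR n.+1) (- s))%C).

Definition fourier_series (a : nat -> C) (z : C) : C :=
  CSeries (fun n => (a n.+1 * Cexp (2 * PI * Ci * INR n.+1 * z))%C).

(* The product of F p over the primes p in P, taken in increasing order,
   converges to l. *)
Definition is_prime_prod (P : pred nat) (F : nat -> C) (l : C) : Prop :=
  filterlim
    (fun n : nat => \big[Cmult/RtoC 1]_(0 <= p < n | prime p && P p) F p)
    eventually (@locally C_UniformSpace l).

Record mat2Z := Mat2Z { ma : Z; mb : Z; mc : Z; md : Z }.

Definition SL2Z (g : mat2Z) : Prop := (ma g * md g - mb g * mc g = 1)%Z.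

Definition Gamma0 (N : nat) (g : mat2Z) : Prop :=
  SL2Z g /\ (Z.of_nat N | mc g)%Z.

Definition slash (k : nat) (g : mat2Z) (f : C -> C) (z : C) : C :=
  (/ ((IZR (mc g) * z + IZR (md g)) ^ k)
   * f ((IZR (ma g) * z + IZR (mb g)) / (IZR (mc g) * z + IZR (md g))))%C.

Definition holomorphic_on_H (f : C -> C) : Prop :=
  forall z : C, (0 < Im z)%R -> holomorphic_at f z.

(* f is given on the upper half-plane by a power series in exp(2 pi i z / h)
   for some integer h >= 1. *)
Definition holomorphic_at_infinity (f : C -> C) : Prop :=
  exists (h : nat) (c : nat -> C), (0 < h)%N /\
    forall z : C, (0 < Im z)%R ->
      @is_series C_AbsRing C_NormedModule
        (fun n => (c n * Cexp (2 * PI * Ci * INR n * z / INR h))%C) (f z).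

(* Weight-k modular forms on a subgroup G of finite index in SL2(Z), with
   trivial character; only the values of f on the upper half-plane matter. *)
Definition modular_form (k : nat) (G : mat2Z -> Prop) (f : C -> C) : Prop :=
  [/\ holomorphic_on_H f,
      forall g, G g -> forall z, (0 < Im z)%R -> slash k g f z = f z
    & forall g, SL2Z g -> holomorphic_at_infinity (slash k g f)].

(* Main.v *)
(** The recursions [a_(p n) = x_p a_n - y_p a_(n / p)] are read off the Euler product: multiplying
    [L_f] by finitely many Euler factors leaves a tail that tends to 1 so fast as [Re s] grows that
    its first Dirichlet coefficients are those of 1.  They say that [f] satisfies the Hecke relations
    at every prime.

    Hecke's argument turns the functional equation into [f|W = f] for [W = (0 -1; N 0)]; instead of
    inverting a Mellin transform, one subtracts the everywhere convergent parts, applies Liouville's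
    theorem to what is left, and concludes by the vanishing of all moments of a continuous function.

    [Gamma_0(N)] is not generated by [W] and the translations, so more elements fixing [f] are needed.
    As [p^2 | N] for [p = 2] (or [3]), [f] is annihilated by [1 + T + ... + T^(p-1)], [T] the
    translation by [1/p].  For [N = 20, 24] the Hecke relation at 3, resp. 5, compared with its
    [W]-conjugate, gives a matrix [g] such that [u = f|g - f] is an eigenfunction, with eigenvalue 1
    or -1, of an elliptic matrix of infinite order; then [u = 0], as one sees on the Taylor expansion
    at the fixed point.  For [N = 18] the relation at 2 shows that [f], [f|T] and one further
    translate span a space on which the group generated by [T] and [W] acts through its action on
    [P^1(F_3)].  A descent on the bottom row of a matrix then yields the invariance of [f].

    At a cusp, [f|g] is invariant under translation by [N] and grows polynomially as [Im z] tends to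
    infinity, so as a function of [q = exp(2 pi i z / N)] it has a removable singularity at 0. *)

Require Import Defs.
From HB Require Import structures.
From Stdlib Require Import Reals ZArith Lra Lia Psatz.
From mathcomp Require Import ssreflect ssrfun ssrbool eqtype ssrnat div prime bigop.
From Coquelicot Require Import Coquelicot.

Set Implicit Arguments.
Unset Strict Implicit.
Unset Printing Implicit Defensive.
Local Open Scope R_scope.

(** * Complex differentiability *)

(** The group actually treated is larger than [Gamma0 N]. Write N = p^2 K with p = 2 or 3, so that K
    = 5, 6, 2 for N = 20, 24, 18. Conjugating Gamma_0(K) by z |-> p z gives the matrices (a, b/p; p
    K c, d) with a d - K b c = 1; they include T, and Gamma_0(N) consists of those with p | b and p
    | c. On the bottom row (c, d), the powers of T reduce when |d/c| > K/2, and those of the lower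
    triangular L, a W-conjugate of the inverse of T, when |d/c| < 2. For K = 2 these ranges overlap,
    so T and L suffice; but f is no eigenfunction of T, and a whole space of translates has to be
    followed. For K = 5, 6 the function f is an eigenfunction of T and L with eigenvalue -1, but the
    range between 2 and K/2 is left open; the additional matrix found through a Hecke relation fills
    it. There the elliptic matrix has eigenvalue quotient zeta with zeta + 1/zeta = 2/9, resp.
    -46/25, not an algebraic integer, hence infinite order. *)

Definition ccont (f : C -> C) (z : C) : Prop :=
  forall e, 0 < e -> exists d, 0 < d /\
    forall w, Cmod (w - z) < d -> Cmod (f w - f z) < e.

Definition cderiv (f : C -> C) (z l : C) : Prop :=
  forall e, 0 < e -> exists d, 0 < d /\
    forall w, Cmod (w - z) < d ->
      Cmod (f w - f z - l * (w - z)) <= e * Cmod (w - z).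

(** Bridge between [holomorphic_at], phrased with filters on a complex normed module, and estimates
    in [Cmod]. *)
Lemma cderivP f z l :
  cderiv f z l <-> @is_derive C_AbsRing C_NormedModule f z l.
Proof.
split.
- move=> H; split; first exact: is_linear_scal_l.
  move=> x Hx.
  have -> : x = z by apply/esym; apply: (@is_filter_lim_locally_unique C_AbsRing (AbsRing_NormedModule C_AbsRing)).
  move=> [e He].
  have [d [Hd H']] := H e He.
  exists (mkposreal d Hd) => w Hw /=.
  have := H' w Hw.
  rewrite (_ : minus (minus (f w) (f z)) (scal (minus w z) l) = (f w - f z - l * (w - z))%C) //.
  rewrite /minus /plus /opp /scal /= /mult /=; ring.
- move=> [_ H] e He.
  have [d Hd] := H z (fun P H => H) (mkposreal e He).
  exists d; split; first exact: cond_pos.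
  move=> w Hw; have := Hd w Hw.
  rewrite (_ : minus (minus (f w) (f z)) (scal (minus w z) l) = (f w - f z - l * (w - z))%C) //.
  rewrite /minus /plus /opp /scal /= /mult /=; ring.
Qed.

Lemma holoP f z : holomorphic_at f z <-> exists l, cderiv f z l.
Proof.
by split=> -[l Hl]; exists l; apply/cderivP.
Qed.

Lemma Cmod_sub_sym z w : Cmod (z - w) = Cmod (w - z).
Proof. by rewrite -Cmod_opp; congr Cmod; ring. Qed.

Lemma Cmod_subrr z : Cmod (z - z) = 0.
Proof. by rewrite (_ : (z - z)%C = 0%C) ?Cmod_0 //; ring. Qed.

Lemma Cmod_triangle3 x y z : Cmod (x - z) <= Cmod (x - y) + Cmod (y - z).
Proof.
rewrite (_ : (x - z)%C = (x - y + (y - z))%C); first exact: Cmod_triangle.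
ring.
Qed.

Lemma Cmod_rev x y : Cmod x - Cmod y <= Cmod (x - y).
Proof.
have := Cmod_triangle (x - y) y.
rewrite (_ : (x - y + y)%C = x); [lra | ring].
Qed.

Lemma Cmod_pos (z : C) : z <> 0%C -> 0 < Cmod z.
Proof. exact: (proj1 (Cmod_gt_0 z)). Qed.

Lemma Cmod_neq0 (z : C) : 0 < Cmod z -> z <> 0%C.
Proof. exact: (proj2 (Cmod_gt_0 z)). Qed.

Lemma ccont_id z : ccont id z.
Proof. by move=> e He; exists e. Qed.

Lemma ccont_const c z : ccont (fun _ => c) z.
Proof. by move=> e He; exists 1; split; [lra | move=> w _; rewrite Cmod_subrr]. Qed.

Lemma ccont_plus f g z : ccont f z -> ccont g z -> ccont (fun w => f w + g w)%C z.
Proof.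
move=> Hf Hg e He.
have [d1 [H1 K1]] := Hf (e / 2) ltac:(lra).
have [d2 [H2 K2]] := Hg (e / 2) ltac:(lra).
exists (Rmin d1 d2); split; first exact: Rmin_pos.
move=> w Hw.
have A := K1 w (Rlt_le_trans _ _ _ Hw (Rmin_l _ _)).
have B := K2 w (Rlt_le_trans _ _ _ Hw (Rmin_r _ _)).
rewrite (_ : (f w + g w - (f z + g z))%C = ((f w - f z) + (g w - g z))%C); last by ring.
have := Cmod_triangle (f w - f z) (g w - g z); lra.
Qed.

Lemma ccont_mult f g z : ccont f z -> ccont g z -> ccont (fun w => f w * g w)%C z.
Proof.
move=> Hf Hg e He.
set M := Cmod (f z) + Cmod (g z) + 1.
have HM : 1 <= M by rewrite /M; have := Cmod_ge_0 (f z); have := Cmod_ge_0 (g z); lra.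
have He' : 0 < Rmin 1 (e / (2 * M)).
  by apply: Rmin_pos; [lra | apply: Rdiv_lt_0_compat; lra].
have [d1 [H1 K1]] := Hf _ He'.
have [d2 [H2 K2]] := Hg _ He'.
exists (Rmin d1 d2); split; first exact: Rmin_pos.
move=> w Hw.
have A := K1 w (Rlt_le_trans _ _ _ Hw (Rmin_l _ _)).
have B := K2 w (Rlt_le_trans _ _ _ Hw (Rmin_r _ _)).
rewrite (_ : (f w * g w - f z * g z)%C = ((f w - f z) * g w + f z * (g w - g z))%C); last by ring.
apply: Rle_lt_trans (Cmod_triangle _ _) _.
rewrite !Cmod_mult.
have G : Cmod (g w) <= M.
  have R1 := Rmin_l 1 (e / (2 * M)).
  have : Cmod (g w - g z) < 1 by lra.
  have := Cmod_rev (g w) (g z).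
  have := Cmod_ge_0 (f z); rewrite /M; lra.
have F : Cmod (f z) <= M by rewrite /M; have := Cmod_ge_0 (g z); lra.
have E := Rmin_r 1 (e / (2 * M)).
have A0 := Cmod_ge_0 (f w - f z).
have B0 := Cmod_ge_0 (g w - g z).
have e2 : e / (2 * M) * M = e / 2 by field; lra.
have : Cmod (f w - f z) * Cmod (g w) <= Cmod (f w - f z) * M by apply: Rmult_le_compat_l.
have : Cmod (f z) * Cmod (g w - g z) <= M * Cmod (g w - g z) by apply: Rmult_le_compat_r.
have : Cmod (f w - f z) * M < e / (2 * M) * M by apply: Rmult_lt_compat_r; lra.
have : M * Cmod (g w - g z) < M * (e / (2 * M)) by apply: Rmult_lt_compat_l; lra.
lra.
Qed.

Lemma ccont_comp f g z : ccont f z -> ccont g (f z) -> ccont (fun w => g (f w)) z.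
Proof.
move=> Hf Hg e /Hg [d [/Hf [d' [Hd' H]] K]].
by exists d'; split=> // w /H /K.
Qed.

Lemma ccont_inv (z : C) : z <> 0%C -> ccont Cinv z.
Proof.
move=> Hz e He.
have M0 : 0 < Cmod z by apply: Cmod_pos.
exists (Rmin (Cmod z / 2) (e * (Cmod z * Cmod z) / 2)); split.
  have M2 := Rmult_lt_0_compat _ _ M0 M0.
  apply: Rmin_pos; first lra.
  have := Rmult_lt_0_compat _ _ He M2; lra.
move=> w Hw.
have A := Rlt_le_trans _ _ _ Hw (Rmin_l _ _).
have B := Rlt_le_trans _ _ _ Hw (Rmin_r _ _).
have W : Cmod z / 2 < Cmod w.
  by have := Cmod_rev z w; rewrite Cmod_sub_sym; lra.
have Hw0 : w <> 0%C by apply: Cmod_neq0; lra.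
rewrite (_ : (/ w - / z)%C = ((z - w) / (w * z))%C); last by field.
rewrite Cmod_div; last exact: Cmult_neq_0.
rewrite Cmod_mult Cmod_sub_sym.
apply/Rlt_div_l; first by apply: Rmult_lt_0_compat; lra.
have P1 := Rmult_lt_0_compat _ _ He M0.
have P2 : 0 < Cmod w - Cmod z / 2 by lra.
have := Rmult_lt_0_compat _ _ P1 P2; lra.
Qed.

Lemma ccont_ext_loc f g z d : 0 < d ->
  (forall w, Cmod (w - z) < d -> f w = g w) -> ccont f z -> ccont g z.
Proof.
move=> Hd H Hf e /Hf [d' [Hd' K]].
exists (Rmin d d'); split; first exact: Rmin_pos.
move=> w Hw.
rewrite -!H ?Cmod_subrr //; last exact: Rlt_le_trans Hw (Rmin_l _ _).
apply: K; exact: Rlt_le_trans Hw (Rmin_r _ _).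
Qed.

(** With Caratheodory's criterion differentiability becomes continuity of a slope function, so that
    the product and chain rules reduce to continuity of sums, products and composites. *)
Lemma cderiv_caratheodory f z l :
  cderiv f z l <-> exists p, ccont p z /\ p z = l /\
    forall w, (f w - f z)%C = (p w * (w - z))%C.
Proof.
split.
- move=> H.
  exists (fun w => if Ceq_dec w z then l else (f w - f z) / (w - z))%C.
  split; last first.
    split; first by case: Ceq_dec.
    move=> w; case: Ceq_dec => Hw /=; first by rewrite Hw; ring.
    field; exact: Cminus_eq_contra.
  move=> e He; have [d [Hd K]] := H (e / 2) ltac:(lra).
  exists d; split=> // w Hw.
  case: (Ceq_dec z z) => [Ez|] //=.
  case: (Ceq_dec w z) => Hwz /=; first by rewrite Cmod_subrr.
  have N := Cminus_eq_contra _ _ Hwz.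
  have P : 0 < Cmod (w - z) by apply: Cmod_pos.
  rewrite (_ : ((f w - f z) / (w - z) - l)%C = ((f w - f z - l * (w - z)) / (w - z))%C); last by field.
  rewrite Cmod_div //; apply/Rlt_div_l => //.
  have := K w Hw; nra.
- move=> [p [Hp [<- H]]] e He.
  have [d [Hd K]] := Hp e He.
  exists d; split=> // w /K Hw.
  rewrite H (_ : (p w * (w - z) - p z * (w - z))%C = ((p w - p z) * (w - z))%C); last by ring.
  rewrite Cmod_mult; apply: Rmult_le_compat_r; [exact: Cmod_ge_0 | lra].
Qed.

Lemma cderiv_ccont f z l : cderiv f z l -> ccont f z.
Proof.
move/cderiv_caratheodory=> [p [Hp [_ H]]].
apply: (@ccont_ext_loc (fun w => f z + p w * (w + (- z)))%C _ _ 1); first lra.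
  move=> w _; have := H w => Hw.
  have -> : f w = (f z + (f w - f z))%C by ring.
  by rewrite Hw.
apply: ccont_plus; first exact: ccont_const.
apply: ccont_mult => //; apply: ccont_plus; [exact: ccont_id | exact: ccont_const].
Qed.

Lemma cderiv_const c z : cderiv (fun _ => c) z 0%C.
Proof.
apply/cderiv_caratheodory; exists (fun _ => 0%C); split; first exact: ccont_const.
by split=> // w; ring.
Qed.

Lemma cderiv_id z : cderiv id z 1%C.
Proof.
apply/cderiv_caratheodory; exists (fun _ => 1%C); split; first exact: ccont_const.
by split=> // w; rewrite /id; ring.
Qed.

Lemma cderiv_plus f g z a b :
  cderiv f z a -> cderiv g z b -> cderiv (fun w => f w + g w)%C z (a + b)%C.
Proof.
move=> /cderiv_caratheodory[p [Hp [<- H]]] /cderiv_caratheodory[q [Hq [<- K]]].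
apply/cderiv_caratheodory; exists (fun w => p w + q w)%C; split; first exact: ccont_plus.
split=> // w.
rewrite (_ : (f w + g w - (f z + g z))%C = ((f w - f z) + (g w - g z))%C); last by ring.
by rewrite H K; ring.
Qed.

Lemma cderiv_mult f g z a b :
  cderiv f z a -> cderiv g z b ->
  cderiv (fun w => f w * g w)%C z (a * g z + f z * b)%C.
Proof.
move=> F /cderiv_caratheodory[q [Hq [<- K]]].
have Cf := cderiv_ccont F.
move: F => /cderiv_caratheodory[p [Hp [<- H]]].
apply/cderiv_caratheodory; exists (fun w => p w * g z + f w * q w)%C; split.
  apply: ccont_plus; apply: ccont_mult => //; exact: ccont_const.
split=> // w.
rewrite (_ : (f w * g w - f z * g z)%C = ((f w - f z) * g z + f w * (g w - g z))%C); last by ring.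
by rewrite H K; ring.
Qed.

Lemma cderiv_comp f g z a b :
  cderiv f z a -> cderiv g (f z) b -> cderiv (fun w => g (f w)) z (b * a)%C.
Proof.
move=> F /cderiv_caratheodory[q [Hq [<- K]]].
have Cf := cderiv_ccont F.
move: F => /cderiv_caratheodory[p [Hp [<- H]]].
apply/cderiv_caratheodory; exists (fun w => q (f w) * p w)%C; split.
  by apply: ccont_mult => //; apply: ccont_comp.
by split=> // w; rewrite K H; ring.
Qed.

Lemma cderiv_inv (z : C) : z <> 0%C -> cderiv Cinv z (- (/ z * / z))%C.
Proof.
move=> Hz.
have M0 : 0 < Cmod z by apply: Cmod_pos.
move=> e He.
have C0 : ccont (fun w => / w)%C z by apply: ccont_inv.
have [d [Hd K]] := C0 (e * Cmod z) ltac:(nra).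
exists (Rmin d (Cmod z)); split; first exact: Rmin_pos.
move=> w Hw.
have Hw0 : w <> 0%C.
  move=> W; have := Rlt_le_trans _ _ _ Hw (Rmin_r _ _).
  rewrite W (_ : (0 - z)%C = (- z)%C); last by ring.
  rewrite Cmod_opp; lra.
have A := K w (Rlt_le_trans _ _ _ Hw (Rmin_l _ _)).
rewrite (_ : (/ w - / z - - (/ z * / z) * (w - z))%C = ((/ w - / z) * / z * (z - w))%C); last by field.
rewrite !Cmod_mult Cmod_inv // (Cmod_sub_sym z).
apply: Rmult_le_compat_r; first exact: Cmod_ge_0.
apply: Rlt_le; apply/Rlt_div_l => //; lra.
Qed.

Lemma cderiv_ext_loc f g z l d : 0 < d ->
  (forall w, Cmod (w - z) < d -> f w = g w) -> cderiv f z l -> cderiv g z l.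
Proof.
move=> Hd H Hf e /Hf [d' [Hd' K]].
exists (Rmin d d'); split; first exact: Rmin_pos.
move=> w Hw.
rewrite -!H ?Cmod_subrr //; last exact: Rlt_le_trans Hw (Rmin_l _ _).
apply: K; exact: Rlt_le_trans Hw (Rmin_r _ _).
Qed.

Lemma cderiv_unique f z a b : cderiv f z a -> cderiv f z b -> a = b.
Proof.
move=> /cderivP/is_C_derive_unique <- /cderivP/is_C_derive_unique <- //.
Qed.

Lemma cderiv_eq f z a b : cderiv f z a -> a = b -> cderiv f z b.
Proof. by move=> H <-. Qed.

Lemma cderiv_opp f z a : cderiv f z a -> cderiv (fun w => - f w)%C z (- a)%C.
Proof.
move=> H; have K := cderiv_mult (cderiv_const (-1)%C z) H.
apply: (@cderiv_ext_loc _ _ _ _ 1 _ _ (cderiv_eq K _)); [lra | move=> w _; ring | ring].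
Qed.

Lemma cderiv_minus f g z a b :
  cderiv f z a -> cderiv g z b -> cderiv (fun w => f w - g w)%C z (a - b)%C.
Proof. by move=> H K; apply: cderiv_plus => //; apply: cderiv_opp. Qed.

Lemma cderiv_pow n z : cderiv (fun w => w ^ n)%C z (INR n * z ^ n.-1)%C.
Proof.
elim: n => [|n IH].
  apply: cderiv_eq (cderiv_const 1%C z) _; rewrite /=; ring.
apply: (cderiv_eq (cderiv_mult (cderiv_id z) IH)).
rewrite S_INR RtoC_plus /id; case: n {IH} => [|n] /=; ring.
Qed.

Lemma cderiv_scal c f z a : cderiv f z a -> cderiv (fun w => c * f w)%C z (c * a)%C.
Proof. by move=> H; apply: cderiv_eq (cderiv_mult (cderiv_const c z) H) _; ring. Qed.

Lemma C_eq (x y : C) : Re x = Re y -> Im x = Im y -> x = y.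
Proof. by case: x y => [a b] [c d] /= -> ->. Qed.

Lemma im_le_Cmod (z : C) : Rabs (Im z) <= Cmod z.
Proof. exact: Rle_trans (Rmax_r _ _) (Rmax_Cmod z). Qed.

Lemma Cmod_le_Re_Im (z : C) : Cmod z <= Rabs (Re z) + Rabs (Im z).
Proof.
have -> : z = (RtoC (Re z) + Ci * RtoC (Im z))%C.
  by apply: C_eq => /=; ring.
apply: Rle_trans (Cmod_triangle _ _) _.
rewrite Cmod_mult Cmod_Ci !Cmod_R /=.
rewrite !(Rmult_0_l, Rmult_1_l, Rmult_0_r, Rminus_0_r, Rplus_0_r, Rplus_0_l); lra.
Qed.

Lemma Cexp_add x y : Cexp (x + y) = (Cexp x * Cexp y)%C.
Proof.
apply: C_eq; rewrite /Cexp re_plus im_plus exp_plus cos_plus sin_plus /=; ring.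
Qed.

Lemma Cexp_0 : Cexp 0 = 1%C.
Proof. by apply: C_eq; rewrite /Cexp /= ?cos_0 ?sin_0 exp_0; ring. Qed.

Lemma Cmod_Cexp z : Cmod (Cexp z) = exp (Re z).
Proof.
rewrite /Cmod /Cexp /=.
have -> : exp (Re z) * cos (Im z) * (exp (Re z) * cos (Im z) * 1) +
   exp (Re z) * sin (Im z) * (exp (Re z) * sin (Im z) * 1)
   = (exp (Re z))² * ((sin (Im z))² + (cos (Im z))²) by rewrite /Rsqr; ring.
rewrite sin2_cos2 Rmult_1_r sqrt_Rsqr //; exact/Rlt_le/exp_pos.
Qed.

Lemma Cexp_neq0 z : Cexp z <> 0%C.
Proof. apply: Cmod_neq0; rewrite Cmod_Cexp; exact: exp_pos. Qed.

Lemma Cexp_opp z : Cexp (- z) = (/ Cexp z)%C.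
Proof.
have H : (Cexp (- z) * Cexp z)%C = 1%C.
  by rewrite -Cexp_add (_ : (- z + z)%C = 0%C) ?Cexp_0 //; ring.
rewrite -[LHS]Cmult_1_r -(Cinv_r (Cexp z)); last exact: Cexp_neq0.
by rewrite Cmult_assoc H Cmult_1_l.
Qed.

Lemma Cexp_real (x : R) : Cexp x = RtoC (exp x).
Proof. by apply: C_eq; rewrite /Cexp /= ?cos_0 ?sin_0; ring. Qed.

Lemma Cexp_pow z n : (Cexp z ^ n)%C = Cexp (INR n * z).
Proof.
elim: n => [|n IH].
  by rewrite /= (_ : (0%R * z)%C = 0%C) ?Cexp_0 //; ring.
rewrite Cpow_S IH -Cexp_add S_INR RtoC_plus; congr Cexp; ring.
Qed.

Lemma mvt_bound (f df : R -> R) M :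
  (forall t, 0 <= t <= 1 -> is_derive f t (df t)) ->
  (forall t, 0 <= t <= 1 -> Rabs (df t) <= M) -> Rabs (f 1 - f 0) <= M.
Proof.
move=> H K.
have I t : Rmin 0 1 <= t <= Rmax 0 1 -> 0 <= t <= 1.
  by rewrite Rmin_left ?Rmax_right; lra.
have [||c [/I Hc ->]] := MVT_gen f 0 1 df.
- move=> x Hx; apply: H; apply: I; lra.
- move=> x /I Hx; apply: derivable_continuous_pt.
  exists (df x); apply/is_derive_Reals; exact: H.
rewrite Rminus_0_r Rmult_1_r; exact: K.
Qed.

Lemma exp_le x y : x <= y -> exp x <= exp y.
Proof. by case=> [/exp_increasing|->]; lra. Qed.

Lemma re_le_abs (z : C) : Re z <= Cmod z.
Proof. by have := re_le_Cmod z; have := Rle_abs (Re z); lra. Qed.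

(** Mean value inequality along t |-> [Cexp (t * h)]. It holds for real functions only, so it is
    applied to both components, at the cost of a factor 2. *)
Lemma Cexp_sub1 h : Cmod (Cexp h - 1) <= 2 * Cmod h * exp (Cmod h).
Proof.
set x := Re h; set y := Im h.
have B t : 0 <= t <= 1 -> Cmod (h * Cexp (RtoC t * h)) <= Cmod h * exp (Cmod h).
  move=> Ht; rewrite Cmod_mult Cmod_Cexp.
  apply: Rmult_le_compat_l; first exact: Cmod_ge_0.
  apply: exp_le; rewrite re_scal_l; have := re_le_abs h; have := Cmod_ge_0 h.
  nra.
have H1 : Rabs (Re (Cexp h - 1)%C) <= Cmod h * exp (Cmod h).
  have := @mvt_bound (fun t => exp (t * x) * cos (t * y))
    (fun t => Re (h * Cexp (RtoC t * h))%C) (Cmod h * exp (Cmod h)).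
  have -> : exp (1 * x) * cos (1 * y) - exp (0 * x) * cos (0 * y) = Re (Cexp h - 1)%C.
    rewrite !Rmult_1_l !Rmult_0_l exp_0 cos_0 /=; rewrite /x /y /Re /Im; ring.
  apply.
  - move=> t Ht; rewrite /Cexp /= -/x -/y; auto_derive => //.
    rewrite /x /y /Re /Im !(Rmult_0_l, Rminus_0_r, Rplus_0_r); ring.
  - move=> t Ht; exact: Rle_trans (re_le_Cmod _) (B t Ht).
have H2 : Rabs (Im (Cexp h - 1)%C) <= Cmod h * exp (Cmod h).
  have := @mvt_bound (fun t => exp (t * x) * sin (t * y))
    (fun t => Im (h * Cexp (RtoC t * h))%C) (Cmod h * exp (Cmod h)).
  have -> : exp (1 * x) * sin (1 * y) - exp (0 * x) * sin (0 * y) = Im (Cexp h - 1)%C.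
    rewrite !Rmult_1_l !Rmult_0_l exp_0 sin_0 /=; rewrite /x /y /Re /Im; ring.
  apply.
  - move=> t Ht; rewrite /Cexp /= -/x -/y; auto_derive => //.
    rewrite /x /y /Re /Im !(Rmult_0_l, Rminus_0_r, Rplus_0_r); ring.
  - move=> t Ht; exact: Rle_trans (im_le_Cmod _) (B t Ht).
have := Cmod_le_Re_Im (Cexp h - 1); lra.
Qed.

(** The same argument for t |-> [Cexp (t * h) - t * h], whose derivative is controlled by
    [Cexp_sub1]; hence the constant 4 = 2 * 2. *)
Lemma Cexp_sub2 h : Cmod (Cexp h - 1 - h) <= 4 * (Cmod h * Cmod h) * exp (Cmod h).
Proof.
set x := Re h; set y := Im h.
have B t : 0 <= t <= 1 ->
  Cmod (h * (Cexp (RtoC t * h) - 1)) <= 2 * (Cmod h * Cmod h) * exp (Cmod h).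
  move=> Ht; rewrite Cmod_mult.
  have T : Cmod (RtoC t * h) <= Cmod h.
    rewrite Cmod_mult Cmod_R Rabs_pos_eq; last lra.
    have := Cmod_ge_0 h; nra.
  have := Cexp_sub1 (RtoC t * h).
  have E := exp_le T; have E0 := exp_pos (Cmod (RtoC t * h)).
  have T0 := Cmod_ge_0 (RtoC t * h); have h0 := Cmod_ge_0 h.
  move=> K; have K' : Cmod (Cexp (RtoC t * h) - 1) <= 2 * Cmod h * exp (Cmod h).
    apply: Rle_trans K _; apply: Rmult_le_compat; lra.
  have := Rmult_le_compat_l _ _ _ h0 K'; lra.
set M := 2 * (Cmod h * Cmod h) * exp (Cmod h) in B *.
have H1 : Rabs (Re (Cexp h - 1 - h)%C) <= M.
  have := @mvt_bound (fun t => exp (t * x) * cos (t * y) - t * x)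
    (fun t => Re (h * (Cexp (RtoC t * h) - 1))%C) M.
  have -> : exp (1 * x) * cos (1 * y) - 1 * x - (exp (0 * x) * cos (0 * y) - 0 * x) = Re (Cexp h - 1 - h)%C.
    rewrite !Rmult_1_l !Rmult_0_l exp_0 cos_0 /=; rewrite /x /y /Re /Im; ring.
  apply.
  - move=> t Ht; rewrite /Cexp /= -/x -/y; auto_derive => //.
    rewrite /x /y /Re /Im !(Rmult_0_l, Rminus_0_r, Rplus_0_r); ring.
  - move=> t Ht; exact: Rle_trans (re_le_Cmod _) (B t Ht).
have H2 : Rabs (Im (Cexp h - 1 - h)%C) <= M.
  have := @mvt_bound (fun t => exp (t * x) * sin (t * y) - t * y)
    (fun t => Im (h * (Cexp (RtoC t * h) - 1))%C) M.
  have -> : exp (1 * x) * sin (1 * y) - 1 * y - (exp (0 * x) * sin (0 * y) - 0 * y) = Im (Cexp h - 1 - h)%C.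
    rewrite !Rmult_1_l !Rmult_0_l exp_0 sin_0 /=; rewrite /x /y /Re /Im; ring.
  apply.
  - move=> t Ht; rewrite /Cexp /= -/x -/y; auto_derive => //.
    rewrite /x /y /Re /Im !(Rmult_0_l, Rminus_0_r, Rplus_0_r); ring.
  - move=> t Ht; exact: Rle_trans (im_le_Cmod _) (B t Ht).
have := Cmod_le_Re_Im (Cexp h - 1 - h); rewrite /M in H1 H2; lra.
Qed.

Lemma cderiv_Cexp z : cderiv Cexp z (Cexp z).
Proof.
have H0 : cderiv Cexp 0 1.
  move=> e He; exists (Rmin 1 (e / (4 * exp 1))).
  have E1 := exp_pos 1.
  split; first by apply: Rmin_pos; [lra | apply: Rdiv_lt_0_compat; lra].
  move=> w; rewrite (_ : (w - 0)%C = w); last by ring.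
  move=> Hw; rewrite Cexp_0 Cmult_1_l.
  have A := Rlt_le_trans _ _ _ Hw (Rmin_l _ _).
  have B : Cmod w * (4 * exp 1) < e.
    apply/Rlt_div_r; [lra | exact: Rlt_le_trans Hw (Rmin_r _ _)].
  apply: Rle_trans (Cexp_sub2 w) _.
  have W := Cmod_ge_0 w.
  have X := exp_le (Rlt_le _ _ A).
  have Y : Cmod w * Cmod w * exp (Cmod w) <= Cmod w * Cmod w * exp 1.
    by apply: Rmult_le_compat_l => //; nra.
  have := Rmult_le_compat_r _ _ _ W (Rlt_le _ _ B); lra.
have S : cderiv (fun w => w - z)%C z 1%C.
  by apply: cderiv_eq (cderiv_minus (cderiv_id z) (cderiv_const z z)) _; ring.
have H1 : cderiv (fun w => Cexp z * Cexp (w - z))%C z (Cexp z * (1 * 1))%C.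
  apply: cderiv_scal; apply: (cderiv_comp S).
  by rewrite (_ : (z - z)%C = 0%C); [exact: H0 | ring].
apply: (@cderiv_ext_loc _ _ _ _ 1 _ _ (cderiv_eq H1 _)); [lra | | ring].
move=> w _; rewrite -Cexp_add; congr Cexp; ring.
Qed.

(** * Integrals and series of complex functions *)

(** Precomposition with [Re] extends [f] to the plane, so that the closure rules for [ccont] apply
    to functions of a real variable as they are. *)
Definition rcont (f : R -> C) (t : R) : Prop := ccont (fun w => f (Re w)) (RtoC t).

Lemma rcontP f t : rcont f t <->
  forall e, 0 < e -> exists d, 0 < d /\
    forall u, Rabs (u - t) < d -> Cmod (f u - f t) < e.
Proof.
split=> H e /H [d [Hd K]]; exists d; split=> // w Hw.
- by apply: (K (RtoC w)); rewrite -RtoC_minus Cmod_R.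
- apply: (K (Re w)); apply: Rle_lt_trans Hw.
  by have := re_le_Cmod (w - RtoC t); rewrite re_plus re_opp re_RtoC.
Qed.

Lemma rcont_continuous f t :
  rcont f t -> @continuous R_UniformSpace C_R_CompleteNormedModule f t.
Proof.
move/rcontP=> H P [[e He] HP].
have [d [Hd K]] := H e He.
exists (mkposreal d Hd) => u Hu; apply: HP.
have M := K u Hu.
have A := re_le_Cmod (f u - f t); have B := im_le_Cmod (f u - f t).
by split; [apply: Rle_lt_trans A M | apply: Rle_lt_trans B M].
Qed.

Lemma rcont_const c t : rcont (fun _ => c) t.
Proof. exact: ccont_const. Qed.

Lemma rcont_plus f g t : rcont f t -> rcont g t -> rcont (fun u => f u + g u)%C t.
Proof. exact: ccont_plus. Qed.

Lemma rcont_mult f g t : rcont f t -> rcont g t -> rcont (fun u => f u * g u)%C t.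
Proof. exact: ccont_mult. Qed.

Lemma rcont_comp f g t : rcont f t -> ccont g (f t) -> rcont (fun u => g (f u)) t.
Proof. by move=> H K; apply: (ccont_comp H). Qed.

Lemma rcont_opp f t : rcont f t -> rcont (fun u => - f u)%C t.
Proof.
move=> H; have K := rcont_mult (@rcont_const (-1)%C t) H.
apply: (@ccont_ext_loc _ _ _ 1 _ _ K) => [|w _]; [lra | rewrite /=; ring].
Qed.

Lemma rcont_RtoC f t : continuous f t -> rcont (fun u => RtoC (f u)) t.
Proof.
move=> H; apply/rcontP => e He.
have [d Hd] := H _ (locally_ball (f t) (mkposreal e He)).
exists d; split; first exact: cond_pos.
by move=> u Hu; rewrite -RtoC_minus Cmod_R; apply: Hd.
Qed.

Lemma rcont_id t : rcont RtoC t.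
Proof. apply: (@rcont_RtoC id); exact: continuous_id. Qed.

Lemma rcont_ext_loc f g t d : 0 < d ->
  (forall u, Rabs (u - t) < d -> f u = g u) -> rcont f t -> rcont g t.
Proof.
move=> Hd H; apply: (@ccont_ext_loc _ _ _ d) => // w Hw; apply: H.
apply: Rle_lt_trans Hw.
by have := re_le_Cmod (w - RtoC t); rewrite re_plus re_opp re_RtoC.
Qed.

Definition rderiv (f : R -> C) (t : R) (l : C) : Prop :=
  @is_derive R_AbsRing C_R_NormedModule f t l.

Lemma rderivP f t l : rderiv f t l <->
  forall e, 0 < e -> exists d, 0 < d /\
    forall u, Rabs (u - t) < d ->
      Cmod (f u - f t - l * RtoC (u - t)) <= e * Rabs (u - t).
Proof.
split.
- move=> [_ H] e He.
  have [d Hd] := H t (fun P H => H) (mkposreal e He).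
  exists d; split; first exact: cond_pos.
  move=> w Hw; have := Hd w Hw; rewrite /= -Cmod_norm.
  suff -> : (f w - f t - l * RtoC (w - t))%C =
    @minus C_R_NormedModule (@minus C_R_NormedModule (f w) (f t)) (@scal R_AbsRing C_R_NormedModule (minus w t) l) by [].
  by rewrite (scal_R_Cmult (w - t) l) Cmult_comm.
- move=> H; split; first exact: is_linear_scal_l.
  move=> x Hx.
  have -> : x = t by apply/esym; apply: (@is_filter_lim_locally_unique R_AbsRing (AbsRing_NormedModule R_AbsRing)).
  move=> [e He].
  have [d [Hd H']] := H e He.
  exists (mkposreal d Hd) => w Hw.
  have := H' w Hw; rewrite /= -Cmod_norm.
  suff -> : (f w - f t - l * RtoC (w - t))%C =
    @minus C_R_NormedModule (@minus C_R_NormedModule (f w) (f t)) (@scal R_AbsRing C_R_NormedModule (minus w t) l) by [].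
  by rewrite (scal_R_Cmult (w - t) l) Cmult_comm.
Qed.

Lemma rderiv_caratheodory f t l : rderiv f t l <->
  exists p, rcont p t /\ p t = l /\ forall u, (f u - f t)%C = (p u * RtoC (u - t))%C.
Proof.
split.
- move/rderivP => H.
  exists (fun w => if Req_EM_T w t then l else (f w - f t) / RtoC (w - t))%C.
  split; last first.
    split; first by case: Req_EM_T.
    move=> w; case: Req_EM_T => Hw /=; first by rewrite Hw RtoC_minus; ring.
    field; rewrite RtoC_minus; apply: Cminus_eq_contra => E; exact: (Hw (RtoC_inj _ _ E)).
  apply/rcontP => e He; have [d [Hd K]] := H (e / 2) ltac:(lra).
  exists d; split=> // w Hw.
  case: (Req_EM_T t t) => [Ez|] //=.
  case: (Req_EM_T w t) => Hwz /=; first by rewrite Cmod_subrr.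
  have P : 0 < Rabs (w - t) by apply: Rabs_pos_lt; lra.
  have N : RtoC (w - t) <> 0%C by apply: Cmod_neq0; rewrite Cmod_R.
  rewrite (_ : ((f w - f t) / RtoC (w - t) - l)%C = ((f w - f t - l * RtoC (w - t)) / RtoC (w - t))%C); last by field.
  rewrite Cmod_div //; apply/Rlt_div_l; rewrite Cmod_R //.
  have := K w Hw; nra.
- move=> [p [/rcontP Hp [<- H]]]; apply/rderivP => e He.
  have [d [Hd K]] := Hp e He.
  exists d; split=> // w /K Hw.
  rewrite H (_ : (p w * RtoC (w - t) - p t * RtoC (w - t))%C = ((p w - p t) * RtoC (w - t))%C); last by ring.
  rewrite Cmod_mult Cmod_R; apply: Rmult_le_compat_r; [exact: Rabs_pos | lra].
Qed.

Lemma rderiv_rcont f t l : rderiv f t l -> rcont f t.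
Proof.
move/rderiv_caratheodory=> [p [Hp [_ H]]].
apply: (@rcont_ext_loc (fun u => f t + p u * (RtoC u + (- RtoC t)))%C _ _ 1); first lra.
  move=> u _; have -> : f u = (f t + (f u - f t))%C by ring.
  by rewrite H RtoC_minus.
apply: rcont_plus; first exact: rcont_const.
apply: rcont_mult => //; apply: rcont_plus; [exact: rcont_id | exact: rcont_const].
Qed.

Lemma rderiv_comp f g t a b :
  rderiv f t a -> cderiv g (f t) b -> rderiv (fun u => g (f u)) t (b * a)%C.
Proof.
move=> F /cderiv_caratheodory[q [Hq [<- K]]].
have Cf := rderiv_rcont F.
move: F => /rderiv_caratheodory[p [Hp [<- H]]].
apply/rderiv_caratheodory; exists (fun w => q (f w) * p w)%C; split.
  by apply: rcont_mult => //; apply: rcont_comp.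
by split=> // w; rewrite K H; ring.
Qed.

Lemma rderiv_affine (a b : C) t : rderiv (fun u => a + RtoC u * b)%C t b.
Proof.
apply/rderiv_caratheodory; exists (fun _ => b); split; first exact: rcont_const.
by split=> // u; rewrite RtoC_minus; ring.
Qed.

Definition CInt (f : R -> C) (a b : R) : C := @RInt C_R_CompleteNormedModule f a b.
Definition cint (f : R -> C) (a b : R) (l : C) := @is_RInt C_R_NormedModule f a b l.

Lemma cint_unique f a b l : cint f a b l -> CInt f a b = l.
Proof. exact: (@is_RInt_unique C_R_CompleteNormedModule). Qed.

Lemma cint_fun f a b l l' : cint f a b l -> cint f a b l' -> l = l'.
Proof. by move=> /cint_unique <- /cint_unique <-. Qed.

Lemma CInt_correct f a b : a <= b -> (forall t, a <= t <= b -> rcont f t) ->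
  cint f a b (CInt f a b).
Proof.
move=> ab H; apply: (@RInt_correct C_R_CompleteNormedModule).
apply: ex_RInt_continuous => z; rewrite Rmin_left // Rmax_right // => Hz.
exact/rcont_continuous/H.
Qed.

Lemma cint_ext f g a b l : a <= b -> (forall t, a < t < b -> f t = g t) ->
  cint f a b l -> cint g a b l.
Proof.
move=> ab H; apply: is_RInt_ext => x; rewrite Rmin_left // Rmax_right //; exact: H.
Qed.

Lemma cint_plus f g a b l m : cint f a b l -> cint g a b m ->
  cint (fun t => f t + g t)%C a b (l + m)%C.
Proof. exact: (@is_RInt_plus C_R_NormedModule). Qed.

(** The integral takes values in C as a real module, where multiplication by a complex constant is
    not the scalar action; hence the passage to components. *)
Lemma cint_scal c f a b l : cint f a b l -> cint (fun t => c * f t)%C a b (c * l)%C.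
Proof.
move=> H.
have H1 : is_RInt (fun t => Re (f t)) a b (Re l) by apply: (is_RInt_fct_extend_fst _ _ _ _ H).
have H2 : is_RInt (fun t => Im (f t)) a b (Im l) by apply: (is_RInt_fct_extend_snd _ _ _ _ H).
apply: (@is_RInt_fct_extend_pair R_NormedModule R_NormedModule).
- apply: is_RInt_ext; last first.
    apply: (is_RInt_minus _ _ _ _ _ _ (is_RInt_scal _ _ _ (Re c) _ H1) (is_RInt_scal _ _ _ (Im c) _ H2)).
  by move=> x _; rewrite /minus /plus /opp /scal /= /mult /=.
- apply: is_RInt_ext; last first.
    apply: (is_RInt_plus _ _ _ _ _ _ (is_RInt_scal _ _ _ (Re c) _ H2) (is_RInt_scal _ _ _ (Im c) _ H1)).
  by move=> x _; rewrite /plus /scal /= /mult /=.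
Qed.

Lemma cint_Chasles f a b c l m : cint f a b l -> cint f b c m -> cint f a c (l + m)%C.
Proof. exact: (@is_RInt_Chasles C_R_NormedModule). Qed.

Lemma cint_bound f a b l M : a <= b -> (forall t, a <= t <= b -> Cmod (f t) <= M) ->
  cint f a b l -> Cmod l <= (b - a) * M.
Proof.
move=> ab H K; rewrite Cmod_norm.
apply: (@norm_RInt_le_const C_R_NormedModule f) K => // x Hx.
rewrite -[X in X <= _]Cmod_norm; exact: H.
Qed.

Lemma cint_derive F f a b : a <= b -> (forall t, a <= t <= b -> rderiv F t (f t)) ->
  (forall t, a <= t <= b -> rcont f t) -> cint f a b (F b - F a)%C.
Proof.
move=> ab H K.
apply: (@is_RInt_derive C_R_CompleteNormedModule) => x; rewrite Rmin_left // Rmax_right // => Hx.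
- exact: H.
- exact/rcont_continuous/K.
Qed.

Lemma cint_const c a b : cint (fun _ => c) a b (RtoC (b - a) * c)%C.
Proof. rewrite -scal_R_Cmult; exact: (@is_RInt_const C_R_NormedModule). Qed.

Lemma cint_affine f u v a b l : cint f (u * a + v) (u * b + v) l ->
  cint (fun t => RtoC u * f (u * t + v)%R)%C a b l.
Proof.
move/(is_RInt_comp_lin (V := C_R_NormedModule)); apply: is_RInt_ext => x _.
exact: scal_R_Cmult.
Qed.

Lemma cint_swap f a b l : cint f b a l -> cint f a b (- l)%C.
Proof. exact: (@is_RInt_swap C_R_NormedModule). Qed.

Lemma CInt_ext f g a b : a <= b -> (forall t, a < t < b -> f t = g t) ->
  CInt f a b = CInt g a b.
Proof.
move=> ab H; apply: (@RInt_ext C_R_CompleteNormedModule) => x; rewrite Rmin_left // Rmax_right //; exact: H.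
Qed.

(** The index [n] counts the terms: Coquelicot's [sum_n u n] has one term more. *)
Fixpoint csum (u : nat -> C) (n : nat) : C :=
  if n is S m then (csum u m + u m)%C else 0%C.

Definition cser (u : nat -> C) (l : C) : Prop :=
  forall e, 0 < e -> exists N, forall n, (N <= n)%coq_nat -> Cmod (csum u n - l) < e.

Lemma sum_n_csum u n : @sum_n C_AbelianMonoid u n = csum u (S n).
Proof.
elim: n => [|n IH]; first by rewrite sum_O /= Cplus_0_l.
by rewrite sum_Sn IH.
Qed.

Lemma cserP u l : cser u l <-> @is_series C_AbsRing C_NormedModule u l.
Proof.
rewrite /is_series; split=> H.
- apply/filterlim_locally_ball_norm => -[e He].
  have [N HN] := H e He.
  exists N => n Hn.
  rewrite /ball_norm sum_n_csum.
  have := HN (S n) ltac:(lia).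
  by [].
- move=> e He.
  have /filterlim_locally_ball_norm K := H.
  have [N HN] := K (mkposreal e He).
  exists (S N) => -[|n] Hn; first by lia.
  have := HN n ltac:(lia); rewrite /ball_norm sum_n_csum.
  by [].
Qed.

Lemma csum_re u n : Re (csum u (S n)) = sum_n (fun k => Re (u k)) n.
Proof.
elim: n => [|n IH]; first by rewrite sum_O /= Rplus_0_l.
by rewrite sum_Sn -IH.
Qed.

Lemma csum_im u n : Im (csum u (S n)) = sum_n (fun k => Im (u k)) n.
Proof.
elim: n => [|n IH]; first by rewrite sum_O /= Rplus_0_l.
by rewrite sum_Sn -IH.
Qed.

Lemma cser_re_im u l : cser u l <->
  is_series (fun n => Re (u n)) (Re l) /\ is_series (fun n => Im (u n)) (Im l).
Proof.
split.
- move=> H; split; apply/filterlim_locally => -[e He]; have [N HN] := H e He;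
    exists N => n Hn; rewrite /ball /= /AbsRing_ball /= /abs /minus /plus /opp /=;
    have K := HN (S n) ltac:(lia).
  + rewrite -csum_re; apply: Rle_lt_trans K.
    by have := re_le_Cmod (csum u n.+1 - l); rewrite re_plus re_opp.
  + rewrite -csum_im; apply: Rle_lt_trans K.
    by have := im_le_Cmod (csum u n.+1 - l); rewrite im_plus im_opp.
- move=> [/filterlim_locally H1 /filterlim_locally H2] e He.
  have He2 : 0 < e / 2 by lra.
  have [N1 K1] := H1 (mkposreal _ He2); have [N2 K2] := H2 (mkposreal _ He2).
  exists (S (N1 + N2)%coq_nat) => -[|n] Hn; first by lia.
  have := K1 n ltac:(lia); have := K2 n ltac:(lia).
  rewrite /ball /= /AbsRing_ball /= /abs /minus /plus /opp /= -csum_re -csum_im => A B.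
  have L := Cmod_le_Re_Im (csum u n.+1 - l); rewrite re_plus re_opp im_plus im_opp in L.
  apply: Rle_lt_trans L _; lra.
Qed.

Lemma CSeries_eq u l : cser u l -> CSeries u = l.
Proof.
by move=> /cser_re_im [/is_series_unique A /is_series_unique B]; rewrite /CSeries A B; case: l {A B}.
Qed.

Lemma cser_unique u l m : cser u l -> cser u m -> l = m.
Proof. by move=> /CSeries_eq <- /CSeries_eq <-. Qed.

Lemma cser_ext u v l : (forall n, u n = v n) -> cser u l -> cser v l.
Proof. by move=> H /cserP K; apply/cserP; apply: is_series_ext K. Qed.

Lemma cser_plus u v l m : cser u l -> cser v m -> cser (fun n => u n + v n)%C (l + m)%C.
Proof. by move=> /cserP H /cserP K; apply/cserP; apply: is_series_plus. Qed.

Lemma cser_scal c u l : cser u l -> cser (fun n => c * u n)%C (c * l)%C.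
Proof. by move=> /cserP H; apply/cserP; apply: (@is_series_scal C_AbsRing C_NormedModule c). Qed.

Lemma cser_minus u v l m : cser u l -> cser v m -> cser (fun n => u n - v n)%C (l - m)%C.
Proof.
move=> H K; have K' := cser_scal (-1)%C K.
apply: (cser_ext _ (l := (l - m)%C)); last first.
  have := cser_plus H K'; rewrite (_ : (l + -1 * m)%C = (l - m)%C); last by ring.
  exact.
by move=> n /=; ring.
Qed.

Lemma csum_shift u n : csum u (S n) = (u 0%nat + csum (fun k => u (S k)) n)%C.
Proof.
elim: n => [|n IH]; first by rewrite /=; ring.
rewrite -[LHS]/(csum u n.+1 + u n.+1)%C IH /=; ring.
Qed.

Lemma cser_shift u l : cser u l <-> cser (fun n => u (S n)) (l - u 0%nat)%C.
Proof.
split=> H e /H [N HN].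
- exists N => n Hn; have := HN (S n) ltac:(lia); rewrite csum_shift.
  rewrite (_ : (u 0%nat + csum (fun k : nat => u k.+1) n - l)%C =
    (csum (fun n0 : nat => u n0.+1) n - (l - u 0%nat))%C) //; ring.
- exists (S N) => -[|n] Hn; first by lia.
  have := HN n ltac:(lia); rewrite csum_shift.
  rewrite (_ : (u 0%nat + csum (fun k : nat => u k.+1) n - l)%C =
    (csum (fun n0 : nat => u n0.+1) n - (l - u 0%nat))%C) //; ring.
Qed.

Fixpoint rsum (u : nat -> R) (n : nat) : R :=
  if n is S m then rsum u m + u m else 0.

Lemma rsum_sum_n u n : sum_n u n = rsum u (S n).
Proof.
elim: n => [|n IH]; first by rewrite sum_O /= Rplus_0_l.
by rewrite sum_Sn IH.
Qed.

Lemma csum_bound u b n : (forall k, (k < n)%coq_nat -> Cmod (u k) <= b k) ->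
  Cmod (csum u n) <= rsum b n.
Proof.
elim: n => [|n IH] H /=; first by rewrite Cmod_0; lra.
apply: Rle_trans (Cmod_triangle _ _) _.
have := IH (fun k Hk => H k ltac:(lia)); have := H n ltac:(lia); lra.
Qed.

Lemma rsum_le_series b B n : (forall k, 0 <= b k) -> is_series b B -> rsum b n <= B.
Proof.
move=> H K.
have M m : rsum b m <= rsum b (S m) by rewrite /=; have := H m; lra.
apply: Rle_trans (M n) _.
rewrite -rsum_sum_n.
apply: (is_lim_seq_incr_compare (sum_n b) B) => // m.
rewrite !rsum_sum_n; exact: M.
Qed.

Lemma cser_abs u b B : (forall n, Cmod (u n) <= b n) -> is_series b B ->
  exists l, cser u l /\ Cmod l <= B.
Proof.
move=> H K.
have H0 n : 0 <= b n by apply: Rle_trans (H n); exact: Cmod_ge_0.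
have Eb : ex_series b by exists B.
have R1 : ex_series (fun n => Re (u n)).
  by apply: (ex_series_le _ b) => // n; apply: Rle_trans (re_le_Cmod _) (H n).
have R2 : ex_series (fun n => Im (u n)).
  by apply: (ex_series_le _ b) => // n; apply: Rle_trans (im_le_Cmod _) (H n).
exists (Series (fun n => Re (u n)), Series (fun n => Im (u n))).
have C1 : cser u (Series (fun n => Re (u n)), Series (fun n => Im (u n))).
  by apply/cser_re_im; split; apply: Series_correct.
split=> //.
apply: Rnot_lt_le => L.
have [N HN] := C1 _ (Rlt_Rminus _ _ L).
have := HN N ltac:(lia).
have := @csum_bound u b N (fun k _ => H k).
have := rsum_le_series N H0 K.
have := Cmod_rev (Series (fun n => Re (u n)), Series (fun n => Im (u n))) (csum u N).
rewrite Cmod_sub_sym; lra.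
Qed.

Lemma cser_le u b l B : (forall n, Cmod (u n) <= b n) -> is_series b B -> cser u l -> Cmod l <= B.
Proof.
by move=> H K L; have [m [Hm]] := cser_abs H K; rewrite (cser_unique L Hm).
Qed.

Lemma is_series_geom_shift K q : 0 <= q < 1 ->
  is_series (fun n => K * q ^ n) (K / (1 - q)).
Proof.
move=> Hq; apply: (is_series_scal_l K (fun n => q ^ n)).
by apply: is_series_geom; rewrite Rabs_pos_eq; lra.
Qed.

Lemma pow_lt_eps q e : 0 <= q < 1 -> 0 < e -> exists N, forall n, (N <= n)%coq_nat -> q ^ n < e.
Proof.
move=> Hq He.
have [|N HN] := pow_lt_1_zero q _ e He; first by rewrite Rabs_pos_eq; lra.
exists N => n Hn; have := HN n Hn; rewrite Rabs_pos_eq //; apply: pow_le; lra.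
Qed.

(** The increments form a geometrically dominated series, and so do its tails. Provides the common
    point of the nested triangles in [goursat]. *)
Lemma geom_limit (u : nat -> C) K q : 0 <= q < 1 ->
  (forall n, Cmod (u (S n) - u n) <= K * q ^ n) ->
  exists z, forall n, Cmod (z - u n) <= K / (1 - q) * q ^ n.
Proof.
move=> Hq H.
have T n m : csum (fun k => u (n + k).+1 - u (n + k)%nat)%C m = (u (n + m)%nat - u n)%C.
  elim: m => [|m IH] /=; first by rewrite addn0; ring.
  rewrite IH addnS; ring.
have A n : exists l, cser (fun k => u (n + k).+1 - u (n + k)%nat)%C l /\
    Cmod l <= (K * q ^ n) / (1 - q).
  apply: (@cser_abs _ (fun k => K * q ^ n * q ^ k)); last exact: is_series_geom_shift.
  by move=> k; rewrite Rmult_assoc -pow_add; exact: H.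
have [l [Hl _]] := A 0%nat.
exists (u 0%nat + l)%C => n.
have [m [Hm Bm]] := A n.
suff <- : m = (u 0%nat + l - u n)%C by apply: Rle_trans Bm _; right; field; lra.
apply: (cser_unique Hm) => e /Hl [N HN].
exists N => k Hk.
have := HN (n + k)%coq_nat ltac:(lia); rewrite !T add0n plusE.
rewrite (_ : (u (n + k)%N - u 0%nat - l)%C = (u (n + k)%N - u n - (u 0%nat + l - u n))%C) //; ring.
Qed.

(** * Goursat's lemma and Taylor expansions *)

Definition hol_closed_disc (f : C -> C) (r : R) : Prop :=
  forall z, Cmod z <= r -> exists l, cderiv f z l.

(** The contour integral of [f] along the segment from [a] to [b]. *)
Definition seg (f : C -> C) (a b : C) : C :=
  (CInt (fun t => f (a + RtoC t * (b - a))%C) 0 1 * (b - a))%C.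

Lemma seg_in r a b t : Cmod a <= r -> Cmod b <= r -> 0 <= t <= 1 ->
  Cmod (a + RtoC t * (b - a)) <= r.
Proof.
move=> Ha Hb Ht.
rewrite (_ : (a + RtoC t * (b - a))%C = (RtoC (1 - t) * a + RtoC t * b)%C); last first.
  by rewrite RtoC_minus; ring.
apply: Rle_trans (Cmod_triangle _ _) _.
rewrite !Cmod_mult !Cmod_R !Rabs_pos_eq; try lra.
have := Cmod_ge_0 a; have := Cmod_ge_0 b; nra.
Qed.

Definition cont_closed_disc (f : C -> C) (r : R) : Prop :=
  forall z, Cmod z <= r -> ccont f z.

Lemma hol_cont f r : hol_closed_disc f r -> cont_closed_disc f r.
Proof. by move=> H z /H [l /cderiv_ccont]. Qed.

Lemma rcont_affine (a b : C) t : rcont (fun u => a + RtoC u * b)%C t.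
Proof. exact: rderiv_rcont (rderiv_affine a b t). Qed.

Lemma seg_cint f r a b : cont_closed_disc f r -> Cmod a <= r -> Cmod b <= r ->
  cint (fun t => f (a + RtoC t * (b - a)))%C 0 1 (CInt (fun t => f (a + RtoC t * (b - a))%C) 0 1).
Proof.
move=> H Ha Hb; apply: CInt_correct; first lra.
move=> t Ht; apply: rcont_comp; first exact: rcont_affine.
apply: H; exact: seg_in.
Qed.

Lemma Cdiv2 (a b : C) : ((a + b) / 2)%C = (a + RtoC (/ 2) * (b - a))%C.
Proof. by rewrite RtoC_inv; [field | lra]. Qed.

Lemma seg_split f r a b : cont_closed_disc f r -> Cmod a <= r -> Cmod b <= r ->
  seg f a b = (seg f a ((a + b) / 2) + seg f ((a + b) / 2) b)%C.
Proof.
move=> H Ha Hb.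
have Hm : Cmod ((a + b) / 2) <= r by rewrite Cdiv2; apply: seg_in => //; lra.
set g := fun t => f (a + RtoC t * (b - a))%C.
have G1 : cint g 0 (/ 2) (CInt g 0 (/ 2)).
  apply: CInt_correct; first lra.
  move=> t Ht; apply: rcont_comp; first exact: rcont_affine.
  apply: H; apply: seg_in => //; lra.
have G2 : cint g (/ 2) 1 (CInt g (/ 2) 1).
  apply: CInt_correct; first lra.
  move=> t Ht; apply: rcont_comp; first exact: rcont_affine.
  apply: H; apply: seg_in => //; lra.
have G : cint g 0 1 (CInt g 0 1) by apply: seg_cint Ha Hb.
have E := cint_fun G (cint_Chasles G1 G2).
have K1 : (CInt (fun t => f (a + RtoC t * ((a + b) / 2 - a))%C) 0 1 = 2 * CInt g 0 (/ 2))%C.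
  apply: cint_unique.
  have := @cint_affine g (/ 2) 0 0 1 (CInt g 0 (/ 2)).
  rewrite Rmult_0_r Rplus_0_r Rmult_1_r Rplus_0_r => /(_ G1) /(@cint_scal 2).
  apply: cint_ext; first lra.
  move=> t _ /=; rewrite /g RtoC_plus RtoC_mult RtoC_inv; last lra.
  rewrite Cmult_assoc Cinv_r ?Cmult_1_l; last by apply: Cmod_neq0; rewrite Cmod_R Rabs_pos_eq; lra.
  congr f; field.
have K2 : (CInt (fun t => f ((a + b) / 2 + RtoC t * (b - (a + b) / 2))%C) 0 1 = 2 * CInt g (/ 2) 1)%C.
  apply: cint_unique.
  have := @cint_affine g (/ 2) (/ 2) 0 1 (CInt g (/ 2) 1).
  rewrite Rmult_0_r Rplus_0_l Rmult_1_r (_ : / 2 + / 2 = 1); last lra.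
  move=> /(_ G2) /(@cint_scal 2).
  apply: cint_ext; first lra.
  move=> t _ /=; rewrite /g RtoC_plus RtoC_mult RtoC_inv; last lra.
  rewrite Cmult_assoc Cinv_r ?Cmult_1_l; last by apply: Cmod_neq0; rewrite Cmod_R Rabs_pos_eq; lra.
  congr f; field.
rewrite /seg K1 K2 -/g E; field.
Qed.

Lemma seg_swap f r a b : cont_closed_disc f r -> Cmod a <= r -> Cmod b <= r ->
  seg f b a = (- seg f a b)%C.
Proof.
move=> H Ha Hb.
have G := seg_cint H Ha Hb.
set g := fun t => f (a + RtoC t * (b - a))%C in G.
suff E : CInt (fun t => f (b + RtoC t * (a - b))%C) 0 1 = CInt g 0 1.
  by rewrite /seg E -/g; ring.
apply: cint_unique.
have := @cint_affine g (-1) 1 0 1 (- CInt g 0 1).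
rewrite Rmult_0_r Rplus_0_l Rmult_1_r (_ : -1 + 1 = 0); last lra.
move=> /(_ (cint_swap G)) /(@cint_scal (-1)%C).
rewrite (_ : (-1 * - CInt g 0 1)%C = CInt g 0 1); last by ring.
apply: cint_ext; first lra.
move=> t _ /=; rewrite /g (_ : (a + RtoC (-1 * t + 1) * (b - a))%C = (b + RtoC t * (a - b))%C).
  ring.
by rewrite RtoC_plus RtoC_mult; ring.
Qed.

Lemma seg_bound f r a b M : cont_closed_disc f r -> Cmod a <= r -> Cmod b <= r ->
  (forall t, 0 <= t <= 1 -> Cmod (f (a + RtoC t * (b - a))%C) <= M) ->
  Cmod (seg f a b) <= M * Cmod (b - a).
Proof.
move=> H Ha Hb K; rewrite /seg Cmod_mult.
apply: Rmult_le_compat_r; first exact: Cmod_ge_0.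
have := cint_bound (M := M) _ _ (seg_cint H Ha Hb).
rewrite Rminus_0_r Rmult_1_l; apply; [lra | exact: K].
Qed.

Lemma seg_derive F f r a b : cont_closed_disc f r -> Cmod a <= r -> Cmod b <= r ->
  (forall z, Cmod z <= r -> cderiv F z (f z)) -> seg f a b = (F b - F a)%C.
Proof.
move=> H Ha Hb K.
have E : cint (fun t => (b - a) * f (a + RtoC t * (b - a)))%C 0 1 (F b - F a)%C.
  have -> : (F b - F a)%C = (F (a + RtoC 1 * (b - a)) - F (a + RtoC 0 * (b - a)))%C.
    congr (F _ - F _)%C; ring.
  apply: (@cint_derive (fun t => F (a + RtoC t * (b - a))%C)); first lra.
  - move=> t Ht; rewrite Cmult_comm.
    apply: (@rderiv_comp (fun u => a + RtoC u * (b - a))%C F); first exact: rderiv_affine.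
    apply: K; exact: seg_in.
  - move=> t Ht; apply: rcont_mult; first exact: rcont_const.
    apply: rcont_comp; first exact: rcont_affine.
    apply: H; exact: seg_in.
have S := @cint_scal (b - a)%C _ _ _ _ (seg_cint H Ha Hb).
by rewrite /seg Cmult_comm; exact: cint_fun S E.
Qed.

Lemma seg_plus f g r a b : cont_closed_disc f r -> cont_closed_disc g r ->
  Cmod a <= r -> Cmod b <= r ->
  seg (fun z => f z + g z)%C a b = (seg f a b + seg g a b)%C.
Proof.
move=> Hf Hg Ha Hb; rewrite /seg.
have := cint_plus (seg_cint Hf Ha Hb) (seg_cint Hg Ha Hb).
move/cint_unique => ->; ring.
Qed.

Definition tri := ((C * C) * C)%type.
Definition tint f (t : tri) : C :=
  (seg f t.1.1 t.1.2 + seg f t.1.2 t.2 + seg f t.2 t.1.1)%C.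
Definition per (t : tri) : R := Cmod (t.1.2 - t.1.1) + Cmod (t.2 - t.1.2) + Cmod (t.1.1 - t.2).
Definition tin (r : R) (t : tri) : Prop := Cmod t.1.1 <= r /\ Cmod t.1.2 <= r /\ Cmod t.2 <= r.
Definition mid (a b : C) : C := ((a + b) / 2)%C.
Definition sub1 (t : tri) : tri := (t.1.1, mid t.1.1 t.1.2, mid t.2 t.1.1).
Definition sub2 (t : tri) : tri := (mid t.1.1 t.1.2, t.1.2, mid t.1.2 t.2).
Definition sub3 (t : tri) : tri := (mid t.2 t.1.1, mid t.1.2 t.2, t.2).
Definition sub4 (t : tri) : tri := (mid t.1.1 t.1.2, mid t.1.2 t.2, mid t.2 t.1.1).
(** Some quarter of the triangle carries at least a quarter of the integral. It is found by deciding
    real inequalities; when the first three fail, the triangle inequality forces the fourth. *)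
Definition step f (t : tri) : tri :=
  if Rle_dec (Cmod (tint f t)) (4 * Cmod (tint f (sub1 t))) then sub1 t else
  if Rle_dec (Cmod (tint f t)) (4 * Cmod (tint f (sub2 t))) then sub2 t else
  if Rle_dec (Cmod (tint f t)) (4 * Cmod (tint f (sub3 t))) then sub3 t else sub4 t.

Lemma mid_in r a b : Cmod a <= r -> Cmod b <= r -> Cmod (mid a b) <= r.
Proof. by move=> Ha Hb; rewrite /mid Cdiv2; apply: seg_in => //; lra. Qed.

Lemma tint_split f r t : cont_closed_disc f r -> tin r t ->
  tint f t = (tint f (sub1 t) + tint f (sub2 t) + tint f (sub3 t) + tint f (sub4 t))%C.
Proof.
case: t => [[a b] c] H [/= Ha [Hb Hc]].
have [Ha' [Hb' Hc']] : Cmod (mid a b) <= r /\ Cmod (mid b c) <= r /\ Cmod (mid c a) <= r.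
  by split; [|split]; apply: mid_in.
rewrite /tint /= (seg_split H Ha Hb) (seg_split H Hb Hc) (seg_split H Hc Ha).
rewrite -!/(mid _ _).
rewrite (seg_swap H Ha' Hb') (seg_swap H Hb' Hc') (seg_swap H Hc' Ha').
ring.
Qed.

Lemma Cmod_half (z : C) : Cmod (z / 2) = Cmod z / 2.
Proof.
rewrite Cmod_div; first by rewrite Cmod_R Rabs_pos_eq; lra.
by apply: Cmod_neq0; rewrite Cmod_R Rabs_pos_eq; lra.
Qed.

Lemma step_spec f r t : cont_closed_disc f r -> tin r t ->
  [/\ tin r (step f t), per (step f t) <= per t / 2,
      Cmod ((step f t).1.1 - t.1.1) <= per t &
      Cmod (tint f t) <= 4 * Cmod (tint f (step f t))].
Proof.
move=> H Ht.
have E := tint_split H Ht.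
have T : Cmod (tint f t) <= Cmod (tint f (sub1 t)) + Cmod (tint f (sub2 t))
    + Cmod (tint f (sub3 t)) + Cmod (tint f (sub4 t)).
  rewrite {1}E.
  apply: Rle_trans (Cmod_triangle _ _) _; apply: Rplus_le_compat_r.
  apply: Rle_trans (Cmod_triangle _ _) _; apply: Rplus_le_compat_r.
  exact: Cmod_triangle.
clear E.
have P s : s = sub1 t \/ s = sub2 t \/ s = sub3 t \/ s = sub4 t ->
  [/\ tin r s, per s <= per t / 2 & Cmod (s.1.1 - t.1.1) <= per t].
  move: Ht {T}; case: t => [[a b] c] [/= Ha [Hb Hc]].
  have e1 : (mid a b - a)%C = ((b - a) / 2)%C by rewrite /mid; field.
  have e2 : (mid c a - mid a b)%C = ((c - b) / 2)%C by rewrite /mid; field.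
  have e3 : (a - mid c a)%C = ((a - c) / 2)%C by rewrite /mid; field.
  have e4 : (b - mid a b)%C = ((b - a) / 2)%C by rewrite /mid; field.
  have e5 : (mid b c - b)%C = ((c - b) / 2)%C by rewrite /mid; field.
  have e6 : (mid a b - mid b c)%C = ((a - c) / 2)%C by rewrite /mid; field.
  have e7 : (mid b c - mid c a)%C = ((b - a) / 2)%C by rewrite /mid; field.
  have e8 : (c - mid b c)%C = ((c - b) / 2)%C by rewrite /mid; field.
  have e9 : (mid c a - c)%C = ((a - c) / 2)%C by rewrite /mid; field.
  have f1 : (mid b c - mid a b)%C = ((c - a) / 2)%C by rewrite /mid; field.
  have f2 : (mid c a - mid b c)%C = ((a - b) / 2)%C by rewrite /mid; field.
  have f3 : (mid c a - a)%C = ((c - a) / 2)%C by rewrite /mid; field.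
  have f4 : (mid a b - mid c a)%C = ((b - c) / 2)%C by rewrite /mid; field.
  have s1 := Cmod_sub_sym a b. have s2 := Cmod_sub_sym b c. have s3 := Cmod_sub_sym c a.
  have p1 := Cmod_ge_0 (b - a). have p2 := Cmod_ge_0 (c - b). have p3 := Cmod_ge_0 (a - c).
  case=> [->|[->|[->|->]]]; (split; first by split; [|split] => //=; apply: mid_in);
    rewrite /per /= ?e1 ?e2 ?e3 ?e4 ?e5 ?e6 ?e7 ?e8 ?e9 ?f1 ?f2 ?f3 ?f4 ?Cmod_subrr ?Cmod_half; lra.
suff [S K] : (step f t = sub1 t \/ step f t = sub2 t \/ step f t = sub3 t \/ step f t = sub4 t)
    /\ Cmod (tint f t) <= 4 * Cmod (tint f (step f t)).
  by have [] := P _ S.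
rewrite /step; case: Rle_dec => L1; first by split=> //; left.
case: Rle_dec => L2; first by split=> //; right; left.
case: Rle_dec => L3; first by split=> //; right; right; left.
split; first by right; right; right.
have M1 := Rnot_le_lt _ _ L1; have M2 := Rnot_le_lt _ _ L2; have M3 := Rnot_le_lt _ _ L3.
rewrite /=; lra.
Qed.

Lemma tint_affine r t (u v : C) : tin r t -> tint (fun z => u + v * z)%C t = 0%C.
Proof.
move=> [Ha [Hb Hc]].
have D z : cderiv (fun z => u * z + v / 2 * (z * z))%C z (u + v * z)%C.
  apply: cderiv_eq.
    apply: cderiv_plus; apply: cderiv_scal; first exact: cderiv_id.
    apply: cderiv_mult; exact: cderiv_id.
  rewrite /=; field.
have K : cont_closed_disc (fun z => u + v * z)%C r.
  move=> z _; apply: ccont_plus; first exact: ccont_const.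
  apply: ccont_mult; [exact: ccont_const | exact: ccont_id].
by rewrite /tint !(@seg_derive (fun z => u * z + v / 2 * (z * z))%C _ r) //; ring.
Qed.

Lemma goursat f r t : hol_closed_disc f r -> tin r t -> tint f t = 0%C.
Proof.
move=> H Ht.
have Hc := hol_cont H.
set T := fun n => Nat.iter n (step f) t.
have TI n : tin r (T n).
  elim: n => [|n IH] //; by have [] := step_spec Hc IH.
have TP n : per (T n) <= per t * (/ 2) ^ n.
  elim: n => [|n IH] /=; first by rewrite Rmult_1_r /T /=; lra.
  have [_ K _ _] := step_spec Hc (TI n).
  rewrite -/(T n) in K *; change (per (step f (T n)) <= per t * (/ 2 * (/ 2) ^ n)); lra.
have TT n : Cmod (tint f t) <= 4 ^ n * Cmod (tint f (T n)).
  elim: n => [|n IH] /=; first by rewrite Rmult_1_l /T /=; lra.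
  have [_ _ _ K] := step_spec Hc (TI n).
  have := Rmult_le_compat_l _ _ _ (pow_le 4 n ltac:(lra)) K.
  change (T n.+1) with (step f (T n)); lra.
have [z Hz] : exists z, forall n, Cmod (z - (T n).1.1) <= per t / (1 - / 2) * (/ 2) ^ n.
  apply: geom_limit; first lra.
  move=> n; have [_ _ K _] := step_spec Hc (TI n).
  apply: Rle_trans (TP n); exact: K.
have P0 : 0 <= per t.
  by rewrite /per; have := Cmod_ge_0 (t.1.2 - t.1.1); have := Cmod_ge_0 (t.2 - t.1.2);
    have := Cmod_ge_0 (t.1.1 - t.2); lra.
have Zr : Cmod z <= r.
  apply: Rnot_lt_le => L.
  have [|N HN] := @pow_lt_eps (/ 2) ((Cmod z - r) / (2 * per t + 1)) ltac:(lra).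
    by apply: Rdiv_lt_0_compat; lra.
  have /(Rlt_div_r _ _ (2 * per t + 1) ltac:(lra)) K := HN N ltac:(lia).
  have [A _] := TI N.
  have := Cmod_rev z (T N).1.1; have := Hz N; have := pow_le (/ 2) N ltac:(lra).
  rewrite (_ : per t / (1 - / 2) = 2 * per t); last by field.
  nra.
have [l Hl] := H z Zr.
apply: Cmod_eq_0; apply: Rle_antisym; last exact: Cmod_ge_0.
apply: le_epsilon => e He; rewrite Rplus_0_l.
(* After N bisections the integral over [t] is at most 4^N times ([e'] times the distance bound 3
   [per t] q) times the perimeter bound [per t] q, where q = 2^(-N). As 4^N q^2 = 1, this is 3 [e']
   ([per t])^2, which is at most [e]. *)
set e' := e / (4 * per t * per t + 1).
have D0 : 0 < 4 * per t * per t + 1 by nra.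
have He' : 0 < e' by apply: Rdiv_lt_0_compat.
have [d [Hd K]] := Hl e' He'.
have [|N HN] := @pow_lt_eps (/ 2) (d / (4 * per t + 1)) ltac:(lra).
  by apply: Rdiv_lt_0_compat; lra.
have /(Rlt_div_r _ _ (4 * per t + 1) ltac:(lra)) HN' := HN N ltac:(lia).
apply: Rle_trans (TT N) _.
set q := (/ 2) ^ N in HN' *.
have q0 : 0 < q by apply: pow_lt; lra.
have near s : Cmod (s - (T N).1.1) <= per (T N) -> Cmod (s - z) <= 3 * per t * q.
  move=> Hs; have := Cmod_triangle3 s (T N).1.1 z; have := Hz N; have := TP N.
  rewrite -/q (Cmod_sub_sym z) (_ : per t / (1 - / 2) = 2 * per t); last by field.
  lra.
have [Ia [Ib Ic]] := TI N.
(* The affine approximation of [f] at [z] has a primitive and integrates to 0 over a triangle, so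
   only the remainder counts. *)
set g := fun w => (f w + (- f z + l * z + - l * w))%C.
have Ca : cont_closed_disc (fun w => (- f z + l * z + - l * w))%C r.
  move=> w _; apply: ccont_plus; first exact: ccont_const.
  apply: ccont_mult; [exact: ccont_const | exact: ccont_id].
have Cg : cont_closed_disc g r by move=> w Hw; apply: ccont_plus; [exact: Hc | exact: Ca].
have E : tint f (T N) = tint g (T N).
  rewrite {2}/tint !(seg_plus Hc Ca) //.
  have := tint_affine (- f z + l * z)%C (- l)%C (TI N); rewrite /tint => E.
  rewrite -[LHS]Cplus_0_r -E /tint; ring.
have gb w : Cmod (w - z) <= 3 * per t * q -> Cmod (g w) <= e' * (3 * per t * q).
  move=> Hw; rewrite /g.
  rewrite (_ : (f w + (- f z + l * z + - l * w))%C = (f w - f z - l * (w - z))%C); last by ring.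
  apply: Rle_trans (K w _) _; last by apply: Rmult_le_compat_l; lra.
  apply: Rle_lt_trans Hw _; nra.
have edge a b : Cmod a <= r -> Cmod b <= r -> Cmod (a - z) <= 3 * per t * q ->
    Cmod (b - z) <= 3 * per t * q -> Cmod (seg g a b) <= e' * (3 * per t * q) * Cmod (b - a).
  move=> Ha Hb Na Nb; apply: (seg_bound Cg) => // s Hs; apply: gb.
  rewrite (_ : (a + RtoC s * (b - a) - z)%C = ((a - z) + RtoC s * ((b - z) - (a - z)))%C); last by ring.
  exact: seg_in.
have p1 := Cmod_ge_0 ((T N).1.2 - (T N).1.1).
have p2 := Cmod_ge_0 ((T N).2 - (T N).1.2).
have p3 := Cmod_ge_0 ((T N).1.1 - (T N).2).
have Na : Cmod ((T N).1.1 - z) <= 3 * per t * q by apply: near; rewrite Cmod_subrr /per; lra.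
have Nb : Cmod ((T N).1.2 - z) <= 3 * per t * q by apply: near; rewrite /per; lra.
have Nc : Cmod ((T N).2 - z) <= 3 * per t * q by apply: near; rewrite Cmod_sub_sym /per; lra.
have B : Cmod (tint f (T N)) <= e' * (3 * per t * q) * per (T N).
  set K0 := e' * (3 * per t * q) in edge *.
  rewrite E /tint /per.
  apply: Rle_trans (Cmod_triangle _ _) _.
  have := Cmod_triangle (seg g (T N).1.1 (T N).1.2) (seg g (T N).1.2 (T N).2).
  have := edge _ _ Ia Ib Na Nb; have := edge _ _ Ib Ic Nb Nc; have := edge _ _ Ic Ia Nc Na.
  lra.
have F4 : 4 ^ N * (q * q) = 1.
  rewrite /q -Rpow_mult_distr -Rpow_mult_distr (_ : 4 * (/ 2 * / 2) = 1); last lra.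
  exact: pow1.
have B2 : e' * (3 * per t * q) * per (T N) <= e' * (3 * per t * q) * (per t * q).
  apply: Rmult_le_compat_l; last exact: TP.
  apply: Rmult_le_pos; [lra | have := Rmult_le_pos _ _ P0 (Rlt_le _ _ q0); lra].
have B3 : 4 ^ N * Cmod (tint f (T N)) <= 4 ^ N * (e' * (3 * per t * q) * (per t * q)).
  by apply: Rmult_le_compat_l; [apply: pow_le; lra | lra].
apply: Rle_trans B3 _.
rewrite (_ : 4 ^ N * (e' * (3 * per t * q) * (per t * q)) = 4 ^ N * (q * q) * (e' * (3 * per t * per t))); last by ring.
rewrite F4 Rmult_1_l.
have : e' * (4 * per t * per t + 1) = e by rewrite /e'; field; lra.
nra.
Qed.

(** * Complex power series *)

Lemma bernoulli_pow r n : 0 < r < 1 -> INR n * r ^ n <= r / (1 - r).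
Proof.
move=> Hr.
have P := pow_lt r n (proj1 Hr).
have := poly n (/ r - 1).
have I : 1 < / r.
  apply: (Rmult_lt_reg_l r); [lra | rewrite Rinv_r; lra].
move=> /(_ ltac:(lra)); rewrite (_ : 1 + (/ r - 1) = / r); last lra.
rewrite pow_inv => H.
have H2 := Rmult_le_compat_r _ _ _ (Rlt_le _ _ P) H.
rewrite Rinv_l in H2; last lra.
apply/(Rle_div_r (INR n * r ^ n) r (1 - r)); first lra.
have E : r * / r = 1 by field; lra.
have : r * ((1 + INR n * (/ r - 1)) * r ^ n) <= r * 1 by apply: Rmult_le_compat_l; lra.
rewrite (_ : r * ((1 + INR n * (/ r - 1)) * r ^ n) = r * r ^ n + INR n * r ^ n * (r * / r - r)); last by ring.
rewrite E => L; have := Rmult_le_pos r (r ^ n) ltac:(lra) ltac:(lra) => L2. lra.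
Qed.

(** Each factor n is absorbed by enlarging the ratio: with p halfway between q and 1 and q <= r p, r
    < 1, [bernoulli_pow] bounds n r^n. *)
Lemma ex_series_poly_geom j q : 0 <= q < 1 -> ex_series (fun n => INR n ^ j * q ^ n).
Proof.
elim: j q => [|j IH] q Hq.
  apply: (ex_series_ext (fun n => q ^ n)); first by move=> n /=; ring.
  by apply: ex_series_geom; rewrite Rabs_pos_eq; lra.
set p := (1 + q) / 2.
set r := (q + p) / 2 / p.
have Hp : q < p < 1 by rewrite /p; lra.
have Hr : 0 < r < 1.
  split; first by apply: Rdiv_lt_0_compat; lra.
  apply/Rlt_div_l; lra.
have Hqr : q <= r * p by rewrite /r; field_simplify; lra.
apply: (ex_series_le _ (fun n => scal (r / (1 - r)) (INR n ^ j * p ^ n))); last first.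
  apply: ex_series_scal; apply: IH; lra.
move=> n; rewrite /norm /= /abs /= /scal /= /mult /=.
have N0 := pow_le (INR n) j (pos_INR n).
rewrite Rabs_pos_eq; last first.
  apply: Rmult_le_pos; last by apply: pow_le; lra.
  apply: Rmult_le_pos => //; exact: pos_INR.
have K : q ^ n <= r ^ n * p ^ n by rewrite -Rpow_mult_distr; apply: pow_incr; lra.
have B := bernoulli_pow n Hr.
have P := pow_le p n ltac:(lra).
have N1 := pos_INR n.
apply: Rle_trans (_ : INR n * INR n ^ j * (r ^ n * p ^ n) <= _).
  by apply: Rmult_le_compat_l => //; apply: Rmult_le_pos.
rewrite (_ : INR n * INR n ^ j * (r ^ n * p ^ n) = (INR n * r ^ n) * (INR n ^ j * p ^ n)); last by ring.
by apply: Rmult_le_compat_r => //; apply: Rmult_le_pos.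
Qed.

Lemma csum_single u n : (u n = csum u (S n) - csum u n)%C.
Proof. rewrite /=; ring. Qed.

Lemma cser_term_bounded u l : cser u l -> exists K, forall n, Cmod (u n) <= K.
Proof.
move=> H; have [N HN] := H 1 ltac:(lra).
have T n : (N <= n)%coq_nat -> Cmod (u n) <= 2.
  move=> Hn; rewrite csum_single.
  have := HN n Hn; have := HN n.+1 ltac:(lia).
  have := Cmod_triangle3 (csum u n.+1) l (csum u n).
  rewrite (Cmod_sub_sym l); lra.
have F m : exists K, forall n, (n < m)%coq_nat -> Cmod (u n) <= K.
  elim: m => [|m [K HK]]; first by exists 0 => n; lia.
  exists (Rmax K (Cmod (u m))) => n Hn.
  have [e|e] : n = m \/ (n < m)%coq_nat by lia.
    by rewrite e; exact: Rmax_r.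
  exact: Rle_trans (HK n e) (Rmax_l _ _).
have [K HK] := F N.
exists (Rmax K 2) => n.
case: (Nat.lt_ge_cases n N) => [/HK|/T] A; [exact: Rle_trans A (Rmax_l _ _) | exact: Rle_trans A (Rmax_r _ _)].
Qed.

Lemma pow_series_coef_bound c r l : 0 < r -> cser (fun n => c n * RtoC r ^ n)%C l ->
  exists K, 0 <= K /\ forall n, Cmod (c n) <= K / r ^ n.
Proof.
move=> Hr /cser_term_bounded [K HK]; exists K; split.
  exact: Rle_trans (Cmod_ge_0 _) (HK 0%nat).
move=> n; apply/Rle_div_r; first exact: pow_lt.
have := HK n; rewrite Cmod_mult Cmod_pow Cmod_R Rabs_pos_eq; lra.
Qed.

(** If all earlier coefficients vanish, the terms after c_n w^n are O(w^(n+1)), so w -> 0 gives c_n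
    = 0. Positive real points suffice, which makes this usable for identities known on a half-line
    only. *)
Lemma pow_series_unique c r : 0 < r ->
  (forall w : R, 0 < w < r -> cser (fun n => c n * RtoC w ^ n)%C 0%C) ->
  forall n, c n = 0%C.
Proof.
move=> Hr H.
have [|K [K0 HK]] := @pow_series_coef_bound c (r / 2) 0 ltac:(lra).
  by apply: H; lra.
set s := r / 2 in HK.
have Hs : 0 < s by rewrite /s; lra.
have main n : (forall k, (k < n)%coq_nat -> c k = 0%C) -> c n = 0%C.
  move=> Z.
  apply: Cmod_eq_0; apply: Rle_antisym; last exact: Cmod_ge_0.
  apply: le_epsilon => e He; rewrite Rplus_0_l.
  have Pn := pow_lt s n.+1 Hs.
  set w := Rmin (s / 2) (e * s ^ n.+1 / (2 * K + 1)).
  have W0 : 0 < w.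
    apply: Rmin_pos; first lra.
    by apply: Rdiv_lt_0_compat; [apply: Rmult_lt_0_compat | lra].
  have W1 : w <= s / 2 := Rmin_l _ _.
  have W2 : w * (2 * K + 1) <= e * s ^ n.+1 by apply/Rle_div_r; [lra | exact: Rmin_r].
  have Hw : cser (fun n => c n * RtoC w ^ n)%C 0%C by apply: H; rewrite /s in W1; lra.
  have S m : (m <= n)%coq_nat -> csum (fun k => c k * RtoC w ^ k)%C m = 0%C.
    elim: m => [|m IH] Hm //=; rewrite IH ?Z; try lia; ring.
  have Q : 0 <= w / s < 1.
    split; first by apply: Rlt_le; apply: Rdiv_lt_0_compat.
    apply/Rlt_div_l; lra.
  have Q2 : w / s <= / 2 by apply/Rle_div_l; lra.
  have Tl : cser (fun k => c (n + k)%nat * RtoC w ^ (n + k)%nat)%C 0%C.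
    move=> e1 /Hw [N HN]; exists N => m Hm.
    have -> : csum (fun k => c (n + k)%nat * RtoC w ^ (n + k)%nat)%C m
       = csum (fun k => c k * RtoC w ^ k)%C (n + m)%nat.
      elim: m {Hm} => [|m IH]; first by rewrite addn0 S.
      by rewrite addnS /= IH.
    by apply: HN; rewrite -plusE; lia.
  move/cser_shift: Tl; rewrite /= addn0 => Tl.
  have B : Cmod (0 - c n * RtoC w ^ n) <= (K * (w / s) ^ n.+1) / (1 - w / s).
    apply: (cser_le _ _ Tl (b := fun k => (K * (w / s) ^ n.+1) * (w / s) ^ k)); last first.
      exact: is_series_geom_shift.
    move=> k; rewrite Cmod_mult Cmod_pow Cmod_R Rabs_pos_eq; last lra.
    rewrite Rmult_assoc -pow_add plusE addSnnS.
    rewrite /Rdiv Rpow_mult_distr pow_inv.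
    have := HK (n + k.+1)%nat; have := pow_le w (n + k.+1) ltac:(lra).
    move=> P Q'; have := Rmult_le_compat_r _ _ _ P Q'; rewrite /Rdiv; lra.
  have E1 : Cmod (0 - c n * RtoC w ^ n) = Cmod (c n) * w ^ n.
    rewrite (_ : (0 - c n * RtoC w ^ n)%C = (- (c n * RtoC w ^ n))%C); last by ring.
    by rewrite Cmod_opp Cmod_mult Cmod_pow Cmod_R Rabs_pos_eq; lra.
  have Wn := pow_lt w n W0.
  have B2 : (K * (w / s) ^ n.+1) / (1 - w / s) <= 2 * (K * (w / s) ^ n.+1).
    have X : 0 <= K * (w / s) ^ n.+1 by apply: Rmult_le_pos => //; apply: pow_le; lra.
    apply/Rle_div_l; nra.
  have E2 : (w / s) ^ n.+1 = w * w ^ n / s ^ n.+1.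
    by rewrite /Rdiv Rpow_mult_distr pow_inv.
  have B3 : Cmod (c n) * w ^ n <= 2 * K * w / s ^ n.+1 * w ^ n.
    rewrite -E1; apply: Rle_trans B _; apply: Rle_trans B2 _; rewrite E2 /Rdiv; right; ring.
  have B4 := Rmult_le_reg_r _ _ _ Wn B3.
  apply: Rle_trans B4 _.
  apply/Rle_div_l => //; lra.
move=> n; elim/(well_founded_induction lt_wf): n => n IH; exact: main.
Qed.

(** Second-order remainder of the n-th power. Multiplying by [r * r] avoids the exponent n - 2, and
    with it the exceptional cases n = 0, 1. *)
Lemma pow_diff_bound (z h : C) r n : 0 < r -> Cmod z <= r -> Cmod (z + h) <= r ->
  Cmod ((z + h) ^ n - z ^ n - INR n * z ^ n.-1 * h) * (r * r)
    <= (INR n * INR n) * (Cmod h * Cmod h) * r ^ n.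
Proof.
move=> Hr Hz Hzh; elim: n => [|n IH].
  rewrite /= (_ : (1 - 1 - 0%R * 1 * h)%C = 0%C) ?Cmod_0; [lra | ring].
have -> : ((z + h) ^ n.+1 - z ^ n.+1 - INR n.+1 * z ^ n.+1.-1 * h)%C =
  ((z + h) * ((z + h) ^ n - z ^ n - INR n * z ^ n.-1 * h) + INR n * z ^ n.-1 * (h * h))%C.
  rewrite S_INR RtoC_plus; case: n {IH} => [|n] /=; ring.
have h0 := Cmod_ge_0 h.
have hh : 0 <= Cmod h * Cmod h by nra.
have I0 := pos_INR n.
have rn := pow_lt r n Hr.
have T2 : Cmod (INR n * z ^ n.-1 * (h * h)) * (r * r) <= INR n * (Cmod h * Cmod h) * (r * r ^ n).
  rewrite !Cmod_mult Cmod_R Cmod_pow Rabs_pos_eq //.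
  case: n {IH rn} I0 => [|n] I0 /=; first by lra.
  have P := pow_incr (Cmod z) r n (conj (Cmod_ge_0 z) Hz).
  have X : 0 <= INR n.+1 * (Cmod h * Cmod h) * (r * r) by apply: Rmult_le_pos; [apply: Rmult_le_pos | nra].
  have := Rmult_le_compat_l _ _ _ X P.
  rewrite -/(INR n.+1); lra.
have T1 : Cmod ((z + h) * ((z + h) ^ n - z ^ n - INR n * z ^ n.-1 * h)) * (r * r)
   <= r * ((INR n * INR n) * (Cmod h * Cmod h) * r ^ n).
  rewrite Cmod_mult Rmult_assoc; apply: Rmult_le_compat => //; first exact: Cmod_ge_0.
  apply: Rmult_le_pos; [exact: Cmod_ge_0 | nra].
have TT := Cmod_triangle ((z + h) * ((z + h) ^ n - z ^ n - INR n * z ^ n.-1 * h)) (INR n * z ^ n.-1 * (h * h)).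
have rr : 0 <= r * r by nra.
have := Rmult_le_compat_r _ _ _ rr TT.
rewrite S_INR /=.
have : 0 <= (INR n + 1) * (Cmod h * Cmod h) * (r * r ^ n).
  by apply: Rmult_le_pos; [apply: Rmult_le_pos; lra | nra].
lra.
Qed.

(** Two radii between |z| and [r]: coefficients are bounded on the larger, [r2], points vary inside
    the smaller, [r1]. The second-order remainders are then dominated by n^2 (r1/r2)^n, uniformly in
    the point. *)
Lemma pow_series_cderiv c F r z : Cmod z < r ->
  (forall w, Cmod w < r -> cser (fun n => c n * w ^ n)%C (F w)) ->
  exists l, cderiv F z l /\ cser (fun n => INR n.+1 * c n.+1 * z ^ n)%C l.
Proof.
move=> Hz H.
have z0 := Cmod_ge_0 z.
set r1 := (Cmod z + r) / 2; set r2 := (r1 + r) / 2.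
have R1 : Cmod z < r1 by rewrite /r1; lra.
have R2 : r1 < r2 by rewrite /r2 /r1; lra.
have R3 : r2 < r by rewrite /r2 /r1; lra.
have [|K [K0 HK]] := @pow_series_coef_bound c r2 (F (RtoC r2)) ltac:(lra).
  by apply: H; rewrite Cmod_R Rabs_pos_eq; lra.
set q := r1 / r2.
have Hq : 0 < q < 1.
  split; first by apply: Rdiv_lt_0_compat; lra.
  apply/Rlt_div_l; lra.
have cb n : Cmod (c n) * r1 ^ n <= K * q ^ n.
  rewrite /q /Rdiv Rpow_mult_distr pow_inv.
  have := Rmult_le_compat_r _ _ _ (pow_le r1 n ltac:(lra)) (HK n); rewrite /Rdiv; lra.
have [B1 HB1] := @ex_series_poly_geom 1 q ltac:(lra).
have [B2 HB2] := @ex_series_poly_geom 2 q ltac:(lra).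
have HB1' : is_series (fun n => K / r1 * (INR n ^ 1 * q ^ n)) (K / r1 * B1).
  by apply: (is_series_scal_l (K / r1) _ _ HB1).
have [|l0 [Hl0 _]] := @cser_abs (fun n => INR n * c n * z ^ n.-1)%C _ _ _ HB1'.
  move=> n; rewrite !Cmod_mult Cmod_R Cmod_pow Rabs_pos_eq; last exact: pos_INR.
  case: n => [|n]; first by rewrite /=; lra.
  have P : Cmod z ^ n.+1.-1 <= r1 ^ n by apply: pow_incr; lra.
  have C0 := Rmult_le_pos _ _ (pos_INR n.+1) (Cmod_ge_0 (c n.+1)).
  apply: Rle_trans (Rmult_le_compat_l _ _ _ C0 P) _.
  have := cb n.+1; have I := pos_INR n.+1.
  move=> Q; have := Rmult_le_compat_l _ _ _ I Q; rewrite pow_1.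
  move=> Q'; rewrite (_ : K / r1 * (INR n.+1 * q ^ n.+1) = (INR n.+1 * (K * q ^ n.+1)) / r1); last by rewrite /Rdiv; ring.
  apply: (proj1 (Rle_div_r _ _ r1 _)); first lra.
  move: Q'; rewrite -tech_pow_Rmult; lra.
exists l0; split; last first.
  move/cser_shift: Hl0.
  rewrite (_ : (l0 - INR 0 * c 0%nat * z ^ 0.-1)%C = l0); last by rewrite /=; ring.
  by apply: cser_ext.
have B20 : 0 <= B2.
  have := @rsum_le_series (fun n => INR n ^ 2 * q ^ n) B2 0 _ HB2; apply=> k.
  by apply: Rmult_le_pos; apply: pow_le; [exact: pos_INR | lra].
set D := K / (r1 * r1) * B2.
have r11 : 0 < r1 * r1 by nra.
have D0 : 0 <= D.
  by apply: Rmult_le_pos => //; apply: Rdiv_le_0_compat.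
move=> e He.
exists (Rmin (r1 - Cmod z) (e / (D + 1))).
split; first by apply: Rmin_pos; [lra | apply: Rdiv_lt_0_compat; lra].
move=> w Hw.
have Hw1 := Rlt_le_trans _ _ _ Hw (Rmin_l _ _).
have Hw2 : Cmod (w - z) * (D + 1) < e.
  by apply/Rlt_div_r; [lra | exact: Rlt_le_trans Hw (Rmin_r _ _)].
have Hwr : Cmod w <= r1 by have := Cmod_rev w z; lra.
have S1 : cser (fun n => c n * w ^ n)%C (F w) by apply: H; lra.
have S2 : cser (fun n => c n * z ^ n)%C (F z) by apply: H; lra.
have S3 := cser_minus (cser_minus S1 S2) (@cser_scal (w - z) _ _ Hl0).
have h0 := Cmod_ge_0 (w - z).
have Hsum : is_series (fun n => K / (r1 * r1) * (Cmod (w - z) * Cmod (w - z)) * (INR n ^ 2 * q ^ n))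
   (K / (r1 * r1) * (Cmod (w - z) * Cmod (w - z)) * B2).
  by apply: (is_series_scal_l (K / (r1 * r1) * (Cmod (w - z) * Cmod (w - z))) _ _ HB2).
have := cser_le _ Hsum S3.
rewrite (_ : (F w - F z - (w - z) * l0)%C = (F w - F z - l0 * (w - z))%C); last by ring.
move=> L; apply: Rle_trans (L _) _.
  move=> n.
  rewrite (_ : (c n * w ^ n - c n * z ^ n - (w - z) * (INR n * c n * z ^ n.-1))%C
    = (c n * (w ^ n - z ^ n - INR n * z ^ n.-1 * (w - z)))%C); last by ring.
  have := @pow_diff_bound z (w - z) r1 n ltac:(lra) ltac:(lra).
  rewrite (_ : (z + (w - z))%C = w); last by ring.
  move=> /(_ Hwr) P.
  rewrite Cmod_mult.
  apply: (Rmult_le_reg_r (r1 * r1)) => //.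
  rewrite Rmult_assoc.
  apply: Rle_trans (Rmult_le_compat_l _ _ _ (Cmod_ge_0 (c n)) P) _.
  have n2 : 0 <= INR n * INR n * (Cmod (w - z) * Cmod (w - z)).
    by apply: Rmult_le_pos; apply: Rmult_le_pos => //; exact: pos_INR.
  have Q := Rmult_le_compat_l _ _ _ n2 (cb n).
  rewrite (_ : K / (r1 * r1) * (Cmod (w - z) * Cmod (w - z)) * (INR n ^ 2 * q ^ n) * (r1 * r1)
    = INR n * INR n * (Cmod (w - z) * Cmod (w - z)) * (K * q ^ n)); last by field; lra.
  apply: Rle_trans Q; right; ring.
rewrite (_ : K / (r1 * r1) * (Cmod (w - z) * Cmod (w - z)) * B2 = Cmod (w - z) * (Cmod (w - z) * D)); last by rewrite /D; ring.
rewrite [e * _]Rmult_comm; apply: Rmult_le_compat_l => //; lra.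
Qed.

(** * Integrals over circles, Taylor coefficients and Liouville's theorem *)

Definition circ (r : R) (t : R) : C := (RtoC r * Cexp (Ci * RtoC t))%C.

Lemma Cmod_circ r t : 0 <= r -> Cmod (circ r t) = r.
Proof.
move=> Hr; rewrite /circ Cmod_mult Cmod_Cexp Cmod_R Rabs_pos_eq //.
rewrite (_ : Re (Ci * RtoC t)%C = 0); last by rewrite /=; ring.
rewrite exp_0; ring.
Qed.

Lemma rderiv_Cexp_lin (u : C) t : rderiv (fun s => Cexp (u * RtoC s)) t (Cexp (u * RtoC t) * u)%C.
Proof.
apply: (@rderiv_comp (fun s => u * RtoC s)%C Cexp); last exact: cderiv_Cexp.
have := rderiv_affine 0 u t => /rderivP H; apply/rderivP => e /H [d [Hd K]].
exists d; split=> // s /K.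
by rewrite (_ : (0 + RtoC s * u - (0 + RtoC t * u) - u * RtoC (s - t))%C =
   (u * RtoC s - u * RtoC t - u * RtoC (s - t))%C) //; ring.
Qed.

Lemma rderiv_circ r t : rderiv (circ r) t (Ci * circ r t)%C.
Proof.
have H := rderiv_Cexp_lin Ci t.
have M : cderiv (fun w => RtoC r * w)%C (Cexp (Ci * RtoC t)) (RtoC r * 1)%C.
  by apply: cderiv_scal; exact: cderiv_id.
have := rderiv_comp H M; rewrite /circ.
by rewrite (_ : (RtoC r * 1 * (Cexp (Ci * RtoC t) * Ci))%C = (Ci * (RtoC r * Cexp (Ci * RtoC t)))%C) //; ring.
Qed.

Lemma rcont_circ r t : rcont (circ r) t.
Proof. exact: rderiv_rcont (rderiv_circ r t). Qed.

Lemma Cexp_im (x : R) : Cexp (Ci * RtoC x) = (cos x, sin x).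
Proof.
rewrite (_ : (Ci * RtoC x)%C = (0, x)); last by apply: C_eq => /=; ring.
by rewrite /Cexp /= exp_0 !Rmult_1_l.
Qed.

Lemma Cexp_2pi (n : nat) : Cexp (Ci * RtoC (INR n * (2 * PI))) = 1%C.
Proof.
rewrite Cexp_im (_ : INR n * (2 * PI) = 0 + 2 * INR n * PI); last by ring.
by rewrite cos_period sin_period cos_0 sin_0.
Qed.

Lemma circ_per r : circ r (2 * PI) = circ r 0.
Proof.
rewrite /circ -(Rmult_1_l (2 * PI)) -[1]/(INR 1) Cexp_2pi.
by rewrite (_ : (Ci * RtoC 0)%C = 0%C) ?Cexp_0 //; ring.
Qed.

Lemma twopi_gt0 : 0 < 2 * PI.
Proof. have := PI_RGT_0; lra. Qed.

Lemma circ_inv_pow r n t : 0 < r ->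
  ((/ circ r t) ^ n)%C = (RtoC (/ r ^ n) * Cexp (- (Ci * RtoC (INR n)) * RtoC t))%C.
Proof.
move=> Hr.
have Hr0 : RtoC r <> 0%C by apply: Cmod_neq0; rewrite Cmod_R Rabs_pos_eq; lra.
rewrite Cpow_inv; last by apply: Cmod_neq0; rewrite Cmod_circ; lra.
rewrite /circ Cpow_mult_l Cexp_pow -RtoC_pow.
rewrite (_ : (- (Ci * RtoC (INR n)) * RtoC t)%C = (- (INR n * (Ci * RtoC t)))%C); last by ring.
rewrite Cexp_opp RtoC_inv; last by apply: pow_nonzero; lra.
field; split; first exact: Cexp_neq0.
rewrite RtoC_pow; exact: Cpow_nz.
Qed.

Lemma cint_circ_pow r n : 0 < r ->
  cint (fun t => (/ circ r t) ^ n)%C 0 (2 * PI) (if n is 0%nat then RtoC (2 * PI) else 0%C).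
Proof.
move=> Hr; have P := twopi_gt0.
case: n => [|n].
  have := @cint_const 1%C 0 (2 * PI); rewrite Rminus_0_r Cmult_1_r.
  by apply: cint_ext => //; lra.
set u := (- (Ci * RtoC (INR n.+1)))%C.
have u0 : u <> 0%C.
  apply: Cmod_neq0; rewrite /u Cmod_opp Cmod_mult Cmod_Ci Cmod_R Rmult_1_l Rabs_pos_eq.
    by apply: lt_0_INR; lia.
  exact: pos_INR.
have H : cint (fun t => Cexp (u * RtoC t) * u)%C 0 (2 * PI) (Cexp (u * RtoC (2 * PI)) - Cexp (u * RtoC 0))%C.
  apply: (@cint_derive (fun t => Cexp (u * RtoC t))).
  - lra.
  - move=> t _; exact: rderiv_Cexp_lin.
  - move=> t _; apply: rcont_mult; last exact: rcont_const.
    exact: rderiv_rcont (rderiv_Cexp_lin u t).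
have E : (Cexp (u * RtoC (2 * PI)) - Cexp (u * RtoC 0))%C = 0%C.
  rewrite (_ : (u * RtoC (2 * PI))%C = (- (Ci * RtoC (INR n.+1 * (2 * PI))))%C).
    have e0 : (u * RtoC 0)%C = 0%C by ring.
    have i1 : (/ 1)%C = 1%C by rewrite -RtoC_inv ?Rinv_1 //; lra.
    rewrite Cexp_opp Cexp_2pi e0 Cexp_0 i1; ring.
  by rewrite /u !RtoC_mult; ring.
rewrite E in H.
have := @cint_scal (RtoC (/ r ^ n.+1) / u)%C _ _ _ _ H.
rewrite (_ : (RtoC (/ r ^ n.+1) / u * 0)%C = 0%C); last by ring.
apply: cint_ext; first lra.
move=> t _; rewrite circ_inv_pow // -/u; field => //.
Qed.

Lemma geom_finite (x : C) N : x <> 1%C ->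
  (/ (1 - x) = csum (fun n => x ^ n) N + x ^ N / (1 - x))%C.
Proof.
move=> Hx; have H : (1 - x)%C <> 0%C by apply: Cminus_eq_contra => E; apply: Hx.
elim: N => [|N IH] /=; first by field.
by rewrite {1}IH; field.
Qed.

Lemma cint_csum (f : nat -> R -> C) (l : nat -> C) a b N :
  (forall n, cint (f n) a b (l n)) -> cint (fun t => csum (fun n => f n t) N) a b (csum l N).
Proof.
move=> H; elim: N => [|N IH] /=; last exact: cint_plus.
have := @cint_const 0%C a b; rewrite (_ : (RtoC (b - a) * 0)%C = 0%C) //; ring.
Qed.

Lemma bounded_on (f : R -> C) a b : (forall t, a <= t <= b -> rcont f t) ->
  exists M, forall t, a <= t <= b -> Cmod (f t) <= M.
Proof.
move=> H.
have [M HM] := @bounded_continuity R_AbsRing C_R_NormedModule f a b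
  (fun x Hx => rcont_continuous (H x Hx)).
exists M => t Ht; have := HM t Ht; rewrite -Cmod_norm; exact: Rlt_le.
Qed.

(** Goursat's lemma on the triangle 0, w, v turns the increment of [seg g 0] into the integral over
    the short segment from w to v. *)
Lemma prim_cderiv g r w : hol_closed_disc g r -> Cmod w < r -> cderiv (seg g 0) w (g w).
Proof.
move=> Hg Hw.
have Gc := hol_cont Hg.
have O : Cmod 0 <= r by rewrite Cmod_0; have := Cmod_ge_0 w; lra.
move=> e He.
have [d [Hd K]] := Gc w ltac:(lra) e He.
exists (Rmin d (r - Cmod w)); split; first by apply: Rmin_pos; lra.
move=> v Hv.
have Hv1 := Rlt_le_trans _ _ _ Hv (Rmin_l _ _).
have Hv2 := Rlt_le_trans _ _ _ Hv (Rmin_r _ _).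
have Hvr : Cmod v <= r by have := Cmod_rev v w; lra.
have Hwr : Cmod w <= r by lra.
have T := goursat (t := (RtoC 0, w, v)) Hg (conj O (conj Hwr Hvr)).
rewrite /tint /= (seg_swap Gc O Hvr) in T.
have E : (seg g 0 v - seg g 0 w)%C = seg g w v.
  have S (x y u : C) : (x + y + - u)%C = 0%C -> (u - x)%C = y.
    move=> X; have -> : y = ((x + y + - u) + (u - x))%C by ring.
    by rewrite X; ring.
  exact: S T.
rewrite E.
have Cc : cont_closed_disc (fun=> - g w)%C r by move=> x _; exact: ccont_const.
have Ec : seg (fun=> - g w)%C w v = (- (g w * (v - w)))%C.
  rewrite (@seg_derive (fun x => - g w * x)%C _ r) //; first by ring.
  move=> x _; apply: cderiv_eq; first by apply: cderiv_scal; exact: cderiv_id.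
  ring.
have Es := seg_plus Gc Cc Hwr Hvr.
rewrite (_ : (seg g w v - g w * (v - w))%C = seg (fun x => g x + - g w)%C w v); last first.
  by rewrite Es Ec; ring.
apply: (@seg_bound _ r) => //.
  by move=> x Hx; apply: ccont_plus; [exact: Gc | exact: Cc].
move=> t Ht; apply: Rlt_le; apply: K; apply: Rle_lt_trans Hv1.
rewrite (_ : (w + RtoC t * (v - w) - w)%C = (RtoC t * (v - w))%C); last by ring.
rewrite Cmod_mult Cmod_R Rabs_pos_eq; last lra.
have := Cmod_ge_0 (v - w); nra.
Qed.

Section CauchyTaylor.
Variables (F f : C -> C) (r : R).
Hypothesis HF : forall z, Cmod z <= r -> cderiv F z (f z).
Hypothesis Hf : hol_closed_disc f r.

(** Goursat's lemma is to be applied to this function, so it has to be differentiable at w = z too,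
    where a second derivative of [F] is needed. That is why the section assumes a holomorphic
    derivative [f]; [hol_derive] later shows that holomorphic functions have one. *)
Definition dquot (z w : C) : C :=
  if Ceq_dec w z then f z else ((F w - F z) / (w - z))%C.

Lemma dquot_neq z w : w <> z -> dquot z w = ((F w - F z) / (w - z))%C.
Proof. by rewrite /dquot; case: Ceq_dec. Qed.

Lemma dquot_eq z : dquot z z = f z.
Proof. by rewrite /dquot; case: Ceq_dec. Qed.

Lemma dquot_hol z r' : Cmod z <= r' -> r' < r -> hol_closed_disc (dquot z) r'.
Proof.
move=> Hz Hr w Hw.
case: (Ceq_dec w z) => [->|Hwz]; last first.
  have N := Cminus_eq_contra _ _ Hwz.
  eexists.
  have D : cderiv (fun w => (F w - F z) * / (w - z))%C w
      ((f w - 0) * / (w - z) + (F w - F z) * (- (/ (w - z) * / (w - z)) * (1 - 0)))%C.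
    apply: (@cderiv_mult (fun w => F w - F z)%C (fun w => / (w - z))%C).
      apply: cderiv_minus; [apply: HF; lra | exact: cderiv_const].
    apply: (@cderiv_comp (fun w => w - z)%C Cinv); last exact: cderiv_inv.
    apply: cderiv_minus; [exact: cderiv_id | exact: cderiv_const].
  apply: (@cderiv_ext_loc _ _ _ _ (Cmod (w - z)) _ _ D); first exact: Cmod_pos.
  move=> v Hv; rewrite dquot_neq // => E.
  by move: Hv; rewrite E Cmod_sub_sym; lra.
have [l Hl] := Hf (z := z) ltac:(lra).
(* Half the second derivative of [F]: the first-order expansion of [f] at [z], integrated along the
   segment from [z] to [v], is the second-order expansion of [F]. *)
exists (l / 2)%C => e He.
have [d [Hd K]] := Hl e He.
exists (Rmin d (r - Cmod z)); split; first by apply: Rmin_pos; lra.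
move=> v Hv.
have Hv1 := Rlt_le_trans _ _ _ Hv (Rmin_l _ _).
have Hv2 := Rlt_le_trans _ _ _ Hv (Rmin_r _ _).
have Hvr : Cmod v <= r by have := Cmod_rev v z; lra.
have Hzr : Cmod z <= r by lra.
rewrite dquot_eq.
case: (Ceq_dec v z) => [->|Nv].
  rewrite dquot_eq.
  rewrite (_ : (f z - f z - l / 2 * (z - z))%C = 0%C); last by ring.
  by rewrite Cmod_0 Cmod_subrr; lra.
rewrite dquot_neq //.
have N := Cminus_eq_contra _ _ Nv.
have Fc := hol_cont Hf.
have D := seg_derive Fc Hzr Hvr HF.
clear w Hw.
set p := (fun w => - f z + - (l * (w - z)))%C.
have Cp : cont_closed_disc p r.
  move=> w _; apply: (@cderiv_ccont _ _ (0 - l * (1 - 0))%C).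
  apply: (@cderiv_minus (fun=> - f z)%C); first exact: cderiv_const.
  apply: cderiv_scal; apply: cderiv_minus; [exact: cderiv_id | exact: cderiv_const].
have Ep : seg p z v = (- (f z * (v - z)) - l / 2 * ((v - z) * (v - z)))%C.
  rewrite (@seg_derive (fun w => - (f z * (w - z)) - l / 2 * ((w - z) * (w - z)))%C p r) //.
    by ring.
  move=> w _.
  have Dw : cderiv (fun w => w - z)%C w (1 - 0)%C.
    by apply: cderiv_minus; [exact: cderiv_id | exact: cderiv_const].
  apply: cderiv_eq.
    apply: cderiv_minus; first by apply: cderiv_opp; apply: cderiv_scal; exact: Dw.
    apply: cderiv_scal; apply: cderiv_mult; exact: Dw.
  rewrite /p; field.
have Es := seg_plus Fc Cp Hzr Hvr.
have B : Cmod (seg (fun w => f w + p w)%C z v) <= (e * Cmod (v - z)) * Cmod (v - z).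
  apply: (@seg_bound _ r) => //.
    by move=> w Hw'; apply: ccont_plus; [exact: Fc | exact: Cp].
  move=> t Ht; set w := (z + RtoC t * (v - z))%C.
  have Ew : Cmod (w - z) = t * Cmod (v - z).
    rewrite /w (_ : (z + RtoC t * (v - z) - z)%C = (RtoC t * (v - z))%C); last by ring.
    by rewrite Cmod_mult Cmod_R Rabs_pos_eq; lra.
  have g0 := Cmod_ge_0 (v - z).
  have Lw : Cmod (w - z) <= Cmod (v - z) by rewrite Ew; nra.
  rewrite /p (_ : (f w + (- f z + - (l * (w - z))))%C = (f w - f z - l * (w - z))%C); last by ring.
  apply: Rle_trans (K w _) _; first lra.
  by apply: Rmult_le_compat_l; lra.
rewrite (_ : ((F v - F z) / (v - z) - f z - l / 2 * (v - z))%C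
  = (seg (fun w => f w + p w)%C z v / (v - z))%C); last by rewrite Es D Ep; field.
rewrite Cmod_div //.
have V0 := Cmod_pos N.
apply: (proj2 (Rle_div_l _ _ _ V0)); exact: B.
Qed.

(** The difference quotient has a primitive on a disc of radius slightly larger than [rho], so its
    integral along the closed circle is 0. This is Cauchy's formula before the integral of 1/(w - z)
    is evaluated. *)
Lemma cauchy_dquot z rho : Cmod z < rho -> rho < r ->
  cint (fun t => (F (circ rho t) - F z) * (circ rho t / (circ rho t - z)))%C 0 (2 * PI) 0%C.
Proof.
move=> Hz Hr.
have z0 := Cmod_ge_0 z.
set r' := (rho + r) / 2.
have Hr1 : rho < r' by rewrite /r'; lra.
have Hr2 : r' < r by rewrite /r'; lra.
have Hg := @dquot_hol z r' ltac:(lra) Hr2.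
have Gc := hol_cont Hg.
have O : Cmod 0 <= r' by rewrite Cmod_0; lra.
set G := seg (dquot z) 0.
have DG w : Cmod w < r' -> cderiv G w (dquot z w) by exact: prim_cderiv.
have P := twopi_gt0.
have Crho t : Cmod (circ rho t) = rho by apply: Cmod_circ; lra.
have I : cint (fun t => dquot z (circ rho t) * (Ci * circ rho t))%C 0 (2 * PI) 0%C.
  rewrite (_ : RtoC 0 = (G (circ rho (2 * PI)) - G (circ rho 0))%C); last first.
    by rewrite circ_per; ring.
  apply: (@cint_derive (fun t => G (circ rho t))); first lra.
  - move=> t _; apply: rderiv_comp; [exact: rderiv_circ | apply: DG; rewrite Crho; lra].
  - move=> t _; apply: rcont_mult.
      by apply: rcont_comp; [exact: rcont_circ | apply: Gc; rewrite Crho; lra].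
    apply: rcont_mult; [exact: rcont_const | exact: rcont_circ].
have := @cint_scal (- Ci)%C _ _ _ _ I.
rewrite (_ : (- Ci * 0)%C = 0%C); last by ring.
apply: cint_ext; first lra.
move=> t _.
have N : circ rho t <> z by move=> E; have := Crho t; rewrite E; lra.
rewrite dquot_neq //.
have N' := Cminus_eq_contra _ _ N.
rewrite (_ : (- Ci * ((F (circ rho t) - F z) / (circ rho t - z) * (Ci * circ rho t)))%C
  = (- (Ci * Ci) * ((F (circ rho t) - F z) / (circ rho t - z) * circ rho t))%C); last by ring.
rewrite (_ : (- (Ci * Ci))%C = 1%C); last by apply: C_eq => /=; ring.
by field.
Qed.

Lemma cauchy_taylor rho M : 0 < rho -> rho < r ->
  (forall t, 0 <= t <= 2 * PI -> Cmod (F (circ rho t)) <= M) ->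
  exists c, (forall n, Cmod (c n) <= M / rho ^ n) /\
    forall z, Cmod z < rho -> cser (fun n => c n * z ^ n)%C (F z).
Proof.
move=> H0 Hr HM.
have P := twopi_gt0.
have Crho t : Cmod (circ rho t) = rho by apply: Cmod_circ; lra.
have Cn0 t : circ rho t <> 0%C by apply: Cmod_neq0; rewrite Crho.
have FC t : rcont (fun t => F (circ rho t)) t.
  apply: rcont_comp; first exact: rcont_circ.
  apply: cderiv_ccont; apply: HF; rewrite Crho; lra.
have IC t : rcont (fun t => / circ rho t)%C t.
  apply: rcont_comp; [exact: rcont_circ | exact: ccont_inv].
have PC n t : rcont (fun t => (/ circ rho t) ^ n)%C t.
  elim: n => [|n IH]; first exact: rcont_const.
  exact: rcont_mult.
set d := fun n => CInt (fun t => F (circ rho t) * (/ circ rho t) ^ n)%C 0 (2 * PI).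
have Hd n : cint (fun t => F (circ rho t) * (/ circ rho t) ^ n)%C 0 (2 * PI) (d n).
  apply: CInt_correct; first lra.
  by move=> t _; apply: rcont_mult.
have pi0 : RtoC (2 * PI) <> 0%C by apply: Cmod_neq0; rewrite Cmod_R Rabs_pos_eq; lra.
exists (fun n => d n / RtoC (2 * PI))%C; split.
  move=> n; rewrite Cmod_div // Cmod_R Rabs_pos_eq; last lra.
  apply: (proj2 (Rle_div_l _ _ _ P)).
  have := cint_bound (M := M / rho ^ n) _ _ (Hd n); rewrite Rminus_0_r.
  rewrite (Rmult_comm (M / rho ^ n)); apply; first lra.
  move=> t Ht; rewrite Cmod_mult Cmod_pow Cmod_inv // Crho pow_inv.
  apply: Rmult_le_compat_r; last exact: HM.
  apply: Rlt_le; apply: Rinv_0_lt_compat; exact: pow_lt.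
move=> z Hz.
have z0 := Cmod_ge_0 z.
have I := cauchy_dquot Hz Hr.
have Nz t : circ rho t <> z by move=> E; have := Crho t; rewrite E; lra.
have Nz' t : (circ rho t - z)%C <> 0%C by apply: Cminus_eq_contra.
have M0 : 0 <= M.
  by apply: Rle_trans (Cmod_ge_0 _) (HM 0 _); lra.
set q := Cmod z / rho.
have Hq : 0 <= q < 1.
  split; first by apply: Rdiv_le_0_compat.
  by apply: (proj2 (Rlt_div_l _ _ _ H0)); lra.
set B := (M + Cmod (F z)) * (rho / (rho - Cmod z)).
(* Expand w/(w - z) in [cauchy_dquot] as a finite geometric sum plus remainder. The constant
   function F(z) contributes to the term of index 0 only, so for N = 0 nothing is subtracted yet. *)
have main N : Cmod (csum (fun n => d n * z ^ n)%C N - RtoC (2 * PI) * F z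
      * (if N is 0%nat then 0 else 1))%C <= 2 * PI * (B * q ^ N).
  pose l n := (d n * z ^ n - F z * ((if n is 0%nat then RtoC (2 * PI) else 0) * z ^ n))%C.
  have S1 : cint (fun t => csum (fun n => (F (circ rho t) - F z) * (z / circ rho t) ^ n)%C N) 0 (2 * PI) (csum l N).
    apply: cint_csum => n.
    have A1 := @cint_scal (z ^ n)%C _ _ _ _ (Hd n).
    have A2 := @cint_scal (- F z * z ^ n)%C _ _ _ _ (@cint_circ_pow rho n H0).
    have := cint_plus A1 A2.
    rewrite (_ : (z ^ n * d n + - F z * z ^ n * (if n is 0%nat then RtoC (2 * PI) else 0))%C = l n).
      apply: cint_ext; first lra.
      move=> t _; rewrite /Cdiv Cpow_mult_l; ring.
    by rewrite /l; ring.
  have S2 := cint_plus I (@cint_scal (-1)%C _ _ _ _ S1).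
  have EL : (0 + -1 * csum l N)%C = (- (csum (fun n => d n * z ^ n)%C N - RtoC (2 * PI) * F z
      * (if N is 0%nat then 0 else 1)))%C.
    rewrite /l; elim: N {S1 S2} => [|N IH] /=; first by ring.
    rewrite Cmult_plus_distr_l Cplus_assoc IH; case: N {IH} => [|N] /=; ring.
  rewrite EL in S2.
  rewrite -Cmod_opp.
  have := cint_bound (M := B * q ^ N) _ _ S2; rewrite Rminus_0_r; apply; first lra.
  move=> t Ht.
  set w := circ rho t.
  have Hx : (z / w)%C <> 1%C.
    move=> E; apply: (Nz t); rewrite -/w.
    have -> : z = (z / w * w)%C by field; exact: Cn0.
    by rewrite E; ring.
  have G := geom_finite N Hx.
  have E1 : (w / (w - z) = / (1 - z / w))%C.
    field; split; [exact: Cn0 | exact: Nz'].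
  have E2 : csum (fun n => (F w - F z) * (z / w) ^ n)%C N = ((F w - F z) * csum (fun n => (z / w) ^ n)%C N)%C.
    elim: N {S1 S2 EL G} => [|N IH] /=; first by ring.
    rewrite IH; ring.
  rewrite E1 E2 G.
  rewrite (_ : ((F w - F z) * (csum (fun n => (z / w) ^ n)%C N + (z / w) ^ N / (1 - z / w)) +
     -1 * ((F w - F z) * csum (fun n : nat => (z / w) ^ n) N))%C
     = ((F w - F z) * (/ (1 - z / w)) * (z / w) ^ N)%C); last by rewrite /Cdiv; ring.
  have Nwz : (w - z)%C <> 0%C := Nz' t. have Nw : w <> 0%C := Cn0 t.
  rewrite -E1 Cmod_mult Cmod_mult (Cmod_div w) // Cmod_pow Cmod_div // (Crho t) -/q.
  apply: Rmult_le_compat_r; first by apply: pow_le; lra.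
  apply: Rmult_le_compat.
  - exact: Cmod_ge_0.
  - apply: Rdiv_le_0_compat; [lra | exact: Cmod_pos].
  - apply: Rle_trans (Cmod_triangle _ _) _; rewrite Cmod_opp.
    have := HM t Ht; rewrite -/w; lra.
  - apply: Rmult_le_compat_l; first lra.
    apply: Rinv_le_contravar; first lra.
    by have := Cmod_rev w z; rewrite (Crho t).
move=> e He.
have B0 : 0 <= B.
  apply: Rmult_le_pos; first by have := Cmod_ge_0 (F z); lra.
  apply: Rdiv_le_0_compat; lra.
have [|N HN] := @pow_lt_eps q (e / (B + 1)) Hq.
  by apply: Rdiv_lt_0_compat; lra.
exists (S N) => -[|n] Hn; first by lia.
have K := main n.+1.
have L := HN n.+1 ltac:(lia).
have L' : q ^ n.+1 * (B + 1) < e by apply: (proj2 (Rlt_div_r _ _ _ _)) => //; lra.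
have -> : (csum (fun n => d n / RtoC (2 * PI) * z ^ n)%C n.+1 - F z)%C =
   ((csum (fun n => d n * z ^ n)%C n.+1 - RtoC (2 * PI) * F z * 1) / RtoC (2 * PI))%C.
  have -> : forall m, csum (fun n => d n / RtoC (2 * PI) * z ^ n)%C m = (csum (fun n => d n * z ^ n)%C m / RtoC (2 * PI))%C.
    elim=> [|m IH] /=; first by field.
    rewrite IH; field => //.
  field => //.
rewrite Cmod_div // Cmod_R Rabs_pos_eq; last lra.
apply: (proj2 (Rlt_div_l _ _ _ P)).
apply: Rle_lt_trans K _.
have qn : 0 <= q ^ n.+1 by apply: pow_le; lra.
rewrite (Rmult_comm e); apply: Rmult_lt_compat_l => //; lra.
Qed.

End CauchyTaylor.

Definition hol_disc (f : C -> C) (r : R) : Prop :=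
  forall z, Cmod z < r -> exists l, cderiv f z l.

Lemma C_derive_cderiv f z : (exists l, cderiv f z l) -> cderiv f z (C_derive f z).
Proof. by move=> [l Hl]; move/cderivP/is_C_derive_unique: (Hl) => ->. Qed.

(** A primitive of [f] has the holomorphic derivative [f], so [cauchy_taylor] applies to it; [f] and
    its derivative are then power series by termwise differentiation. *)
Lemma hol_derive f r : hol_disc f r -> hol_disc (C_derive f) r.
Proof.
move=> H z Hz.
have z0 := Cmod_ge_0 z.
set r1 := (Cmod z + r) / 2; set r2 := (r1 + r) / 2; set r3 := (r2 + r) / 2.
have R1 : Cmod z < r1 by rewrite /r1; lra.
have R2 : r1 < r2 by rewrite /r2 /r1; lra.
have R3 : r2 < r3 by rewrite /r3 /r2 /r1; lra.
have R4 : r3 < r by rewrite /r3 /r2 /r1; lra.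
have H3 : hol_closed_disc f r3 by move=> w Hw; apply: H; lra.
have H2 : hol_closed_disc f r2 by move=> w Hw; apply: H; lra.
have PF w : Cmod w <= r2 -> cderiv (seg f 0) w (f w).
  by move=> Hw; apply: (prim_cderiv H3); lra.
have [|M HM] := @bounded_on (fun t => seg f 0 (circ r1 t)) 0 (2 * PI).
  move=> t _; apply: rcont_comp; first exact: rcont_circ.
  by apply: cderiv_ccont; apply: PF; rewrite Cmod_circ; lra.
have [c [_ Hc]] := cauchy_taylor PF H2 (Rle_lt_trans _ _ _ z0 R1) R2 HM.
have D1 w : Cmod w < r1 -> cser (fun n => INR n.+1 * c n.+1 * w ^ n)%C (f w).
  move=> Hw; have [l [L1 L2]] := pow_series_cderiv Hw Hc.
  by rewrite (cderiv_unique (PF w ltac:(lra)) L1).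
have D2 w : Cmod w < r1 ->
    cser (fun n => INR n.+1 * (INR n.+2 * c n.+2) * w ^ n)%C (C_derive f w).
  move=> Hw; have [l [L1 L2]] := pow_series_cderiv Hw D1.
  by move/cderivP/is_C_derive_unique: L1 => ->.
by have [l [L1 _]] := pow_series_cderiv R1 D2; exists l.
Qed.

Lemma taylor f r rho M : hol_disc f r -> 0 < rho -> rho < r ->
  (forall t, 0 <= t <= 2 * PI -> Cmod (f (circ rho t)) <= M) ->
  exists c, (forall n, Cmod (c n) <= M / rho ^ n) /\
    forall z, Cmod z < rho -> cser (fun n => c n * z ^ n)%C (f z).
Proof.
move=> H H0 Hr HM.
have H' := hol_derive H.
apply: (@cauchy_taylor f (C_derive f) ((rho + r) / 2)) => //; try lra.
- move=> z Hz; apply: C_derive_cderiv; apply: H; lra.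
- move=> z Hz; apply: H'; lra.
Qed.

(** [taylor] gives an expansion for each smaller radius, and [pow_series_unique] shows that all of
    them have the coefficients obtained for [r / 2]. *)
Lemma taylor_disc f r : 0 < r -> hol_disc f r ->
  exists c, forall z, Cmod z < r -> cser (fun n => c n * z ^ n)%C (f z).
Proof.
move=> Hr H.
have A rho : 0 < rho -> rho < r -> exists c, forall z, Cmod z < rho -> cser (fun n => c n * z ^ n)%C (f z).
  move=> H0 H1.
  have [|M HM] := @bounded_on (fun t => f (circ rho t)) 0 (2 * PI).
    move=> t _; apply: rcont_comp; first exact: rcont_circ.
    have [|l /cderiv_ccont //] := H (circ rho t).
    by rewrite Cmod_circ; lra.
  by have [c [_ Hc]] := taylor H H0 H1 HM; exists c.
have [c Hc] := A (r / 2) ltac:(lra) ltac:(lra).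
exists c => z Hz.
have z0 := Cmod_ge_0 z.
have M1 := Rmax_l (Cmod z) (r / 2).
have M2 := Rmax_r (Cmod z) (r / 2).
have M3 : Rmax (Cmod z) (r / 2) < r by apply: Rmax_lub_lt; lra.
have [d Hd] := A ((Rmax (Cmod z) (r / 2) + r) / 2) ltac:(lra) ltac:(lra).
have E n : (c n - d n)%C = 0%C.
  move: n; apply: (@pow_series_unique _ (r / 2)); first lra.
  move=> w Hw.
  have S1 := Hc w ltac:(rewrite Cmod_R Rabs_pos_eq; lra).
  have S2 := Hd w ltac:(rewrite Cmod_R Rabs_pos_eq; lra).
  have := cser_minus S1 S2; rewrite (_ : (f w - f w)%C = 0%C); last by ring.
  apply: cser_ext => n; ring.
apply: cser_ext (Hd z _); last lra.
by move=> n; rewrite (proj2 (Ceq_minus _ _) (E n)).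
Qed.

Lemma liouville f M : (forall z, exists l, cderiv f z l) -> (forall z, Cmod (f z) <= M) ->
  forall z, f z = f 0%C.
Proof.
move=> H HM z.
have M0 : 0 <= M by apply: Rle_trans (Cmod_ge_0 _) (HM 0%C).
have z0 := Cmod_ge_0 z.
suff : (f z - f 0)%C = 0%C.
  by move=> E; exact: (proj2 (Ceq_minus _ _) E).
apply: Cmod_eq_0; apply: Rle_antisym; last exact: Cmod_ge_0.
apply: le_epsilon => e He; rewrite Rplus_0_l.
(* With q = |z| / [rho] the series without its constant term is at most M q / (1 - q). The first
   summand gives q <= 1/2, the second then 2 M q <= e. *)
set rho := 2 * (Cmod z + 1) + 2 * M * Cmod z / e.
have Q0 : 0 <= 2 * M * Cmod z / e.
  by apply: Rdiv_le_0_compat => //; apply: Rmult_le_pos; lra.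
have R0 : 0 < rho by rewrite /rho; lra.
have R1 : 2 * (Cmod z + 1) <= rho by rewrite /rho; lra.
have [c [Bc Hc]] := @taylor f (rho + 1) rho M (fun w _ => H w) R0 ltac:(lra) (fun t _ => HM _).
have S1 := Hc z ltac:(lra).
have c0 : f 0%C = c 0%nat.
  have S0 := Hc 0%C ltac:(rewrite Cmod_0; lra).
  apply: (cser_unique S0); apply/cser_shift.
  rewrite (_ : (c 0%nat - c 0%nat * 0 ^ 0)%C = 0%C); last by rewrite /=; ring.
  move=> e1 He1; exists 0%nat => n _.
  suff -> : csum (fun n0 : nat => (c n0.+1 * 0 ^ n0.+1)%C) n = 0%C by rewrite Cmod_subrr.
  elim: n => [|n IH] //=; rewrite IH /=; ring.
move/cser_shift: S1; rewrite -[(z ^ 0)%C]/(RtoC 1) Cmult_1_r -c0 => S1.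
set q := Cmod z / rho.
have Hq : 0 <= q <= / 2.
  split; first exact: Rdiv_le_0_compat.
  apply: (proj2 (Rle_div_l _ _ _ R0)); lra.
apply: Rle_trans (cser_le (b := fun n => M * q * q ^ n) (B := M * q / (1 - q)) _ _ S1) _.
- move=> n; rewrite Cmod_mult Cmod_pow.
  rewrite (_ : M * q * q ^ n = M / rho ^ n.+1 * Cmod z ^ n.+1).
    exact: Rmult_le_compat_r (pow_le _ n.+1 z0) (Bc n.+1).
  rewrite /q /Rdiv Rpow_mult_distr pow_inv /=; field; split; last lra.
  by apply: pow_nonzero; lra.
- apply: is_series_geom_shift; lra.
- have Mq : 0 <= M * q by apply: Rmult_le_pos; lra.
  apply: Rle_trans (_ : 2 * (M * q) <= _).
    apply: (proj2 (Rle_div_l _ _ _ _)); first lra.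
    nra.
  rewrite /q (_ : 2 * (M * (Cmod z / rho)) = (2 * M * Cmod z) / rho); last by rewrite /Rdiv; ring.
  apply: (proj2 (Rle_div_l _ _ _ R0)).
  rewrite /rho (_ : e * (2 * (Cmod z + 1) + 2 * M * Cmod z / e) = e * (2 * (Cmod z + 1)) + 2 * M * Cmod z); last by field; lra.
  nra.
Qed.

Lemma pow_series_zero (c : nat -> C) : (forall n, c n = 0%C) -> forall z l, cser (fun n => c n * z ^ n)%C l -> l = 0%C.
Proof.
move=> H z l /cser_unique; apply; move=> e He; exists 0%nat => n _.
suff -> : csum (fun n0 : nat => (c n0 * z ^ n0)%C) n = 0%C by rewrite Cmod_subrr.
elim: n => [|n IH] //=; rewrite IH H; ring.
Qed.

Lemma identity_disc f r : 0 < r -> hol_disc f r -> (forall x : R, 0 < x < r -> f x = 0%C) ->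
  forall z, Cmod z < r -> f z = 0%C.
Proof.
move=> Hr H H0 z Hz.
have [c Hc] := taylor_disc Hr H.
apply: (@pow_series_zero c _ z _ (Hc z Hz)).
apply: (pow_series_unique Hr) => w Hw.
by rewrite -(H0 w Hw); apply: Hc; rewrite Cmod_R Rabs_pos_eq; lra.
Qed.

(** * Growth and holomorphy of Fourier series *)

Arguments INR : simpl never.

Lemma inv_sq_telescope n : / INR n.+1 ^ 2 <= 2 * (/ INR n.+1 - / INR n.+2).
Proof.
have P : 0 < INR n.+1 by apply: lt_0_INR; lia.
have P1 : 1 <= INR n.+1 by rewrite S_INR; have := pos_INR n; lra.
rewrite [INR n.+2]S_INR; set x := INR n.+1 in P P1 *.
have -> : 2 * (/ x - / (x + 1)) = 2 * x / (x + 1) * / x ^ 2 by field; lra.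
rewrite -{1}(Rmult_1_l (/ x ^ 2)); apply: Rmult_le_compat_r.
  by apply: Rlt_le; apply: Rinv_0_lt_compat; apply: pow_lt.
apply: (proj1 (Rle_div_r _ _ _ _)); lra.
Qed.

Lemma rsumS u n : rsum u n.+1 = rsum u n + u n.
Proof. by []. Qed.

Lemma inv_sq_sum n m : rsum (fun k => / INR (n + k).+1 ^ 2) m <= 2 * (/ INR n.+1).
Proof.
have H : rsum (fun k => / INR (n + k).+1 ^ 2) m <= 2 * (/ INR n.+1 - / INR (n + m).+1).
  elim: m => [|m IH]; first by rewrite addn0 /=; lra.
  have := inv_sq_telescope (n + m); rewrite addnS rsumS; lra.
have : 0 < / INR (n + m).+1 by apply: Rinv_0_lt_compat; apply: lt_0_INR; lia.
lra.
Qed.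

Lemma is_series_of_bound (b : nat -> R) B : (forall n, 0 <= b n) -> (forall n, rsum b n <= B) ->
  exists l, is_series b l /\ l <= B.
Proof.
move=> H0 H.
have [||l Hl] := @ex_finite_lim_seq_incr (sum_n b) B.
- by move=> n; rewrite !rsum_sum_n /=; have := H0 n.+1; lra.
- by move=> n; rewrite rsum_sum_n.
exists l; split=> //.
have K := @is_lim_seq_le (sum_n b) (fun=> B) l B.
apply: K => //; last exact: is_lim_seq_const.
by move=> n; rewrite rsum_sum_n.
Qed.

(* The rate 1/(n+1) of the remainder is what makes all the limits below uniform. *)
Lemma cser_inv_sq (u : nat -> C) K : 0 <= K ->
  (forall n, Cmod (u n) <= K * / INR n.+1 ^ 2) ->
  exists l, cser u l /\ forall n, Cmod (l - csum u n) <= K * (2 * / INR n.+1).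
Proof.
move=> K0 H.
have P n m : 0 <= K * / INR (n + m).+1 ^ 2.
  apply: Rmult_le_pos => //; apply: Rlt_le; apply: Rinv_0_lt_compat; apply: pow_lt.
  by apply: lt_0_INR; lia.
have S n : exists B, is_series (fun k => K * / INR (n + k).+1 ^ 2) B /\ B <= K * (2 * / INR n.+1).
  apply: is_series_of_bound => m; first exact: P.
  have -> : rsum (fun k => K * / INR (n + k).+1 ^ 2) m = K * rsum (fun k => / INR (n + k).+1 ^ 2) m.
    elim: m => [|m IH]; [rewrite /=; ring | rewrite !rsumS IH; ring].
  apply: Rmult_le_compat_l => //; exact: inv_sq_sum.
have [B0 [HB0 _]] := S 0%nat.
have [l [Hl _]] := cser_abs (u := u) H HB0.
exists l; split=> // n.
have [B [HB LB]] := S n.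
apply: Rle_trans LB.
apply: (cser_le (u := fun k => u (n + k)%nat) _ HB) => [k|]; first exact: H.
move=> e /Hl [N HN]; exists N => m Hm.
have -> : csum (fun k => u (n + k)%nat) m = (csum u (n + m)%nat - csum u n)%C.
  elim: m {Hm} => [|m IH] /=; first by rewrite addn0; ring.
  rewrite IH addnS /=; ring.
have := HN (n + m)%nat; rewrite (_ : (csum u (n + m)%N - csum u n - (l - csum u n))%C = (csum u (n + m)%N - l)%C); last by ring.
by apply; rewrite -plusE; lia.
Qed.

(** A natural exponent replaces the real [sigma]; the shifted index leaves the ignored value [a 0]
    unconstrained. *)
Definition poly_bounded (a : nat -> C) (M : R) (j : nat) : Prop :=
  0 <= M /\ forall n, Cmod (a n.+1) <= M * INR n.+1 ^ j.

Lemma poly_bounded_of_power a sigma :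
  (exists M : R, forall n : nat, (0 < n)%N -> (Cmod (a n) <= M * Rpower (INR n) sigma)%R) ->
  exists M j, poly_bounded a M j /\ sigma <= INR j.
Proof.
move=> [M HM].
have [j Hj] : exists j, sigma <= INR j.
  have [n Hn] := nfloor_ex (Rmax 0 sigma) (Rmax_l _ _).
  exists n.+1; rewrite S_INR; have := Rmax_r 0 sigma; lra.
have M0 : 0 <= M.
  have := HM 1%nat isT; rewrite /Rpower ln_1 Rmult_0_r exp_0 Rmult_1_r.
  by apply: Rle_trans; exact: Cmod_ge_0.
exists M, j; split=> //; split=> // n.
apply: Rle_trans (HM n.+1 isT) _; apply: Rmult_le_compat_l => //.
rewrite -Rpower_pow; last by apply: lt_0_INR; lia.
rewrite /Rpower; apply: exp_le; apply: Rmult_le_compat_r => //.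
rewrite -ln_1; case: n => [|n]; first by rewrite -[INR 1]/1; lra.
apply: Rlt_le; apply: ln_increasing; first lra.
by rewrite S_INR; have : 0 < INR n.+1 by [apply: lt_0_INR; lia]; lra.
Qed.

(** From exp(-x) = exp(-x/p)^p and exp(y) >= y. All exponential decay below is used in this form, as
    decay of an arbitrary power. *)
Lemma exp_neg_pow x p : 0 < x -> exp (- x) <= (INR p / x) ^ p.
Proof.
move=> Hx; case: p => [|p].
  rewrite /= -exp_0; apply: exp_le; lra.
have P : 0 < INR p.+1 by apply: lt_0_INR; lia.
set n := p.+1 in P *.
have E : exp (- x) = (exp (- (x / INR n))) ^ n.
  have F m : (exp (- (x / INR n))) ^ m = exp (- (x / INR n * INR m)).
    elim: m => [|m IH]; first by rewrite /= Rmult_0_r Ropp_0 exp_0.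
    rewrite -tech_pow_Rmult IH -exp_plus S_INR; congr exp; ring.
  by rewrite F; congr exp; field; lra.
rewrite E; apply: pow_incr; split; first exact/Rlt_le/exp_pos.
rewrite exp_Ropp.
have -> : INR n / x = / (x / INR n) by field; lra.
have Q : 0 < x / INR n by apply: Rdiv_lt_0_compat.
apply: Rinv_le_contravar => //.
by have := exp_ineq1_le (x / INR n); lra.
Qed.

Definition qterm (a : nat -> C) (z : C) (n : nat) : C :=
  (a n.+1 * Cexp (2 * PI * Ci * INR n.+1 * z))%C.

Lemma Cmod_qexp n z : Cmod (Cexp (2 * PI * Ci * INR n * z)) = exp (- (2 * PI * INR n * Im z)).
Proof.
rewrite Cmod_Cexp; congr exp.
rewrite (_ : (2 * PI * Ci * INR n * z)%C = (RtoC (2 * PI * INR n) * (Ci * z))%C).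
  rewrite re_scal_l (_ : Re (Ci * z)%C = - Im z); [ring | rewrite /= /Im; ring].
by rewrite !RtoC_mult; ring.
Qed.

(** What remains of M n^j exp(-2 pi n y) after [exp_neg_pow] with exponent p >= j + 2, once j powers
    of n have absorbed n^j and two are set aside for the convergence of the sum over n. *)
Definition fbound M (p : nat) (y : R) : R := M * (INR p / (2 * PI)) ^ p * / y ^ p.

Lemma fbound_pos M p y : 0 <= M -> 0 < y -> 0 <= fbound M p y.
Proof.
move=> M0 Hy; apply: Rmult_le_pos.
  apply: Rmult_le_pos => //; apply: pow_le; apply: Rdiv_le_0_compat; first exact: pos_INR.
  by have := PI_RGT_0; lra.
apply: Rlt_le; apply: Rinv_0_lt_compat; exact: pow_lt.
Qed.

Lemma qterm_bound a M j p z n : poly_bounded a M j -> (j + 2 <= p)%nat -> 0 < Im z ->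
  Cmod (qterm a z n) <= fbound M p (Im z) * / INR n.+1 ^ 2.
Proof.
move=> [M0 HM] Hp Hy; rewrite /qterm Cmod_mult Cmod_qexp.
have PP := PI_RGT_0.
have N0 : 0 < INR n.+1 by apply: lt_0_INR; lia.
have N1 : 1 <= INR n.+1 by rewrite S_INR; have := pos_INR n; lra.
have X0 : 0 < 2 * PI * INR n.+1 * Im z by apply: Rmult_lt_0_compat => //; apply: Rmult_lt_0_compat; lra.
have E := exp_neg_pow p X0.
apply: Rle_trans (_ : M * INR n.+1 ^ j * (INR p / (2 * PI * INR n.+1 * Im z)) ^ p <= _).
  apply: Rmult_le_compat => //; [exact: Cmod_ge_0 | exact/Rlt_le/exp_pos].
have -> : INR p / (2 * PI * INR n.+1 * Im z) = INR p / (2 * PI) * / INR n.+1 * / Im z by field; lra.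
rewrite /fbound !Rpow_mult_distr !pow_inv.
have <- : (j + 2 + (p - (j + 2)))%nat = p by rewrite subnKC.
set i := (p - (j + 2))%nat; rewrite -!plusE.
rewrite [INR n.+1 ^ (j + 2 + i)]pow_add [INR n.+1 ^ (j + 2)]pow_add.
set u := INR n.+1 in N0 N1 *.
have uj := pow_lt u j N0. have ui := pow_lt u i N0.
have -> : forall A B, M * u ^ j * (A * / (u ^ j * u ^ 2 * u ^ i) * B) = M * A * B * / u ^ 2 * / u ^ i.
  by move=> A B; field; repeat split; apply: Rgt_not_eq; lra.
rewrite -[X in _ <= X]Rmult_1_r; apply: Rmult_le_compat_l.
  apply: Rmult_le_pos; last by apply: Rlt_le; apply: Rinv_0_lt_compat; apply: pow_lt.
  apply: Rmult_le_pos; last by apply: Rlt_le; apply: Rinv_0_lt_compat; apply: pow_lt.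
  apply: Rmult_le_pos => //; apply: Rmult_le_pos; first by apply: pow_le; exact: pos_INR.
  by apply: Rlt_le; apply: Rinv_0_lt_compat; apply: pow_lt; lra.
rewrite -Rinv_1; apply: Rinv_le_contravar; first lra.
exact: pow_R1_Rle.
Qed.

Lemma fourier_cser a M j p z : poly_bounded a M j -> (j + 2 <= p)%nat -> 0 < Im z ->
  cser (qterm a z) (fourier_series a z) /\
  forall n, Cmod (fourier_series a z - csum (qterm a z) n) <= fbound M p (Im z) * (2 * / INR n.+1).
Proof.
move=> Ha Hp Hy.
have [||l [H1 H2]] := @cser_inv_sq (qterm a z) (fbound M p (Im z)).
- by apply: fbound_pos => //; case: Ha.
- move=> n; exact: (@qterm_bound a M j).
have E : fourier_series a z = l by exact: CSeries_eq.
by rewrite E.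
Qed.

Lemma fourier_bound a M j p z : poly_bounded a M j -> (j + 2 <= p)%nat -> 0 < Im z ->
  Cmod (fourier_series a z) <= 2 * fbound M p (Im z).
Proof.
move=> Ha Hp Hy; have [_ H] := fourier_cser Ha Hp Hy.
have := H 0%nat; rewrite /= Rinv_1 (_ : (fourier_series a z - 0)%C = fourier_series a z); last by ring.
lra.
Qed.

Lemma fourier_hol a M j : poly_bounded a M j ->
  forall z, 0 < Im z -> exists l, cderiv (fourier_series a) z l.
Proof.
move=> Ha z Hz.
(* As a power series in q = exp(2 pi i z); the arbitrary value [a 0] must not become its constant
   term. *)
pose c n : C := if n is 0%nat then 0%C else a n.
pose G q := CSeries (fun n => c n * q ^ n)%C.
have S q : Cmod q < 1 -> cser (fun n => c n * q ^ n)%C (G q).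
  move=> Hq; have q0 := Cmod_ge_0 q.
  have [B HB] := @ex_series_poly_geom j (Cmod q) ltac:(lra).
  case: (Ha) => M0 HM.
  have HB' : is_series (fun n => M * (INR n ^ j * Cmod q ^ n)) (M * B) by apply: (is_series_scal_l M _ _ HB).
  have [|l [Hl _]] := @cser_abs (fun n => c n * q ^ n)%C _ _ _ HB'.
    move=> n; rewrite Cmod_mult Cmod_pow -Rmult_assoc; apply: Rmult_le_compat_r; first exact: pow_le.
    case: n => [|n] //=; rewrite Cmod_0; apply: Rmult_le_pos => //; apply: pow_le; exact: pos_INR.
  by rewrite /G (CSeries_eq Hl).
have E w : 0 < Im w -> G (Cexp (2 * PI * Ci * w)) = fourier_series a w.
  move=> Hw.
  have Hq : Cmod (Cexp (2 * PI * Ci * w)) < 1.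
    have := Cmod_qexp 1 w; rewrite (_ : (2 * PI * Ci * INR 1 * w)%C = (2 * PI * Ci * w)%C); last first.
      by rewrite -[INR 1]/1; ring.
    move=> ->; rewrite -exp_0; apply: exp_increasing.
    have := PI_RGT_0; rewrite -[INR 1]/1 => PP; have := Rmult_lt_0_compat _ _ PP Hw; lra.
  have [F _] := fourier_cser Ha (leqnn (j + 2)) Hw.
  have := S _ Hq => /cser_shift.
  rewrite (_ : (c 0%nat * Cexp (2 * PI * Ci * w) ^ 0)%C = 0%C); last by rewrite /=; ring.
  move=> S1; have {S1} : cser (qterm a w) (G (Cexp (2 * PI * Ci * w)) - 0)%C.
    apply: cser_ext S1 => n; rewrite Cexp_pow /qterm; congr (_ * Cexp _)%C.
    ring.
  by move/cser_unique=> /(_ _ F) <-; ring.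
have Hq : Cmod (Cexp (2 * PI * Ci * z)) < 1.
  have := Cmod_qexp 1 z; rewrite (_ : (2 * PI * Ci * INR 1 * z)%C = (2 * PI * Ci * z)%C); last first.
    by rewrite -[INR 1]/1; ring.
  move=> ->; rewrite -exp_0; apply: exp_increasing.
  have := PI_RGT_0; rewrite -[INR 1]/1 => PP; have := Rmult_lt_0_compat _ _ PP Hz; lra.
have [l [Hl _]] := pow_series_cderiv Hq S.
eexists; apply: (@cderiv_ext_loc (fun w => G (Cexp (2 * PI * Ci * w)))%C _ _ _ (Im z)) => //.
  move=> w Hw; apply: E.
  have := im_le_Cmod (w - z); rewrite im_plus im_opp.
  have := Rle_abs (- (Im w + - Im z)); rewrite Rabs_Ropp; lra.
apply: (@cderiv_comp (fun w => Cexp (2 * PI * Ci * w))%C G); last exact: Hl.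
apply: (@cderiv_comp (fun w => 2 * PI * Ci * w)%C Cexp); last exact: cderiv_Cexp.
apply: cderiv_scal; exact: cderiv_id.
Qed.

(** * The slash action of real matrices; elliptic fixed points *)

(** Real entries and arbitrary positive determinant: SL_2(Z), [W], translations by 1/2 or 1/3 and
    the matrices of Hecke operators have to be multiplied with one another. *)
Record M2 := mk { e11 : R; e12 : R; e21 : R; e22 : R }.

Definition det (A : M2) : R := e11 A * e22 A - e12 A * e21 A.

Definition mmul (A B : M2) : M2 :=
  mk (e11 A * e11 B + e12 A * e21 B) (e11 A * e12 B + e12 A * e22 B)
     (e21 A * e11 B + e22 A * e21 B) (e21 A * e12 B + e22 A * e22 B).

Definition jfac (A : M2) (z : C) : C := (RtoC (e21 A) * z + RtoC (e22 A))%C.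
Definition mob (A : M2) (z : C) : C := ((RtoC (e11 A) * z + RtoC (e12 A)) / jfac A z)%C.

(* Weight 2m, normalized by det^m so that scalar matrices act trivially. *)
Definition sl (m : nat) (A : M2) (F : C -> C) (z : C) : C :=
  (RtoC (det A) ^ m / jfac A z ^ (2 * m) * F (mob A z))%C.

Definition holH (F : C -> C) : Prop := forall z, 0 < Im z -> exists l, cderiv F z l.

Lemma det_mmul A B : det (mmul A B) = det A * det B.
Proof. by rewrite /det /mmul /=; ring. Qed.

Lemma Cmod_sq z : Cmod z * Cmod z = Re z * Re z + Im z * Im z.
Proof. by have := Cmod2_alt z; rewrite /= !Rmult_1_r. Qed.

Lemma jfac_neq0 A z : 0 < det A -> 0 < Im z -> jfac A z <> 0%C.
Proof.
move=> Hd Hz E.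
have E1 : Im (jfac A z) = 0 by rewrite E.
have E2 : Re (jfac A z) = 0 by rewrite E.
move: E1 E2; rewrite /jfac im_plus re_plus im_scal_l re_scal_l im_RtoC re_RtoC Rplus_0_r => E1 E2.
have c0 : e21 A = 0 by nra.
have d0 : e22 A = 0 by move: E2; rewrite c0; lra.
by move: Hd; rewrite /det c0 d0; lra.
Qed.

Lemma Im_mob A z : 0 < det A -> 0 < Im z ->
  Im (mob A z) = det A * Im z / (Cmod (jfac A z) * Cmod (jfac A z)).
Proof.
move=> Hd Hz.
have J := jfac_neq0 Hd Hz.
have J0 := Cmod_pos J.
have S := Cmod_sq (jfac A z).
have S0 : 0 < Re (jfac A z) * Re (jfac A z) + Im (jfac A z) * Im (jfac A z) by rewrite -S; nra.
rewrite S /mob /Cdiv im_mult.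
move: S0; rewrite /jfac /= !(Rmult_0_l, Rminus_0_r, Rplus_0_r) /Re /Im /det => S0.
field; lra.
Qed.

Lemma mob_H A z : 0 < det A -> 0 < Im z -> 0 < Im (mob A z).
Proof.
move=> Hd Hz; rewrite Im_mob //.
have J0 := Cmod_pos (jfac_neq0 Hd Hz).
by apply: Rdiv_lt_0_compat; apply: Rmult_lt_0_compat.
Qed.

Lemma jfac_mul A B z : 0 < det B -> 0 < Im z ->
  jfac (mmul A B) z = (jfac A (mob B z) * jfac B z)%C.
Proof.
move=> Hd Hz; have J := jfac_neq0 Hd Hz.
rewrite /mob {1 2}/jfac /= !RtoC_plus !RtoC_mult; move: J; rewrite /jfac => J.
field => //.
Qed.

Lemma mob_mul A B z : 0 < det A -> 0 < det B -> 0 < Im z ->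
  mob (mmul A B) z = mob A (mob B z).
Proof.
move=> HA HB Hz.
have JB := jfac_neq0 HB Hz.
have JA := jfac_neq0 HA (mob_H HB Hz).
rewrite {1}/mob jfac_mul // {2}/mob.
have -> : (RtoC (e11 (mmul A B)) * z + RtoC (e12 (mmul A B)))%C =
  ((RtoC (e11 A) * mob B z + RtoC (e12 A)) * jfac B z)%C.
  rewrite /mob /= !RtoC_plus !RtoC_mult.
  rewrite /jfac in JB *.
  field => //.
field; split => //.
Qed.

Lemma sl_mul m A B F z : 0 < det A -> 0 < det B -> 0 < Im z ->
  sl m (mmul A B) F z = sl m B (sl m A F) z.
Proof.
move=> HA HB Hz.
have JB := jfac_neq0 HB Hz.
have JA := jfac_neq0 HA (mob_H HB Hz).
rewrite /sl mob_mul // jfac_mul // det_mmul RtoC_mult !Cpow_mult_l.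
field; split; exact: Cpow_nz.
Qed.

Lemma sl_ext m A F G z : 0 < det A -> 0 < Im z ->
  (forall w, 0 < Im w -> F w = G w) -> sl m A F z = sl m A G z.
Proof. by move=> HA Hz H; rewrite /sl H //; apply: mob_H. Qed.

Lemma sl_scalar m (l : R) A F z : l <> 0 -> 0 < det A -> 0 < Im z ->
  sl m (mk (l * e11 A) (l * e12 A) (l * e21 A) (l * e22 A)) F z = sl m A F z.
Proof.
move=> Hl HA Hz.
have J := jfac_neq0 HA Hz.
have Hl' : RtoC l <> 0%C by move=> E; apply: Hl; exact: RtoC_inj.
set B := mk _ _ _ _.
have EJ : jfac B z = (RtoC l * jfac A z)%C by rewrite /jfac /= !RtoC_mult; ring.
have EM : mob B z = mob A z by rewrite /mob EJ /= !RtoC_mult; field.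
have ED : RtoC (det B) = (RtoC l * RtoC l * RtoC (det A))%C.
  by rewrite -!RtoC_mult; congr RtoC; rewrite /det /=; ring.
rewrite /sl EM EJ ED !Cpow_mult_l (_ : (2 * m)%nat = (m + m)%nat); last by rewrite mul2n addnn.
rewrite -!plusE !Cpow_add_r; field; split; exact: Cpow_nz.
Qed.

Lemma sl_plus m A F G z : sl m A (fun w => F w + G w)%C z = (sl m A F z + sl m A G z)%C.
Proof. rewrite /sl; ring. Qed.

Lemma sl_scal m A c F z : sl m A (fun w => c * F w)%C z = (c * sl m A F z)%C.
Proof. rewrite /sl; ring. Qed.

Lemma sl_hol m A F : 0 < det A -> holH F -> holH (sl m A F).
Proof.
move=> HA HF z Hz.
have J := jfac_neq0 HA Hz.
have [l Hl] := HF _ (mob_H HA Hz).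
have D1 : cderiv (jfac A) z (RtoC (e21 A) * 1 + 0)%C.
  apply: cderiv_plus; last exact: cderiv_const.
  apply: cderiv_scal; exact: cderiv_id.
have D2 n : exists l', cderiv (fun w => / jfac A w ^ n)%C z l'.
  eexists; apply: (@cderiv_comp (fun w => jfac A w ^ n)%C Cinv).
    apply: (@cderiv_comp (jfac A) (fun w => w ^ n)%C); first exact: D1.
    exact: cderiv_pow.
  by apply: cderiv_inv; exact: Cpow_nz.
have [l1 H1] := D2 (2 * m)%nat.
have D3 : exists l', cderiv (mob A) z l'.
  eexists; apply: (@cderiv_mult (fun w => RtoC (e11 A) * w + RtoC (e12 A))%C (fun w => / jfac A w)%C).
    apply: cderiv_plus; last exact: cderiv_const.
    apply: cderiv_scal; exact: cderiv_id.
  by apply: (@cderiv_comp (jfac A) Cinv); [exact: D1 | exact: cderiv_inv].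
have [l3 H3] := D3.
eexists; apply: (@cderiv_mult (fun w => RtoC (det A) ^ m / jfac A w ^ (2 * m))%C (fun w => F (mob A w))).
  apply: cderiv_mult; [exact: cderiv_const | exact: H1].
by apply: (@cderiv_comp (mob A) F); [exact: H3 | exact: Hl].
Qed.

(** Inverse Cayley transform: it carries the unit disc to the upper half-plane and 0 to [z0]. [cayE]
    gives the usual fractional linear form. *)
Definition cay (z0 w : C) : C :=
  (RtoC (Re z0) + Ci * RtoC (Im z0) * ((1 + w) / (1 - w)))%C.

Lemma one_minus_neq0 (w : C) : Cmod w < 1 -> (1 - w)%C <> 0%C.
Proof.
by move=> Hw; apply: Cminus_eq_contra => E; move: Hw; rewrite -E Cmod_1; lra.
Qed.

Lemma cay_H z0 w : 0 < Im z0 -> Cmod w < 1 -> 0 < Im (cay z0 w).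
Proof.
move=> H0 Hw.
have N := one_minus_neq0 Hw.
have w0 := Cmod_ge_0 w.
have S := Cmod_sq w.
have L : 0 < 1 - (Re w * Re w + Im w * Im w) by rewrite -S; nra.
have P := Cmod_pos N.
have Q := Cmod_sq (1 - w).
have Q0 : 0 < (1 - Re w) * (1 - Re w) + Im w * Im w.
  move: Q; rewrite re_plus im_plus re_opp im_opp re_RtoC im_RtoC => Q.
  have := Rmult_lt_0_compat _ _ P P; rewrite Q; lra.
have -> : Im (cay z0 w) = Im z0 * ((1 - (Re w * Re w + Im w * Im w)) / ((1 - Re w) * (1 - Re w) + Im w * Im w)).
  move: Q0; rewrite /cay /= /Re /Im => Q0; field; nra.
by apply: Rmult_lt_0_compat => //; apply: Rdiv_lt_0_compat.
Qed.

Lemma cay_surj z0 z : 0 < Im z0 -> 0 < Im z -> exists w, Cmod w < 1 /\ cay z0 w = z.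
Proof.
move=> H0 Hz.
have N : (z - Cconj z0)%C <> 0%C.
  move=> E; have : Im (z - Cconj z0) = 0 by rewrite E.
  rewrite im_plus im_opp im_conj; lra.
have N2 : (z0 - Cconj z0)%C <> 0%C.
  move=> E; have : Im (z0 - Cconj z0) = 0 by rewrite E.
  rewrite im_plus im_opp im_conj; lra.
exists ((z - z0) / (z - Cconj z0))%C; split.
  rewrite Cmod_div //; apply: (proj2 (Rlt_div_l _ _ _ (Cmod_pos N))); rewrite Rmult_1_l.
  apply: sqrt_lt_1_alt; split; first by apply: Rplus_le_le_0_compat; exact: pow2_ge_0.
  move: H0 Hz; rewrite /= /Im; nra.
have Ez : (RtoC (Re z0) = (z0 + Cconj z0) / 2)%C by exact: re_alt.
have Ez' : (Ci * RtoC (Im z0) = (z0 - Cconj z0) / 2)%C.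
  rewrite im_alt; field; exact: Ci_nz.
rewrite /cay Ez Ez'; field; split; first exact: N.
rewrite (_ : (z - Cconj z0 - (z - z0))%C = (z0 - Cconj z0)%C) //; ring.
Qed.

Lemma cay_hol z0 w : Cmod w < 1 -> exists l, cderiv (cay z0) w l.
Proof.
move=> Hw; have N := one_minus_neq0 Hw.
eexists; apply: (@cderiv_plus (fun=> RtoC (Re z0))); first exact: cderiv_const.
apply: cderiv_scal.
apply: (@cderiv_mult (fun w => 1 + w)%C (fun w => / (1 - w))%C).
  by apply: (@cderiv_plus (fun=> 1%C)); [exact: cderiv_const | exact: cderiv_id].
apply: (@cderiv_comp (fun w => 1 - w)%C Cinv); last exact: cderiv_inv.
by apply: (@cderiv_minus (fun=> 1%C)); [exact: cderiv_const | exact: cderiv_id].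
Qed.

(** The Cayley coordinate centred at i y0 carries the real interval ]0, 1[ to the half-line above i
    y0, which reduces the claim to [identity_disc]. *)
Lemma identity_H F y0 : 0 < y0 -> holH F -> (forall y, y0 < y -> F (0, y) = 0%C) ->
  forall z, 0 < Im z -> F z = 0%C.
Proof.
move=> Hy HF H0 z Hz.
have [w [Hw <-]] := @cay_surj (0, y0) z Hy Hz.
apply: (@identity_disc (fun w => F (cay (0, y0) w)) 1) => //; first lra.
- move=> v Hv; have [l Hl] := @cay_hol (0, y0) v Hv.
  have [l' Hl'] := HF _ (@cay_H (0, y0) v Hy Hv).
  by eexists; apply: cderiv_comp; [exact: Hl | exact: Hl'].
- move=> x Hx.
  have -> : cay (0, y0) (RtoC x) = (0, y0 * ((1 + x) / (1 - x))).
    rewrite /cay -RtoC_minus -RtoC_plus -RtoC_div; last lra.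
    by apply: C_eq => /=; ring.
  apply: H0; rewrite -{1}(Rmult_1_r y0); apply: Rmult_lt_compat_l => //.
  apply: (proj1 (Rlt_div_r _ _ _ _)); lra.
Qed.

Section Elliptic.
Variable A : M2.
Hypothesis c_pos : 0 < e21 A.
Hypothesis det_pos : 0 < det A.
Hypothesis tr_lt : (e11 A + e22 A) * (e11 A + e22 A) < 4 * det A.

(** The fixed point of [A] in the upper half-plane; the eigenvalue [ell_j] of [A], which is the
    automorphy factor there; the quotient [ell_zeta] of the two conjugate eigenvalues, which is the
    multiplier of [A] at the fixed point. *)
Definition ell_s : R := sqrt (4 * det A - (e11 A + e22 A) * (e11 A + e22 A)).
Definition ell_fix : C := ((e11 A - e22 A) / (2 * e21 A), ell_s / (2 * e21 A)).
Definition ell_j : C := ((e11 A + e22 A) / 2, ell_s / 2).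
Definition ell_zeta : C := (Cconj ell_j / ell_j)%C.

Lemma ell_s_pos : 0 < ell_s.
Proof. by apply: sqrt_lt_R0; lra. Qed.

Lemma ell_s_sq : ell_s * ell_s = 4 * det A - (e11 A + e22 A) * (e11 A + e22 A).
Proof. by apply: sqrt_sqrt; lra. Qed.

Lemma ell_fix_H : 0 < Im ell_fix.
Proof. by rewrite /=; apply: Rdiv_lt_0_compat; [exact: ell_s_pos | lra]. Qed.

Lemma ell_jE : (RtoC (e21 A) * ell_fix + RtoC (e22 A))%C = ell_j.
Proof. by apply: C_eq; rewrite /=; field; lra. Qed.

Lemma ell_fixE : (RtoC (e11 A) * ell_fix + RtoC (e12 A))%C = (ell_j * ell_fix)%C.
Proof.
have S := ell_s_sq; rewrite /det in S.
have C0 : e21 A <> 0 by lra.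
apply: C_eq; rewrite /=; last by field.
apply: (Rmult_eq_reg_r (4 * e21 A)); last lra.
rewrite (_ : ((e11 A + e22 A) / 2 * ((e11 A - e22 A) / (2 * e21 A)) -
   ell_s / 2 * (ell_s / (2 * e21 A))) * (4 * e21 A) =
   (e11 A + e22 A) * (e11 A - e22 A) - ell_s * ell_s); last by field.
rewrite S; field => //.
Qed.

Lemma ell_j_norm : (ell_j * Cconj ell_j)%C = RtoC (det A).
Proof.
have S := ell_s_sq.
rewrite -Cmod2_conj; congr RtoC; rewrite Cmod2_alt /=.
rewrite (_ : (e11 A + e22 A) / 2 * ((e11 A + e22 A) / 2 * 1) + ell_s / 2 * (ell_s / 2 * 1)
  = ((e11 A + e22 A) * (e11 A + e22 A) + ell_s * ell_s) / 4); last by field.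
rewrite S; field.
Qed.

Lemma ell_j_neq0 : ell_j <> 0%C.
Proof.
move=> E; have := ell_s_pos; have : Im ell_j = 0 by rewrite E.
rewrite /=; lra.
Qed.

Lemma Cmod_zeta : Cmod ell_zeta = 1.
Proof.
rewrite /ell_zeta Cmod_div; last exact: ell_j_neq0.
rewrite Cmod_conj; field; apply: Rgt_not_eq; apply: Cmod_pos; exact: ell_j_neq0.
Qed.

Lemma cayE z0 w : Cmod w < 1 -> cay z0 w = ((z0 - w * Cconj z0) / (1 - w))%C.
Proof.
move=> Hw; have N := one_minus_neq0 Hw.
rewrite /cay re_alt im_alt; field; split; [exact: N | exact: Ci_nz].
Qed.

Lemma conj_real_lin (x y : R) (z : C) :
  Cconj (RtoC x * z + RtoC y) = (RtoC x * Cconj z + RtoC y)%C.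
Proof. by rewrite Cplus_conj Cmult_conj; congr (_ * _ + _)%C; apply: C_eq => /=; ring. Qed.

Lemma ell_jac w : Cmod w < 1 ->
  jfac A (cay ell_fix w) = (ell_j * (1 - ell_zeta * w) / (1 - w))%C.
Proof.
move=> Hw; have N := one_minus_neq0 Hw; have J := ell_j_neq0.
have E := ell_jE; have E' := conj_real_lin (e21 A) (e22 A) ell_fix.
rewrite E in E'.
rewrite cayE // /jfac /ell_zeta.
have -> : (ell_j * (1 - Cconj ell_j / ell_j * w) / (1 - w) = (ell_j - Cconj ell_j * w) / (1 - w))%C by field.
rewrite E' -E; field => //.
Qed.

Lemma ell_mob w : Cmod w < 1 -> mob A (cay ell_fix w) = cay ell_fix (ell_zeta * w).
Proof.
move=> Hw; have N := one_minus_neq0 Hw; have J := ell_j_neq0.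
have Hw' : Cmod (ell_zeta * w) < 1 by rewrite Cmod_mult Cmod_zeta; lra.
have N' := one_minus_neq0 Hw'.
have E := ell_fixE; have E' := conj_real_lin (e11 A) (e12 A) ell_fix.
rewrite E Cmult_conj in E'.
rewrite /mob ell_jac // !cayE //.
have -> : (RtoC (e11 A) * ((ell_fix - w * Cconj ell_fix) / (1 - w)) + RtoC (e12 A) =
  ((RtoC (e11 A) * ell_fix + RtoC (e12 A)) - w * (RtoC (e11 A) * Cconj ell_fix + RtoC (e12 A))) / (1 - w))%C by field.
rewrite E -E'.
have -> : (ell_j * ell_fix - w * (Cconj ell_j * Cconj ell_fix) =
  ell_j * (ell_fix - ell_zeta * w * Cconj ell_fix))%C by rewrite /ell_zeta; field.
field; split => //.
Qed.

Lemma pow_eq1_cancel (x e y : C) : (x * x <> 1)%C -> (e * e = 1)%C -> (y * (x - e) = 0)%C -> y = 0%C.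
Proof.
move=> Hx He Hy.
case: (Ceq_dec (x - e) 0) => [E|N].
  have X : x = e by exact: (proj2 (Ceq_minus _ _) E).
  by case: Hx; rewrite X.
by rewrite -[LHS]Cmult_1_r -(Cinv_r _ N) Cmult_assoc Hy; ring.
Qed.

(* In the Cayley coordinate centred at the fixed point, [A] is the rotation by [ell_zeta], so each
   Taylor coefficient of the transported function is scaled by a power of [ell_zeta], never 1 or -1. *)
Lemma elliptic_zero (u : C -> C) (m : nat) (e : C) : (0 < m)%N -> (e * e = 1)%C -> holH u ->
  (forall n, (0 < n)%N -> (ell_zeta ^ n)%C <> 1%C) ->
  (forall z, 0 < Im z -> sl m A u z = (e * u z)%C) ->
  forall z, 0 < Im z -> u z = 0%C.
Proof.
move=> Hm He Hu Hz Hs z Hz0.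
pose U w := (/ (1 - w) ^ (2 * m) * u (cay ell_fix w))%C.
have HU : hol_disc U 1.
  move=> w Hw; have N := one_minus_neq0 Hw.
  have [l1 L1] := cay_hol ell_fix Hw.
  have [l2 L2] := Hu _ (cay_H ell_fix_H Hw).
  eexists; apply: (@cderiv_mult (fun w => / (1 - w) ^ (2 * m))%C (fun w => u (cay ell_fix w))); last first.
    by apply: cderiv_comp; [exact: L1 | exact: L2].
  apply: (@cderiv_comp (fun w => (1 - w) ^ (2 * m))%C Cinv); last by apply: cderiv_inv; exact: Cpow_nz.
  apply: (@cderiv_comp (fun w => 1 - w)%C (fun w => w ^ (2 * m))%C); last exact: cderiv_pow.
  by apply: (@cderiv_minus (fun=> 1%C)); [exact: cderiv_const | exact: cderiv_id].
have FE w : Cmod w < 1 -> (ell_zeta ^ m * U (ell_zeta * w) = e * U w)%C.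
  move=> Hw; have N := one_minus_neq0 Hw; have J := ell_j_neq0.
  have Hw' : Cmod (ell_zeta * w) < 1 by rewrite Cmod_mult Cmod_zeta; lra.
  have N' := one_minus_neq0 Hw'.
  have := Hs _ (cay_H ell_fix_H Hw); rewrite /sl ell_mob // ell_jac // => K.
  have -> : (e * U w = / (1 - w) ^ (2 * m) * (e * u (cay ell_fix w)))%C by rewrite /U; ring.
  rewrite -K /U -ell_j_norm /ell_zeta -/ell_zeta.
  rewrite /Cdiv !Cpow_mult_l Cpow_inv // Cpow_inv //.
  have P1 := Cpow_nz _ (2 * m) N; have P2 := Cpow_nz _ (2 * m) N'; have P3 := Cpow_nz _ m J.
  rewrite (_ : (ell_j ^ (2 * m))%C = (ell_j ^ m * ell_j ^ m)%C); last first.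
    by rewrite mul2n -addnn -plusE Cpow_add_r.
  move: P2; rewrite /ell_zeta /Cdiv => P2.
  field; repeat split => //.
have [c Hc] := taylor_disc Rlt_0_1 HU.
have c0 n : c n = 0%C.
  (* The factor [ell_zeta ^ m] comes from the weight. Since m > 0, the exponent m + n is positive
     for n = 0 too, so the constant coefficient is also killed. *)
  apply: (@pow_eq1_cancel (ell_zeta ^ (m + n)) e) => //.
    rewrite -Cpow_add_r; apply: Hz; rewrite !plusE.
    by case: (m) Hm.
  move: n; apply: (@pow_series_unique _ 1); first lra.
  move=> w Hw.
  have Hw1 : Cmod w < 1 by rewrite Cmod_R Rabs_pos_eq; lra.
  have Hw' : Cmod (ell_zeta * w) < 1 by rewrite Cmod_mult Cmod_zeta; lra.
  have S1 := @cser_scal (ell_zeta ^ m)%C _ _ (Hc _ Hw').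
  have S2 := @cser_scal e _ _ (Hc _ Hw1).
  have := cser_minus S1 S2; rewrite FE // (_ : (e * U w - e * U w)%C = 0%C); last by ring.
  apply: cser_ext => n; rewrite Cpow_mult_l -plusE Cpow_add_r; ring.
have [w [Hw Ew]] := cay_surj ell_fix_H Hz0.
have := @pow_series_zero c c0 w _ (Hc w Hw).
rewrite /U Ew => E.
have N := Cpow_nz _ (2 * m) (one_minus_neq0 Hw).
by rewrite -[LHS]Cmult_1_l -(Cinv_r _ N) -Cmult_assoc E; ring.
Qed.

(* A root of unity [zeta] has [zeta + 1 / zeta] an algebraic integer, while here it is [p / q]; only
   the congruences that the application needs are assumed. *)
Lemma ell_zeta_root (p q l : Z) : (1 < l)%Z -> (l | q)%Z -> (l | p + 1)%Z -> (0 < q)%Z ->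
  IZR q * ((e11 A + e22 A) * (e11 A + e22 A) - 2 * det A) = IZR p * det A ->
  forall n, (0 < n)%N -> (ell_zeta ^ n)%C <> 1%C.
Proof.
move=> Hl Hq Hp Hq0 H.
have J := ell_j_neq0.
have Jb : Cconj ell_j <> 0%C.
  by apply: Cmod_neq0; rewrite Cmod_conj; apply: Cmod_pos.
have Zn : ell_zeta <> 0%C by apply: Cmod_neq0; rewrite Cmod_zeta; lra.
(* The sequence satisfies the Chebyshev recursion with t_1 = p / q. Multiplying by q^n clears
   denominators and gives the integers [w n]. *)
pose t n := (ell_zeta ^ n + / ell_zeta ^ n)%C.
have T1 : (RtoC (IZR q) * t 1%nat = RtoC (IZR p))%C.
  have ED : (ell_j * Cconj ell_j)%C = RtoC (det A) := ell_j_norm.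
  have Et : (ell_j + Cconj ell_j)%C = RtoC (e11 A + e22 A) by apply: C_eq; rewrite /=; field.
  have D0 : RtoC (det A) <> 0%C by apply: Cmod_neq0; rewrite Cmod_R Rabs_pos_eq; lra.
  have -> : t 1%nat = (((ell_j + Cconj ell_j) * (ell_j + Cconj ell_j) - 2 * (ell_j * Cconj ell_j)) / (ell_j * Cconj ell_j))%C.
    by rewrite /t /ell_zeta /=; field; split.
  rewrite Et ED.
  have -> : (RtoC (IZR q) * ((RtoC (e11 A + e22 A) * RtoC (e11 A + e22 A) - 2 * RtoC (det A)) / RtoC (det A)))%C
    = (RtoC (IZR q * ((e11 A + e22 A) * (e11 A + e22 A) - 2 * det A)) / RtoC (det A))%C.
    by rewrite RtoC_mult RtoC_minus !RtoC_mult; field.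
  by rewrite H RtoC_mult; field.
have rec n : t n.+2 = (t 1%nat * t n.+1 - t n)%C.
  rewrite /t /=; field; split=> //; exact: Cpow_nz.
pose w n := (RtoC (IZR q) ^ n * t n)%C.
have wrec n : w n.+2 = (RtoC (IZR p) * w n.+1 - RtoC (IZR q) * RtoC (IZR q) * w n)%C.
  rewrite /w rec -T1 /=; ring.
have i1 : (/ 1)%C = 1%C by rewrite -RtoC_inv ?Rinv_1 //; lra.
have w0 : w 0%nat = RtoC 2 by rewrite /w /t /= i1 -RtoC_plus -RtoC_mult; congr RtoC; ring.
(* Modulo [l] one has p = -1 and q = 0, so that w_1, w_2, ... are alternately -1 and 1. If
   [ell_zeta ^ n] were 1, then w_n would be 2 q^n, which is 0 modulo [l]. *)
have main n : exists S S' s : Z, (s = 1 \/ s = -1)%Z /\ w n.+1 = RtoC (IZR S) /\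
   w n.+2 = RtoC (IZR S') /\ (l | S - s)%Z /\ (l | S' + s)%Z.
  elim: n => [|n [S [S' [s [Hs [W1 [W2 [D1 D2]]]]]]]].
    exists p, (p * p - 2 * (q * q))%Z, (-1)%Z.
    split; first by right.
    have W1 : w 1%nat = RtoC (IZR p) by rewrite -T1 /w /=; ring.
    split; first exact: W1.
    split.
      rewrite wrec W1 w0 minus_IZR !mult_IZR RtoC_minus !RtoC_mult; ring.
    split; first by rewrite (_ : (p - -1 = p + 1)%Z) //; ring.
    rewrite (_ : (p * p - 2 * (q * q) + -1 = (p + 1) * (p - 1) - 2 * q * q)%Z); last by ring.
    apply: Z.divide_sub_r; [exact: Z.divide_mul_l | exact: Z.divide_mul_r].
  exists S', (p * S' - q * q * S)%Z, (- s)%Z.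
  split; first by lia.
  split; first exact: W2.
  split.
    by rewrite wrec W1 W2 minus_IZR !mult_IZR RtoC_minus !RtoC_mult; ring.
  split; first by rewrite (_ : (S' - - s = S' + s)%Z) //; ring.
  rewrite (_ : (p * S' - q * q * S + - s = (p + 1) * S' - (S' + s) - q * q * S)%Z); last by ring.
  apply: Z.divide_sub_r; last by apply: Z.divide_mul_l; exact: Z.divide_mul_r.
  apply: Z.divide_sub_r => //; exact: Z.divide_mul_l.
move=> [|n] // _ E.
have [S [_ [s [Hs [W [_ [D _]]]]]]] := main n.
have ES : S = (2 * q ^ Z.of_nat n.+1)%Z.
  apply: eq_IZR; apply: RtoC_inj; rewrite -W /w /t E.
  rewrite mult_IZR -pow_IZR RtoC_mult RtoC_pow.
  rewrite i1 (_ : RtoC 2 = (1 + 1)%C); [ring | by rewrite -RtoC_plus; congr RtoC; ring].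
have LS : (l | S)%Z.
  rewrite ES Nat2Z.inj_succ Z.pow_succ_r; last exact: Nat2Z.is_nonneg.
  by apply: Z.divide_mul_r; apply: Z.divide_mul_l.
have [k Hk] : (l | s)%Z.
  rewrite (_ : s = (S - (S - s))%Z); last by ring.
  exact: Z.divide_sub_r.
have [k1|[k1|k1]] : (k <= -1 \/ k = 0 \/ 1 <= k)%Z by lia.
- case: Hs => Hs; nia.
- case: Hs => Hs; nia.
- case: Hs => Hs; nia.
Qed.
End Elliptic.

(** * Hecke's converse theorem *)

Ltac Rring := match goal with |- @eq _ ?a ?b => change (@eq R a b) end; ring.

Lemma moments_poly (h : R -> R) (c0 c1 c2 : R) :
  (forall n, is_RInt (fun t => h t * t ^ n) 0 1 0) ->
  forall n j, is_RInt (fun t => h t * t ^ j * (c0 + c1 * t + c2 * t ^ 2) ^ n) 0 1 0.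
Proof.
move=> H; elim=> [|n IH] j.
  by apply: is_RInt_ext (H j) => x _; rewrite /= Rmult_1_r.
have S0 := is_RInt_scal _ _ _ c0 _ (IH j).
have S1 := is_RInt_scal _ _ _ c1 _ (IH j.+1).
have S2 := is_RInt_scal _ _ _ c2 _ (IH j.+2).
have := is_RInt_plus _ _ _ _ _ _ (is_RInt_plus _ _ _ _ _ _ S0 S1) S2.
rewrite /plus /scal /= /mult /= !Rmult_0_r !Rplus_0_r.
by apply: is_RInt_ext => x _; Rring.
Qed.

(** Replaces Weierstrass approximation. If h(t0) > 0, the powers of P(t) = 1 + d^2/2 - (t - t0)^2
    concentrate at t0: P >= 1 + d^2/4 within distance d/2, P >= 0 within d, and |P| <= 1 elsewhere.
    The integral of h P^n would then grow without bound, while it is a combination of moments. *)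
Lemma moments_nonpos (h : R -> R) :
  (forall t, 0 <= t <= 1 -> continuous h t) ->
  (forall n, is_RInt (fun t => h t * t ^ n) 0 1 0) ->
  forall t, 0 < t < 1 -> h t <= 0.
Proof.
move=> Hc Hm t0 Ht0; apply: Rnot_lt_le => Hpos.
have [M HM] : exists M, forall t, 0 <= t <= 1 -> Rabs (h t) <= M.
  have [M HM] := @bounded_continuity R_AbsRing R_NormedModule h 0 1 Hc.
  by exists M => t /HM; apply: Rlt_le.
have [d0 Hd0] := Hc t0 ltac:(lra) _ (locally_ball (h t0) (mkposreal (h t0 / 2) ltac:(lra))).
set d := Rmin (d0 / 2) (Rmin (t0 / 2) ((1 - t0) / 2)).
have D1 : d <= d0 / 2 := Rmin_l _ _.
have D2 : d <= t0 / 2 := Rle_trans _ _ _ (Rmin_r _ _) (Rmin_l _ _).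
have D3 : d <= (1 - t0) / 2 := Rle_trans _ _ _ (Rmin_r _ _) (Rmin_r _ _).
have D0 : 0 < d.
  have P := cond_pos d0.
  apply: Rmin_pos; first lra.
  by apply: Rmin_pos; lra.
have near t : Rabs (t - t0) <= d -> h t0 / 2 <= h t.
  move=> Ht.
  have : Rabs (h t - h t0) < h t0 / 2.
    by apply: Hd0; apply: Rle_lt_trans Ht _; have := cond_pos d0; lra.
  by move/Rabs_def2; lra.
set P := fun t => (1 + d * d / 2 - t0 * t0) + (2 * t0) * t + (-1) * t ^ 2.
have PE t : P t = 1 + d * d / 2 - (t - t0) * (t - t0) by rewrite /P /=; ring.
have I n : is_RInt (fun t => h t * P t ^ n) 0 1 0.
  have := @moments_poly h (1 + d * d / 2 - t0 * t0) (2 * t0) (-1) Hm n 0.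
  by apply: is_RInt_ext => x _; rewrite /P /=; Rring.
have M0 : 0 <= M by apply: Rle_trans (Rabs_pos _) (HM 0 _); lra.
have low t n : 0 <= t <= 1 -> - M <= h t * P t ^ n.
  move=> Ht; case: (Rle_lt_dec (Rabs (t - t0)) d) => L.
    have A := near t L.
    have : 0 <= P t.
      rewrite PE; move/Rabs_le_between: L => L; nra.
    move/(pow_le _ n) => B; have : 0 <= h t * P t ^ n by apply: Rmult_le_pos; lra.
    lra.
  have : Rabs (P t) <= 1.
    apply: Rabs_le; rewrite PE.
    have : d * d <= (t - t0) * (t - t0).
      move: L; rewrite /Rabs; case: Rcase_abs => ? ?; nra.
    have : (t - t0) * (t - t0) <= 1 by nra.
    nra.
  move=> B; have C : Rabs (P t ^ n) <= 1.
    by rewrite -RPow_abs -(pow1 n); apply: pow_incr; split; [exact: Rabs_pos |].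
  have : Rabs (h t * P t ^ n) <= M * 1.
    by rewrite Rabs_mult; apply: Rmult_le_compat => //; try exact: Rabs_pos; exact: HM.
  by move/Rabs_le_between; lra.
have mid n : d * (h t0 / 2 * (1 + d * d / 4) ^ n) - M <= 0.
  have ex : ex_RInt (fun t => h t * P t ^ n) 0 1 by exists 0.
  have ex1 : ex_RInt (fun t => h t * P t ^ n) 0 (t0 - d / 2).
    by apply: ex_RInt_Chasles_1 ex; lra.
  have ex2 : ex_RInt (fun t => h t * P t ^ n) (t0 - d / 2) 1.
    by apply: ex_RInt_Chasles_2 ex; lra.
  have ex3 : ex_RInt (fun t => h t * P t ^ n) (t0 - d / 2) (t0 + d / 2).
    by apply: ex_RInt_Chasles_1 ex2; lra.
  have ex4 : ex_RInt (fun t => h t * P t ^ n) (t0 + d / 2) 1.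
    by apply: ex_RInt_Chasles_2 ex2; lra.
  have E1 := RInt_Chasles _ _ _ _ ex1 ex2.
  have E2 := RInt_Chasles _ _ _ _ ex3 ex4.
  rewrite (is_RInt_unique _ _ _ _ (I n)) -E2 /plus /= in E1.
  have L1 := is_RInt_le _ _ _ _ _ _ _ (is_RInt_const 0 (t0 - d / 2) (- M)) (RInt_correct _ _ _ ex1).
  have L2 := is_RInt_le _ _ _ _ _ _ _ (is_RInt_const (t0 + d / 2) 1 (- M)) (RInt_correct _ _ _ ex4).
  have L3 := is_RInt_le _ _ _ _ _ _ _ (is_RInt_const (t0 - d / 2) (t0 + d / 2) (h t0 / 2 * (1 + d * d / 4) ^ n)) (RInt_correct _ _ _ ex3).
  have {}L1 := L1 ltac:(lra) (fun x Hx => low x n ltac:(lra)).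
  have {}L2 := L2 ltac:(lra) (fun x Hx => low x n ltac:(lra)).
  have {}L3 : scal (t0 + d / 2 - (t0 - d / 2)) (h t0 / 2 * (1 + d * d / 4) ^ n) <= RInt (fun t : R => h t * P t ^ n) (t0 - d / 2) (t0 + d / 2).
    apply: L3; first lra.
    move=> x Hx; apply: Rmult_le_compat; first lra.
    - by apply: pow_le; nra.
    - by apply: near; apply: Rabs_le; lra.
    - by apply: pow_incr; split; [nra | rewrite PE; nra].
  rewrite /scal /= /mult /= in L1 L2 L3; nra.
have K0 : 0 < d * (h t0 / 2) * (d * d / 4).
  by repeat apply: Rmult_lt_0_compat; nra.
have [n Hn] := INR_unbounded (M / (d * (h t0 / 2) * (d * d / 4))).
have := mid n; have := @poly n (d * d / 4) ltac:(nra).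
have X0 : 0 < d * (h t0 / 2) by nra.
have Hn' := proj2 (Rlt_div_l M _ _ K0) .
have Hn2 : M < INR n * (d * (h t0 / 2) * (d * d / 4)).
  have := Rmult_lt_compat_r _ _ _ K0 Hn; rewrite /Rdiv Rmult_assoc Rinv_l; lra.
move=> B /Rle_minus L.
have := Rmult_le_compat_l _ _ _ (Rlt_le _ _ X0) B; lra.
Qed.

Lemma moments_zero (H : R -> C) :
  (forall t, 0 <= t <= 1 -> rcont H t) ->
  (forall n, cint (fun t => H t * RtoC t ^ n)%C 0 1 0%C) ->
  forall t, 0 < t < 1 -> H t = 0%C.
Proof.
move=> Hc Hm.
have R0 (h : R -> R) : (forall t, 0 <= t <= 1 -> continuous h t) ->
  (forall n, is_RInt (fun t => h t * t ^ n) 0 1 0) -> forall t, 0 < t < 1 -> h t = 0.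
  move=> C I t Ht; apply: Rle_antisym; first exact: moments_nonpos.
  suff : - h t <= 0 by lra.
  apply: (@moments_nonpos (fun t => - h t)) => //.
  - move=> s /C K; exact: (@continuous_opp _ _ R_NormedModule h s).
  - move=> n; have := is_RInt_opp _ _ _ _ (I n); rewrite /opp /= Ropp_0.
    by apply: is_RInt_ext => x _; rewrite /opp /=; Rring.
move=> t Ht; apply: C_eq.
- apply: (R0 (fun t => Re (H t))) => //.
  + move=> s Hs; apply: (continuous_comp H (@fst R R)); first exact/rcont_continuous/Hc.
    exact: continuous_fst.
  + move=> n; have := is_RInt_fct_extend_fst _ _ _ _ (Hm n).
    by apply: is_RInt_ext => x _; rewrite -RtoC_pow -re_scal_r.
- apply: (R0 (fun t => Im (H t))) => //.
  + move=> s Hs; apply: (continuous_comp H (@snd R R)); first exact/rcont_continuous/Hc.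
    exact: continuous_snd.
  + move=> n; have := is_RInt_fct_extend_snd _ _ _ _ (Hm n).
    by apply: is_RInt_ext => x _; rewrite -RtoC_pow -im_scal_r.
Qed.

(** * Complex powers and Mellin integrals over the unit interval *)

Lemma Cmod_cpow x s : Cmod (cpow x s) = exp (Re s * ln x).
Proof. by rewrite /cpow Cmod_Cexp re_scal_r. Qed.

Lemma cpow_add x s t : cpow x (s + t) = (cpow x s * cpow x t)%C.
Proof. by rewrite /cpow -Cexp_add; congr Cexp; ring. Qed.

Lemma cpow_neq0 x s : cpow x s <> 0%C.
Proof. exact: Cexp_neq0. Qed.

Lemma cpow_mul x y s : 0 < x -> 0 < y -> cpow (x * y) s = (cpow x s * cpow y s)%C.
Proof. by move=> Hx Hy; rewrite /cpow ln_mult // RtoC_plus -Cexp_add; congr Cexp; ring. Qed.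

Lemma cpow_inv x s : 0 < x -> cpow (/ x) s = cpow x (- s).
Proof. by move=> Hx; rewrite /cpow ln_Rinv // RtoC_opp; congr Cexp; ring. Qed.

Lemma cpow_nat x n : 0 < x -> cpow x (RtoC (INR n)) = (RtoC x ^ n)%C.
Proof.
move=> Hx; rewrite /cpow -RtoC_mult Cexp_real -RtoC_pow; congr RtoC.
by rewrite -Rpower_pow.
Qed.

Lemma cpow_0 x : cpow x 0 = 1%C.
Proof. by rewrite /cpow Cmult_0_l Cexp_0. Qed.

Lemma ln_le0 x : 0 < x <= 1 -> ln x <= 0.
Proof. by move=> [H [L|->]]; [apply: Rlt_le; rewrite -ln_1; apply: ln_increasing | rewrite ln_1; lra]. Qed.

Lemma cpow_le x s q : 0 < x <= 1 -> INR q <= Re s -> Cmod (cpow x s) <= x ^ q.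
Proof.
move=> Hx Hs; rewrite Cmod_cpow -Rpower_pow; last lra.
apply: exp_le; have := ln_le0 Hx; nra.
Qed.

Lemma cpow_le_neg x s q : 0 < x <= 1 -> - INR q <= Re s -> Cmod (cpow x s) * x ^ q <= 1.
Proof.
move=> Hx Hs; rewrite Cmod_cpow -Rpower_pow; last lra.
rewrite /Rpower -exp_plus -exp_0; apply: exp_le; have := ln_le0 Hx; nra.
Qed.

Lemma rcont_ln t : 0 < t -> rcont (fun u => RtoC (ln u)) t.
Proof.
move=> Ht; apply: rcont_RtoC; apply: (proj1 (continuity_pt_filterlim _ _)).
apply: derivable_continuous_pt; exists (/ t); exact: derivable_pt_lim_ln.
Qed.

Lemma rcont_cpow s t : 0 < t -> rcont (fun u => cpow u s) t.
Proof.
move=> Ht; apply: (@rcont_comp (fun u => s * RtoC (ln u))%C Cexp).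
  by apply: rcont_mult; [exact: rcont_const | exact: rcont_ln].
exact: cderiv_ccont (cderiv_Cexp _).
Qed.

Lemma rcont_inv_arg (f : R -> C) t : 0 < t -> (forall u, 0 < u -> rcont f u) -> rcont (fun u => f (/ u)) t.
Proof.
move=> Ht Hf; apply/rcontP => e He.
have [d [Hd K]] := proj1 (rcontP f (/ t)) (Hf (/ t) (Rinv_0_lt_compat _ Ht)) e He.
have C : continuous Rinv t by apply: continuous_Rinv; lra.
have [d' Hd'] := C _ (locally_ball (/ t) (mkposreal d Hd)).
exists d'; split; first exact: cond_pos.
by move=> u Hu; apply: K; apply: Hd'.
Qed.

(** For an integrand that is at most K t near 0 (see [egood]), this extension is continuous on the
    closed interval, so the integral [EInt] over ]0, 1] is a proper one, bounded by K. *)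
Definition ext0 (g : R -> C) (t : R) : C := if Rlt_dec 0 t then g t else 0%C.

Lemma ext0_pos g t : 0 < t -> ext0 g t = g t.
Proof. by rewrite /ext0; case: Rlt_dec. Qed.

Lemma ext0_neg g t : t <= 0 -> ext0 g t = 0%C.
Proof. by rewrite /ext0; case: Rlt_dec => // H1 H2; lra. Qed.

Lemma ext0_bound g K t : 0 <= K -> (forall t, 0 < t <= 1 -> Cmod (g t) <= K * t) -> t <= 1 ->
  Cmod (ext0 g t) <= K * Rmax 0 t.
Proof.
move=> K0 H Ht; rewrite /ext0; case: Rlt_dec => L.
  by rewrite Rmax_right; [apply: H; lra | lra].
by rewrite Cmod_0; apply: Rmult_le_pos => //; exact: Rmax_l.
Qed.

Lemma ext0_cont g K : 0 <= K -> (forall t, 0 < t -> rcont g t) ->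
  (forall t, 0 < t <= 1 -> Cmod (g t) <= K * t) -> forall t, t <= 1 -> rcont (ext0 g) t.
Proof.
move=> K0 Hc Hb t Ht.
case: (Rlt_le_dec 0 t) => L.
  apply: (@rcont_ext_loc g _ _ t) => //; last exact: Hc.
  move=> u Hu; rewrite ext0_pos //; move/Rabs_def2: Hu; lra.
apply/rcontP => e He.
exists (Rmin 1 (e / (K + 1))); split.
  by apply: Rmin_pos; [lra | apply: Rdiv_lt_0_compat; lra].
move=> u Hu.
have U1 := Rlt_le_trans _ _ _ Hu (Rmin_l _ _).
have U2 : Rabs (u - t) * (K + 1) < e.
  by apply: (proj2 (Rlt_div_r _ _ _ _)); [lra | exact: Rlt_le_trans Hu (Rmin_r _ _)].
rewrite (ext0_neg g L) (_ : (ext0 g u - 0)%C = ext0 g u); last by ring.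
have : u <= 1 by move/Rabs_def2: U1; lra.
move=> Hu1; apply: Rle_lt_trans (ext0_bound K0 Hb Hu1) _.
have : Rmax 0 u <= Rabs (u - t).
  apply: Rmax_lub; first exact: Rabs_pos.
  by apply: Rle_trans (Rle_abs _); lra.
have := Rmax_l 0 u; have := Rabs_pos (u - t); nra.
Qed.

Definition EInt (g : R -> C) : C := CInt (ext0 g) 0 1.

Definition egood (g : R -> C) (K : R) : Prop :=
  [/\ 0 <= K, forall t, 0 < t -> rcont g t & forall t, 0 < t <= 1 -> Cmod (g t) <= K * t].

Lemma EInt_correct g K : egood g K -> cint (ext0 g) 0 1 (EInt g).
Proof.
move=> [K0 Hc Hb]; apply: CInt_correct; first lra.
move=> t Ht; apply: (ext0_cont K0 Hc Hb); lra.
Qed.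

Lemma EInt_bound g K : egood g K -> Cmod (EInt g) <= K.
Proof.
move=> H; have := cint_bound (M := K) _ _ (EInt_correct H).
rewrite Rminus_0_r Rmult_1_l; apply; first lra.
move=> t Ht; case: H => K0 Hc Hb.
apply: Rle_trans (ext0_bound K0 Hb _) _; first lra.
have := Rmax_lub 0 t 1 ltac:(lra) ltac:(lra); nra.
Qed.

Lemma EInt_ext g h : (forall t, 0 < t < 1 -> g t = h t) -> EInt g = EInt h.
Proof.
move=> H; apply: CInt_ext; first lra.
by move=> t Ht; rewrite !ext0_pos; [apply: H | lra | lra].
Qed.

Lemma EInt_plus g h K L : egood g K -> egood h L ->
  EInt (fun t => g t + h t)%C = (EInt g + EInt h)%C.
Proof.
move=> Hg Hh; apply: cint_unique.
apply: cint_ext (cint_plus (EInt_correct Hg) (EInt_correct Hh)); first lra.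
by move=> t Ht; rewrite !ext0_pos //; lra.
Qed.

Lemma EInt_scal c g K : egood g K -> EInt (fun t => c * g t)%C = (c * EInt g)%C.
Proof.
move=> Hg; apply: cint_unique.
apply: cint_ext (@cint_scal c _ _ _ _ (EInt_correct Hg)); first lra.
by move=> t Ht; rewrite !ext0_pos //; lra.
Qed.

Lemma egood_scal c g K : egood g K -> egood (fun t => c * g t)%C (Cmod c * K).
Proof.
move=> [K0 Hc Hb]; split.
- by apply: Rmult_le_pos => //; exact: Cmod_ge_0.
- by move=> t Ht; apply: rcont_mult; [exact: rcont_const | exact: Hc].
- move=> t Ht; rewrite Cmod_mult Rmult_assoc; apply: Rmult_le_compat_l; [exact: Cmod_ge_0 | exact: Hb].
Qed.

Lemma egood_plus g h K L : egood g K -> egood h L -> egood (fun t => g t + h t)%C (K + L).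
Proof.
move=> [K0 Kc Kb] [L0 Lc Lb]; split.
- lra.
- by move=> t Ht; apply: rcont_plus; [exact: Kc | exact: Lc].
- move=> t Ht; apply: Rle_trans (Cmod_triangle _ _) _.
  by have := Kb t Ht; have := Lb t Ht; lra.
Qed.

Lemma egood_minus g h K L : egood g K -> egood h L -> egood (fun t => g t - h t)%C (K + 1 * L).
Proof.
move=> Hg Hh; have := egood_plus Hg (@egood_scal (-1)%C _ _ Hh).
rewrite Cmod_R (_ : Rabs (-1) = 1) => [|]; last (by rewrite Rabs_left; lra); move=> -[A B D]; split => //.
- move=> t Ht; apply: (@rcont_ext_loc _ _ _ 1 _ _ (B t Ht)); first lra.
  by move=> u _ /=; ring.
- move=> t Ht; have := D t Ht.
  by rewrite (_ : (g t + -1 * h t)%C = (g t - h t)%C) //; ring.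
Qed.

Lemma EInt_minus g h K L : egood g K -> egood h L ->
  EInt (fun t => g t - h t)%C = (EInt g - EInt h)%C.
Proof.
move=> Hg Hh.
rewrite (_ : EInt _ = EInt (fun t => g t + (-1) * h t)%C); last by apply: EInt_ext => t _; ring.
rewrite (EInt_plus Hg (@egood_scal (-1)%C _ _ Hh)) (EInt_scal _ Hh); ring.
Qed.

(** The remainder bound is linear in t, so that [g] minus a partial sum is again [egood], with a
    constant tending to 0; [EInt_bound] then gives termwise integration. *)
Lemma EInt_series (g : R -> C) (u : R -> nat -> C) K :
  egood g K -> (forall n, exists L, egood (fun t => u t n) L) ->
  (forall n t, 0 < t <= 1 -> Cmod (g t - csum (u t) n) <= K * t * (2 * / INR n.+1)) ->
  cser (fun n => EInt (fun t => u t n)) (EInt g).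
Proof.
move=> Hg Hu H.
have S n : exists L', egood (fun t => csum (u t) n) L' /\
    EInt (fun t => csum (u t) n) = csum (fun n => EInt (fun t => u t n)) n.
  elim: n => [|n [L' [G E]]].
    exists 0; split.
      split; [lra | by move=> t _; exact: rcont_const | by move=> t _; rewrite Cmod_0; lra].
    apply: cint_unique; have := @cint_const 0%C 0 1; rewrite Cmult_0_r.
    by apply: cint_ext; [lra | move=> t Ht; rewrite ext0_pos //; lra].
  have [L HL] := Hu n.
  exists (L' + L); split; first exact: egood_plus.
  by rewrite (EInt_plus G HL) E.
case: (Hg) => K0 Gc Gb.
move=> e He.
have [m Hm] := INR_unbounded (2 * K / e).
exists m => n Hn.
have [L' [G E]] := S n.
have B : egood (fun t => g t - csum (u t) n)%C (K * (2 * / INR n.+1)).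
  have P : 0 < / INR n.+1 by apply: Rinv_0_lt_compat; apply: lt_0_INR; lia.
  have [A1 A2 A3] := egood_minus Hg G.
  split=> //; first by apply: Rmult_le_pos; lra.
  by move=> t Ht; have := H n t Ht; lra.
have := EInt_bound B; rewrite (EInt_minus Hg G) E Cmod_sub_sym.
move=> X; apply: Rle_lt_trans X _.
have N0 : 0 < INR n.+1 by apply: lt_0_INR; lia.
have N1 : INR m <= INR n by apply: le_INR.
rewrite (_ : K * (2 * / INR n.+1) = 2 * K / INR n.+1); last by rewrite /Rdiv; ring.
apply: (proj2 (Rlt_div_l _ _ _ N0)); rewrite S_INR.
have := Rmult_lt_compat_l _ _ _ He Hm.
rewrite (_ : e * (2 * K / e) = 2 * K); last by field; lra.
nra.
Qed.

Lemma locally_Cmod (l : C) (P : C -> Prop) : @locally C_R_NormedModule l P ->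
  exists e, 0 < e /\ forall y, Cmod (y - l) < e -> P y.
Proof.
move=> [[e He] HP]; exists e; split=> // y Hy; apply: HP.
have A := re_le_Cmod (y - l); have B := im_le_Cmod (y - l).
by split; [apply: Rle_lt_trans A Hy | apply: Rle_lt_trans B Hy].
Qed.

Section GammaSplit.
Variables (b : R) (s : C).
Hypothesis Hb : 0 < b.
Hypothesis Hs : 2 <= Re s.

(** Euler's integral, rescaled by [b], is cut at 1, and the substitution t = 1/x carries the
    unbounded half to ]0, 1], where its integrand becomes [gB]. *)
Definition gA (t : R) : C := (RtoC (exp (- (b * t))) * cpow t (s - 1))%C.
Definition gB (x : R) : C := (RtoC (exp (- (b / x))) * cpow x (- s - 1))%C.

Lemma rcont_exp_lin (c t : R) : rcont (fun u => RtoC (exp (- (c * u)))) t.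
Proof.
apply: rcont_RtoC.
apply: (@ex_derive_continuous R_AbsRing R_NormedModule).
by auto_derive.
Qed.

Lemma gA_good : egood gA 1.
Proof.
split; first lra.
- by move=> t Ht; apply: rcont_mult; [exact: rcont_exp_lin | exact: rcont_cpow].
- move=> t Ht; rewrite /gA Cmod_mult Cmod_R Rabs_pos_eq; last exact/Rlt_le/exp_pos.
  apply: Rmult_le_compat.
  + exact/Rlt_le/exp_pos.
  + exact: Cmod_ge_0.
  + rewrite -exp_0; apply: exp_le; nra.
  + rewrite -{2}(pow_1 t); apply: cpow_le => //.
    rewrite re_plus re_opp re_RtoC -[INR 1]/1; lra.
Qed.

Lemma gB_good : exists K, egood gB K.
Proof.
have [q Hq] := INR_unbounded (Re s + 1).
set K := (INR (q + 1) / b) ^ (q + 1).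
have K0 : 0 <= K by apply: pow_le; apply: Rdiv_le_0_compat => //; exact: pos_INR.
exists K; split=> //.
- move=> t Ht; apply: rcont_mult; last exact: rcont_cpow.
  apply: (@rcont_inv_arg (fun u => RtoC (exp (- (b * u))))) => // u _; exact: rcont_exp_lin.
- move=> t Ht; rewrite /gB Cmod_mult Cmod_R Rabs_pos_eq; last exact/Rlt_le/exp_pos.
  have Q : 0 < b / t by apply: Rdiv_lt_0_compat; lra.
  have E := @exp_neg_pow (b / t) (q + 1) Q.
  have C : Cmod (cpow t (- s - 1)) * t ^ q <= 1.
    apply: cpow_le_neg => //; rewrite re_plus !re_opp re_RtoC; lra.
  have C0 := Cmod_ge_0 (cpow t (- s - 1)).
  apply: Rle_trans (Rmult_le_compat_r _ _ _ C0 E) _.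
  rewrite (_ : INR (q + 1) / (b / t) = INR (q + 1) / b * t); last by field; lra.
  rewrite Rpow_mult_distr -/K -!plusE pow_add pow_1.
  rewrite (_ : K * (t ^ q * t) * Cmod (cpow t (- s - 1)) = K * t * (Cmod (cpow t (- s - 1)) * t ^ q)); last by ring.
  rewrite -{2}[K * t]Rmult_1_r; apply: Rmult_le_compat_l => //.
  by apply: Rmult_le_pos; lra.
Qed.

Lemma cut_bound g K d : egood g K -> 0 < d < 1 ->
  exists r, cint g d 1 (EInt g - r)%C /\ Cmod r <= K * d.
Proof.
move=> Hg Hd; case: (Hg) => K0 Gc Gb.
have G1 : cint (ext0 g) 0 d (CInt (ext0 g) 0 d).
  by apply: CInt_correct; [lra | move=> t Ht; apply: (ext0_cont K0 Gc Gb); lra].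
have G2 : cint (ext0 g) d 1 (CInt (ext0 g) d 1).
  by apply: CInt_correct; [lra | move=> t Ht; apply: (ext0_cont K0 Gc Gb); lra].
have E := cint_fun (EInt_correct Hg) (cint_Chasles G1 G2).
exists (CInt (ext0 g) 0 d); split.
  rewrite E (_ : (CInt (ext0 g) 0 d + CInt (ext0 g) d 1 - CInt (ext0 g) 0 d)%C = CInt (ext0 g) d 1); last by ring.
  by apply: cint_ext G2; [lra | move=> t Ht; rewrite ext0_pos //; lra].
have := cint_bound (M := K) _ _ G1; rewrite Rminus_0_r Rmult_comm; apply; first lra.
move=> t Ht; apply: Rle_trans (ext0_bound K0 Gb _) _; first lra.
have := Rmax_lub 0 t 1 ltac:(lra) ltac:(lra); nra.
Qed.

Lemma gB_subst d l : 0 < d < 1 -> cint gB d 1 l -> cint gA 1 (/ d) l.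
Proof.
move=> Hd H.
have D1 : 1 < / d by rewrite -Rinv_1; apply: Rinv_lt_contravar; lra.
have [_ Gc _] := gA_good.
have C : cint (fun y => RtoC (- / y ^ 2) * gA (/ y))%C d 1 (CInt gA (/ d) (/ 1)).
  have := @is_RInt_comp C_R_CompleteNormedModule gA Rinv (fun y => - / y ^ 2) d 1.
  rewrite Rmin_left ?Rmax_right; try lra.
  move=> K; apply: (@is_RInt_ext C_R_NormedModule _ _ _ _ _ _ (K _ _)).
  - by move=> x _; rewrite scal_R_Cmult.
  - by move=> x Hx; apply: rcont_continuous; apply: Gc; apply: Rinv_0_lt_compat; lra.
  - move=> x Hx; split.
      by auto_derive; [lra | field; lra].
    apply: (@ex_derive_continuous R_AbsRing R_NormedModule).
    by auto_derive; nra.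
have E := @cint_scal (-1)%C _ _ _ _ C.
have E2 : cint gB d 1 (-1 * CInt gA (/ d) (/ 1))%C.
  apply: cint_ext E; first lra.
  move=> y Hy; rewrite /gA /gB.
  have -> : cpow (/ y) (s - 1) = (cpow y (- s - 1) * RtoC y ^ 2)%C.
    rewrite cpow_inv; last lra.
    rewrite -(@cpow_nat y 2); last lra.
    rewrite -cpow_add; congr cpow; rewrite (_ : INR 2 = 2); last by rewrite -[INR 2]/(1 + 1); ring.
    ring.
  have Y0 : RtoC y <> 0%C by apply: Cmod_neq0; rewrite Cmod_R Rabs_pos_eq; lra.
  rewrite RtoC_opp RtoC_inv; last by apply: pow_nonzero; lra.
  rewrite RtoC_pow /Rdiv; field => //.
have -> : l = (- CInt gA (/ d) (/ 1))%C by rewrite (cint_fun H E2); ring.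
rewrite Rinv_1; apply: cint_swap.
apply: (@RInt_correct C_R_CompleteNormedModule); apply: ex_RInt_continuous => z.
rewrite Rmin_right ?Rmax_left; try lra.
by move=> Hz; apply: rcont_continuous; apply: Gc; lra.
Qed.

Lemma gamma_split : CGamma s = (cpow b s * (EInt gA + EInt gB))%C.
Proof.
have [K HB] := gB_good.
have HA := gA_good.
have K0 : 0 <= K by case: HB.
rewrite /CGamma.
apply: (@is_RInt_gen_unique C_R_CompleteNormedModule (at_right 0) (Rbar_locally p_infty) _ _ _ (cpow b s * (EInt gA + EInt gB))%C).
move=> P /locally_Cmod [e [He HP]].
set m := Cmod (cpow b s).
have m0 : 0 < m by apply: Cmod_pos; exact: cpow_neq0.
(* Cutting the integral below b [eta] and above b / [eta] costs at most [eta], resp. K [eta]; after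
   multiplication by b^s, of modulus [m], the total is at most e / 2. *)
set eta := Rmin (/ 2) (e / (2 * m * (K + 1))).
have Y0 : 0 < 2 * m * (K + 1) by apply: Rmult_lt_0_compat; lra.
have E0 : 0 < eta by apply: Rmin_pos; [lra | apply: Rdiv_lt_0_compat].
have E1 : eta <= / 2 := Rmin_l _ _.
have E2 : eta * (2 * m * (K + 1)) <= e by apply: (proj2 (Rle_div_r _ _ _ Y0)); exact: Rmin_r.
apply: (Filter_prod _ _ _ (fun x => 0 < x < b * eta) (fun x => b / eta < x)).
- exists (mkposreal (b * eta) (Rmult_lt_0_compat _ _ Hb E0)) => y Hy Hy0.
  split=> //; move: Hy; rewrite /ball /= /AbsRing_ball /abs /minus /plus /opp /=.
  by move/Rabs_def2; lra.
- by exists (b / eta).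
move=> x y Hx Hy.
have hb := Rinv_0_lt_compat _ Hb.
have X1 : 0 < / b * x < eta.
  split; first by apply: Rmult_lt_0_compat; lra.
  rewrite Rmult_comm; apply: (proj2 (Rlt_div_l _ _ _ Hb)); lra.
have yy : b / eta * eta < y * eta by apply: Rmult_lt_compat_r.
rewrite (_ : b / eta * eta = b) in yy; last by field; lra.
have y0 : 0 < y by nra.
have Y1 : 0 < b / y < eta.
  split; first by apply: Rdiv_lt_0_compat.
  by apply: (proj2 (Rlt_div_l _ _ _ y0)); lra.
have [r1 [I1 B1]] := @cut_bound _ _ (/ b * x) HA ltac:(lra).
have [r2 [I2 B2]] := @cut_bound _ _ (b / y) HB ltac:(lra).
have I2' := gB_subst (d := b / y) ltac:(lra) I2.
have I := cint_Chasles I1 I2'.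
rewrite (_ : / (b / y) = / b * y) in I; last by field; lra.
have I3 := @cint_scal (cpow b s) _ _ _ _ I.
set l := (cpow b s * _)%C in I3.
exists l; split; last first.
  apply: HP; rewrite /l.
  rewrite (_ : (cpow b s * (EInt gA - r1 + (EInt gB - r2)) - cpow b s * (EInt gA + EInt gB))%C
    = (cpow b s * - (r1 + r2))%C); last by ring.
  rewrite Cmod_mult Cmod_opp -/m.
  have R : Cmod (r1 + r2) <= (K + 1) * eta.
    apply: Rle_trans (Cmod_triangle _ _) _; nra.
  have := Rmult_le_compat_l _ _ _ (Rlt_le _ _ m0) R; nra.
have := @cint_affine (fun t => cpow b s * gA t)%C (/ b) 0 x y l.
rewrite !Rplus_0_r => /(_ I3).
apply: cint_ext; first by nra.
move=> t Ht.
have t0 : 0 < t by lra.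
rewrite Rplus_0_r /gA (_ : b * (/ b * t) = t); last by field; lra.
rewrite (cpow_mul _ hb t0) cpow_inv //.
have B0 : RtoC b <> 0%C by apply: Cmod_neq0; rewrite Cmod_R Rabs_pos_eq; lra.
have Eb : (cpow b s * cpow b (- (s - 1)))%C = RtoC b.
  have := @cpow_nat b 1 Hb; rewrite -[INR 1]/1 Cpow_1_r => <-.
  by rewrite -cpow_add; congr cpow; ring.
rewrite RtoC_inv; last lra.
rewrite (_ : (/ RtoC b * (cpow b s * (RtoC (exp (- t)) * (cpow b (- (s - 1)) * cpow t (s - 1)))))%C
  = (/ RtoC b * (cpow b s * cpow b (- (s - 1))) * (RtoC (exp (- t)) * cpow t (s - 1)))%C); last by ring.
rewrite Eb Cinv_l //; ring.
Qed.
End GammaSplit.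

Lemma egood_ext g h K : (forall t, 0 < t -> g t = h t) -> egood g K -> egood h K.
Proof.
move=> H [A B D]; split=> //.
- move=> t Ht; apply: (@rcont_ext_loc g _ _ t) => //; last exact: B.
  by move=> u /Rabs_def2 Hu; apply: H; lra.
- by move=> t Ht; rewrite -H; [exact: D | lra].
Qed.

Lemma egood_le g K L : K <= L -> egood g K -> egood g L.
Proof.
move=> H [A B D]; split=> //; first lra.
by move=> t Ht; apply: Rle_trans (D t Ht) _; apply: Rmult_le_compat_r; lra.
Qed.

Section MellinPieces.
Variables (a : nat -> C) (M : R) (j : nat) (r : R).
Hypothesis Ha : poly_bounded a M j.
Hypothesis Hr : 0 < r.

(** The series on the imaginary axis, in the scale that will be used with [r] = sqrt N, for which
    [W] acts as t |-> 1/t. *)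
Definition phi (t : R) : C := fourier_series a (0, t / r).
Definition freq (n : nat) : R := 2 * PI * INR n.+1 / r.

Lemma freq_pos n : 0 < freq n.
Proof.
apply: Rdiv_lt_0_compat => //; apply: Rmult_lt_0_compat; first exact: twopi_gt0.
by apply: lt_0_INR; lia.
Qed.

Lemma qterm_phi t n : qterm a (0, t / r) n = (a n.+1 * RtoC (exp (- (freq n * t))))%C.
Proof.
rewrite /qterm; congr (_ * _)%C; rewrite -Cexp_real; congr Cexp.
by apply: C_eq => /=; rewrite /freq; field; lra.
Qed.

Lemma phi_cont t : 0 < t -> rcont phi t.
Proof.
move=> Ht.
have [|l /cderiv_ccont Hl] := fourier_hol Ha (z := (0, t / r)).
  by rewrite /=; exact: Rdiv_lt_0_compat.
have E u : (0, u / r) = (RtoC u * (Ci / RtoC r))%C.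
  rewrite /Cdiv -RtoC_inv; last lra.
  by apply: C_eq => /=; rewrite /Rdiv; ring.
apply: (@rcont_comp (fun u => (0, u / r)) (fourier_series a)) => //.
apply: (@rcont_ext_loc (fun u => RtoC u * (Ci / RtoC r))%C _ _ 1); first lra.
  by move=> u _; rewrite E.
by apply: rcont_mult; [exact: rcont_id | exact: rcont_const].
Qed.

Definition Kp (p : nat) : R := M * (INR p / (2 * PI)) ^ p * r ^ p.

Lemma Kp_pos p : 0 <= Kp p.
Proof.
case: Ha => M0 _; have P := twopi_gt0.
apply: Rmult_le_pos; last by apply: pow_le; lra.
apply: Rmult_le_pos => //; apply: pow_le; apply: Rdiv_le_0_compat => //; exact: pos_INR.
Qed.

Definition qt (t : R) (n : nat) : C := qterm a (0, t / r) n.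

Lemma phi_tail p n t : (j + 2 <= p)%nat -> 0 < t ->
  Cmod (phi t - csum (qt t) n) <= Kp p * / t ^ p * (2 * / INR n.+1).
Proof.
move=> Hp Ht.
have Hy : 0 < Im (0, t / r) by rewrite /=; exact: Rdiv_lt_0_compat.
have [_ H] := fourier_cser Ha Hp Hy.
rewrite (_ : Kp p * / t ^ p = fbound M p (t / r)); first exact: H.
rewrite /Kp /fbound; set A := (INR p / (2 * PI)) ^ p.
by rewrite /Rdiv Rpow_mult_distr pow_inv; field; split; apply: pow_nonzero; lra.
Qed.

(** The Mellin integrand of [phi] on ]0, 1], and on [1, +oo[ after t = 1/x. Rapid decay of [phi] at
    infinity makes the second integrable for every s; the first is under control for large Re s. *)
Definition near_zero (s : C) (t : R) : C := (phi t * cpow t (s - 1))%C.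
Definition near_inf (s : C) (x : R) : C := (phi (/ x) * cpow x (- s - 1))%C.

(** The remainders of [phi] are O(t^(-(j+2))), and t^(s-1) must supply one power more for a bound
    linear in t; hence Re s - 1 >= j + 3. *)
Lemma near_zero_tail s n t : INR (j + 4) <= Re s -> 0 < t <= 1 ->
  Cmod (near_zero s t - csum (fun n => qt t n * cpow t (s - 1))%C n)
    <= Kp (j + 2) * t * (2 * / INR n.+1).
Proof.
move=> Hs Ht.
have -> : csum (fun n => qt t n * cpow t (s - 1))%C n =
  (csum (qt t) n * cpow t (s - 1))%C.
  elim: n => [|n IH] /=; [ring | rewrite IH; ring].
rewrite (_ : (near_zero s t - csum (qt t) n * cpow t (s - 1))%C = ((phi t - csum (qt t) n) * cpow t (s - 1))%C); last by rewrite /near_zero; ring.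
rewrite Cmod_mult.
have C : Cmod (cpow t (s - 1)) <= t ^ (j + 2).+1.
  apply: cpow_le => //; rewrite re_plus re_opp re_RtoC.
  move: Hs; rewrite (_ : (j + 4)%nat = (j + 2).+2); last by rewrite !addnS addn0.
  by rewrite S_INR; lra.
have T := @phi_tail (j + 2) n t (leqnn _) ltac:(lra).
apply: Rle_trans (Rmult_le_compat _ _ _ _ (Cmod_ge_0 _) (Cmod_ge_0 _) T C) _.
right; rewrite -tech_pow_Rmult; field; split; last by apply: pow_nonzero; lra.
apply: not_0_INR; lia.
Qed.

Lemma near_inf_tail q : exists K, 0 <= K /\ forall s n x, Re s + 1 <= INR q -> 0 < x <= 1 ->
  Cmod (near_inf s x - csum (fun n => qt (/ x) n * cpow x (- s - 1))%C n)
    <= K * x * (2 * / INR n.+1).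
Proof.
(* Powers of x: [q] compensate x^(-s-1), one gives the bound linear in x, and j + 2 are required by
   [phi_tail]. *)
set p := (q + (j + 2)).+1.
exists (Kp p); split; first exact: Kp_pos.
move=> s n x Hs Hx.
have -> : csum (fun n => qt (/ x) n * cpow x (- s - 1))%C n =
  (csum (qt (/ x)) n * cpow x (- s - 1))%C.
  elim: n => [|n IH] /=; [ring | rewrite IH; ring].
rewrite (_ : (near_inf s x - csum (qt (/ x)) n * cpow x (- s - 1))%C = ((phi (/ x) - csum (qt (/ x)) n) * cpow x (- s - 1))%C); last by rewrite /near_inf; ring.
rewrite Cmod_mult.
have C : Cmod (cpow x (- s - 1)) * x ^ q <= 1.
  apply: cpow_le_neg => //; rewrite re_plus !re_opp re_RtoC; lra.
have hp : (j + 2 <= p)%nat by rewrite /p -addnS addnC leq_addl || rewrite /p; apply: leqW; exact: leq_addl.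
have T := @phi_tail p n (/ x) hp (Rinv_0_lt_compat _ (proj1 Hx)).
have C0 := Cmod_ge_0 (cpow x (- s - 1)).
apply: Rle_trans (Rmult_le_compat_r _ _ _ C0 T) _.
have N0 : 0 < INR n.+1 by apply: lt_0_INR; lia.
have Z0 : 0 <= Kp p * x * (2 * / INR n.+1).
  apply: Rmult_le_pos; first by apply: Rmult_le_pos; [exact: Kp_pos | lra].
  by have := Rinv_0_lt_compat _ N0; lra.
rewrite pow_inv Rinv_inv /p -tech_pow_Rmult -!plusE pow_add.
have X2 : 0 <= x ^ (j + 2)%coq_nat <= 1.
  by split; [apply: pow_le; lra | rewrite -(pow1 (j + 2)%coq_nat); apply: pow_incr; lra].
apply: Rle_trans (_ : Kp (q + (j + 2)%coq_nat)%coq_nat.+1 * x * (2 * / INR n.+1) * ((Cmod (cpow x (- s - 1)) * x ^ q) * x ^ (j + 2)%coq_nat) <= _).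
  right; ring.
rewrite -[X in _ <= X]Rmult_1_r; apply: Rmult_le_compat_l; first exact: Z0.
have : 0 <= Cmod (cpow x (- s - 1)) * x ^ q by apply: Rmult_le_pos => //; apply: pow_le; lra.
nra.
Qed.

Lemma near_zero_good s : INR (j + 4) <= Re s -> egood (near_zero s) (2 * Kp (j + 2)).
Proof.
move=> Hs; have K0 := Kp_pos (j + 2); split; first lra.
- by move=> t Ht; apply: rcont_mult; [exact: phi_cont | exact: rcont_cpow].
- move=> t Ht; have := near_zero_tail 0 Hs Ht.
  rewrite (_ : (near_zero s t - csum _ 0)%C = near_zero s t); last by rewrite /=; ring.
  rewrite (_ : INR 1 = 1) // Rinv_1; lra.
Qed.

Lemma near_inf_good q : exists K, forall s, Re s + 1 <= INR q -> egood (near_inf s) K.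
Proof.
have [K [K0 H]] := near_inf_tail q.
exists (2 * K) => s Hs; split; first lra.
- move=> t Ht; apply: rcont_mult; last exact: rcont_cpow.
  apply: rcont_inv_arg => // u Hu; exact: phi_cont.
- move=> t Ht; have := H s 0%nat t Hs Ht.
  rewrite (_ : (near_inf s t - csum _ 0)%C = near_inf s t); last by rewrite /=; ring.
  rewrite (_ : INR 1 = 1) // Rinv_1; lra.
Qed.

Definition Phi0 (s : C) : C := EInt (near_zero s).
Definition Phi1 (s : C) : C := EInt (near_inf s).

Lemma Phi0_series s : INR (j + 4) <= Re s ->
  cser (fun n => a n.+1 * EInt (gA (freq n) s))%C (Phi0 s).
Proof.
move=> Hs.
have H2 : 2 <= Re s.
  apply: Rle_trans Hs; rewrite -plusE plus_INR (_ : INR 4 = 4) /=; last by rewrite /INR; ring.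
  by have := pos_INR j; lra.
have K0 := Kp_pos (j + 2).
have := @EInt_series (near_zero s) (fun t n => qt t n * cpow t (s - 1))%C
  (2 * Kp (j + 2)) (near_zero_good Hs).
have E n t : (qt t n * cpow t (s - 1) = a n.+1 * gA (freq n) s t)%C.
  by rewrite /qt qterm_phi /gA Cmult_assoc.
move=> X; apply: cser_ext (X _ _).
- move=> n; rewrite -(EInt_scal _ (gA_good (freq_pos n) H2)).
  by apply: EInt_ext => t _.
- move=> n; eexists; apply: egood_ext (egood_scal _ (gA_good (freq_pos n) H2)) => t _; by rewrite E.
- move=> n t Ht; apply: Rle_trans (near_zero_tail n Hs Ht) _.
  apply: Rmult_le_compat_r.
    by have : 0 < / INR n.+1; [apply: Rinv_0_lt_compat; apply: lt_0_INR; lia | lra].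
  by apply: Rmult_le_compat_r; lra.
Qed.

Lemma Phi1_series s : 2 <= Re s ->
  cser (fun n => a n.+1 * EInt (gB (freq n) s))%C (Phi1 s).
Proof.
move=> H2.
have [q Hq] := INR_unbounded (Re s + 1).
have [K [K0 HT]] := near_inf_tail q.
have [K' HG] := near_inf_good q.
have G := HG s ltac:(lra).
have E n t : 0 < t -> (qt (/ t) n * cpow t (- s - 1) = a n.+1 * gB (freq n) s t)%C.
  by move=> Ht; rewrite /qt qterm_phi /gB Cmult_assoc.
have GB n := gB_good s (freq_pos n).
have X := @EInt_series (near_inf s) (fun t n => qt (/ t) n * cpow t (- s - 1))%C (Rmax K K').
apply: cser_ext (X _ _ _).
- move=> n; have [L HL] := GB n.
  rewrite -(EInt_scal _ HL); apply: EInt_ext => t Ht; apply: E; lra.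
- apply: egood_le G; exact: Rmax_r.
- move=> n; have [L HL] := GB n; eexists.
  by apply: egood_ext (egood_scal _ HL) => t Ht; rewrite E.
- move=> n t Ht; apply: Rle_trans (HT s n t _ Ht) _; first lra.
  apply: Rmult_le_compat_r.
    by have : 0 < / INR n.+1; [apply: Rinv_0_lt_compat; apply: lt_0_INR; lia | lra].
  by apply: Rmult_le_compat_r; [lra | exact: Rmax_l].
Qed.

Lemma Phi1_cderiv s : exists l, cderiv Phi1 s l.
Proof.
have [q0 Hq0] := INR_unbounded (Re s + 1).
(* Room for differentiating under the integral: [shift] shows that [near_inf s x] times x^(-n) is
   still at most K x for n <= 4. The derivative, with its factor ln x, uses n = 1; the remainder
   uses n = 3, two for the square of ln x and one for the exponential in [Cexp_sub2]. *)
set q := (q0 + 4)%nat.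
have [K HG] := near_inf_good q.
have Hq : Re s + 1 + 4 <= INR q.
  rewrite /q -plusE plus_INR (_ : INR 4 = 4); last by rewrite /INR; ring.
  lra.
have K0 : 0 <= K by have [] := HG s ltac:(lra).
pose D := fun x : R => (near_inf s x * - RtoC (ln x))%C.
have Lx x : 0 < x <= 1 -> 0 <= - ln x <= / x.
  move=> Hx; split; first by have := ln_le0 Hx; lra.
  rewrite -ln_Rinv; last lra.
  have I := Rinv_0_lt_compat _ (proj1 Hx).
  by have := exp_ineq1_le (ln (/ x)); rewrite exp_ln; lra.
have shift n x : (n <= 4)%coq_nat -> 0 < x <= 1 -> Cmod (near_inf s x) * (/ x) ^ n <= K * x.
  move=> Hn Hx.
  have X0 : RtoC x <> 0%C by apply: Cmod_neq0; rewrite Cmod_R Rabs_pos_eq; lra.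
  have Hs' : Re (s + RtoC (INR n))%C + 1 <= INR q.
    rewrite re_plus re_RtoC; have := le_INR _ _ Hn; rewrite (_ : INR 4 = 4); last by rewrite /INR; ring.
    lra.
  have [_ _ B] := HG _ Hs'.
  have := B x Hx; rewrite /near_inf !Cmod_mult Rmult_assoc.
  suff -> : Cmod (cpow x (- (s + RtoC (INR n)) - 1)) = Cmod (cpow x (- s - 1)) * (/ x) ^ n by [].
  rewrite (_ : (- (s + RtoC (INR n)) - 1)%C = (- s - 1 + - RtoC (INR n))%C); last by ring.
  rewrite cpow_add Cmod_mult; congr (_ * _).
  rewrite -cpow_inv; last lra.
  rewrite cpow_nat; last by apply: Rinv_0_lt_compat; lra.
  by rewrite Cmod_pow Cmod_R Rabs_pos_eq //; apply: Rlt_le; apply: Rinv_0_lt_compat; lra.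
have GD : egood D K.
  split=> //.
  - move=> t Ht; have [_ C _] := HG s ltac:(lra).
    apply: rcont_mult; first exact: C.
    by apply: rcont_opp; exact: rcont_ln.
  - move=> t Ht; rewrite /D Cmod_mult Cmod_opp Cmod_R -Rabs_Ropp Rabs_pos_eq; last by have := Lx t Ht; lra.
    have := shift 1%nat t ltac:(lia) Ht; rewrite pow_1 => S.
    apply: Rle_trans S; apply: Rmult_le_compat_l; first exact: Cmod_ge_0.
    by have := Lx t Ht; lra.
exists (EInt D) => e He.
exists (Rmin 1 (e / (4 * (K + 1)))); split.
  by apply: Rmin_pos; [lra | apply: Rdiv_lt_0_compat; lra].
move=> w Hw.
have W1 := Rlt_le_trans _ _ _ Hw (Rmin_l _ _).
have W2 : Cmod (w - s) * (4 * (K + 1)) < e.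
  by apply: (proj2 (Rlt_div_r _ _ _ _)); [lra | exact: Rlt_le_trans Hw (Rmin_r _ _)].
set h := (w - s)%C in W1 W2 *.
have h0 := Cmod_ge_0 h.
have Hwq : Re w + 1 <= INR q.
  rewrite (_ : w = (s + h)%C); last by rewrite /h; ring.
  rewrite re_plus; have := re_le_abs h; lra.
have Gw := HG w Hwq; have Gs := HG s ltac:(lra).
have G1 := egood_minus Gw Gs.
have G2 := egood_minus G1 (@egood_scal h _ _ GD).
have E : (Phi1 w - Phi1 s - EInt D * h)%C =
   EInt (fun x => near_inf w x - near_inf s x - h * D x)%C.
  by rewrite (EInt_minus G1 (@egood_scal h _ _ GD)) (EInt_minus Gw Gs) (EInt_scal _ GD) /Phi1; ring.
rewrite E.
have B : egood (fun x => near_inf w x - near_inf s x - h * D x)%C (4 * (Cmod h * Cmod h) * K).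
  case: G2 => _ C _; split=> //; first by apply: Rmult_le_pos => //; nra.
  move=> x Hx.
  have -> : (near_inf w x - near_inf s x - h * D x)%C =
     (near_inf s x * (Cexp (- h * RtoC (ln x)) - 1 - (- h * RtoC (ln x))))%C.
    rewrite /D /near_inf (_ : (- w - 1)%C = (- s - 1 + - h)%C); last by rewrite /h; ring.
    rewrite cpow_add -[cpow x (- h)]/(Cexp (- h * RtoC (ln x))); ring.
  rewrite Cmod_mult.
  have N0 := Cmod_ge_0 (near_inf s x).
  have [L0 L1] := Lx x Hx.
  set u := (- h * RtoC (ln x))%C.
  have U : Cmod u = Cmod h * - ln x.
    by rewrite /u Cmod_mult Cmod_opp Cmod_R -Rabs_Ropp Rabs_pos_eq.
  have I0 : 0 < / x by apply: Rinv_0_lt_compat; lra.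
  have Ex : exp (Cmod u) <= / x.
    rewrite -(exp_ln (/ x)) // ln_Rinv; last lra.
    apply: exp_le; rewrite U; nra.
  have T : 4 * (Cmod u * Cmod u) * exp (Cmod u) <= 4 * (Cmod h * Cmod h) * (/ x) ^ 3.
    rewrite U (_ : 4 * (Cmod h * - ln x * (Cmod h * - ln x)) = 4 * (Cmod h * Cmod h) * (- ln x * - ln x)); last by ring.
    rewrite (_ : (/ x) ^ 3 = / x * / x * / x); last by ring.
    rewrite Rmult_assoc; apply: Rmult_le_compat_l; first nra.
    by apply: Rmult_le_compat; [nra | exact/Rlt_le/exp_pos | apply: Rmult_le_compat | by rewrite -U].
  have S := shift 3%nat x ltac:(lia) Hx.
  apply: Rle_trans (Rmult_le_compat_l _ _ _ N0 (Rle_trans _ _ _ (Cexp_sub2 u) T)) _.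
  have hh : 0 <= 4 * (Cmod h * Cmod h) by nra.
  have := Rmult_le_compat_l _ _ _ hh S; lra.
apply: Rle_trans (EInt_bound B) _; nra.
Qed.

Lemma Phi1_bounded X : exists K, forall s, Re s <= X -> Cmod (Phi1 s) <= K.
Proof.
have [q Hq] := INR_unbounded (X + 1).
have [K HG] := near_inf_good q.
by exists K => s Hs; apply: EInt_bound; apply: HG; lra.
Qed.

Lemma Phi0_bounded s : INR (j + 4) <= Re s -> Cmod (Phi0 s) <= 2 * Kp (j + 2).
Proof. by move=> Hs; apply: EInt_bound; exact: near_zero_good. Qed.

End MellinPieces.

Lemma dirichlet_cser a M j s : poly_bounded a M j -> INR (j + 2) <= Re s ->
  cser (fun n => a n.+1 * cpow (INR n.+1) (- s))%C (dirichlet_series a s).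
Proof.
move=> [M0 HM] Hs.
have [n|l [Hl _]] := @cser_inv_sq (fun n => a n.+1 * cpow (INR n.+1) (- s))%C M M0; last first.
  by rewrite /dirichlet_series (CSeries_eq Hl).
have N0 : 0 < INR n.+1 by apply: lt_0_INR; lia.
have N1 : 1 <= INR n.+1 by rewrite S_INR; have := pos_INR n; lra.
rewrite Cmod_mult Cmod_cpow re_opp.
have L0 : 0 <= ln (INR n.+1).
  by rewrite -ln_1; case: N1 => [H|<-]; [apply: Rlt_le; apply: ln_increasing; lra | lra].
have E : exp (- Re s * ln (INR n.+1)) <= / INR n.+1 ^ (j + 2).
  rewrite -Rpower_pow // /Rpower -exp_Ropp; apply: exp_le; nra.
apply: Rle_trans (Rmult_le_compat _ _ _ _ (Cmod_ge_0 _) (Rlt_le _ _ (exp_pos _)) (HM n) E) _.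
right; rewrite -plusE pow_add; field; split; apply: Rgt_not_eq => //; exact: pow_lt.
Qed.

(** Constancy of [Efun] will only say that consecutive moments coincide; the weight 1 - t converts
    this into vanishing moments, and it has no zero inside the interval. *)
Lemma one_minus_EInt g K : egood g K -> EInt g = EInt (fun t => g t * RtoC t)%C ->
  cint (fun t => ext0 g t * (1 - RtoC t))%C 0 1 0%C.
Proof.
move=> Hg E.
have G' : egood (fun t => g t * RtoC t)%C K.
  case: Hg => K0 C B; split=> //.
  - by move=> t Ht; apply: rcont_mult; [exact: C | exact: rcont_id].
  - move=> t Ht; rewrite Cmod_mult Cmod_R Rabs_pos_eq; last lra.
    have := B t Ht; have := Cmod_ge_0 (g t); nra.
have := EInt_correct (egood_minus Hg G').
rewrite (EInt_minus Hg G') -E (_ : (EInt g - EInt g)%C = 0%C); last by ring.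
apply: cint_ext; first lra.
by move=> t Ht; rewrite !ext0_pos; try lra; ring.
Qed.

(** * From the functional equation to invariance under W *)

Section Hecke.
Variables (a : nat -> C) (sigma M : R) (j m N : nat) (Lambda : C -> C).
Hypothesis Ha : poly_bounded a M j.
Hypothesis Hsigma : sigma <= INR j.
Hypothesis HN : (0 < N)%N.
Hypothesis HLambda : forall s : C, (sigma + 1 < Re s)%R ->
  Lambda s = (GammaC s * dirichlet_series a s)%C.
Hypothesis Hentire : entire Lambda.
Hypothesis Hbounded : bounded_on_vertical_strips Lambda.
Let k : R := INR (2 * m).
Let sgn : C := ((- 1) ^ m)%C.
Hypothesis Hfunc : forall s : C,
  Lambda s = (sgn * cpow (INR N) (RtoC k / 2 - s) * Lambda (RtoC k - s))%C.

Let r : R := sqrt (INR N).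

Lemma INR_N_ge1 : 1 <= INR N.
Proof. by case: N HN => // n _; rewrite S_INR; have := pos_INR n; lra. Qed.

Lemma r_pos : 0 < r.
Proof. by apply: sqrt_lt_R0; have := INR_N_ge1; lra. Qed.

Lemma r_sq : r * r = INR N.
Proof. by apply: sqrt_sqrt; exact: pos_INR. Qed.

Lemma sgn_sq : (sgn * sgn)%C = 1%C.
Proof. by rewrite /sgn -Cpow_mult_l (_ : (-1 * -1)%C = 1%C) ?Cpow_1_l //; ring. Qed.

(** This factor removes the power of N from the functional equation, leaving the sign and the
    reflection s |-> k - s. *)
Definition Lt (s : C) : C := (cpow (INR N) (s / 2) * Lambda s)%C.

Lemma Lt_func s : Lt s = (sgn * Lt (RtoC k - s))%C.
Proof.
rewrite /Lt {1}Hfunc.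
rewrite (_ : ((RtoC k - s) / 2)%C = (s / 2 + (RtoC k / 2 - s))%C); last by field.
rewrite cpow_add; ring.
Qed.

(** Termwise: N^(s/2) (2 pi)^(-s) n^(-s) is the power -s of the n-th frequency 2 pi n / r, and
    cancels the factor b^s of [gamma_split]. *)
Lemma Lt_eq s : INR (j + 4) <= Re s -> Lt s = (Phi0 a r s + Phi1 a r s)%C.
Proof.
move=> Hs.
have P2 := twopi_gt0; have Pr := r_pos; have P1 := INR_N_ge1.
have j4 : INR (j + 4) = INR j + 4 by rewrite !addnS addn0 !S_INR; ring.
have j2 : INR (j + 2) = INR j + 2 by rewrite !addnS addn0 !S_INR; ring.
have j0 := pos_INR j.
have Hs2 : 2 <= Re s by lra.
have D := dirichlet_cser Ha (s := s) ltac:(lra).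
have S := cser_plus (Phi0_series Ha Pr Hs) (Phi1_series Ha Pr Hs2).
set c := (cpow (INR N) (s / 2) * (cpow (2 * PI) (- s) * CGamma s))%C.
have D' := @cser_scal c _ _ D.
rewrite -(cser_unique D' (l := (c * dirichlet_series a s)%C) (m := (Phi0 a r s + Phi1 a r s)%C)) //.
  rewrite /Lt HLambda; last by lra.
  rewrite /GammaC /c; ring.
apply: cser_ext S => n.
have Pf := freq_pos Pr n.
have Pn : 0 < INR n.+1 by apply: lt_0_INR; lia.
rewrite /c (gamma_split Pf Hs2).
have EN : cpow (INR N) (s / 2) = cpow r s.
  by rewrite -r_sq cpow_mul // -cpow_add; congr cpow; field.
have Ef : cpow (freq r n) s = (cpow (2 * PI) s * cpow (INR n.+1) s * cpow r (- s))%C.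
  have Pi := Rinv_0_lt_compat _ Pr.
  rewrite /freq /Rdiv cpow_mul //; last by apply: Rmult_lt_0_compat.
  by rewrite cpow_mul // cpow_inv.
rewrite EN Ef.
have I x : (cpow x s * cpow x (- s))%C = 1%C.
  by rewrite -cpow_add (_ : (s + - s)%C = 0%C) ?cpow_0 //; ring.
set A := EInt _; set B := EInt _.
rewrite (_ : (cpow r s * (cpow (2 * PI) (- s) * (cpow (2 * PI) s * cpow (INR n.+1) s * cpow r (- s) * (A + B))) *
    (a n.+1 * cpow (INR n.+1) (- s)))%C
  = ((cpow r s * cpow r (- s)) * (cpow (2 * PI) s * cpow (2 * PI) (- s)) *
    (cpow (INR n.+1) s * cpow (INR n.+1) (- s)) * (a n.+1 * A + a n.+1 * B))%C); last by ring.
rewrite !I; ring.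
Qed.

(* [Lt] minus the parts of its two Mellin integrals that converge everywhere: bounded and entire,
   hence constant, and its constancy makes the moments of the remaining integral vanish. *)
Definition Efun (s : C) : C := (Lt s - Phi1 a r s - sgn * Phi1 a r (RtoC k - s))%C.

Lemma Efun_func s : Efun s = (sgn * Efun (RtoC k - s))%C.
Proof.
rewrite /Efun {1}Lt_func (_ : (RtoC k - (RtoC k - s))%C = s); last by ring.
rewrite (_ : (sgn * (Lt (RtoC k - s) - Phi1 a r (RtoC k - s) - sgn * Phi1 a r s))%C =
  (sgn * Lt (RtoC k - s) - sgn * Phi1 a r (RtoC k - s) - sgn * sgn * Phi1 a r s)%C); last by ring.
rewrite sgn_sq; ring.
Qed.

Lemma Efun_right s : INR (j + 4) <= Re s ->
  Efun s = (Phi0 a r s - sgn * Phi1 a r (RtoC k - s))%C.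
Proof. by move=> Hs; rewrite /Efun Lt_eq //; ring. Qed.

Lemma Efun_cderiv s : exists l, cderiv Efun s l.
Proof.
have [l1 H1] := proj1 (holoP _ _) (Hentire s).
have [l2 H2] := Phi1_cderiv Ha r_pos s.
have [l3 H3] := Phi1_cderiv Ha r_pos (RtoC k - s).
eexists; apply: (@cderiv_minus (fun s => Lt s - Phi1 a r s)%C).
  apply: cderiv_minus; last exact: H2.
  apply: cderiv_mult; last exact: H1.
  apply: (@cderiv_comp (fun s => s / 2 * RtoC (ln (INR N)))%C Cexp); last exact: cderiv_Cexp.
  apply: cderiv_mult; last exact: cderiv_const.
  apply: cderiv_mult; [exact: cderiv_id | exact: cderiv_const].
apply: cderiv_scal; apply: (@cderiv_comp (fun s => RtoC k - s)%C (Phi1 a r)); last exact: H3.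
by apply: (@cderiv_minus (fun=> RtoC k)); [exact: cderiv_const | exact: cderiv_id].
Qed.

Lemma Cmod_sgn : Cmod sgn = 1.
Proof. by rewrite /sgn Cmod_pow Cmod_R Rabs_left ?Ropp_involutive ?pow1; lra. Qed.

(** Three regions: for Re s >= c the Mellin integrals are bounded, for Re s <= k - c the functional
    equation reflects to the first region, and between them the bound for [Lambda] on a vertical
    strip applies. *)
Lemma Efun_bounded : exists B, forall s, Cmod (Efun s) <= B.
Proof.
set c := INR (j + 4).
have Pr := r_pos.
have [B1 HB1] := Phi1_bounded Ha Pr k.
have [B2 HB2] := Phi1_bounded Ha Pr (Rmax c (k - (k - c))).
have [B3 HB3] := Hbounded (k - c) c.
set R1 := 2 * Kp M r (j + 2) + B1.
have right s : c <= Re s -> Cmod (Efun s) <= R1.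
  move=> Hs; rewrite Efun_right //.
  apply: Rle_trans (Cmod_triangle _ _) _.
  rewrite Cmod_opp Cmod_mult Cmod_sgn Rmult_1_l.
  apply: Rplus_le_compat; first exact: Phi0_bounded.
  apply: HB1; rewrite re_plus re_opp re_RtoC; have : 0 <= c by exact: pos_INR.
  lra.
set R2 := exp (c / 2 * ln (INR N)) * B3 + B2 + B2.
exists (Rmax R1 R2) => s.
case: (Rle_lt_dec c (Re s)) => L1; first exact: Rle_trans (right s L1) (Rmax_l _ _).
case: (Rle_lt_dec (Re s) (k - c)) => L2.
  rewrite Efun_func Cmod_mult Cmod_sgn Rmult_1_l.
  apply: Rle_trans (right _ _) (Rmax_l _ _).
  rewrite re_plus re_opp re_RtoC; lra.
apply: Rle_trans (Rmax_r _ _).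
apply: Rle_trans (Cmod_triangle _ _) _.
rewrite Cmod_opp Cmod_mult Cmod_sgn Rmult_1_l.
have M1 := Rmax_l c (k - (k - c)).
apply: Rplus_le_compat; last by apply: HB2; rewrite re_plus re_opp re_RtoC; lra.
apply: Rle_trans (Cmod_triangle _ _) _; rewrite Cmod_opp.
apply: Rplus_le_compat; last by apply: HB2; lra.
rewrite /Lt Cmod_mult; apply: Rmult_le_compat; try exact: Cmod_ge_0; last by apply: HB3; lra.
rewrite Cmod_cpow; apply: exp_le.
have L0 : 0 <= ln (INR N).
  have := INR_N_ge1; case=> [H|<-]; last by rewrite ln_1; lra.
  by rewrite -ln_1; apply: Rlt_le; apply: ln_increasing; lra.
apply: Rmult_le_compat_r => //.
have -> : (s / 2)%C = (RtoC (/ 2) * s)%C by rewrite RtoC_inv; [field | lra].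
rewrite re_scal_l; lra.
Qed.

Lemma phi_inversion t : 0 < t < 1 -> phi a r (/ t) = (sgn * RtoC t ^ (2 * m) * phi a r t)%C.
Proof.
move=> Ht.
have Pr := r_pos.
have [B HB] := Efun_bounded.
have EC := liouville Efun_cderiv HB.
set c0 := (j + 4)%nat.
(* Its integral is [Efun (c0 + n)], hence independent of n, and [g n t] = [g 0 t] * t^n: the
   integrals are the successive moments of one function, which vanishes exactly when the inversion
   formula holds. *)
pose g n := fun t => (near_zero a r (RtoC (INR (c0 + n))) t - sgn * near_inf a r (RtoC k - RtoC (INR (c0 + n))) t)%C.
have Hc n : INR (j + 4) <= Re (RtoC (INR (c0 + n))).
  by rewrite re_RtoC; apply: le_INR; rewrite /c0 -!plusE; lia.
have [q Hq] := INR_unbounded (k + 1).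
have [K HK] := near_inf_good Ha Pr q.
have HI n : egood (near_inf a r (RtoC k - RtoC (INR (c0 + n)))) K.
  apply: HK; rewrite re_plus re_opp !re_RtoC; have := pos_INR (c0 + n); lra.
have HG n := egood_minus (near_zero_good Ha Pr (Hc n)) (@egood_scal sgn _ _ (HI n)).
have EI n : EInt (g n) = Efun 0.
  rewrite -(EC (RtoC (INR (c0 + n)))) Efun_right //.
  by rewrite (EInt_minus (near_zero_good Ha Pr (Hc n)) (@egood_scal sgn _ _ (HI n))) (EInt_scal _ (HI n)).
have gS n u : 0 < u -> g n u = (g 0%nat u * RtoC u ^ n)%C.
  move=> Hu; rewrite /g /near_zero /near_inf addn0 -(cpow_nat n Hu).
  rewrite -plusE plus_INR RtoC_plus.
  rewrite (_ : (RtoC (INR c0) + RtoC (INR n) - 1)%C = (RtoC (INR c0) - 1 + RtoC (INR n))%C); last by ring.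
  rewrite (_ : (- (RtoC k - (RtoC (INR c0) + RtoC (INR n))) - 1)%C = (- (RtoC k - RtoC (INR c0)) - 1 + RtoC (INR n))%C); last by ring.
  rewrite !cpow_add; ring.
have Z : (ext0 (g 0%nat) t * (1 - RtoC t))%C = 0%C.
  apply: (@moments_zero (fun t => ext0 (g 0%nat) t * (1 - RtoC t))%C) => //.
    case: (HG 0%nat) => K0 Gc Gb u Hu.
    apply: rcont_mult; first by apply: (ext0_cont K0 Gc Gb); lra.
    apply: (@rcont_plus (fun=> 1%C) (fun u => - RtoC u)%C); first exact: rcont_const.
    by apply: rcont_opp; exact: rcont_id.
  move=> n.
  have := one_minus_EInt (HG n).
  rewrite -/(g n) (_ : EInt (fun t => g n t * RtoC t)%C = EInt (g n.+1)); last first.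
    by apply: EInt_ext => u Hu; rewrite (gS n) ?(gS n.+1) /=; try lra; ring.
  rewrite !EI => /(_ erefl).
  apply: cint_ext; first lra.
  by move=> u Hu; rewrite !ext0_pos ?(gS n); try lra; ring.
have N1 : (1 - RtoC t)%C <> 0%C.
  by apply: one_minus_neq0; rewrite Cmod_R Rabs_pos_eq; lra.
have Z0 : g 0%nat t = 0%C.
  rewrite -(ext0_pos (g 0%nat) (t := t)); last lra.
  by rewrite -[LHS]Cmult_1_r -(Cinv_r _ N1) Cmult_assoc Z; ring.
move: Z0; rewrite /g /near_zero /near_inf addn0.
rewrite (_ : (- (RtoC k - RtoC (INR c0)) - 1)%C = (RtoC (INR c0) - 1 + - RtoC k)%C); last by ring.
rewrite cpow_add => Z0.
set u := cpow t (RtoC (INR c0) - 1) in Z0.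
have u0 : u <> 0%C by exact: cpow_neq0.
have Ek : (cpow t (- RtoC k) * RtoC t ^ (2 * m))%C = 1%C.
  rewrite -cpow_nat; last lra.
  by rewrite -cpow_add -/k (_ : (- RtoC k + RtoC k)%C = 0%C) ?cpow_0 //; ring.
have E1 : (phi a r t * u = sgn * (phi a r (/ t) * (u * cpow t (- RtoC k))))%C.
  exact: (proj2 (Ceq_minus _ _) Z0).
have -> : (sgn * RtoC t ^ (2 * m) * phi a r t = / u * (sgn * RtoC t ^ (2 * m) * (phi a r t * u)))%C by field.
rewrite E1.
rewrite (_ : (/ u * (sgn * RtoC t ^ (2 * m) * (sgn * (phi a r (/ t) * (u * cpow t (- RtoC k))))))%C =
  (sgn * sgn * (cpow t (- RtoC k) * RtoC t ^ (2 * m)) * phi a r (/ t))%C); last by field.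
by rewrite sgn_sq Ek; ring.
Qed.

(** [phi_inversion] is this identity on the imaginary axis above i / sqrt N, and [identity_H]
    extends it. The sign (-1)^m cancels the power i^(2m) in the automorphy factor N z at z = i y. *)
Theorem hecke z : 0 < Im z -> sl m (mk 0 (-1) (INR N) 0) (fourier_series a) z = fourier_series a z.
Proof.
move=> Hz.
have Pr := r_pos. have P1 := INR_N_ge1.
have Hdet : 0 < det (mk 0 (-1) (INR N) 0) by rewrite /det /=; lra.
have HF : holH (fourier_series a) by exact: fourier_hol Ha.
apply: (proj2 (Ceq_minus _ _)).
apply: (@identity_H (fun z => sl m (mk 0 (-1) (INR N) 0) (fourier_series a) z - fourier_series a z)%C (/ r)) => //.
- exact: Rinv_0_lt_compat.
- move=> w Hw.
  have [l1 H1] := sl_hol m Hdet HF Hw; have [l2 H2] := HF w Hw.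
  by eexists; apply: cderiv_minus; [exact: H1 | exact: H2].
move=> y Hy.
have y0 : 0 < y by have := Rinv_0_lt_compat _ Pr; lra.
have ry : 1 < r * y.
  have := Rmult_lt_compat_l _ _ _ Pr Hy; rewrite Rinv_r; lra.
set t := / (r * y).
have Ht : 0 < t < 1.
  split; first by apply: Rinv_0_lt_compat; lra.
  rewrite -Rinv_1; apply: Rinv_lt_contravar; lra.
have I := phi_inversion Ht.
have E1 : phi a r (/ t) = fourier_series a (0, y).
  rewrite /phi /t Rinv_inv; congr (fourier_series a (0, _)); field; lra.
have y0' : RtoC y <> 0%C by apply: Cmod_neq0; rewrite Cmod_R Rabs_pos_eq; lra.
have N0' : RtoC (INR N) <> 0%C by apply: Cmod_neq0; rewrite Cmod_R Rabs_pos_eq; lra.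
have Ey : (0, y) = (Ci * RtoC y)%C by apply: C_eq => /=; ring.
have Ci2 : (Ci * Ci)%C = RtoC (-1) by apply: C_eq => /=; ring.
have EJ : jfac (mk 0 (-1) (INR N) 0) (0, y) = (RtoC (INR N) * (Ci * RtoC y))%C.
  by rewrite /jfac /= Ey; ring.
have E2 : mob (mk 0 (-1) (INR N) 0) (0, y) = (0, t / r).
  rewrite /mob EJ /= (_ : (0, t / r) = (Ci * RtoC (t / r))%C); last by apply: C_eq => /=; ring.
  rewrite (_ : t / r = / (INR N * y)); last by rewrite -r_sq /t; field; lra.
  rewrite RtoC_inv ?RtoC_mult; last by apply: Rgt_not_eq; apply: Rmult_lt_0_compat; lra.
  have -> : (RtoC 0 * (0, y) + RtoC (-1) = Ci * Ci)%C by rewrite Ci2; apply: C_eq => /=; ring.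
  by field; repeat split => //; exact: Ci_nz.
rewrite /sl EJ E2 -E1 I /phi.
apply: (proj1 (Ceq_minus _ _)).
congr (_ * _)%C.
have -> : RtoC (det (mk 0 (-1) (INR N) 0)) = RtoC (INR N) by congr RtoC; rewrite /det /=; ring.
rewrite (_ : (2 * m)%nat = (m + m)%nat); last by rewrite mul2n addnn.
rewrite -plusE !Cpow_add_r -!Cpow_mult_l.
rewrite (_ : (RtoC (INR N) * (Ci * RtoC y) * (RtoC (INR N) * (Ci * RtoC y)))%C = (-1 * (RtoC (INR N) * RtoC (INR N) * (RtoC y * RtoC y)))%C); last first.
  by rewrite -Ci2; ring.
rewrite /Cdiv -Cpow_inv; last first.
  apply: Cmult_neq_0; last by repeat apply: Cmult_neq_0.
  by rewrite -Ci2; apply: Cmult_neq_0; exact: Ci_nz.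
rewrite /sgn -!Cpow_mult_l; congr (_ ^ m)%C.
rewrite -(RtoC_mult t t) (_ : t * t = / (INR N * (y * y))); last first.
  by rewrite /t -r_sq; field; lra.
rewrite RtoC_inv; last by apply: Rgt_not_eq; apply: Rmult_lt_0_compat; [lra | nra].
rewrite !RtoC_mult; field; split => //; split => //.
Qed.
End Hecke.

(** * From the Euler product to recursions for the coefficients *)

(** Dirichlet series at an integer argument [e]. Arbitrarily large integers are enough to determine
    the coefficients, and only ordinary powers occur. *)
Definition dser (c : nat -> C) (e : nat) (A : C) : Prop :=
  cser (fun n => c n.+1 * RtoC (/ INR n.+1 ^ e))%C A.

(** Dirichlet coefficients of the product of the series by 1 - x p^(-s) + y p^(-2s). *)
Definition loc (p : nat) (x y : C) (c : nat -> C) (i : nat) : C :=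
  (c i - x * (if (p %| i)%N then c (i %/ p)%N else 0)
     + y * (if (p ^ 2 %| i)%N then c (i %/ p ^ 2)%N else 0))%C.

Lemma csum_dilate (d : nat) (v : nat -> C) n : (0 < d)%N ->
  csum (fun i => if (d %| i.+1)%N then v (i.+1 %/ d).-1 else 0%C) n = csum v (n %/ d)%N.
Proof.
move=> Hd; elim: n => [|n IH]; first by rewrite div0n.
rewrite /= IH; case: ifP => [/dvdnP [q Hq]|Hn].
  have q0 : (0 < q)%N by case: q Hq.
  have -> : (n.+1 %/ d = q)%N by rewrite Hq mulnK.
  have -> : (n %/ d = q.-1)%N.
    have -> : n = (q.-1 * d + d.-1)%N.
      by apply: succn_inj; rewrite Hq -addnS (prednK Hd) addnC -mulSn (prednK q0).
    by rewrite divnMDl // divn_small ?addn0 // prednK.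
  by case: q q0 {Hq} => // q _ /=.
rewrite Cplus_0_r; congr csum.
by rewrite divnS // Hn.
Qed.

Lemma dser_dilate c e A d : (0 < d)%N -> dser c e A ->
  dser (fun i => if (d %| i)%N then c (i %/ d)%N else 0%C) e (RtoC (/ INR d ^ e) * A)%C.
Proof.
move=> Hd HA.
set v := fun n => (RtoC (/ INR d ^ e) * (c n.+1 * RtoC (/ INR n.+1 ^ e)))%C.
have H : cser (fun i => if (d %| i.+1)%N then v (i.+1 %/ d).-1 else 0%C) (RtoC (/ INR d ^ e) * A)%C.
  move=> e0 He0.
  have [n Hn] := @cser_scal (RtoC (/ INR d ^ e)) _ _ HA e0 He0.
  exists (n * d)%N => i Hi; rewrite (csum_dilate v _ Hd); apply: Hn.
  by apply/leP; rewrite leq_divRL //; apply/leP.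
apply: cser_ext H => i.
rewrite /v; case: ifP => [/dvdnP [q Hq]|_]; last by ring.
have q0 : (0 < q)%N by case: q Hq.
have -> : (i.+1 %/ d = q)%N by rewrite Hq mulnK.
rewrite (prednK q0) Hq -multE mult_INR.
have d0 : 0 < INR d by apply: lt_0_INR; apply/ltP.
have q1 : 0 < INR q by apply: lt_0_INR; apply/ltP.
rewrite Rpow_mult_distr Rinv_mult RtoC_mult; ring.
Qed.

Definition efac (p : nat) (x y : C) (e : nat) : C :=
  (1 - x * RtoC (/ INR p ^ e) + y * RtoC (/ INR p ^ (2 * e)))%C.

Lemma dser_loc p x y c e A : (0 < p)%N -> dser c e A ->
  dser (loc p x y c) e (efac p x y e * A)%C.
Proof.
move=> Hp HA.
have S1 := @cser_scal x _ _ (dser_dilate Hp HA).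
have Hp2 : (0 < p ^ 2)%N by rewrite expn_gt0 Hp.
have S2 := @cser_scal y _ _ (dser_dilate Hp2 HA).
have S := cser_plus (cser_minus HA S1) S2.
rewrite (_ : (efac p x y e * A)%C = (A - x * (RtoC (/ INR p ^ e) * A) + y * (RtoC (/ INR (p ^ 2) ^ e) * A))%C).
  by apply: cser_ext S => n; rewrite /loc; ring.
rewrite /efac (_ : INR (p ^ 2) ^ e = INR p ^ (2 * e)); first by ring.
by rewrite expnS expn1 -multE mult_INR pow_mult; congr (_ ^ _); rewrite /=; ring.
Qed.

Lemma poly_bounded_loc c K j p x y : (0 < p)%N -> poly_bounded c K j ->
  poly_bounded (loc p x y c) (K * (1 + Cmod x + Cmod y)) j.
Proof.
move=> Hp [K0 H].
have x0 := Cmod_ge_0 x; have y0 := Cmod_ge_0 y.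
split; first by apply: Rmult_le_pos; lra.
move=> n; rewrite /loc.
have I0 : 0 <= K * INR n.+1 ^ j by apply: Rmult_le_pos => //; apply: pow_le; exact: pos_INR.
have B d : (0 < d)%N -> Cmod (if (d %| n.+1)%N then c (n.+1 %/ d)%N else 0%C) <= K * INR n.+1 ^ j.
  move=> Hd; case: ifP => Dv; last by rewrite Cmod_0.
  have q0 : (0 < n.+1 %/ d)%N by rewrite divn_gt0 // dvdn_leq.
  rewrite -(prednK q0); apply: Rle_trans (H _) _; rewrite (prednK q0).
  apply: Rmult_le_compat_l => //; apply: pow_incr; split; first exact: pos_INR.
  by apply: le_INR; apply/leP; exact: leq_div.
have B1 := B p Hp.
have B2 := B (p ^ 2)%N ltac:(by rewrite expn_gt0 Hp).
apply: Rle_trans (Cmod_triangle _ _) _.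
apply: Rle_trans (Rplus_le_compat_r _ _ _ (Cmod_triangle _ _)) _.
rewrite Cmod_opp !Cmod_mult.
have := Rmult_le_compat_l _ _ _ x0 B1; have := Rmult_le_compat_l _ _ _ y0 B2; have := H n.
lra.
Qed.

Lemma pow_ratio_small (m : nat) K : (0 < m)%N -> 0 <= K -> forall e0 eps, 0 < eps ->
  exists e, (e0 <= e)%coq_nat /\ K * (INR m / INR m.+1) ^ e < eps.
Proof.
move=> Hm K0 e0 eps He.
have P : 0 < INR m by apply: lt_0_INR; apply/ltP.
have Q : 0 <= INR m / INR m.+1 < 1.
  rewrite S_INR; split; first by apply: Rdiv_le_0_compat; lra.
  by apply: (proj2 (Rlt_div_l _ _ _ _)); lra.
have [|n Hn] := @pow_lt_eps (INR m / INR m.+1) (eps / (K + 1)) Q.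
  by apply: Rdiv_lt_0_compat; lra.
exists (e0 + n)%coq_nat; split; first lia.
have := Hn (e0 + n)%coq_nat ltac:(lia) => X.
have := proj2 (Rlt_div_r _ _ _ _) X => /(_ ltac:(lra)).
have := pow_le _ (e0 + n)%coq_nat (proj1 Q); nra.
Qed.

Definition delta1 (i : nat) : C := if i == 1%N then 1%C else 0%C.

Lemma csum_delta c e m : (forall i, (0 < i)%N -> (i <= m)%N -> c i = delta1 i) -> (0 < m)%N ->
  csum (fun n => c n.+1 * RtoC (/ INR n.+1 ^ e))%C m = 1%C.
Proof.
elim: m => // -[|m] IH H _.
  rewrite /= H // /delta1 /= (_ : INR 1 = 1) // pow1 Rinv_1; ring.
rewrite -[LHS]/(csum (fun n => c n.+1 * RtoC (/ INR n.+1 ^ e))%C m.+1 + c m.+2 * RtoC (/ INR m.+2 ^ e))%C.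
rewrite IH //; last by move=> i i0 im; apply: H => //; exact: leqW.
by rewrite (H m.+2) // /delta1 /=; ring.
Qed.

(** By induction the coefficients before i are those of 1, so A - 1 is (c_i - delta_i) i^(-e) up to
    O((i+1)^(-e)). Multiplying by i^e and letting e tend to infinity leaves c_i = delta_i, as long
    as i + 1 <= n0. *)
Lemma dirichlet_coefs c K j n0 B e0 : poly_bounded c K j -> 0 <= B ->
  (forall e A, (e0 <= e)%coq_nat -> dser c e A -> Cmod (A - 1) <= B * / INR n0 ^ e) ->
  forall i, (0 < i)%N -> (i < n0)%N -> c i = delta1 i.
Proof.
move=> [K0 Hc] B0 H.
elim/ltn_ind=> i IH i0 ilt.
apply: (proj2 (Ceq_minus _ _)); apply: Cmod_eq_0; apply: Rle_antisym; last exact: Cmod_ge_0.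
apply: le_epsilon => eps Heps; rewrite Rplus_0_l.
have ip : 0 < INR i by apply: lt_0_INR; apply/ltP.
set D := 2 * K * INR i.+1 ^ (j + 2) + B.
have S0 : 0 < INR i.+1 by apply: lt_0_INR; lia.
have D0 : 0 <= D.
  have : 0 <= K * INR i.+1 ^ (j + 2) by apply: Rmult_le_pos => //; apply: pow_le; lra.
  rewrite /D; lra.
have [e [He Hs]] := pow_ratio_small i0 D0 (e0 + (j + 2)) Heps.
have He' : (e0 <= e)%coq_nat by move: He; rewrite -plusE; lia.
have Hj : (j + 2 <= e)%N by apply/leP; move: He; rewrite -!plusE; lia.
have tb n : (i <= n)%N -> Cmod (c n.+1 * RtoC (/ INR n.+1 ^ e)) <=
    K * INR i.+1 ^ (j + 2) * / INR i.+1 ^ e * / INR n.+1 ^ 2.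
  move=> Hn; have N0 : 0 < INR n.+1 by apply: lt_0_INR; lia.
  have Nle : INR i.+1 <= INR n.+1 by apply: le_INR; apply/leP.
  rewrite Cmod_mult Cmod_R Rabs_pos_eq; last by apply: Rlt_le; apply: Rinv_0_lt_compat; exact: pow_lt.
  have Ie : 0 < / INR n.+1 ^ e by apply: Rinv_0_lt_compat; exact: pow_lt.
  apply: Rle_trans (Rmult_le_compat_r _ _ _ (Rlt_le _ _ Ie) (Hc n)) _.
  rewrite -(subnKC Hj); set f := (e - (j + 2))%N.
  have pa (x : R) (u w : nat) : x ^ (u + w)%N = x ^ u * x ^ w by exact: pow_add.
  rewrite !(pa _ (j + 2)%N f) !(pa _ j 2%N).
  have a1 := pow_lt _ j N0; have a2 := pow_lt _ f N0; have a3 := pow_lt _ j S0; have a4 := pow_lt _ f S0.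
  have -> : K * INR n.+1 ^ j * / (INR n.+1 ^ j * INR n.+1 ^ 2 * INR n.+1 ^ f) = K * / INR n.+1 ^ 2 * / INR n.+1 ^ f.
    field; repeat split; apply: Rgt_not_eq; lra.
  have -> : K * (INR i.+1 ^ j * INR i.+1 ^ 2) * / (INR i.+1 ^ j * INR i.+1 ^ 2 * INR i.+1 ^ f) * / INR n.+1 ^ 2
     = K * / INR n.+1 ^ 2 * / INR i.+1 ^ f.
    field; repeat split; apply: Rgt_not_eq; lra.
  apply: Rmult_le_compat_l.
    by apply: Rmult_le_pos => //; apply: Rlt_le; apply: Rinv_0_lt_compat; exact: pow_lt.
  by apply: Rinv_le_contravar => //; apply: pow_incr; lra.
have [A [HA HT]] : exists A, dser c e A /\
    Cmod (A - csum (fun n => c n.+1 * RtoC (/ INR n.+1 ^ e))%C i) <= 2 * K * INR i.+1 ^ (j + 2) * / INR i.+1 ^ e.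
  have KK : 0 <= K * INR i.+1 ^ (j + 2) * / INR i.+1 ^ e.
    apply: Rmult_le_pos; last by apply: Rlt_le; apply: Rinv_0_lt_compat; exact: pow_lt.
    by apply: Rmult_le_pos => //; apply: pow_le; lra.
  have [n|l [Hl Bl]] := @cser_inv_sq (fun n => c (i + n)%N.+1 * RtoC (/ INR (i + n)%N.+1 ^ e))%C _ KK.
    apply: Rle_trans (tb _ (leq_addr _ _)) _.
    apply: Rmult_le_compat_l => //.
    have N0 : 0 < INR n.+1 by apply: lt_0_INR; lia.
    apply: Rinv_le_contravar; first exact: pow_lt.
    by apply: pow_incr; split; [lra | apply: le_INR; apply/leP; rewrite ltnS; exact: leq_addl].
  set u := fun n => (c n.+1 * RtoC (/ INR n.+1 ^ e))%C.
  exists (csum u i + l)%C; split; last first.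
    rewrite (_ : (csum u i + l - csum u i)%C = l); last by ring.
    have := Bl 0%nat; rewrite (_ : INR 1 = 1) // Rinv_1 (_ : (l - csum _ 0)%C = l); last by rewrite /=; ring.
    lra.
  move=> e1 /Hl [n Hn]; exists (i + n)%coq_nat => m' Hm'.
  have -> : m' = (i + (m' - i))%N by rewrite subnKC //; apply/leP; lia.
  have -> : forall q, csum u (i + q)%N = (csum u i + csum (fun n => u (i + n)%N) q)%C.
    elim=> [|q IHq]; first by rewrite addn0 /=; ring.
    rewrite addnS /= IHq; ring.
  have := Hn (m' - i)%N; rewrite -minusE => /(_ ltac:(lia)).
  set w := csum _ _; rewrite (_ : (csum u i + w - (csum u i + l))%C = (w - l)%C) //; ring.
have HB := H e A He' HA.
have IH' q : (0 < q)%N -> (q < i)%N -> c q = delta1 q.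
  by move=> q0 qi; apply: IH => //; exact: ltn_trans ilt.
have Ei : csum (fun n => c n.+1 * RtoC (/ INR n.+1 ^ e))%C i = (1 + (c i - delta1 i) * RtoC (/ INR i ^ e))%C.
  case: (i) i0 IH' => // -[|i'] _ IH'; last first.
    rewrite -[LHS]/(csum (fun n => c n.+1 * RtoC (/ INR n.+1 ^ e))%C i'.+1 + c i'.+2 * RtoC (/ INR i'.+2 ^ e))%C.
    rewrite csum_delta //.
    rewrite (_ : delta1 i'.+2 = 0%C) //; ring.
  rewrite /= (_ : delta1 1 = 1%C) // (_ : INR 1 = 1) // pow1 Rinv_1; ring.
have Pe := pow_lt _ e ip; have Qe := pow_lt _ e S0.
have Ie : 0 < / INR i ^ e by apply: Rinv_0_lt_compat.
have n0B : / INR n0 ^ e <= / INR i.+1 ^ e.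
  by apply: Rinv_le_contravar => //; apply: pow_incr; split; [lra | apply: le_INR; apply/leP].
have X : Cmod (c i - delta1 i) * / INR i ^ e <= D * / INR i.+1 ^ e.
  have <- : Cmod ((c i - delta1 i) * RtoC (/ INR i ^ e)) = Cmod (c i - delta1 i) * / INR i ^ e.
    by rewrite Cmod_mult Cmod_R Rabs_pos_eq //; lra.
  rewrite (_ : ((c i - delta1 i) * RtoC (/ INR i ^ e))%C = ((A - 1) - (A - (1 + (c i - delta1 i) * RtoC (/ INR i ^ e))))%C); last by ring.
  rewrite -Ei; apply: Rle_trans (Cmod_triangle _ _) _; rewrite Cmod_opp.
  have := Rmult_le_compat_l _ _ _ B0 n0B; rewrite /D; lra.
apply: Rlt_le; apply: Rle_lt_trans Hs.
rewrite /Rdiv Rpow_mult_distr pow_inv.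
have := Rmult_le_compat_r _ _ _ (Rlt_le _ _ Pe) X.
rewrite Rmult_assoc Rinv_l; last lra.
lra.
Qed.

(** * Partial Euler products and sieving *)

Fixpoint cprod (F : nat -> C) (n : nat) : C :=
  if n is p.+1 then (cprod F p * F p)%C else 1%C.

Lemma cprod_add F n m : cprod F (n + m) = (cprod F n * cprod (fun k => F (n + k)%N) m)%C.
Proof.
elim: m => [|m IH]; first by rewrite addn0 /=; ring.
rewrite addnS /= IH; ring.
Qed.

Lemma cprod_mul F G n : cprod (fun k => F k * G k)%C n = (cprod F n * cprod G n)%C.
Proof. elim: n => [|n IH] /=; [ring | rewrite IH; ring]. Qed.

Lemma cprod_eq1 (F : nat -> C) n : (forall k, (k < n)%N -> F k = 1%C) -> cprod F n = 1%C.
Proof.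
elim: n => [|n IH] H //=; rewrite IH ?H //; first by ring.
by move=> k Hk; apply: H; exact: leqW.
Qed.

Lemma cprod_ext F G n : (forall k, (k < n)%N -> F k = G k) -> cprod F n = cprod G n.
Proof.
elim: n => [|n IH] H //=; rewrite IH ?H // => k Hk; apply: H; exact: leqW.
Qed.

(* Product of the 1/(1+t_k): the constant 2 is stable under induction as long as the sum of the
   bounds stays below 1/2. *)
Lemma cprod_near1 (F t : nat -> C) (b : nat -> R) n :
  (forall k, Cmod (t k) <= b k) -> (forall k, F k = 1%C \/ F k = (/ (1 + t k))%C) ->
  rsum b n <= / 2 -> Cmod (cprod F n - 1) <= 2 * rsum b n.
Proof.
move=> Ht HF.
have b0 k : 0 <= b k by apply: Rle_trans (Ht k); exact: Cmod_ge_0.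
have S0 k : 0 <= rsum b k by elim: k => [|k IH] /=; [lra | have := b0 k; lra].
elim: n => [|n IH] /= Hs; first by rewrite Cmod_subrr; lra.
have bn := b0 n; have Sn := S0 n.
have {}IH := IH ltac:(lra).
case: (HF n) => [->|->]; first by rewrite Cmult_1_r; lra.
have tn := Ht n.
have L : 1 - b n <= Cmod (1 + t n).
  have := Cmod_rev 1 (- t n); rewrite Cmod_1 Cmod_opp (_ : (1 - - t n)%C = (1 + t n)%C); last by ring.
  lra.
have N : (1 + t n)%C <> 0%C by apply: Cmod_neq0; lra.
have -> : (cprod F n * / (1 + t n) - 1)%C = ((cprod F n - 1 - t n) / (1 + t n))%C by field.
rewrite Cmod_div //; apply: (proj2 (Rle_div_l _ _ _ (Cmod_pos N))).
apply: Rle_trans (Cmod_triangle _ _) _; rewrite Cmod_opp.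
apply: Rle_trans (_ : 2 * (rsum b n + b n) * (1 - b n) <= _); last by apply: Rmult_le_compat_l; lra.
nra.
Qed.

Section EulerSieve.
Variables (a x y : nat -> C) (tau : nat) (K : R) (j : nat) (e0 : nat).
Hypothesis Ha : poly_bounded a K j.
Hypothesis Hx : forall p, prime p -> Cmod (x p) <= INR p ^ tau.
Hypothesis Hy : forall p, prime p -> Cmod (y p) <= INR p ^ (2 * tau).

Definition Ef (e p : nat) : C := if prime p then efac p (x p) (y p) e else 1%C.

Hypothesis Hdser : forall e, (e0 <= e)%N -> exists A, dser a e A /\
  forall eps, 0 < eps -> exists n0, forall n, (n0 <= n)%N -> Cmod (cprod (fun p => / Ef e p)%C n - A) < eps.

Lemma prime_INR2 p : prime p -> 2 <= INR p.
Proof.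
move=> /prime_gt1 H; rewrite (_ : 2 = INR 2); last by rewrite /INR; ring.
by apply: le_INR; apply/leP.
Qed.

Lemma Ef_near1 e p : (tau + 5 <= e)%N -> prime p ->
  Cmod (Ef e p - 1) <= 2 * / INR p ^ (e - tau).
Proof.
move=> He Hp; rewrite /Ef Hp /efac.
have P2 := prime_INR2 Hp.
have -> : (1 - x p * RtoC (/ INR p ^ e) + y p * RtoC (/ INR p ^ (2 * e)) - 1)%C =
  (- (x p * RtoC (/ INR p ^ e)) + y p * RtoC (/ INR p ^ (2 * e)))%C by ring.
apply: Rle_trans (Cmod_triangle _ _) _; rewrite Cmod_opp !Cmod_mult.
have I n : 0 < / INR p ^ n by apply: Rinv_0_lt_compat; apply: pow_lt; lra.
have pa (u w : nat) : INR p ^ (u + w)%N = INR p ^ u * INR p ^ w by exact: pow_add.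
have pn n : INR p ^ n <> 0 by apply: pow_nonzero; lra.
set f := (e - tau)%N.
have Ee : e = (tau + f)%N by rewrite subnKC //; apply: leq_trans He; exact: leq_addr.
rewrite !Cmod_R !Rabs_pos_eq; try exact/Rlt_le/I.
have B1 : Cmod (x p) * / INR p ^ e <= / INR p ^ f.
  apply: Rle_trans (Rmult_le_compat_r _ _ _ (Rlt_le _ _ (I e)) (Hx Hp)) _.
  by rewrite Ee pa; right; field.
have B2 : Cmod (y p) * / INR p ^ (2 * e) <= / INR p ^ f.
  apply: Rle_trans (Rmult_le_compat_r _ _ _ (Rlt_le _ _ (I _)) (Hy Hp)) _.
  rewrite Ee mulnDr pa (_ : INR p ^ (2 * tau) * / (INR p ^ (2 * tau) * INR p ^ (2 * f)) = / INR p ^ (2 * f)); last by field.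
  apply: Rinv_le_contravar; first by apply: pow_lt; lra.
  apply: Rle_pow; first lra.
  by apply/leP; rewrite mul2n -addnn leq_addr.
lra.
Qed.

Lemma Ef_neq0 e p : (tau + 5 <= e)%N -> Ef e p <> 0%C.
Proof.
move=> He; case Hp: (prime p); last by rewrite /Ef Hp; exact: C1_nz.
have H := Ef_near1 He Hp.
have P2 := prime_INR2 Hp.
have : 2 * / INR p ^ (e - tau) <= / 2.
  have F : 4 <= INR p ^ (e - tau).
    apply: Rle_trans (_ : INR p ^ 2 <= _); first by rewrite /=; nra.
    apply: Rle_pow; first lra.
    by apply/leP; rewrite leq_subRL ?(leq_trans _ He) // ?leq_add2l // leq_addr.
  have := Rinv_le_contravar 4 _ ltac:(lra) F; lra.
move=> L; apply: Cmod_neq0.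
have := Cmod_rev 1 (1 - Ef e p); rewrite Cmod_1 (Cmod_sub_sym 1) (_ : (1 - (1 - Ef e p))%C = Ef e p); last by ring.
lra.
Qed.

(** After cancellation only factors at k >= n remain, each within 2 k^(tau-e) of 1. Two powers of k
    make the sum converge; e >= tau + 5 leaves at least three more, so that n^3 >= 8 brings the sum
    below the threshold 1/2 of [cprod_near1]. *)
Lemma tail_value e n A : (tau + 5 <= e)%N -> (2 <= n)%N ->
  (forall eps, 0 < eps -> exists n0, forall n, (n0 <= n)%N -> Cmod (cprod (fun p => / Ef e p)%C n - A) < eps) ->
  Cmod (cprod (Ef e) n * A - 1) <= 4 * INR n ^ (tau + 2) * / INR n ^ e.
Proof.
move=> He Hn HA.
have n2 : 2 <= INR n.
  rewrite (_ : 2 = INR 2); last by rewrite /INR; ring.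
  by apply: le_INR; apply/leP.
pose b k := 2 * / INR (n + k) ^ (e - tau).
have Ef1 : (e = tau + 2 + (e - (tau + 2)))%N by rewrite subnKC // (leq_trans _ He) // leq_add2l.
set f := (e - (tau + 2))%N in Ef1.
have Ef2 : (e - tau = 2 + f)%N by rewrite Ef1 -addnA addKn.
have pa (z : R) (u w : nat) : z ^ (u + w)%N = z ^ u * z ^ w by exact: pow_add.
have f3 : (3 <= f)%N by rewrite /f leq_subRL ?(leq_trans _ He) -?addnA ?leq_add2l.
have nf : 0 < INR n ^ f by apply: pow_lt; lra.
have bb m : rsum b m <= 2 * / INR n ^ f.
  have : rsum b m <= 2 * / INR n ^ f * rsum (fun k => / INR (n.-1 + k).+1 ^ 2) m.
    elim: m => [|m IH]; first by rewrite /=; lra.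
    rewrite !rsumS Rmult_plus_distr_l; apply: Rplus_le_compat => //.
    rewrite /b Ef2 pa -addSn prednK; last exact: leq_trans Hn.
    have N0 : INR n <= INR (n + m) by apply: le_INR; apply/leP; exact: leq_addr.
    have Q2 : 0 < INR (n + m) ^ 2 by apply: pow_lt; lra.
    have Qf : 0 < INR (n + m) ^ f by apply: pow_lt; lra.
    rewrite Rinv_mult (_ : 2 * (/ INR (n + m) ^ 2 * / INR (n + m) ^ f) = 2 * / INR (n + m) ^ f * / INR (n + m) ^ 2); last by ring.
    apply: Rmult_le_compat_r; first by apply: Rlt_le; exact: Rinv_0_lt_compat.
    apply: Rmult_le_compat_l; first lra.
    by apply: Rinv_le_contravar => //; apply: pow_incr; lra.
  have := inv_sq_sum n.-1 m; rewrite prednK; last exact: leq_trans Hn.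
  move=> H1 H2; apply: Rle_trans H2 _.
  rewrite -[X in _ <= X]Rmult_1_r; apply: Rmult_le_compat_l.
    by have := Rinv_0_lt_compat _ nf; lra.
  apply: Rle_trans H1 _.
  have := Rinv_le_contravar 2 _ ltac:(lra) n2; lra.
have small : 2 * / INR n ^ f <= / 4.
  have F : 8 <= INR n ^ f.
    apply: Rle_trans (_ : INR n ^ 3 <= _); first by rewrite /=; nra.
    by apply: Rle_pow; [lra | apply/leP].
  have := Rinv_le_contravar 8 _ ltac:(lra) F; lra.
have T m : Cmod (cprod (fun k => / Ef e (n + k))%C m - 1) <= 2 * (2 * / INR n ^ f).
  apply: Rle_trans (@cprod_near1 _ (fun k => Ef e (n + k) - 1)%C b m _ _ _) _.
  - move=> k; case Hp: (prime (n + k)); first by exact: Ef_near1.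
    rewrite /Ef Hp Cmod_subrr /b.
    have : 0 < / INR (n + k) ^ (e - tau); last by lra.
    apply: Rinv_0_lt_compat; apply: pow_lt; apply: lt_0_INR; apply/ltP.
    by rewrite addn_gt0 (leq_trans _ Hn).
  - by move=> k; right; congr Cinv; ring.
  - by have := bb m; lra.
  - by have := bb m; lra.
have -> : 4 * INR n ^ (tau + 2) * / INR n ^ e = 2 * (2 * / INR n ^ f).
  rewrite {1}Ef1 (pa _ (tau + 2)%N f); field; split; apply: Rgt_not_eq => //; apply: pow_lt; lra.
apply: le_epsilon => eps Heps.
set E := cprod (Ef e) n.
have E0 := Cmod_ge_0 E.
have [n0 H0] := HA (eps / (Cmod E + 1)) ltac:(apply: Rdiv_lt_0_compat; lra).
have := H0 (n + n0)%N (leq_addl _ _); rewrite cprod_add.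
set Tm := cprod (fun k => / Ef e (n + k))%C n0.
move=> X; have {}X := proj2 (Rlt_div_r _ _ _ _) X.
have {}X := X ltac:(lra).
have EI : (E * cprod (fun p => / Ef e p)%C n = 1)%C.
  rewrite /E -cprod_mul; apply: cprod_eq1 => k _; rewrite Cinv_r //; exact: Ef_neq0.
have -> : (E * A - 1 = (E * cprod (fun p => / Ef e p)%C n) * Tm - 1
    - E * (cprod (fun p => / Ef e p)%C n * Tm - A))%C by ring.
rewrite EI Cmult_1_l; apply: Rle_trans (Cmod_triangle _ _) _; rewrite Cmod_opp Cmod_mult.
have := T n0; rewrite -/Tm.
have := Cmod_ge_0 (cprod (fun p => / Ef e p)%C n * Tm - A); nra.
Qed.

Variable q : nat.
Hypothesis Hq : prime q.

(** The factor at [q] is put innermost, so that the factors at the other primes can be peeled off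
    again by [loc_vanish], leaving information about [loc q] applied to [a]. *)
Fixpoint sieve (n : nat) : nat -> C :=
  if n is p.+1 then
    if prime p && (p != q) then loc p (x p) (y p) (sieve p) else sieve p
  else loc q (x q) (y q) a.

Lemma sieve_poly n : exists K', poly_bounded (sieve n) K' j.
Proof.
elim: n => [|n [K' IH]] /=.
  by eexists; apply: (poly_bounded_loc _ _ (prime_gt0 Hq) Ha).
case: ifP => [/andP [Hn _]|_]; last by exists K'.
by eexists; apply: (poly_bounded_loc _ _ (prime_gt0 Hn) IH).
Qed.

Lemma sieve_dser e A n : dser a e A ->
  dser (sieve n) e (Ef e q * cprod (fun p => if p == q then RtoC 1 else Ef e p) n * A)%C.
Proof.
move=> HA; elim: n => [|n IH] /=.
  rewrite Cmult_1_r /Ef Hq; exact: dser_loc (prime_gt0 Hq) HA.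
case Hn: (prime n && (n != q)).
  move/andP: Hn => [Hn /negbTE nq].
  have H := dser_loc (x n) (y n) (prime_gt0 Hn) IH.
  rewrite nq (_ : (Ef e q * (cprod (fun p => if p == q then RtoC 1 else Ef e p) n * Ef e n) * A)%C =
    (efac n (x n) (y n) e * (Ef e q * cprod (fun p => if p == q then RtoC 1 else Ef e p) n * A))%C) //.
  have -> : Ef e n = efac n (x n) (y n) e by rewrite /Ef Hn.
  ring.
rewrite (_ : (if n == q then RtoC 1 else Ef e n) = 1%C) ?Cmult_1_r //.
case: eqP => // /eqP nq; rewrite /Ef; case: ifP => // Hp.
by move: Hn; rewrite Hp nq.
Qed.

Lemma skip_prod e n : (q < n)%N ->
  (Ef e q * cprod (fun p => if p == q then RtoC 1 else Ef e p) n)%C = cprod (Ef e) n.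
Proof.
elim: n => // n IH; rewrite ltnS leq_eqVlt => /orP [/eqP <-|H] /=.
  rewrite eqxx Cmult_1_r Cmult_comm; congr (_ * _)%C.
  by apply: cprod_ext => k Hk; rewrite ltn_eqF.
rewrite (gtn_eqF H) -IH //; ring.
Qed.

Lemma sieve_delta n : (q < n)%N -> forall i, (0 < i)%N -> (i < n)%N -> sieve n i = delta1 i.
Proof.
move=> Hqn.
have n2 : (2 <= n)%N by apply: leq_trans Hqn; exact: leqW (prime_gt1 Hq).
have [K' HK] := sieve_poly n.
apply: (@dirichlet_coefs _ K' j n (4 * INR n ^ (tau + 2)) (e0 + (tau + 5))%N HK).
  by apply: Rmult_le_pos; [lra | apply: pow_le; exact: pos_INR].
move=> e A He HA.
have He' : (e0 + (tau + 5) <= e)%N by apply/leP.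
have [A0 [D0 L0]] := Hdser (leq_trans (leq_addr _ _) He').
have -> : A = (cprod (Ef e) n * A0)%C.
  rewrite -skip_prod //; apply: (cser_unique HA); exact: sieve_dser.
by apply: tail_value => //; exact: leq_trans (leq_addl _ _) He'.
Qed.

(** Since p differs from q, the quotients of i by p and p^2 are again multiples of q, and smaller
    than i: strong induction solves the relation for c_i. *)
Lemma loc_vanish p u v c n : prime p -> p != q ->
  (forall i, (0 < i)%N -> (i < n)%N -> (q %| i)%N -> loc p u v c i = 0%C) ->
  forall i, (0 < i)%N -> (i < n)%N -> (q %| i)%N -> c i = 0%C.
Proof.
move=> Hp pq H; elim/ltn_ind=> i IH i0 ilt qi.
have D d : (1 < d)%N -> coprime q d -> (d %| i)%N -> c (i %/ d)%N = 0%C.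
  move=> d1 qd di.
  have d0 : (0 < d)%N by exact: ltnW.
  have lt : (i %/ d < i)%N by apply: ltn_Pdiv.
  apply: IH => //; first by rewrite divn_gt0 // dvdn_leq.
    exact: ltn_trans ilt.
  by rewrite -(Gauss_dvdl _ qd) divnK.
have cp : coprime q p by rewrite prime_coprime // dvdn_prime2 // eq_sym.
have := H i i0 ilt qi; rewrite /loc.
have -> : (if (p %| i)%N then c (i %/ p)%N else 0%C) = 0%C.
  by case: ifP => // /(D _ (prime_gt1 Hp) cp).
have -> : (if (p ^ 2 %| i)%N then c (i %/ p ^ 2)%N else 0%C) = 0%C.
  case: ifP => // /D; apply; last exact: coprimeXr.
  by rewrite -(exp1n 2) ltn_exp2r // prime_gt1.
by move=> <-; ring.
Qed.

Lemma sieve_vanish n b : (forall i, (0 < i)%N -> (i < b)%N -> (q %| i)%N -> sieve n i = 0%C) ->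
  forall i, (0 < i)%N -> (i < b)%N -> (q %| i)%N -> loc q (x q) (y q) a i = 0%C.
Proof.
elim: n => [|n IH] H; first exact: H.
apply: IH; move: H; rewrite /=; case: ifP => [/andP [Hp pq]|_] // H.
exact: (loc_vanish Hp pq H).
Qed.

Lemma euler_relation l : (0 < l)%N ->
  a (q * l)%N = (x q * a l - y q * (if (q %| l)%N then a (l %/ q)%N else 0))%C.
Proof.
move=> Hl.
have q0 := prime_gt0 Hq.
have ql : (0 < q * l)%N by rewrite muln_gt0 q0.
(* Sieving up to this bound makes the coefficients at all i <= q l known; multiples of q are never
   1, so there they vanish. *)
set n := (q * l).+1.
have qn : (q < n)%N by rewrite ltnS leq_pmulr.
have S := sieve_delta qn.
have V := @sieve_vanish n n.
have := V _ (q * l)%N ql (ltnSn _) (dvdn_mulr _ (dvdnn _)).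
rewrite /loc dvdn_mulr // mulKn // (_ : (q ^ 2 %| q * l)%N = (q %| l)%N); last first.
  by rewrite expnS expn1 dvdn_pmul2l.
rewrite (_ : (q * l %/ q ^ 2)%N = (l %/ q)%N); last by rewrite expnS expn1 divnMl.
move=> Z; have {}Z := Z _.
have E : (a (q * l)%N - x q * a l + y q * (if (q %| l)%N then a (l %/ q)%N else 0))%C = 0%C.
  apply: Z => i i0 il qi; rewrite S // /delta1; case: eqP => // i1.
  by move: qi; rewrite i1 dvdn1 => /eqP q1; move: (prime_gt1 Hq); rewrite q1.
set w := (if _ then _ else _) in E *.
rewrite -[LHS]Cplus_0_r -(Cplus_opp_r (x q * a l - y q * w)).
rewrite (_ : (a (q * l)%N + (x q * a l - y q * w + - (x q * a l - y q * w)))%C = (a (q * l)%N - x q * a l + y q * w + (x q * a l - y q * w))%C); last by ring.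
by rewrite E; ring.
Qed.
End EulerSieve.

HB.instance Definition _ := Monoid.isComLaw.Build C (RtoC 1) Cmult Cmult_assoc Cmult_comm Cmult_1_l.

Lemma bigop_cprod (P : pred nat) (F : nat -> C) n :
  \big[Cmult/RtoC 1]_(0 <= p < n | prime p && P p) F p =
  cprod (fun p => if prime p && P p then F p else RtoC 1) n.
Proof.
rewrite big_mkcond /=; elim: n => [|n IH]; first by rewrite big_nil.
by rewrite big_nat_recr //= IH.
Qed.

Lemma is_prime_prod_eps P F l : is_prime_prod P F l ->
  forall eps, 0 < eps -> exists n0, forall n, (n0 <= n)%N ->
    Cmod (cprod (fun p => if prime p && P p then F p else RtoC 1) n - l) < eps.
Proof.
move=> H eps He.
have [|n0 Hn0] := H (fun z => Cmod (z - l) < eps); last first.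
  by exists n0 => n /leP Hn; have := Hn0 n Hn; rewrite bigop_cprod.
have He2 : 0 < eps / 2 by lra.
exists (mkposreal _ He2) => z [B1 B2].
apply: Rle_lt_trans (Cmod_le_Re_Im _) _.
rewrite re_plus re_opp im_plus im_opp.
move: B1 B2; rewrite /ball /= /AbsRing_ball /abs /minus /plus /opp /= => B1 B2.
rewrite /Re /Im; lra.
Qed.

Lemma lim_prod (u v : nat -> C) P Q :
  (forall eps, 0 < eps -> exists n0, forall n, (n0 <= n)%N -> Cmod (u n - P) < eps) ->
  (forall eps, 0 < eps -> exists n0, forall n, (n0 <= n)%N -> Cmod (v n - Q) < eps) ->
  forall eps, 0 < eps -> exists n0, forall n, (n0 <= n)%N -> Cmod (u n * v n - P * Q) < eps.
Proof.
move=> Hu Hv eps He.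
set B := Cmod P + Cmod Q + 1.
have p0 := Cmod_ge_0 P; have q0 := Cmod_ge_0 Q.
have Bp : 0 < B by rewrite /B; lra.
have Hd : 0 < Rmin 1 (eps / (2 * B)) by apply: Rmin_pos; [lra | apply: Rdiv_lt_0_compat; lra].
have [n1 H1] := Hu _ Hd; have [n2 H2] := Hv _ Hd.
exists (n1 + n2)%N => n Hn.
have {}H1 := H1 n (leq_trans (leq_addr _ _) Hn).
have {}H2 := H2 n (leq_trans (leq_addl _ _) Hn).
have M1 := Rmin_l 1 (eps / (2 * B)); have M2 := Rmin_r 1 (eps / (2 * B)).
set d := Rmin _ _ in H1 H2 Hd M1 M2.
have dB : d * (2 * B) <= eps by apply: (proj2 (Rle_div_r _ _ _ _)); lra.
have -> : (u n * v n - P * Q)%C = ((u n - P) * v n + P * (v n - Q))%C by ring.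
apply: Rle_lt_trans (Cmod_triangle _ _) _; rewrite !Cmod_mult.
have a0 := Cmod_ge_0 (u n - P); have b0 := Cmod_ge_0 (v n - Q).
have V : Cmod (v n) <= B by have := Cmod_rev (v n) Q; rewrite /B; lra.
have : Cmod (u n - P) * Cmod (v n) <= d * B.
  by apply: Rmult_le_compat; try lra; exact: Cmod_ge_0.
have : Cmod P * Cmod (v n - Q) <= Cmod P * d by apply: Rmult_le_compat_l; lra.
have : Cmod P * d < B * d by apply: Rmult_lt_compat_r => //; rewrite /B; lra.
lra.
Qed.

(** The Euler factor at p is 1 / (1 - x p^(-s) + y p^(-2s)) with this x and with y = [local_norm],
    where k = 2m. When p^2 | N both are 0, which encodes the absence of a factor at p. *)
Definition local_trace (a : nat -> C) (m N p : nat) : C :=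
  if ~~ (p %| N)%N then a p else if ~~ (p ^ 2 %| N)%N then RtoC (INR p ^ (m - 1)) else RtoC 0.
Definition local_norm (m N p : nat) : C :=
  if ~~ (p %| N)%N then RtoC (INR p ^ (2 * m - 1)) else RtoC 0.

Lemma cpow_neg_nat p e : 0 < INR p -> cpow (INR p) (- RtoC (INR e)) = RtoC (/ INR p ^ e).
Proof.
move=> Hp; rewrite -cpow_inv // cpow_nat; last exact: Rinv_0_lt_compat.
by rewrite -RtoC_pow pow_inv.
Qed.

Lemma euler_coefs (a : nat -> C) (sigma M : R) (j m N : nat) :
  poly_bounded a M j -> (0 < m)%N ->
  (forall s : C, (sigma + 1 < Re s)%R ->
     exists P Q : C,
       is_prime_prod (fun p => ~~ (p %| N)%N)
         (fun p => / (1 - a p * cpow (INR p) (- s)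
                      + cpow (INR p) (INR (2 * m) - 1 - 2 * s)))%C P /\
       is_prime_prod (fun p => (p %| N)%N && ~~ (p ^ 2 %| N)%N)
         (fun p => / (1 - cpow (INR p) (INR (2 * m) / 2 - 1 - s)))%C Q /\
       dirichlet_series a s = (P * Q)%C) ->
  forall q l, prime q -> (0 < l)%N ->
  a (q * l)%N = (local_trace a m N q * a l - local_norm m N q * (if (q %| l)%N then a (l %/ q)%N else RtoC 0))%C.
Proof.
move=> Ha m0 HE q l Hq Hl.
have [M' HM'] := INR_unbounded M.
(* p^tau must dominate |a_p| <= M p^j, for which M <= M' <= 2^M' <= p^M', as well as p^(m-1); and
   p^(2 tau) must dominate p^(2m-1). *)
set tau := (j + M' + 2 * m)%N.
have [e1 He1] := INR_unbounded (sigma + 1).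
have I2 : INR 2 = 2 by rewrite /INR; ring.
have Ppos p : prime p -> 0 < INR p.
  by move=> Hp; apply: lt_0_INR; apply/ltP; exact: prime_gt0.
have P1 p : prime p -> 1 <= INR p by move=> /prime_INR2; lra.
have pa (z : R) (u w : nat) : z ^ (u + w)%N = z ^ u * z ^ w by exact: pow_add.
apply: (@euler_relation a (local_trace a m N) (local_norm m N) tau M j (e1 + (j + 2))%N) => //.
- move=> p Hp; rewrite /local_trace.
  have pp := Ppos p Hp; have p1 := P1 p Hp; have p2 := prime_INR2 Hp.
  have ge1 n : 1 <= INR p ^ n by apply: pow_R1_Rle.
  case: ifP => _.
    case: Ha => M0 /(_ p.-1); rewrite prednK ?prime_gt0 // => H.
    apply: Rle_trans H _; rewrite /tau (pa _ (j + M')%N (2 * m)%N) (pa _ j M') Rmult_comm.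
    have : M <= INR p ^ M'.
      apply: Rle_trans (_ : INR M' <= _); first lra.
      apply: Rle_trans (_ : 2 ^ M' <= _); last by apply: pow_incr; lra.
      have := @poly M' 1 ltac:(lra); rewrite (_ : 1 + 1 = 2); lra.
    have J := pow_lt _ j pp; have G := ge1 (2 * m)%N; have G' := ge1 M'.
    move=> L; apply: Rle_trans (Rmult_le_compat_l _ _ _ (Rlt_le _ _ J) L) _.
    rewrite -[X in X <= _]Rmult_1_r; apply: Rmult_le_compat_l; [apply: Rmult_le_pos; lra | exact: G].
  case: ifP => _; last by rewrite Cmod_0; apply: pow_le; lra.
  rewrite Cmod_R Rabs_pos_eq; last by apply: pow_le; lra.
  apply: Rle_pow => //; apply/leP; rewrite /tau.
  apply: leq_trans (leq_subr _ _) _; apply: leq_trans (leq_addl _ _).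
  by rewrite mul2n -addnn leq_addr.
- move=> p Hp; rewrite /local_norm; have pp := Ppos p Hp; have p1 := P1 p Hp.
  case: ifP => _; last by rewrite Cmod_0; apply: pow_le; lra.
  rewrite Cmod_R Rabs_pos_eq; last by apply: pow_le; lra.
  apply: Rle_pow => //; apply/leP.
  apply: leq_trans (leq_subr _ _) _; rewrite leq_mul2l /= /tau.
  by apply: leq_trans (leq_addl _ _); rewrite mul2n -addnn leq_addr.
move=> e He.
have E1 : INR e1 <= INR e.
  by apply: le_INR; apply/leP; apply: leq_trans He; exact: leq_addr.
have E2 : INR (j + 2) <= INR e.
  by apply: le_INR; apply/leP; apply: leq_trans He; exact: leq_addl.
have [P [Q [HP [HQ HL]]]] := HE (RtoC (INR e)) ltac:(rewrite re_RtoC; lra).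
exists (dirichlet_series a (RtoC (INR e))); split.
  have := dirichlet_cser Ha (s := RtoC (INR e)); rewrite re_RtoC => /(_ E2).
  apply: cser_ext => n; rewrite cpow_neg_nat //; apply: lt_0_INR; lia.
rewrite HL => eps Heps.
have [n0 Hn0] := lim_prod (is_prime_prod_eps HP) (is_prime_prod_eps HQ) Heps.
exists n0 => n /Hn0; rewrite -cprod_mul; set w := cprod _ n => X.
have -> : cprod (fun p => / Ef (local_trace a m N) (local_norm m N) e p)%C n = w; last exact: X.
rewrite /w {w X}; apply: cprod_ext => p _.
rewrite /Ef; case Hp: (prime p); last first.
  by rewrite /= Cmult_1_r -RtoC_inv ?Rinv_1 //; lra.
have pp := Ppos p Hp.
rewrite /= /efac /local_trace /local_norm.
case: (p %| N)%N => /=; last first.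
  rewrite Cmult_1_r; congr Cinv; congr (_ + _)%C; first by rewrite cpow_neg_nat.
  have -> : (RtoC (INR (2 * m)) - 1 - 2 * RtoC (INR e))%C = (RtoC (INR (2 * m - 1)) + - RtoC (INR (2 * e)))%C.
    rewrite -!minusE -!multE minus_INR; last by (move/ltP: m0; lia).
    rewrite RtoC_minus (mult_INR 2 m) (mult_INR 2 e) !RtoC_mult I2 (_ : INR 1 = 1) //; ring.
  by rewrite cpow_add cpow_neg_nat // cpow_nat // -RtoC_pow.
case: (p ^ 2 %| N)%N => /=.
  rewrite (_ : (1 - 0 * RtoC (/ INR p ^ e) + 0 * RtoC (/ INR p ^ (2 * e)))%C = RtoC 1); last by ring.
  by rewrite Cmult_1_r -RtoC_inv ?Rinv_1 //; lra.
rewrite Cmult_1_l; congr Cinv.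
have -> : (RtoC (INR (2 * m)) / 2 - 1 - RtoC (INR e))%C = (RtoC (INR (m - 1)) + - RtoC (INR e))%C.
  rewrite -!minusE -!multE minus_INR; last by apply/leP.
  rewrite RtoC_minus (mult_INR 2 m) RtoC_mult I2 (_ : INR 1 = 1) //; field.
rewrite cpow_add cpow_neg_nat // cpow_nat // -RtoC_pow; ring.
Qed.

(** * Hecke relations on the upper half-plane *)

Lemma Cexp_period_neq1 r p : (0 < r)%N -> (r < p)%N ->
  Cexp (Ci * RtoC (2 * PI * (INR r / INR p))) <> 1%C.
Proof.
move=> Hr Hp; rewrite Cexp_im => -[E _].
have r0 : 0 < INR r by apply: lt_0_INR; apply/ltP.
have rp : INR r < INR p by apply: lt_INR; apply/ltP.
set t := INR r / INR p in E.
have t0 : 0 < t < 1.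
  split; first by apply: Rdiv_lt_0_compat; lra.
  by apply: (proj2 (Rlt_div_l _ _ _ _)); lra.
have PP := PI_RGT_0.
have S : 0 < sin (PI * t) by apply: sin_gt_0; nra.
move: E; rewrite (_ : 2 * PI * t = 2 * (PI * t)); last by ring.
rewrite cos_2a_sin; nra.
Qed.

Lemma geom_root (x : C) p : (x ^ p)%C = 1%C -> x <> 1%C -> csum (fun j => x ^ j)%C p = 0%C.
Proof.
move=> H N; have G := geom_finite p N.
have N' : (1 - x)%C <> 0%C by apply: Cminus_eq_contra => E; apply: N.
move: G; rewrite H /Cdiv Cmult_1_l => G.
have -> : csum (fun j => x ^ j)%C p = (csum (fun j => x ^ j)%C p + / (1 - x) - / (1 - x))%C by ring.
by rewrite -G; ring.
Qed.

Lemma root_sum n p : (0 < p)%N ->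
  csum (fun j => Cexp (Ci * RtoC (2 * PI * (INR n / INR p))) ^ j)%C p =
    if (p %| n)%N then RtoC (INR p) else RtoC 0.
Proof.
move=> Hp.
have p0 : 0 < INR p by apply: lt_0_INR; apply/ltP.
have E : Cexp (Ci * RtoC (2 * PI * (INR n / INR p))) = Cexp (Ci * RtoC (2 * PI * (INR (n %% p) / INR p))).
  rewrite {1}(divn_eq n p) -plusE -multE plus_INR mult_INR.
  rewrite (_ : 2 * PI * ((INR (n %/ p) * INR p + INR (n %% p)) / INR p) =
     INR (n %/ p) * (2 * PI) + 2 * PI * (INR (n %% p) / INR p)); last by field; lra.
  by rewrite RtoC_plus Cmult_plus_distr_l Cexp_add Cexp_2pi Cmult_1_l.
rewrite E; case: ifP => Hn.
  move/eqP: Hn => ->; rewrite (_ : INR 0 = 0) // /Rdiv Rmult_0_l Rmult_0_r Cmult_0_r Cexp_0.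
  elim: (p) => [|k IH] //; rewrite [LHS]/= IH Cpow_1_l S_INR RtoC_plus //.
apply: geom_root; last first.
  by apply: Cexp_period_neq1; [rewrite lt0n; apply/negbT | rewrite ltn_mod].
rewrite Cexp_pow (_ : (INR p * (Ci * RtoC (2 * PI * (INR (n %% p) / INR p))))%C = (Ci * RtoC (INR (n %% p) * (2 * PI)))%C); first exact: Cexp_2pi.
rewrite (_ : INR (n %% p) * (2 * PI) = INR p * (2 * PI * (INR (n %% p) / INR p))); last by field; lra.
rewrite [in RHS]RtoC_mult; ring.
Qed.

Lemma cser_csum (u : nat -> nat -> C) (l : nat -> C) p :
  (forall j, (j < p)%N -> cser (u j) (l j)) ->
  cser (fun n => csum (fun j => u j n) p) (csum l p).
Proof.
elim: p => [|p IH] H /=.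
  move=> e He; exists 0%N => n _.
  suff -> : csum (fun=> RtoC 0) n = RtoC 0 by rewrite Cmod_subrr.
  by elim: n => [|n E] //=; rewrite E Cplus_0_r.
apply: cser_plus; last exact: H.
by apply: IH => j Hj; apply: H; exact: leqW.
Qed.

Section HeckeRelation.
Variables (a : nat -> C) (M : R) (j : nat).
Hypothesis Ha : poly_bounded a M j.

Let f := fourier_series a.

Lemma fourier_cserT z : 0 < Im z -> cser (qterm a z) (f z).
Proof. by move=> Hz; have [] := fourier_cser Ha (leqnn _) Hz. Qed.

Lemma Im_div_nat (z : C) i p : (0 < p)%N -> Im ((z + RtoC (INR i)) / RtoC (INR p))%C = Im z / INR p.
Proof.
move=> Hp; have p0 : 0 < INR p by apply: lt_0_INR; apply/ltP.
rewrite /Cdiv -RtoC_inv; last lra.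
by rewrite im_scal_r im_plus im_RtoC Rplus_0_r.
Qed.

(** Orthogonality of the p-th roots of unity singles out the coefficients at multiples of p, and the
    recursion expresses those through [a]. The series are compared along partial sums of length a
    multiple of p. *)
Lemma fourier_hecke p (x y : C) z : (0 < p)%N -> 0 < Im z ->
  (forall l, (0 < l)%N -> a (p * l)%N = (x * a l - y * (if (p %| l)%N then a (l %/ p)%N else RtoC 0))%C) ->
  csum (fun i => f ((z + RtoC (INR i)) / RtoC (INR p))%C) p =
    (RtoC (INR p) * (x * f z - y * f (RtoC (INR p) * z)))%C.
Proof.
move=> Hp Hz H.
have p0 : 0 < INR p by apply: lt_0_INR; apply/ltP.
have pC : RtoC (INR p) <> 0%C by apply: Cmod_neq0; rewrite Cmod_R Rabs_pos_eq; lra.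
have S1 : cser (fun n => csum (fun i => qterm a ((z + RtoC (INR i)) / RtoC (INR p))%C n) p)
    (csum (fun i => f ((z + RtoC (INR i)) / RtoC (INR p))%C) p).
  apply: cser_csum => i Hi; apply: fourier_cserT.
  by rewrite Im_div_nat //; apply: Rdiv_lt_0_compat.
pose v n := (RtoC (INR p) * (a (p * n.+1)%N * Cexp (2 * PI * Ci * INR n.+1 * z)))%C.
have E1 n : csum (fun i => qterm a ((z + RtoC (INR i)) / RtoC (INR p))%C n) p =
    if (p %| n.+1)%N then v (n.+1 %/ p).-1 else RtoC 0.
  have -> k : csum (fun i => qterm a ((z + RtoC (INR i)) / RtoC (INR p))%C n) k =
    (qterm a (z / RtoC (INR p))%C n * csum (fun i => Cexp (Ci * RtoC (2 * PI * (INR n.+1 / INR p))) ^ i) k)%C.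
    elim: k => [|k IH]; first by rewrite /=; ring.
    rewrite [LHS]/= IH [in RHS]/= Cmult_plus_distr_l; congr (_ + _)%C.
    rewrite /qterm Cexp_pow -[RHS]Cmult_assoc -Cexp_add; congr (_ * Cexp _)%C.
    rewrite /Rdiv !RtoC_mult RtoC_inv; last lra.
    by field.
  rewrite root_sum //; case: ifP => [/dvdnP [q Hq]|_]; last by ring.
  have q0 : (0 < q)%N by case: q Hq.
  rewrite /v Hq mulnK // (prednK q0) /qterm Hq (mulnC p) Cmult_comm; congr (_ * (_ * Cexp _))%C.
  by rewrite -multE mult_INR RtoC_mult; field.
have S2 : cser v (csum (fun i => f ((z + RtoC (INR i)) / RtoC (INR p))%C) p).
  move=> e He; have [n0 Hn0] := S1 e He.
  exists n0 => n Hn; have := Hn0 (n * p)%N.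
  rewrite (_ : csum _ (n * p)%N = csum v n); first by apply; apply/leP; apply: leq_trans (leq_pmulr _ Hp); apply/leP.
  have -> : csum v n = csum v ((n * p) %/ p)%N by rewrite mulnK.
  rewrite -csum_dilate //; elim: (n * p)%N => [|k IH] //=; by rewrite IH E1.
have Hpz : 0 < Im (RtoC (INR p) * z) by rewrite im_scal_l; apply: Rmult_lt_0_compat.
have S3 := @cser_scal x _ _ (fourier_cserT Hz).
have S4 : cser (fun n => if (p %| n.+1)%N then qterm a (RtoC (INR p) * z) (n.+1 %/ p).-1 else 0%C) (f (RtoC (INR p) * z)).
  move=> e He; have [n0 Hn0] := fourier_cserT Hpz He.
  exists (n0 * p)%N => n Hn; rewrite csum_dilate //; apply: Hn0.
  by apply/leP; rewrite leq_divRL //; apply/leP.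
have S5 := @cser_scal (RtoC (INR p)) _ _ (cser_minus S3 (@cser_scal y _ _ S4)).
apply: (cser_unique S2); apply: cser_ext S5 => n.
rewrite /v H //; case: ifP => [/dvdnP [q Hq]|_]; last by rewrite /qterm; ring.
have q0 : (0 < q)%N by case: q Hq.
rewrite Hq mulnK // /qterm (prednK q0) -Hq.
have -> : (2 * PI * Ci * INR q * (RtoC (INR p) * z) = 2 * PI * Ci * INR n.+1 * z)%C.
  by rewrite Hq -multE mult_INR RtoC_mult; ring.
ring.
Qed.
End HeckeRelation.

(** * Levels 20 and 24 *)

Definition smul (l : R) (A : M2) : M2 := mk (l * e11 A) (l * e12 A) (l * e21 A) (l * e22 A).

Ltac m2eq := rewrite /smul /mmul /=; f_equal; (lra || (field; lra) || idtac).

(** [true] stands for -1, so that exclusive or multiplies signs and a character of order 2 can be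
    written as a parity. *)
Definition sg (b : bool) : C := if b then RtoC (-1) else RtoC 1.

Lemma sg_mul b c : (sg b * sg c)%C = sg (b (+) c).
Proof. by case: b; case: c; rewrite /sg /= -RtoC_mult; congr RtoC; ring. Qed.

Lemma lincomb (a b c x y : C) : a = b -> (x - y = c * (a - b))%C -> x = y.
Proof.
move=> -> E; have -> : x = (x - y + y)%C by ring.
by rewrite E; ring.
Qed.

Section Action.
Variables (m : nat) (f : C -> C).
Hypothesis Hf : holH f.

Definition fixes (g : M2) (b : bool) : Prop :=
  0 < det g /\ forall z, 0 < Im z -> sl m g f z = (sg b * f z)%C.

Lemma sl_smul l A F z : l <> 0 -> 0 < det A -> 0 < Im z -> sl m (smul l A) F z = sl m A F z.
Proof. exact: sl_scalar. Qed.

Lemma det_smul l A : det (smul l A) = l * l * det A.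
Proof. by rewrite /det /smul /=; ring. Qed.

(** Matrices count only up to a scalar [l], so every use of an element that fixes f up to sign comes
    down to an identity between four real entries. *)
Lemma act_left g b A B l z : fixes g b -> 0 < Im z -> 0 < det A -> 0 < det B -> l <> 0 ->
  smul l A = mmul g B -> sl m A f z = (sg b * sl m B f z)%C.
Proof.
move=> [Hg H] Hz HA HB Hl E.
rewrite -(sl_smul f Hl HA Hz) E sl_mul // -sl_scal.
by apply: sl_ext.
Qed.

Lemma act_eq A B l F z : 0 < Im z -> 0 < det A -> l <> 0 -> smul l A = B ->
  sl m B F z = sl m A F z.
Proof. by move=> Hz HA Hl <-; rewrite sl_smul. Qed.

Lemma sl_one F z : sl m (mk 1 0 0 1) F z = F z.
Proof.
rewrite /sl /mob /jfac /det /= (_ : 1 * 1 - 0 * 0 = 1); last by ring.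
rewrite (_ : (0 * z + 1)%C = 1%C); last by ring.
rewrite !Cpow_1_l (_ : ((1 * z + 0) / 1)%C = z); last by field.
by field.
Qed.

Lemma fixes_mul g h A b c l : fixes g b -> fixes h c -> l <> 0 -> smul l A = mmul g h ->
  fixes A (b (+) c).
Proof.
move=> Hg Hh Hl E.
have HA : 0 < det A.
  have := det_smul l A; rewrite E det_mmul.
  have P := Rmult_lt_0_compat _ _ (proj1 Hg) (proj1 Hh).
  have L : 0 < l * l by nra.
  move=> X; apply: (Rmult_lt_reg_l (l * l)) => //; lra.
split=> // z Hz.
by rewrite (act_left Hg Hz HA (proj1 Hh) Hl E) (proj2 Hh) // Cmult_assoc sg_mul.
Qed.

Lemma fixes_cancel g B A b c l : fixes g b -> fixes B c -> 0 < det A -> l <> 0 ->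
  smul l B = mmul g A -> fixes A (b (+) c).
Proof.
move=> Hg HB HA Hl E; split=> // z Hz.
have H := act_left Hg Hz (proj1 HB) HA Hl E.
rewrite (proj2 HB) // in H.
by rewrite -sg_mul -Cmult_assoc H Cmult_assoc sg_mul addbb /= Cmult_1_l.
Qed.

Lemma fixes_one : fixes (mk 1 0 0 1) false.
Proof. split; first by rewrite /det /=; lra. by move=> z Hz; rewrite sl_one Cmult_1_l. Qed.

Lemma fixes_inv g A b l : fixes g b -> 0 < det A -> l <> 0 ->
  smul l (mk 1 0 0 1) = mmul g A -> fixes A b.
Proof.
by move=> Hg HA Hl E; have := fixes_cancel Hg fixes_one HA Hl E; rewrite addbF.
Qed.

(* The hypothesis says that [u = f|A - f] satisfies [u|X = u] or [u|X = - u] with [X] elliptic of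
   infinite order. *)
Lemma elliptic_fixes (A X : M2) (b : bool) (p q l : Z) : (0 < m)%N ->
  0 < det A -> 0 < e21 X -> 0 < det X -> (e11 X + e22 X) * (e11 X + e22 X) < 4 * det X ->
  (1 < l)%Z -> (l | q)%Z -> (l | p + 1)%Z -> (0 < q)%Z ->
  IZR q * ((e11 X + e22 X) * (e11 X + e22 X) - 2 * det X) = IZR p * det X ->
  (forall z, 0 < Im z -> (sl m (mmul A X) f z - sl m X f z = sg b * (sl m A f z - f z))%C) ->
  fixes A false.
Proof.
move=> Hm HA Hc Hd Ht Hl Hlq Hlp Hq E H; split=> // z Hz.
have Z : (sl m A f z + (-1) * f z)%C = 0%C.
  apply: (@elliptic_zero X Hc Ht (fun w => sl m A f w + (-1) * f w)%C m (sg b)) => //.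
  - by rewrite sg_mul addbb.
  - move=> w Hw; have [d1 D1] := sl_hol m HA Hf Hw; have [d2 D2] := Hf Hw.
    by eexists; apply: cderiv_plus D1 _; apply: cderiv_scal; exact: D2.
  - exact: (ell_zeta_root Hd Ht Hl Hlq Hlp Hq E).
  - move=> w Hw; rewrite sl_plus sl_scal -(sl_mul m f HA Hd Hw).
    have := H w Hw => K.
    have -> : (sl m (mmul A X) f w + -1 * sl m X f w = sl m (mmul A X) f w - sl m X f w)%C by ring.
    by rewrite K; ring.
have -> : sl m A f z = (sl m A f z + -1 * f z + f z)%C by ring.
by rewrite Z /sg; ring.
Qed.

Lemma fixes_eq g b b' : b = b' -> fixes g b -> fixes g b'.
Proof. by move=> ->. Qed.

End Action.

Ltac dpos := by rewrite /det /=; lra.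
Ltac side := first [dpos | lra | by m2eq].

Section Level20.
Variables (m : nat) (f : C -> C) (lam : C).
Hypothesis Hm : (0 < m)%N.
Hypothesis Hf : holH f.
Let fx := fixes m f.
Hypothesis HT : fx (mk 1 (/ 2) 0 1) true.
Hypothesis HW : fx (mk 0 (-1) 20 0) false.
Hypothesis H3 : forall z, 0 < Im z ->
  (sl m (mk 1 0 0 3) f z + sl m (mk 1 1 0 3) f z + sl m (mk 1 2 0 3) f z + sl m (mk 3 0 0 1) f z
    = lam * f z)%C.

Lemma Ti20 : fx (mk 1 (- / 2) 0 1) true.
Proof. apply: (fixes_inv (l := 1) HT); side. Qed.

(** W L = T^(-1) W: the matrix is the conjugate of T^(-1) by W and inherits its sign. *)
Lemma L20 : fx (mk 1 0 10 1) true.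
Proof.
have H := fixes_mul (A := mk (-10) (-1) 20 0) (l := 1) Ti20 HW ltac:(lra) ltac:(m2eq).
apply: (fixes_cancel (l := 1) HW H); side.
Qed.

Lemma Li20 : fx (mk 1 0 (-10) 1) true.
Proof. apply: (fixes_inv (l := 1) L20); side. Qed.

(* The relation [H3] minus its conjugate by [W]: the terms with [b = 0] cancel. *)
Lemma rel20 z : 0 < Im z ->
  (sl m (mk 1 (/ 2) 0 3) f z + sl m (mk 1 (- / 2) 0 3) f z =
   sl m (mk 3 0 (-10) 1) f z + sl m (mk 3 0 10 1) f z)%C.
Proof.
have R w : 0 < Im w -> (sl m (mk 1 0 0 3) f w + (-1) * sl m (mk 1 (/ 2) 0 3) f w
    + (-1) * sl m (mk 1 (- / 2) 0 3) f w + sl m (mk 3 0 0 1) f w = lam * f w)%C.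
  move=> Hw; rewrite -(H3 Hw).
  rewrite (act_left (A := mk 1 1 0 3) (B := mk 1 (- / 2) 0 3) (l := 1) HT Hw); try side.
  have T2 := fixes_mul (A := mk 1 1 0 1) (l := 1) HT HT ltac:(lra) ltac:(m2eq).
  rewrite (act_left (A := mk 1 2 0 3) (B := mk 1 (-1) 0 3) (l := 1) T2 Hw); try side.
  rewrite (act_left (A := mk 1 (-1) 0 3) (B := mk 1 (/ 2) 0 3) (l := 1) Ti20 Hw); try side.
move=> Hz.
have W w : 0 < Im w -> (sl m (mk 3 0 0 1) f w + (-1) * sl m (mk 3 0 (-10) 1) f w
    + (-1) * sl m (mk 3 0 10 1) f w + sl m (mk 1 0 0 3) f w = lam * f w)%C.
  move=> Hw.
  have dW : 0 < det (mk 0 (-1) 20 0) by dpos.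
  have := sl_ext m dW Hw R.
  rewrite !(sl_plus, sl_scal) -!sl_mul //; try dpos.
  rewrite (proj2 HW) // [sg _]/=.
  rewrite (act_left (A := mmul (mk 1 0 0 3) _) (B := mk 3 0 0 1) (l := 1) HW Hw); try side.
  rewrite (act_left (A := mmul (mk 1 (/ 2) 0 3) _) (B := mk 3 0 (-10) 1) (l := 1) HW Hw); try side.
  rewrite (act_left (A := mmul (mk 1 (- / 2) 0 3) _) (B := mk 3 0 10 1) (l := 1) HW Hw); try side.
  rewrite (act_left (A := mmul (mk 3 0 0 1) _) (B := mk 1 0 0 3) (l := 1) HW Hw); try side.
  by rewrite /sg /= !Cmult_1_l => ->.
have X := W z Hz; rewrite -(R z Hz) in X.
have Y : forall A B b1 b2 d1 d2 : C, (A + -1 * d1 + -1 * d2 + B = B + -1 * b1 + -1 * b2 + A)%C -> (b1 + b2 = d1 + d2)%C.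
  move=> A B b1 b2 d1 d2 E.
  have -> : (b1 + b2 = A + B - (B + -1 * b1 + -1 * b2 + A))%C by ring.
  by rewrite -E; ring.
exact: Y X.
Qed.

(** Translating [rel20] by (1 0; 10 3) makes one term on the left f|gamma and one on the right f;
    with X = (-10, -3/2; 30, 0), W and L turn the other two into f|(gamma X) and f|X. Hence u =
    f|gamma - f satisfies u|X = -u. X has trace -10 and determinant 45, so zeta + 1/zeta = 100/45 -
    2 = 2/9, and the congruences hold modulo 3. *)
Lemma gamma20 : fx (mk 2 (/ 2) 10 3) false.
Proof.
apply: (@elliptic_fixes m f Hf _ (mk (-10) (- (3 / 2)) 30 0) true 2 9 3); rewrite ?/det /=; try exact: Hm; try lra; try lia;
  try by [exists 3%Z | exists 1%Z].
move=> z Hz.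
have dD : 0 < det (mk 1 0 10 3) by dpos.
have := sl_ext m dD Hz rel20.
rewrite !(sl_plus, sl_scal) -!sl_mul //; try dpos.
rewrite (act_eq m (A := mk 2 (/ 2) 10 3) (l := 3) (B := mmul (mk 1 (/ 2) 0 3) _) f Hz); try side.
rewrite (act_eq m (A := mk 1 0 0 1) (l := 3) (B := mmul (mk 3 0 (-10) 1) _) f Hz); try side.
rewrite sl_one.
set E := mk (-4) (- (3 / 2)) 30 9.
rewrite (act_eq m (A := E) (l := 1) (B := mmul (mk 1 (- / 2) 0 3) _) f Hz); try side.
rewrite (act_left (A := mmul (mk 3 0 10 1) _) (B := mk (-10) (- (3 / 2)) 30 0) (l := -10) HW Hz); try side.
set X := mk (-10) _ _ _.
rewrite (act_left (A := E) (B := mk (-4) (- (3 / 2)) (-10) (-6)) (l := 1) Li20 Hz); try (rewrite /E; side).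
rewrite (act_left (A := mk (-4) (- (3 / 2)) (-10) (-6)) (B := mk (-5) (-3) 40 15) (l := 10) HW Hz); try side.
rewrite (act_left (A := mmul (mk 2 _ _ _) X) (B := mk (-5) (-3) 40 15) (l := 1) L20 Hz); try (rewrite /X; side).
rewrite /sg => H; apply: (lincomb (c := 1%C) H); ring.
Qed.
End Level20.

(* The matrix [[a, b], [K c, d]] of determinant 1, conjugated by the dilation [z |-> 2 z]. *)
Definition hmat (K a b c d : Z) : M2 := mk (IZR a) (IZR b / 2) (2 * IZR K * IZR c) (IZR d).

Ltac Zm2eq := rewrite /smul /mmul /hmat; cbn [e11 e12 e21 e22]; rewrite ?(plus_IZR, minus_IZR, mult_IZR, opp_IZR); f_equal; field.

Section Descent.
Variables (m : nat) (f : C -> C) (K : Z).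
Hypothesis HT : fixes m f (mk 1 (/ 2) 0 1) true.

Lemma fixes_T b : fixes m f (hmat K 1 b 0 1) (Z.odd b).
Proof.
have HP : forall n, fixes m f (hmat K 1 (Z.of_nat n) 0 1) (Z.odd (Z.of_nat n)).
  elim=> [|n IH].
    have -> : hmat K 1 (Z.of_nat 0) 0 1 = mk 1 0 0 1 by rewrite /hmat /=; f_equal; lra.
    exact: fixes_one.
  apply: (fixes_eq _ (fixes_mul (l := 1) IH HT _ _)); last first.
  - rewrite Nat2Z.inj_succ -Z.add_1_r; Zm2eq.
  - lra.
  - by rewrite Nat2Z.inj_succ Z.odd_succ -Z.negb_odd addbT.
have [n [E|E]] : exists n, b = Z.of_nat n \/ b = (- Z.of_nat n)%Z by exists (Z.abs_nat b); lia.
  by rewrite E.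
rewrite E Z.odd_opp; apply: (fixes_inv (l := 1) (HP n)).
- by rewrite /det /hmat /=; lra.
- lra.
- Zm2eq.
Qed.

Lemma fixes_upper a b d s : (a * d = 1)%Z -> s = Z.odd b -> fixes m f (hmat K a b 0 d) s.
Proof.
move=> E ->.
have [[-> ->]|[-> ->]] : (a = 1 /\ d = 1)%Z \/ (a = -1 /\ d = -1)%Z.
  by have := @Z.eq_mul_1 a d; lia.
  exact: fixes_T.
rewrite -(Z.odd_opp b) -[Z.odd _](addbF _).
apply: (fixes_mul (l := -1) (fixes_T _) (fixes_one m f)); first lra.
by rewrite /smul /mmul /hmat; cbn [e11 e12 e21 e22]; rewrite opp_IZR; f_equal; field.
Qed.

(** The new entries are those of (a b; K c d) times the inverse (s, -q; -K r, p), with K divided out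
    of the lower left one. *)
Lemma hmat_step p q r s t a b c d u v : fixes m f (hmat K p q r s) t ->
  (p * s - K * q * r = 1)%Z -> (a * d - K * b * c = 1)%Z -> v = u (+) t ->
  (((a * s - K * b * r) * (d * p - K * c * q) - K * (b * p - a * q) * (c * s - d * r) = 1)%Z ->
    fixes m f (hmat K (a * s - K * b * r) (b * p - a * q) (c * s - d * r) (d * p - K * c * q)) u) ->
  fixes m f (hmat K a b c d) v.
Proof.
move=> H E E' -> IH.
apply: (fixes_mul (l := 1) (IH _) H).
- have -> : 1%Z = ((p * s - K * q * r) * (a * d - K * b * c))%Z by rewrite E E'; lia.
  ring.
- lra.
- have X : IZR p * IZR s - IZR K * IZR q * IZR r = 1 by rewrite -!mult_IZR -minus_IZR E.
  rewrite /smul /mmul /hmat; cbn [e11 e12 e21 e22]; rewrite ?(plus_IZR, minus_IZR, mult_IZR, opp_IZR); f_equal.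
  + transitivity (IZR a * (IZR p * IZR s - IZR K * IZR q * IZR r)); [rewrite X; ring | field].
  + transitivity (IZR b /2 * (IZR p * IZR s - IZR K * IZR q * IZR r)); [rewrite X; ring | field].
  + transitivity (2 * IZR K * IZR c * (IZR p * IZR s - IZR K * IZR q * IZR r)); [rewrite X; ring | field].
  + transitivity (IZR d * (IZR p * IZR s - IZR K * IZR q * IZR r)); [rewrite X; ring | field].
Qed.

End Descent.

(** The sign character of SL_2(F_2), a symmetric group on three letters, on (a b; 5c d) modulo 2:
    transpositions are the elements of trace 0 other than the identity. *)
Definition sign20 (a b c d : Z) : bool := ~~ Z.odd (a + d) && (Z.odd b || Z.odd c).

Section Descent20.
Variables (m : nat) (f : C -> C).
Hypothesis HT : fixes m f (mk 1 (/ 2) 0 1) true.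
Hypothesis HW : fixes m f (mk 0 (-1) 20 0) false.
Hypothesis HL : fixes m f (mk 1 0 10 1) true.
Hypothesis HG : fixes m f (mk 2 (/ 2) 10 3) false.

Let fx a b c d := fixes m f (hmat 5 a b c d).

Lemma fixes_e20 : fx 2 1 (-1) (-2) true.
Proof.
apply: (fixes_cancel (l := 1) HL HG); last Zm2eq; last lra.
by rewrite /det /hmat /=; lra.
Qed.

Lemma fixes_e20' : fx 2 (-1) 1 (-2) true.
Proof.
have H := fixes_mul (A := mk 10 (-2) (-40) 10) (l := 1) fixes_e20 HW ltac:(lra) ltac:(Zm2eq).
apply: (fixes_cancel (l := -1) HW H); last Zm2eq; last lra.
by rewrite /det /hmat /=; lra.
Qed.

(** T replaces d by d - 5c or d + 5c, a gain when |d| > 5/2 |c|; L replaces c by c - d or c + d, a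
    gain when |d| < 2 |c|. In the remaining range the elliptic elements (2 1; -5 -2) and (2 -1; 5
    -2) reduce: for positive c, d the new row (d - 2c, 2d - 5c) has size 3c - d <= c. *)
Lemma descent20 n a b c d : (Z.abs c + Z.abs d < Z.of_nat n)%Z -> (a * d - 5 * b * c = 1)%Z ->
  fx a b c d (sign20 a b c d).
Proof.
elim: n a b c d => [|n IH] a b c d Hn E; first by lia.
have Hn' : (Z.abs c + Z.abs d <= Z.of_nat n)%Z by lia.
have P : (Z.odd a && Z.odd d) (+) (Z.odd b && Z.odd c).
  have := congr1 Z.odd E; rewrite Z.odd_sub !Z.odd_mul [Z.odd 1]/= [Z.odd 5]/= andTb.
  by case: (Z.odd a); case: (Z.odd b); case: (Z.odd c); case: (Z.odd d).
have S p q r s : sign20 a b c d = sign20 (a * s - 5 * b * r) (b * p - a * q) (c * s - d * r) (d * p - 5 * c * q)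
   (+) sign20 p q r s -> fx p q r s (sign20 p q r s) -> (p * s - 5 * q * r = 1)%Z ->
   (Z.abs (c * s - d * r) + Z.abs (d * p - 5 * c * q) < Z.abs c + Z.abs d)%Z -> fx a b c d (sign20 a b c d).
  move=> S H1 H2 H3.
  by apply: (hmat_step H1 H2 E S) => E'; apply: IH => //; lia.
have SP p q r s : (Z.odd p && Z.odd s) (+) (Z.odd q && Z.odd r) -> sign20 a b c d = sign20 (a * s - 5 * b * r) (b * p - a * q) (c * s - d * r) (d * p - 5 * c * q)
   (+) sign20 p q r s.
  rewrite /sign20 ?(Z.odd_add, Z.odd_sub, Z.odd_mul) [Z.odd 5]/= => Q; move: P Q.
  by case: (Z.odd a); case: (Z.odd b); case: (Z.odd c); case: (Z.odd d) => //;
     case: (Z.odd p); case: (Z.odd q); case: (Z.odd r); case: (Z.odd s).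
have Li : fx 1 0 (-1) 1 true.
  apply: (fixes_inv (l := 1) HL); last Zm2eq; last lra.
  by rewrite /det /hmat /=; lra.
have L : fx 1 0 1 1 true.
  rewrite /fx; have -> : hmat 5 1 0 1 1 = mk 1 0 10 1 by rewrite /hmat; f_equal; field.
  exact: HL.
have [C0|C0] := Z.eq_dec c 0.
  move: E; rewrite C0 => E.
  apply: (fixes_upper _ HT); first by lia.
  rewrite /sign20.
  have [[-> ->]|[-> ->]] : (a = 1 /\ d = 1)%Z \/ (a = -1 /\ d = -1)%Z.
    by have := @Z.eq_mul_1 a d; lia.
    by rewrite /= orbF.
  by rewrite /= orbF.
have D0 : (d <> 0)%Z by move=> D; move: E; rewrite D; lia.
have sgn : (0 < c /\ 0 < d \/ c < 0 /\ d < 0 \/ 0 < c /\ d < 0 \/ c < 0 /\ 0 < d)%Z by lia.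
have [H|H] := Z_lt_le_dec (5 * Z.abs c) (2 * Z.abs d).
  case: sgn => [Q|[Q|Q]].
  - apply: (S 1%Z 1%Z 0%Z 1%Z (SP _ _ _ _ _) (fixes_T 5 HT 1)) => //; lia.
  - apply: (S 1%Z 1%Z 0%Z 1%Z (SP _ _ _ _ _) (fixes_T 5 HT 1)) => //; lia.
  - apply: (S 1%Z (-1)%Z 0%Z 1%Z (SP _ _ _ _ _) (fixes_T 5 HT (-1))) => //; lia.
have [H1|H1] := Z_lt_le_dec (Z.abs d) (2 * Z.abs c).
  case: sgn => [Q|[Q|Q]].
  - apply: (S 1%Z 0%Z 1%Z 1%Z (SP _ _ _ _ _) L) => //; lia.
  - apply: (S 1%Z 0%Z 1%Z 1%Z (SP _ _ _ _ _) L) => //; lia.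
  - apply: (S 1%Z 0%Z (-1)%Z 1%Z (SP _ _ _ _ _) Li) => //; lia.
case: sgn => [Q|[Q|Q]].
- apply: (S 2%Z 1%Z (-1)%Z (-2)%Z (SP _ _ _ _ _) fixes_e20) => //; lia.
- apply: (S 2%Z 1%Z (-1)%Z (-2)%Z (SP _ _ _ _ _) fixes_e20) => //; lia.
- apply: (S 2%Z (-1)%Z 1%Z (-2)%Z (SP _ _ _ _ _) fixes_e20') => //; lia.
Qed.

End Descent20.

Definition Gamma0_invariant (m : nat) (N : Z) (f : C -> C) : Prop :=
  forall a b c d : Z, (a * d - b * (N * c) = 1)%Z -> forall z, 0 < Im z ->
    sl m (mk (IZR a) (IZR b) (IZR (N * c)) (IZR d)) f z = f z.

(** Gamma_0(4K) sits in the larger group as the matrices with b and c even, on which the sign is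
    trivial. *)
Lemma hmat_invariant m f K s :
  (forall a b c d, (a * d - K * b * c = 1)%Z -> fixes m f (hmat K a b c d) (s a b c d)) ->
  (forall a b c d, s a (2 * b)%Z (2 * c)%Z d = false) -> Gamma0_invariant m (4 * K) f.
Proof.
move=> H Hs a b c d E z Hz.
have -> : mk (IZR a) (IZR b) (IZR (4 * K * c)) (IZR d) = hmat K a (2 * b) (2 * c) d.
  by rewrite /hmat !mult_IZR; f_equal; field.
have [_ ->] // := H a (2 * b)%Z (2 * c)%Z d ltac:(lia).
by rewrite Hs Cmult_1_l.
Qed.

Lemma level20 (m : nat) (f : C -> C) (lam : C) : (0 < m)%N -> holH f ->
  fixes m f (mk 1 (/ 2) 0 1) true -> fixes m f (mk 0 (-1) 20 0) false ->
  (forall z, 0 < Im z -> (sl m (mk 1 0 0 3) f z + sl m (mk 1 1 0 3) f z + sl m (mk 1 2 0 3) f z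
    + sl m (mk 3 0 0 1) f z = lam * f z)%C) ->
  Gamma0_invariant m 20 f.
Proof.
move=> Hm Hf HT HW H3; apply: (@hmat_invariant m f 5 sign20).
  move=> a b c d E.
  apply: (descent20 HT HW (L20 HT HW) (gamma20 Hm Hf HT HW H3) (n := Z.to_nat (Z.abs c + Z.abs d + 1))) => //.
  lia.
by move=> a b c d; rewrite /sign20 !Z.odd_mul /= andbF.
Qed.

Section Level24.
Variables (m : nat) (f : C -> C) (lam : C).
Hypothesis Hm : (0 < m)%N.
Hypothesis Hf : holH f.
Let fx := fixes m f.
Hypothesis HT : fx (mk 1 (/ 2) 0 1) true.
Hypothesis HW : fx (mk 0 (-1) 24 0) false.
Hypothesis H5 : forall z, 0 < Im z ->
  (sl m (mk 1 0 0 5) f z + sl m (mk 1 1 0 5) f z + sl m (mk 1 2 0 5) f z + sl m (mk 1 3 0 5) f z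
    + sl m (mk 1 4 0 5) f z + sl m (mk 5 0 0 1) f z = lam * f z)%C.

Lemma Ti24 : fx (mk 1 (- / 2) 0 1) true.
Proof. apply: (fixes_inv (l := 1) HT); side. Qed.

Lemma L24 : fx (mk 1 0 12 1) true.
Proof.
have H := fixes_mul (A := mk (-12) (-1) 24 0) (l := 1) Ti24 HW ltac:(lra) ltac:(m2eq).
apply: (fixes_cancel (l := 1) HW H); side.
Qed.

Lemma Li24 : fx (mk 1 0 (-12) 1) true.
Proof. apply: (fixes_inv (l := 1) L24); side. Qed.

(* As for [rel20]; moreover the terms with [b = 1] and [b = -1] are exchanged by [T] and [L]. *)
Lemma rel24 z : 0 < Im z ->
  (sl m (mk 1 1 0 5) f z + sl m (mk 1 (-1) 0 5) f z =
   sl m (mk 5 0 (-24) 1) f z + sl m (mk 5 0 24 1) f z)%C.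
Proof.
have R w : 0 < Im w -> (sl m (mk 1 0 0 5) f w + sl m (mk 1 1 0 5) f w
    + sl m (mk 1 (-1) 0 5) f w + (-1) * sl m (mk 1 (/ 2) 0 5) f w + (-1) * sl m (mk 1 (- / 2) 0 5) f w
    + sl m (mk 5 0 0 1) f w = lam * f w)%C.
  move=> Hw.
  have A2 := act_left (A := mk 1 2 0 5) (B := mk 1 (- / 2) 0 5) (l := 1) HT Hw ltac:(dpos) ltac:(dpos) ltac:(lra) ltac:(m2eq).
  have A3 := act_left (A := mk 1 3 0 5) (B := mk 1 (/ 2) 0 5) (l := 1) HT Hw ltac:(dpos) ltac:(dpos) ltac:(lra) ltac:(m2eq).
  have A4 := act_left (A := mk 1 4 0 5) (B := mk 1 (3 / 2) 0 5) (l := 1) HT Hw ltac:(dpos) ltac:(dpos) ltac:(lra) ltac:(m2eq).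
  have A5 := act_left (A := mk 1 (3 / 2) 0 5) (B := mk 1 (-1) 0 5) (l := 1) HT Hw ltac:(dpos) ltac:(dpos) ltac:(lra) ltac:(m2eq).
  rewrite -(H5 Hw) A2 A3 A4 A5 /sg; ring.
move=> Hz.
have W w : 0 < Im w -> (sl m (mk 5 0 0 1) f w + sl m (mk 5 0 (-24) 1) f w
    + sl m (mk 5 0 24 1) f w + (-1) * sl m (mk 5 0 (-12) 1) f w + (-1) * sl m (mk 5 0 12 1) f w
    + sl m (mk 1 0 0 5) f w = lam * f w)%C.
  move=> Hw.
  have dW : 0 < det (mk 0 (-1) 24 0) by dpos.
  have := sl_ext m dW Hw R.
  rewrite !(sl_plus, sl_scal) -!sl_mul //; try dpos.
  rewrite (proj2 HW) // [sg _]/=.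
  rewrite (act_left (A := mmul (mk 1 0 0 5) _) (B := mk 5 0 0 1) (l := 1) HW Hw); try side.
  rewrite (act_left (A := mmul (mk 1 1 0 5) _) (B := mk 5 0 (-24) 1) (l := 1) HW Hw); try side.
  rewrite (act_left (A := mmul (mk 1 (-1) 0 5) _) (B := mk 5 0 24 1) (l := 1) HW Hw); try side.
  rewrite (act_left (A := mmul (mk 1 (/ 2) 0 5) _) (B := mk 5 0 (-12) 1) (l := 1) HW Hw); try side.
  rewrite (act_left (A := mmul (mk 1 (- / 2) 0 5) _) (B := mk 5 0 12 1) (l := 1) HW Hw); try side.
  rewrite (act_left (A := mmul (mk 5 0 0 1) _) (B := mk 1 0 0 5) (l := 1) HW Hw); try side.
  by rewrite /sg !Cmult_1_l => ->.
have E1 := act_left (A := mk 1 (- / 2) 0 5) (B := mk (-1) (/ 2) (-12) 1) (l := -1) Li24 Hz ltac:(dpos) ltac:(dpos) ltac:(lra) ltac:(m2eq).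
have E2 := act_left (A := mk (-1) (/ 2) (-12) 1) (B := mk 5 0 (-12) 1) (l := 1) HT Hz ltac:(dpos) ltac:(dpos) ltac:(lra) ltac:(m2eq).
have E3 := act_left (A := mk 1 (/ 2) 0 5) (B := mk (-1) (- / 2) 12 1) (l := -1) L24 Hz ltac:(dpos) ltac:(dpos) ltac:(lra) ltac:(m2eq).
have E4 := act_left (A := mk (-1) (- / 2) 12 1) (B := mk 5 0 12 1) (l := 1) Ti24 Hz ltac:(dpos) ltac:(dpos) ltac:(lra) ltac:(m2eq).
have X := W z Hz; rewrite -(R z Hz) E1 E2 E3 E4 /sg in X.
apply: (lincomb (c := (- (1))%C) X); ring.
Qed.

(** Translating [rel24] by (1 0; 24 5) gives f|gamma + f|X = f + f|(gamma X) with X = (-23 -5; 120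
    25), so u = f|gamma - f satisfies u|X = u. X has trace 2 and determinant 25, so zeta + 1/zeta =
    -46/25, and the congruences hold modulo 5. *)
Lemma gamma24 : fx (mk 5 1 24 5) false.
Proof.
apply: (@elliptic_fixes m f Hf _ (mk (-23) (-5) 120 25) false (-46) 25 5); rewrite ?/det /=;
  try exact: Hm; try lra; try lia; try by [exists 5%Z | exists (-9)%Z].
move=> z Hz.
have dD : 0 < det (mk 1 0 24 5) by dpos.
have := sl_ext m dD Hz rel24.
rewrite !(sl_plus, sl_scal) -!sl_mul //; try dpos.
rewrite (act_eq m (A := mk 5 1 24 5) (l := 5) (B := mmul (mk 1 1 0 5) _) f Hz); try side.
rewrite (act_eq m (A := mk 1 0 0 1) (l := 5) (B := mmul (mk 5 0 (-24) 1) _) f Hz); try side.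
rewrite sl_one.
rewrite (act_eq m (A := mk (-23) (-5) 120 25) (l := 1) (B := mmul (mk 1 (-1) 0 5) _) f Hz); try side.
rewrite (act_eq m (A := mmul (mk 5 1 24 5) (mk (-23) (-5) 120 25)) (l := 1) (B := mmul (mk 5 0 24 1) _) f Hz); try side.
rewrite /sg => H; apply: (lincomb (c := (- (1))%C) H); ring.
Qed.

(** As 6 is even, a and d are odd and the parity of b + c is multiplicative. T reduces when |d| > 3
    |c| and L when |d| < 2 |c|; between, [gamma24] or its inverse does. At the end points |d| = 2|c|
    and |d| = 3|c| the size would stay the same, but there the determinant would be divisible by 2,
    resp. 3. *)
Lemma descent24 n a b c d : (Z.abs c + Z.abs d < Z.of_nat n)%Z -> (a * d - 6 * b * c = 1)%Z ->
  fx (hmat 6 a b c d) (Z.odd (b + c)).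
Proof.
elim: n a b c d => [|n IH] a b c d Hn E; first by lia.
have P : Z.odd a && Z.odd d.
  have := congr1 Z.odd E; rewrite Z.odd_sub !Z.odd_mul [Z.odd 1]/= [Z.odd 6]/= andFb.
  by case: (Z.odd a); case: (Z.odd d).
have S p q r s : fx (hmat 6 p q r s) (Z.odd (q + r)) -> Z.odd p && Z.odd s -> (p * s - 6 * q * r = 1)%Z ->
   (Z.abs (c * s - d * r) + Z.abs (d * p - 6 * c * q) < Z.abs c + Z.abs d)%Z ->
   fx (hmat 6 a b c d) (Z.odd (b + c)).
  move=> H1 Q H2 H3.
  apply: (hmat_step H1 H2 E _ (IH _ _ _ _ _)); last by lia.
  rewrite ?(Z.odd_add, Z.odd_sub, Z.odd_mul); move: P Q.
  by case: (Z.odd a); case: (Z.odd b); case: (Z.odd c); case: (Z.odd d) => //;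
     case: (Z.odd p); case: (Z.odd q); case: (Z.odd r); case: (Z.odd s).
have L : fx (hmat 6 1 0 1 1) true.
  have -> : hmat 6 1 0 1 1 = mk 1 0 12 1 by rewrite /hmat; f_equal; field.
  exact: L24.
have Li : fx (hmat 6 1 0 (-1) 1) true.
  have -> : hmat 6 1 0 (-1) 1 = mk 1 0 (-12) 1 by rewrite /hmat; f_equal; field.
  exact: Li24.
have G : fx (hmat 6 5 2 2 5) false.
  have -> : hmat 6 5 2 2 5 = mk 5 1 24 5 by rewrite /hmat; f_equal; field.
  exact: gamma24.
have Gi : fx (hmat 6 5 (-2) (-2) 5) false.
  have -> : hmat 6 5 (-2) (-2) 5 = mk 5 (-1) (-24) 5 by rewrite /hmat; f_equal; field.
  by apply: (fixes_inv (l := 1) gamma24); side.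
have [C0|C0] := Z.eq_dec c 0.
  move: E; rewrite C0 => E.
  apply: (fixes_upper _ HT); first by lia.
  by rewrite Z.add_0_r.
have D0 : (d <> 0)%Z by move=> D; move: E; rewrite D; lia.
have D2 : (d <> 2 * c)%Z by move=> D; move: E; rewrite D; lia.
have D2' : (d <> - 2 * c)%Z by move=> D; move: E; rewrite D; lia.
have D3 : (d <> 3 * c)%Z by move=> D; move: E; rewrite D; lia.
have D3' : (d <> - 3 * c)%Z by move=> D; move: E; rewrite D; lia.
have sgn : ((0 < c /\ 0 < d \/ c < 0 /\ d < 0) \/ (0 < c /\ d < 0 \/ c < 0 /\ 0 < d))%Z by lia.
have [H|H] := Z_lt_le_dec (3 * Z.abs c) (Z.abs d).
  case: sgn => Q.
  - apply: (S 1%Z 1%Z 0%Z 1%Z (fixes_T 6 HT 1)) => //; lia.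
  - apply: (S 1%Z (-1)%Z 0%Z 1%Z (fixes_T 6 HT (-1))) => //; lia.
have [H1|H1] := Z_lt_le_dec (Z.abs d) (2 * Z.abs c).
  case: sgn => Q.
  - apply: (S 1%Z 0%Z 1%Z 1%Z L) => //; lia.
  - apply: (S 1%Z 0%Z (-1)%Z 1%Z Li) => //; lia.
case: sgn => Q.
- apply: (S 5%Z 2%Z 2%Z 5%Z G) => //; lia.
- apply: (S 5%Z (-2)%Z (-2)%Z 5%Z Gi) => //; lia.
Qed.

Lemma level24 : Gamma0_invariant m 24 f.
Proof.
apply: (@hmat_invariant m f 6 (fun _ b c _ => Z.odd (b + c))).
  move=> a b c d E.
  apply: (descent24 (n := Z.to_nat (Z.abs c + Z.abs d + 1))) => //; lia.
by move=> a b c d; rewrite Z.odd_add !Z.odd_mul.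
Qed.

End Level24.

(** * Level 18 *)

Section Level18.
Variables (m : nat) (f : C -> C).
Hypothesis Hf : holH f.
Let fx := fixes m f.
Let v (A : M2) : C -> C := sl m A f.
Let T := mk 1 (/ 3) 0 1.
Let T2 := mk 1 (2 / 3) 0 1.
Let L := mk 1 0 6 1.
Let e := mk 1 (- / 3) 6 (-1).
Let W := mk 0 (-1) 18 0.
Hypothesis HT1 : fx (mk 1 1 0 1) false.
Hypothesis HT : forall z, 0 < Im z -> (f z + v T z + v T2 z = 0)%C.
Hypothesis HW : fx W false.
Hypothesis H2 : forall z, 0 < Im z -> (v (mk 1 0 0 2) z + v (mk 1 1 0 2) z = f z)%C.

Lemma relation_mul c1 c2 c3 A1 A2 A3 g B1 l1 B2 l2 B3 l3 z : 0 < Im z ->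
  (forall w, 0 < Im w -> c1 * v A1 w + c2 * v A2 w + c3 * v A3 w = 0)%C ->
  0 < det A1 -> 0 < det A2 -> 0 < det A3 -> 0 < det g ->
  l1 <> 0 -> l2 <> 0 -> l3 <> 0 -> 0 < det B1 -> 0 < det B2 -> 0 < det B3 ->
  smul l1 B1 = mmul A1 g -> smul l2 B2 = mmul A2 g -> smul l3 B3 = mmul A3 g ->
  (c1 * v B1 z + c2 * v B2 z + c3 * v B3 z = 0)%C.
Proof.
move=> Hz H D1 D2 D3 Dg L1 L2 L3 P1 P2 P3 E1 E2 E3.
rewrite /v -(sl_smul m f L1 P1 Hz) -(sl_smul m f L2 P2 Hz) -(sl_smul m f L3 P3 Hz) E1 E2 E3.
rewrite !sl_mul // -!sl_scal -!sl_plus.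
rewrite (sl_ext m (G := fun=> RtoC 0) Dg Hz H) /sl; ring.
Qed.

(** Two translates of the relation at 2, the second rewritten with W, contain f|(2 -1; 0 1) and f|(1
    -1/2; 0 1) with opposite signs. In their sum only f + f|Q survives. *)
Lemma fixes_Q : fx (mk (-3) (5 / 3) (-6) 3) true.
Proof.
have U z : 0 < Im z -> (1 * v (mk 1 0 0 2) z + 1 * v (mk 1 1 0 2) z + -1 * v (mk 1 0 0 1) z = 0)%C.
  by move=> Hz; rewrite /v sl_one -(H2 Hz) /v; ring.
split; first by dpos.
move=> z Hz.
have A : (1 * v (mk 1 (- / 2) 0 1) z + 1 * v (mk 1 0 0 1) z + -1 * v (mk 2 (-1) 0 1) z = 0)%C.
  apply: (relation_mul (g := mk 2 (-1) 0 1) (l1 := 2) (l2 := 2) (l3 := 1) Hz U); side.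
have B : (1 * v (mk 0 (-1) 36 (-18)) z + 1 * v (mk 18 (-10) 36 (-18)) z + -1 * v (mk 0 (-1) 18 (-9)) z = 0)%C.
  apply: (relation_mul (g := mk 0 (-1) 18 (-9)) (l1 := 1) (l2 := 1) (l3 := 1) Hz U); side.
have E1 := act_left (A := mk 0 (-1) 36 (-18)) (B := mk 2 (-1) 0 1) (l := 1) HW Hz ltac:(dpos) ltac:(dpos) ltac:(lra) ltac:(m2eq).
have E2 := act_left (A := mk 18 (-10) 36 (-18)) (B := mk 2 (-1) (-18) 10) (l := 1) HW Hz ltac:(dpos) ltac:(dpos) ltac:(lra) ltac:(m2eq).
have E3 := act_left (A := mk 0 (-1) 18 (-9)) (B := mk 1 (- / 2) 0 1) (l := 1) HW Hz ltac:(dpos) ltac:(dpos) ltac:(lra) ltac:(m2eq).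
have E4 := act_left (A := mk 2 (-1) (-18) 10) (B := mk (-3) (5 / 3) (-6) 3) (l := 3) HW Hz ltac:(dpos) ltac:(dpos) ltac:(lra) ltac:(m2eq).
rewrite /v E1 E2 E3 E4 -[f z](sl_one m f z) in B *.
have -> : forall x : C, (sg true * x = - x)%C by move=> x; rewrite /sg; ring.
have D : (sl m (mk (-3) (5 / 3) (-6) 3) f z + sl m (mk 1 0 0 1) f z = 0)%C.
  rewrite -[RHS](Cplus_0_r 0) -{1}A -B /v /sg; ring.
by apply: (lincomb (c := 1%C) D); ring.
Qed.

Lemma act_Te z : 0 < Im z -> v (mk 3 (- (2 / 3)) 6 (-1)) z = (- v T z)%C.
Proof.
move=> Hz; rewrite /v /T (act_left (B := mk 1 (/ 3) 0 1) (l := -1) fixes_Q Hz); try side.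
Qed.

Lemma T_relation z : 0 < Im z -> (1 * v (mk 1 0 0 1) z + 1 * v T z + 1 * v T2 z = 0)%C.
Proof. by move=> Hz; rewrite {1}/v sl_one -(HT Hz); ring. Qed.

Lemma act_T2e z : 0 < Im z -> v (mk 5 (-1) 6 (-1)) z = (v T z - v e z)%C.
Proof.
move=> Hz.
have A : (1 * v e z + 1 * v (mk 3 (- (2 / 3)) 6 (-1)) z + 1 * v (mk 5 (-1) 6 (-1)) z = 0)%C.
  by apply: (relation_mul (g := e) (l1 := 1) (l2 := 1) (l3 := 1) Hz T_relation); rewrite ?/e ?/T ?/T2; side.
by rewrite act_Te // in A; apply: (lincomb (c := 1%C) A); ring.
Qed.

(** Conjugating [T_relation] by W gives f|L + f + f|L^(-1) = 0. The last term is known from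
    [act_T2e], because T^2 e is, up to sign, the translation by 1 times L^(-1). *)
Lemma act_L z : 0 < Im z -> v L z = (v e z - f z - v T z)%C.
Proof.
move=> Hz.
have A : (1 * v (mk (-6) (-1) 18 0) z + 1 * v (mk 0 (-1) 18 0) z + 1 * v (mk 6 (-1) 18 0) z = 0)%C.
  by apply: (relation_mul (g := mk (-6) (-1) 18 0) (l1 := 1) (l2 := 1) (l3 := 1) Hz T_relation); rewrite ?/T ?/T2; side.
have E1 : _ = _ := act_left (A := mk (-6) (-1) 18 0) (B := mk 1 0 6 1) (l := 1) HW Hz ltac:(dpos) ltac:(dpos) ltac:(lra) ltac:(m2eq).
have E2 := act_left (A := mk 6 (-1) 18 0) (B := mk 1 0 (-6) 1) (l := 1) HW Hz ltac:(dpos) ltac:(dpos) ltac:(lra) ltac:(m2eq).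
have E3 := act_left (A := mk 5 (-1) 6 (-1)) (B := mk 1 0 (-6) 1) (l := -1) HT1 Hz ltac:(dpos) ltac:(dpos) ltac:(lra) ltac:(m2eq).
have E4 := act_T2e Hz.
rewrite /v E1 E2 (proj2 HW z Hz) /sg in A.
rewrite {1}/v E3 /sg in E4.
have E5 : sl m (mk 1 0 (-6) 1) f z = (v T z - v e z)%C by rewrite -E4; ring.
rewrite E5 in A.
by apply: (lincomb (c := 1%C) A); rewrite /v /L; ring.
Qed.

Lemma T_action z : 0 < Im z -> sl m T f z = v T z /\ sl m T (v T) z = (- f z - v T z)%C /\
  sl m T (v e) z = (v e z - f z - v T z)%C.
Proof.
move=> Hz; split=> //; split.
  rewrite {1}/v -sl_mul //; try by rewrite /T; dpos.
  rewrite (act_eq m (A := T2) (l := 1) f Hz); try by rewrite /T2 /T; side.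
  by apply: (lincomb (c := 1%C) (HT Hz)); rewrite /v; ring.
rewrite -act_L // /v -sl_mul //; try by rewrite /T /e; dpos.
by rewrite (act_eq m (A := L) (l := 1) f Hz) // /L /T /e; side.
Qed.

Lemma L_action z : 0 < Im z -> sl m L f z = (v e z - f z - v T z)%C /\
  sl m L (v T) z = (f z + v T z)%C /\ sl m L (v e) z = v T z.
Proof.
move=> Hz; split; first exact: act_L.
split.
  rewrite {1}/v -sl_mul //; try by rewrite /T /L; dpos.
  have E := act_left (A := mmul T L) (B := T2) (l := -1) fixes_Q Hz.
  rewrite E; try by rewrite /T2 /T /L; side.
  by apply: (lincomb (c := (- (1))%C) (HT Hz)); rewrite /v /sg; ring.
rewrite /v -sl_mul //; try by rewrite /e /L; dpos.
by rewrite (act_eq m (A := T) (l := -1) f Hz) // /L /T /e; side.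
Qed.

(* The class of [y / x] in [P^1(F_3)] indexes four functions spanned by
   [f], [f|T], [f|e], which [T] and [L] permute up to a common translation. *)
Definition Psi0 (i j : Z) (z : C) : C :=
  if (i =? 0)%Z then v e z else
  match ((i * j) mod 3)%Z with
  | 0%Z => RtoC 0 | 1%Z => (f z + v T z)%C | _ => v T z
  end.

Definition Psi (x y : Z) : C -> C := Psi0 (x mod 3) (y mod 3).

(** Ensures that (x, y) is non-zero modulo 3 and so defines a point of P^1(F_3). *)
Definition unimodular (x y : Z) := (exists p q, x * p + y * q = 1)%Z.

Ltac Zval := repeat match goal with
  | |- context [Z.modulo ?a 3] => let r := eval vm_compute in (Z.modulo a 3) in change (Z.modulo a 3) with r
  | |- context [Z.eqb ?a ?b] => let r := eval vm_compute in (Z.eqb a b) in change (Z.eqb a b) with r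
  end; cbv beta iota.

Lemma Psi_T x y z : unimodular x y -> 0 < Im z ->
  sl m T (Psi x y) z = (Psi x (x + y) z - (f z + v T z))%C.
Proof.
move=> [p [q E]] Hz; have [E1 [E2 E3]] := T_action Hz.
have Hx := Z.mod_pos_bound x 3 ltac:(lia); have Hy := Z.mod_pos_bound y 3 ltac:(lia).
have Dx := Z.div_mod x 3 ltac:(lia); have Dy := Z.div_mod y 3 ltac:(lia).
rewrite /Psi Zplus_mod; move: Hx Hy Dx Dy; move: (Z.modulo x 3) (Z.modulo y 3) => i j Hi Hj Dx Dy.
have N0 : ~ (i = 0 /\ j = 0)%Z by move=> [I J]; move: E; rewrite Dx Dy I J; lia.
have [I|[I|I]] : (i = 0 \/ i = 1 \/ i = 2)%Z by lia.
all: have [J|[J|J]] : (j = 0 \/ j = 1 \/ j = 2)%Z by lia.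
all: try (by case: N0; split); rewrite ?I ?J /Psi0; Zval; rewrite ?sl_plus ?E1 ?E2 ?E3; try ring.
all: rewrite /sl; ring.
Qed.

Lemma Psi_L x y z : unimodular x y -> 0 < Im z ->
  sl m L (Psi x y) z = Psi (x + 2 * y) y z.
Proof.
move=> [p [q E]] Hz; have [E1 [E2 E3]] := L_action Hz.
have Hx := Z.mod_pos_bound x 3 ltac:(lia); have Hy := Z.mod_pos_bound y 3 ltac:(lia).
have Dx := Z.div_mod x 3 ltac:(lia); have Dy := Z.div_mod y 3 ltac:(lia).
rewrite /Psi Zplus_mod (Zmult_mod 2 y); move: Hx Hy Dx Dy; move: (Z.modulo x 3) (Z.modulo y 3) => i j Hi Hj Dx Dy.
have N0 : ~ (i = 0 /\ j = 0)%Z by move=> [I J]; move: E; rewrite Dx Dy I J; lia.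
have [I|[I|I]] : (i = 0 \/ i = 1 \/ i = 2)%Z by lia.
all: have [J|[J|J]] : (j = 0 \/ j = 1 \/ j = 2)%Z by lia.
all: try (by case: N0; split); rewrite ?I ?J /Psi0; Zval; rewrite ?sl_plus ?E1 ?E2 ?E3; try ring.
all: rewrite /sl; ring.
Qed.

Definition mat18 (a b c d : Z) : M2 := mk (IZR a) (IZR b / 3) (6 * IZR c) (IZR d).

(* [f = Psi 1 1 - Psi 1 2] and the translations cancel, so [f|M] is read off the images of the
   rows [(1, 1)] and [(1, 2)]; both classes are fixed when [M] is diagonal modulo 3. *)
Definition coset_formula (a b c d : Z) : Prop := forall z, 0 < Im z ->
  v (mat18 a b c d) z = (Psi (a + 2 * c) (b + d) z + -1 * Psi (a + 4 * c) (b + 2 * d) z)%C.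

Lemma det_mat18 a b c d : (a * d - 2 * b * c = 1)%Z -> 0 < det (mat18 a b c d).
Proof.
move=> E; rewrite (_ : det _ = IZR (a * d - 2 * b * c)); first by rewrite E; lra.
by rewrite /det /mat18 minus_IZR !mult_IZR; cbn [e11 e12 e21 e22]; field.
Qed.

Lemma sl_cancel g h F G z : 0 < det g -> 0 < det h -> mmul g h = mk 1 0 0 1 ->
  (forall w, 0 < Im w -> sl m g F w = sl m g G w) -> 0 < Im z -> F z = G z.
Proof.
move=> Dg Dh E H Hz.
by rewrite -(sl_one m F z) -(sl_one m G z) -E !sl_mul //; apply: sl_ext.
Qed.

(** Both sides are translated by T, and T acts on the right-hand side through [Psi_T]. An
    equivalence is wanted because the descent multiplies by T and by its inverse. *)
Lemma coset_formula_T a b c d : (a * d - 2 * b * c = 1)%Z -> coset_formula a b c d <-> coset_formula a (a + b) c (2 * c + d).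
Proof.
move=> E.
have U1 : unimodular (a + 2 * c) (b + d) by exists d, (- 2 * c)%Z; rewrite -E; ring.
have U2 : unimodular (a + 4 * c) (b + 2 * d) by exists d, (- 2 * c)%Z; rewrite -E; ring.
have DT : 0 < det T by rewrite /T; dpos.
have D := det_mat18 E.
have V z : 0 < Im z -> sl m T (v (mat18 a b c d)) z = v (mat18 a (a + b) c (2 * c + d)) z.
  move=> Hz; rewrite /v -sl_mul //; congr (sl m _ f z).
  by rewrite /mat18 /T /mmul; cbn [e11 e12 e21 e22]; rewrite !plus_IZR !mult_IZR; f_equal; field.
have R z : 0 < Im z -> sl m T (fun w => Psi (a + 2 * c) (b + d) w + -1 * Psi (a + 4 * c) (b + 2 * d) w)%C z =
   (Psi (a + 2 * c) (a + b + (2 * c + d)) z + -1 * Psi (a + 4 * c) (a + b + 2 * (2 * c + d)) z)%C.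
  move=> Hz; rewrite sl_plus sl_scal !Psi_T //.
  rewrite (_ : a + 2 * c + (b + d) = a + b + (2 * c + d))%Z; last by ring.
  rewrite (_ : a + 4 * c + (b + 2 * d) = a + b + 2 * (2 * c + d))%Z; last by ring.
  ring.
split=> H z Hz.
  by rewrite -V // (sl_ext m DT Hz H) R.
apply: (sl_cancel (g := T) (h := mk 1 (- / 3) 0 1) (G := fun w => Psi (a + 2 * c) (b + d) w + -1 * Psi (a + 4 * c) (b + 2 * d) w)%C) => //.
- by dpos.
- by rewrite /T; m2eq.
- by move=> w Hw; rewrite V // H // R.
Qed.

Lemma coset_formula_L a b c d : (a * d - 2 * b * c = 1)%Z -> coset_formula a b c d <-> coset_formula (a + 2 * b) b (c + d) d.
Proof.
move=> E.
have U1 : unimodular (a + 2 * c) (b + d) by exists d, (- 2 * c)%Z; rewrite -E; ring.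
have U2 : unimodular (a + 4 * c) (b + 2 * d) by exists d, (- 2 * c)%Z; rewrite -E; ring.
have DT : 0 < det L by rewrite /L; dpos.
have D := det_mat18 E.
have V z : 0 < Im z -> sl m L (v (mat18 a b c d)) z = v (mat18 (a + 2 * b) b (c + d) d) z.
  move=> Hz; rewrite /v -sl_mul //; congr (sl m _ f z).
  by rewrite /mat18 /L /mmul; cbn [e11 e12 e21 e22]; rewrite !plus_IZR !mult_IZR; f_equal; field.
have R z : 0 < Im z -> sl m L (fun w => Psi (a + 2 * c) (b + d) w + -1 * Psi (a + 4 * c) (b + 2 * d) w)%C z =
   (Psi (a + 2 * b + 2 * (c + d)) (b + d) z + -1 * Psi (a + 2 * b + 4 * (c + d)) (b + 2 * d) z)%C.
  move=> Hz; rewrite sl_plus sl_scal !Psi_L //.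
  rewrite (_ : a + 2 * c + 2 * (b + d) = a + 2 * b + 2 * (c + d))%Z; last by ring.
  rewrite (_ : a + 4 * c + 2 * (b + 2 * d) = a + 2 * b + 4 * (c + d))%Z; last by ring.
  ring.
split=> H z Hz.
  by rewrite -V // (sl_ext m DT Hz H) R.
apply: (sl_cancel (g := L) (h := mk 1 0 (-6) 1) (G := fun w => Psi (a + 2 * c) (b + d) w + -1 * Psi (a + 4 * c) (b + 2 * d) w)%C) => //.
- by dpos.
- by rewrite /L; m2eq.
- by move=> w Hw; rewrite V // H // R.
Qed.

Lemma coset_formula_one : coset_formula 1 0 0 1.
Proof.
move=> z Hz; rewrite /v (_ : mat18 1 0 0 1 = mk 1 0 0 1).
  by rewrite sl_one /Psi /Psi0; Zval; ring.
by rewrite /mat18; f_equal; field.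
Qed.

Lemma Psi_opp x y z : Psi (- x) (- y) z = Psi x y z.
Proof.
have E t : ((- t) mod 3 = (2 * (t mod 3)) mod 3)%Z.
  by rewrite Zmult_mod_idemp_r (_ : 2 * t = - t + t * 3)%Z ?Z_mod_plus_full //; ring.
rewrite /Psi !E.
have Hx := Z.mod_pos_bound x 3 ltac:(lia); have Hy := Z.mod_pos_bound y 3 ltac:(lia).
move: Hx Hy; move: (Z.modulo x 3) (Z.modulo y 3) => i j Hi Hj.
have [->|[->|->]] : (i = 0 \/ i = 1 \/ i = 2)%Z by lia.
all: have [->|[->|->]] : (j = 0 \/ j = 1 \/ j = 2)%Z by lia.
all: rewrite /Psi0; Zval => //.
Qed.

Lemma coset_formula_opp a b c d : (a * d - 2 * b * c = 1)%Z -> coset_formula a b c d -> coset_formula (- a) (- b) (- c) (- d).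
Proof.
move=> E H z Hz.
rewrite (_ : - a + 2 * - c = - (a + 2 * c))%Z; last by ring.
rewrite (_ : - a + 4 * - c = - (a + 4 * c))%Z; last by ring.
rewrite (_ : - b + - d = - (b + d))%Z; last by ring.
rewrite (_ : - b + 2 * - d = - (b + 2 * d))%Z; last by ring.
rewrite !Psi_opp -H // /v; apply: (act_eq m (l := -1) f Hz (det_mat18 E)); first by lra.
by rewrite /mat18 /smul; cbn [e11 e12 e21 e22]; rewrite !opp_IZR; f_equal; field.
Qed.

Lemma coset_formula_upper b : coset_formula 1 b 0 1.
Proof.
have HP : forall n, coset_formula 1 (Z.of_nat n) 0 1 /\ coset_formula 1 (- Z.of_nat n) 0 1.
  elim=> [|n [I1 I2]]; first by split; exact: coset_formula_one.
  rewrite Nat2Z.inj_succ -Z.add_1_r; split.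
    have := proj1 (@coset_formula_T 1 (Z.of_nat n) 0 1 ltac:(lia)) I1.
    by rewrite Z.add_comm.
  apply: (proj2 (@coset_formula_T 1 (- (Z.of_nat n + 1)) 0 1 ltac:(lia))).
  by have -> : (1 + - (Z.of_nat n + 1) = - Z.of_nat n)%Z by ring.
have [n [E|E]] : exists n, b = Z.of_nat n \/ b = (- Z.of_nat n)%Z by exists (Z.abs_nat b); lia.
  by rewrite E; have [] := HP n.
by rewrite E; have [] := HP n.
Qed.

(** With K = 2 the element T shortens d as soon as |d| > |c|, and L shortens c whenever |d| < 2 |c|,
    so the two ranges cover everything. *)
Lemma descent18 n a b c d : (Z.abs c + Z.abs d < Z.of_nat n)%Z -> (a * d - 2 * b * c = 1)%Z ->
  coset_formula a b c d.
Proof.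
elim: n a b c d => [|n IH] a b c d Hn E; first by lia.
have [C0|C0] := Z.eq_dec c 0.
  move: E; rewrite C0 => E.
  have [[-> ->]|[-> ->]] : (a = 1 /\ d = 1)%Z \/ (a = -1 /\ d = -1)%Z.
    by have := @Z.eq_mul_1 a d; lia.
    exact: coset_formula_upper.
  have := @coset_formula_opp 1 (- b) 0 1 ltac:(lia) (coset_formula_upper _).
  by rewrite Z.opp_involutive.
have D0 : (d <> 0)%Z by move=> D; move: E; rewrite D; lia.
have sgn : ((0 < c /\ 0 < d \/ c < 0 /\ d < 0) \/ (0 < c /\ d < 0 \/ c < 0 /\ 0 < d))%Z by lia.
have [H|H] := Z_lt_le_dec (Z.abs c) (Z.abs d).
  case: sgn => Q.
    have E' : (a * (d - 2 * c) - 2 * (b - a) * c = 1)%Z by rewrite -E; ring.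
    have := proj1 (coset_formula_T E') (IH a (b - a)%Z c (d - 2 * c)%Z ltac:(lia) E').
    have -> : (a + (b - a) = b)%Z by ring.
    by have -> : (2 * c + (d - 2 * c) = d)%Z by ring.
  by apply: (proj2 (coset_formula_T E)); apply: IH; lia.
case: sgn => Q.
  have E' : ((a - 2 * b) * d - 2 * b * (c - d) = 1)%Z by rewrite -E; ring.
  have := proj1 (coset_formula_L E') (IH (a - 2 * b)%Z b (c - d)%Z d ltac:(lia) E').
  have -> : (a - 2 * b + 2 * b = a)%Z by ring.
  by have -> : (c - d + d = c)%Z by ring.
by apply: (proj2 (coset_formula_L E)); apply: IH; lia.
Qed.

Lemma level18 : Gamma0_invariant m 18 f.
Proof.
move=> a b c d E z Hz.
have := @descent18 (Z.to_nat (Z.abs (3 * c) + Z.abs d + 1)) a (3 * b) (3 * c) d ltac:(lia) ltac:(lia) z Hz.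
rewrite (_ : mat18 _ _ _ _ = mk (IZR a) (IZR b) (IZR (18 * c)) (IZR d)); last first.
  by rewrite /mat18 !mult_IZR; f_equal; field.
rewrite /v => ->.
have R x y t : Psi (x + t * 3) y = Psi x y by rewrite /Psi Z_mod_plus_full.
rewrite (_ : a + 2 * (3 * c) = a + (2 * c) * 3)%Z; last by ring.
rewrite (_ : a + 4 * (3 * c) = a + (4 * c) * 3)%Z; last by ring.
rewrite !R /Psi (Z.add_comm (3 * b)) (Z.add_comm (3 * b)) (Z.mul_comm 3 b) !Z_mod_plus_full.
rewrite (Zmult_mod 2 d).
have K : ((a mod 3) * (d mod 3) mod 3 = 1)%Z.
  by rewrite -Zmult_mod (_ : a * d = 1 + (6 * b * c) * 3)%Z ?Z_mod_plus_full //; lia.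
have Hx := Z.mod_pos_bound a 3 ltac:(lia); have Hy := Z.mod_pos_bound d 3 ltac:(lia).
move: Hx Hy K; move: (Z.modulo a 3) (Z.modulo d 3) => i j Hi Hj.
have [->|[->|->]] : (i = 0 \/ i = 1 \/ i = 2)%Z by lia.
all: have [->|[->|->]] : (j = 0 \/ j = 1 \/ j = 2)%Z by lia.
all: rewrite /Psi0; Zval => // _; ring.
Qed.

End Level18.

Lemma sl_affine m (p x : R) F z : 0 < p ->
  sl m (mk 1 x 0 p) F z = (/ RtoC p ^ m * F ((z + RtoC x) / RtoC p))%C.
Proof.
move=> Hp; have P0 : RtoC p <> RtoC 0 by move=> E; have := RtoC_inj _ _ E; lra.
rewrite /sl /mob /jfac /det; cbn [e11 e12 e21 e22].
rewrite (_ : 1 * p - x * 0 = p); last by ring.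
rewrite (_ : (0 * z + p)%C = RtoC p); last by ring.
rewrite (_ : (1 * z + x)%C = (z + RtoC x)%C); last by ring.
rewrite (_ : (2 * m)%N = (m + m)%coq_nat); last by rewrite mul2n -addnn.
rewrite Cpow_add_r; congr Cmult; field; exact: Cpow_nz.
Qed.

Lemma sl_dilation m (p : R) F z :
  sl m (mk p 0 0 1) F z = (RtoC p ^ m * F (RtoC p * z))%C.
Proof.
rewrite /sl /mob /jfac /det; cbn [e11 e12 e21 e22].
rewrite (_ : p * 1 - 0 * 0 = p); last by ring.
rewrite (_ : (0 * z + 1)%C = RtoC 1); last by ring.
rewrite Cpow_1_l (_ : ((p * z + 0) / 1)%C = (RtoC p * z)%C); last by field.
by field.
Qed.

Lemma fourier_periodic a z : fourier_series a (z + 1)%C = fourier_series a z.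
Proof.
rewrite /fourier_series /CSeries.
have E n : (a n.+1 * Cexp (2 * PI * Ci * INR n.+1 * (z + 1)))%C = (a n.+1 * Cexp (2 * PI * Ci * INR n.+1 * z))%C.
  rewrite (_ : (2 * PI * Ci * INR n.+1 * (z + 1))%C = (2 * PI * Ci * INR n.+1 * z + Ci * RtoC (INR n.+1 * (2 * PI)))%C); last by rewrite !RtoC_mult; ring.
  by rewrite Cexp_add Cexp_2pi; ring.
by congr pair; apply: Series_ext => n; rewrite E.
Qed.

Section Levels.
Variables (a : nat -> C) (M : R) (j m : nat).
Hypothesis Ha : poly_bounded a M j.
Hypothesis m0 : (0 < m)%N.
Let f := fourier_series a.

Definition hecke_at (p : nat) (x y : C) : Prop := forall l, (0 < l)%N ->
  a (p * l)%N = (x * a l - y * (if (p %| l)%N then a (l %/ p)%N else RtoC 0))%C.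

Lemma hecke_sl p x y z : (0 < p)%N -> hecke_at p x y -> 0 < Im z ->
  csum (fun i => sl m (mk 1 (INR i) 0 (INR p)) f z) p =
  (RtoC (INR p) / RtoC (INR p) ^ m * (x * f z - y * f (RtoC (INR p) * z)))%C.
Proof.
move=> Hp H Hz; have P0 : 0 < INR p by apply: lt_0_INR; apply/ltP.
have P1 : RtoC (INR p) <> RtoC 0 by move=> E; have := RtoC_inj _ _ E; lra.
have S := fourier_hecke Ha Hp Hz H.
have -> : csum (fun i => sl m (mk 1 (INR i) 0 (INR p)) f z) p =
   (/ RtoC (INR p) ^ m * csum (fun i => f ((z + RtoC (INR i)) / RtoC (INR p))) p)%C.
  elim: {2 5}p => [|n IH] /=; first by ring.
  rewrite IH sl_affine //; ring.
rewrite S; have := @Cpow_nz _ m P1; rewrite -/f; move: (RtoC (INR p) ^ m)%C => q Q; field; exact: Q.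
Qed.

Lemma hecke_sl_good p x z : (0 < p)%N -> hecke_at p x (RtoC (INR p ^ (2 * m - 1))) -> 0 < Im z ->
  (csum (fun i => sl m (mk 1 (INR i) 0 (INR p)) f z) p + sl m (mk (INR p) 0 0 1) f z =
  (RtoC (INR p) / RtoC (INR p) ^ m * x) * f z)%C.
Proof.
move=> Hp H Hz; rewrite (hecke_sl Hp H Hz) sl_dilation.
have P0 : 0 < INR p by apply: lt_0_INR; apply/ltP.
have P1 : RtoC (INR p) <> RtoC 0 by move=> E; have := RtoC_inj _ _ E; lra.
have PM := @Cpow_nz (RtoC (INR p)) m P1.
have E : (RtoC (INR p ^ (2 * m - 1)) * RtoC (INR p) = RtoC (INR p) ^ m * RtoC (INR p) ^ m)%C.
  rewrite -!RtoC_pow -!RtoC_mult -pow_add; congr RtoC.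
  rewrite -[X in _ * X = _]pow_1 -pow_add; congr pow.
  move: m0; case: (m) => // k _; rewrite -multE -minusE; lia.
apply: (lincomb (c := (- / RtoC (INR p) ^ m * f (RtoC (INR p) * z))%C) E).
by field.
Qed.

(** All coefficients of even index vanish, and [fourier_hecke] at the point 2z then reads f(z) + f(z
    + 1/2) = 0. *)
Lemma hecke_zero_T : hecke_at 2 (RtoC 0) (RtoC 0) -> fixes m f (mk 1 (/ 2) 0 1) true.
Proof.
move=> H; split; first by dpos.
move=> z Hz; have H2 : 0 < Im (2 * z)%C by rewrite im_scal_l; lra.
have := fourier_hecke Ha (isT : (0 < 2)%N) H2 H.
rewrite sl_affine; last by lra.
rewrite -[csum _ _]/(RtoC 0 + _ + _)%C.
rewrite (_ : INR 2 = 2); last by rewrite /INR; ring.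
rewrite (erefl : INR 0 = 0) (erefl : INR 1 = 1) Cpow_1_l.
rewrite (_ : ((2 * z + 0) / 2)%C = z); last by field.
rewrite (_ : ((2 * z + 1) / 2)%C = ((z + RtoC (/ 2)) / 1)%C); last by rewrite RtoC_inv; [field | lra].
rewrite /sg -/f => E; apply: (lincomb (c := 1%C) E); field.
Qed.

Lemma periodic_fixes : fixes m f (mk 1 1 0 1) false.
Proof.
split; first by dpos.
move=> z Hz; rewrite sl_affine; last by lra.
rewrite Cpow_1_l (_ : ((z + 1) / 1)%C = (z + 1)%C); last by field.
by rewrite /f fourier_periodic /sg; field.
Qed.

Variable N : nat.
Hypothesis HE : forall q, prime q -> hecke_at q (local_trace a m N q) (local_norm m N q).
Hypothesis HW : forall z, 0 < Im z -> sl m (mk 0 (-1) (INR N) 0) f z = f z.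

Lemma hecke_fixes_W : (0 < N)%N -> fixes m f (mk 0 (-1) (IZR (Z.of_nat N)) 0) false.
Proof.
move=> HN; rewrite -INR_IZR_INZ; have N0 : 0 < INR N by apply: lt_0_INR; apply/ltP.
split; first by dpos.
by move=> z Hz; rewrite HW // Cmult_1_l.
Qed.

Lemma Gamma0_levels : N = 18%N \/ N = 20%N \/ N = 24%N -> Gamma0_invariant m (Z.of_nat N) f.
Proof.
have Hf : holH f by exact: fourier_hol Ha.
have I2 : INR 2 = 2 by rewrite /INR; ring.
have I3 : INR 3 = 3 by rewrite /INR; ring.
have I4 : INR 4 = 4 by rewrite /INR; ring.
have I5 : INR 5 = 5 by rewrite /INR; ring.
move=> HN; have HW' := hecke_fixes_W; have HE' := HE.
case: HN => [E|[E|E]]; rewrite E in HE' HW' *.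
- have U := HE' 2%N isT; have V := HE' 3%N isT.
  rewrite /local_trace /local_norm [(_ %| _)%N]/= [(_ %| _)%N]/= in U.
  rewrite /local_trace /local_norm [(_ %| _)%N]/= [(_ %| _)%N]/= in V.
  apply: level18 => //.
  + exact: periodic_fixes.
  + move=> z Hz; have H3 : 0 < Im (3 * z)%C by rewrite im_scal_l; lra.
    have := fourier_hecke Ha (isT : (0 < 3)%N) H3 V.
    rewrite !sl_affine; try lra.
    rewrite -[csum _ _]/(RtoC 0 + _ + _ + _)%C I2 I3 (erefl : INR 0 = 0) (erefl : INR 1 = 1) Cpow_1_l.
    rewrite (_ : ((3 * z + 0) / 3)%C = z); last by field.
    rewrite (_ : ((3 * z + 1) / 3)%C = ((z + RtoC (/ 3)) / 1)%C); last by rewrite RtoC_inv; [field | lra].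
    rewrite (_ : ((3 * z + 2) / 3)%C = ((z + RtoC (2 / 3)) / 1)%C); last by rewrite RtoC_div; [field | lra].
    by rewrite -/f => X; apply: (lincomb (c := 1%C) X); field.
  + exact: HW'.
  + move=> z Hz; have := hecke_sl (isT : (0 < 2)%N) U Hz.
    rewrite -[csum _ _]/(RtoC 0 + _ + _)%C I2 (erefl : INR 0 = 0) (erefl : INR 1 = 1) => X.
    (* At a prime dividing N exactly once the eigenvalue p^(m-1) cancels against the normalization
       of the slash action; this is why the relation at 2 has coefficient 1. *)
    have X2 : (2 / 2 ^ m * 2 ^ (m - 1)%N = RtoC 1)%C.
      rewrite -{1}(subnK m0) addn1 Cpow_S; field; apply: Cpow_nz => Y.
      by have := RtoC_inj _ _ Y; lra.
    rewrite RtoC_pow in X.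
    have -> : f z = ((2 / 2 ^ m * 2 ^ (m - 1)%N) * f z)%C by rewrite X2; ring.
    by apply: (lincomb (c := 1%C) X); ring.
- have U := HE' 2%N isT; have V := HE' 3%N isT.
  rewrite /local_trace /local_norm [(_ %| _)%N]/= [(_ %| _)%N]/= in U.
  rewrite /local_trace /local_norm [(_ %| _)%N]/= in V.
  apply: (level20 (lam := RtoC (INR 3) / RtoC (INR 3) ^ m * a 3%N)%C) => //.
  + exact: hecke_zero_T.
  + exact: HW'.
  + move=> z Hz; have := hecke_sl_good (isT : (0 < 3)%N) V Hz.
    rewrite -[csum _ _]/(RtoC 0 + _ + _ + _)%C I2 I3 (erefl : INR 0 = 0) (erefl : INR 1 = 1) => X.
    by apply: (lincomb (c := 1%C) X); ring.
- have U := HE' 2%N isT; have V := HE' 5%N isT.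
  rewrite /local_trace /local_norm [(_ %| _)%N]/= [(_ %| _)%N]/= in U.
  rewrite /local_trace /local_norm [(_ %| _)%N]/= in V.
  apply: (level24 (lam := RtoC (INR 5) / RtoC (INR 5) ^ m * a 5%N)%C) => //.
  + exact: hecke_zero_T.
  + exact: HW'.
  + move=> z Hz; have := hecke_sl_good (isT : (0 < 5)%N) V Hz.
    rewrite -[csum _ _]/(RtoC 0 + _ + _ + _ + _ + _)%C I2 I3 I4 I5 (erefl : INR 0 = 0) (erefl : INR 1 = 1) => X.
    by apply: (lincomb (c := 1%C) X); ring.
Qed.
End Levels.

(** * Expansions at the cusps *)

(** An argument with a cut along the negative axis. The jump by 2 pi disappears in [Flog], where [F]
    has the matching period, and the bound by pi keeps the logarithm in the strip on which the
    growth of [F] is known. *)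
Definition Carg (w : C) : R :=
  if Rle_dec 0 (Im w) then acos (Re w / Cmod w) else - acos (Re w / Cmod w).

Definition Clog (w : C) : C := (ln (Cmod w), Carg w).

Lemma Carg_bound w : - PI <= Carg w <= PI.
Proof.
have := acos_bound (Re w / Cmod w).
by rewrite /Carg => H; case: Rle_dec => ? /=; lra.
Qed.

Lemma Cexp_Clog (w : C) : w <> 0%C -> Cexp (Clog w) = w.
Proof.
move=> H; have M := Cmod_pos H; have S := Cmod_sq w.
set r := Cmod w in M S *.
have B : -1 <= Re w / r <= 1.
  have := re_le_abs w; have := re_le_abs (- w)%C; rewrite Cmod_opp re_opp -/r => H1 H2.
  split; last by apply: (proj2 (Rle_div_l _ _ _ M)); lra.
  by apply: (proj1 (Rle_div_r _ _ _ M)); lra.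
have Q : 1 - (Re w / r)² = (Im w / r)².
  have U : 1 = (Re w * Re w + Im w * Im w) / (r * r) by rewrite -S; field; lra.
  by rewrite {1}U /Rsqr; field; lra.
rewrite /Cexp /Clog /= -/r exp_ln //.
apply: C_eq => /=; rewrite /Carg -/r; case: Rle_dec => I; rewrite [is_left _]/=; cbv iota.
- by rewrite cos_acos //; field; lra.
- by rewrite cos_neg cos_acos //; field; lra.
- rewrite sin_acos // Q sqrt_Rsqr_abs Rabs_pos_eq; first by field; lra.
  by apply: Rmult_le_pos => //; apply/Rlt_le/Rinv_0_lt_compat.
- rewrite sin_neg sin_acos // Q sqrt_Rsqr_abs Rabs_left; first by field; lra.
  by have := Rinv_0_lt_compat _ M; rewrite /Rdiv; nra.
Qed.

Lemma Cexp_inj (x y : C) : Cexp x = Cexp y -> exists k : Z, x = (y + Ci * RtoC (IZR k * (2 * PI)))%C.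
Proof.
move=> E; have E1 : Re x = Re y.
  by apply: exp_inv; rewrite -!Cmod_Cexp E.
have X := exp_pos (Re y).
have Ec : cos (Im x) = cos (Im y).
  by have := congr1 Re E; rewrite /Cexp /= E1 => /Rmult_eq_reg_l; apply; lra.
have Es : sin (Im x) = sin (Im y).
  by have := congr1 Im E; rewrite /Cexp /= E1 => /Rmult_eq_reg_l; apply; lra.
have C1 : cos (Im x - Im y) = 1.
  by rewrite cos_minus Ec Es; have := sin2_cos2 (Im y); rewrite /Rsqr; lra.
have S0 : sin ((Im x - Im y) / 2) = 0.
  have := cos_2a_sin ((Im x - Im y) / 2).
  rewrite (_ : 2 * ((Im x - Im y) / 2) = Im x - Im y) ?C1; last by field.
  by nra.
have [k Hk] := sin_eq_0_0 _ S0.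
exists k; apply: C_eq; rewrite /=; first by rewrite E1 /Re; ring.
have -> : Im x = Im y + 2 * ((Im x - Im y) / 2) by field.
by rewrite Hk /Im; ring.
Qed.

Lemma atan_small e : 0 < e -> exists d, 0 < d /\ forall t, Rabs t < d -> Rabs (atan t) < e.
Proof.
move=> He; have := proj1 (filterlim_locally _ _) (continuous_atan 0) (mkposreal e He).
move=> [d Hd]; exists d; split=> [|t Ht]; first exact: cond_pos.
have := Hd t; rewrite /ball /= /AbsRing_ball /abs /minus /plus /opp /= atan_0 Ropp_0 !Rplus_0_r.
by apply.
Qed.

Lemma ln_small e : 0 < e -> exists d, 0 < d /\ forall t, Rabs (t - 1) < d -> Rabs (ln t) < e.
Proof.
move=> He; have := proj1 (filterlim_locally _ _) (continuous_ln 1 Rlt_0_1) (mkposreal e He).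
move=> [d Hd]; exists d; split=> [|t Ht]; first exact: cond_pos.
have := Hd t; rewrite /ball /= /AbsRing_ball /abs /minus /plus /opp /= ln_1 Ropp_0 !Rplus_0_r.
by apply.
Qed.

(** A second logarithm, for use near 1: [Clog q + log1 (u / q)] is a branch for u near any q, also
    when q lies on the cut of [Clog]. *)
Definition log1 (w : C) : C := (ln (Cmod w), atan (Im w / Re w)).

Lemma Cexp_log1 w : 0 < Re w -> Cexp (log1 w) = w.
Proof.
move=> Hx; have M : 0 < Cmod w by have := re_le_abs w; lra.
rewrite /Cexp /log1 /= exp_ln //.
have E : sqrt (1 + (Im w / Re w)²) = Cmod w / Re w.
  rewrite -[RHS]sqrt_Rsqr; last by apply/Rlt_le/Rdiv_lt_0_compat.
  congr sqrt; rewrite /Rsqr.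
  have -> : Cmod w / Re w * (Cmod w / Re w) = Cmod w * Cmod w / (Re w * Re w) by field; lra.
  by rewrite Cmod_sq; field; lra.
by apply: C_eq => /=; rewrite ?cos_atan ?sin_atan E; field; lra.
Qed.

Lemma log1_small e : 0 < e -> exists d, 0 < d /\ forall w, Cmod (w - 1) < d ->
  0 < Re w /\ Cmod (log1 w) < e.
Proof.
move=> He; have e2 : 0 < e / 2 by lra.
have [d1 [P1 H1]] := ln_small e2; have [d2 [P2 H2]] := atan_small e2.
exists (Rmin (1 / 2) (Rmin d1 (d2 / 2))); split.
  by do ! apply: Rmin_pos; lra.
move=> w Hw.
have A1 : Cmod (w - 1) < 1 / 2 by apply: Rlt_le_trans Hw (Rmin_l _ _).
have A2 : Cmod (w - 1) < d1.
  by apply: Rlt_le_trans Hw _; apply: Rle_trans (Rmin_r _ _) (Rmin_l _ _).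
have A3 : Cmod (w - 1) < d2 / 2.
  by apply: Rlt_le_trans Hw _; apply: Rle_trans (Rmin_r _ _) (Rmin_r _ _).
have R1 : Re w > 1 / 2.
  have := re_le_abs (- (w - 1))%C; rewrite Cmod_opp.
  by rewrite (_ : Re (- (w - 1)) = 1 - Re w); [lra | rewrite /Re /=; ring].
split; first by lra.
apply: Rle_lt_trans (Cmod_le_Re_Im _) _; rewrite /log1 /=.
have B1 : Rabs (Cmod w - 1) < d1.
  apply: Rle_lt_trans A2; apply: Rabs_le; have := Cmod_rev w 1; have := Cmod_rev 1 w.
  by rewrite Cmod_1 Cmod_sub_sym; lra.
have B2 : Rabs (Im w / Re w) < d2.
  have I : Rabs (Im w) <= Cmod (w - 1).
    by rewrite (_ : Im w = Im (w - 1)); [exact: im_le_Cmod | rewrite /Im /=; ring].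
  rewrite Rabs_mult Rabs_inv (Rabs_pos_eq (Re w)); last by lra.
  apply: (proj2 (Rlt_div_l _ _ _ _)); first by lra.
  by nra.
have := H1 _ B1; have := H2 _ B2; lra.
Qed.

Lemma cderiv_log1 : cderiv log1 1 1.
Proof.
have L1 : log1 1 = 0%C by rewrite /log1 Cmod_1 ln_1 /= (_ : 0 / 1 = 0) ?atan_0 //; field.
(* With h = [log1 w], [Cexp_sub2] gives |w - 1 - h| <= 12 |h|^2. For |h| <= 1/24 this implies |h| <=
   2 |w - 1|, so the error is at most 24 |h| |w - 1|, and |h| <= e/24 finishes. *)
move=> e He; have H0 : 0 < Rmin (1 / 24) (e / 24) by apply: Rmin_pos; lra.
have [d [Hd H]] := log1_small H0.
exists d; split=> // w Hw; have [R1 B] := H w Hw.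
have B1 := Rlt_le_trans _ _ _ B (Rmin_l _ _); have B2 := Rlt_le_trans _ _ _ B (Rmin_r _ _).
have S := Cexp_sub2 (log1 w); rewrite Cexp_log1 // in S.
have X : exp (Cmod (log1 w)) <= 3.
  by apply: Rle_trans exp_le_3; apply: exp_le; lra.
have h0 := Cmod_ge_0 (log1 w).
rewrite L1; set h := log1 w in S X h0 B1 B2 *.
have T : Cmod h <= Cmod (w - 1) + Cmod (w - 1 - h).
  have := Cmod_triangle (w - 1)%C (- (w - 1 - h))%C; rewrite Cmod_opp.
  by rewrite (_ : (w - 1 + - (w - 1 - h))%C = h) //; ring.
have -> : (h - 0 - 1 * (w - 1))%C = (- (w - 1 - h))%C by ring.
rewrite Cmod_opp.
have Y : Cmod (w - 1 - h) <= 12 * Cmod h * Cmod h.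
  by apply: Rle_trans S _; have := Rmult_le_pos _ _ h0 h0; nra.
have w0 := Cmod_ge_0 (w - 1)%C.
have Z : Cmod h <= 2 * Cmod (w - 1) by nra.
by nra.
Qed.

Lemma cser_at_zero (u : nat -> C) : cser (fun n => u n * 0 ^ n)%C (u 0%nat).
Proof.
move=> e He; exists 1%nat => n Hn.
have -> : csum (fun k => u k * 0 ^ k)%C n = u 0%nat.
  case: n Hn => [|n _]; first by lia.
  elim: n => [|n IH]; first by rewrite /=; ring.
  rewrite -[csum _ _]/(csum (fun k => u k * 0 ^ k)%C n.+1 + u n.+1 * 0 ^ n.+1)%C IH Cpow_S; ring.
by rewrite Cmod_subrr.
Qed.

Section Cusp.
Variables (F : C -> C) (N : nat) (K : R) (p : nat).
Hypothesis N0 : (0 < N)%N.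
Hypothesis HF : holH F.
Hypothesis Hper : forall z, 0 < Im z -> F (z + RtoC (INR N))%C = F z.
Hypothesis K0 : 0 <= K.
Hypothesis Hb : forall z, Rabs (Re z) <= INR N -> 1 <= Im z -> Cmod (F z) <= K * Im z ^ p.

Let h := INR N.
(** The number h / (2 pi i): multiplying by it inverts z |-> 2 pi i z / h, so that [Flog] is [F] as
    a function of q. *)
Let kap : C := (0, - (h / (2 * PI))).
Let Flog (q : C) : C := F (kap * Clog q)%C.

Lemma h_pos : 0 < h.
Proof. by apply: lt_0_INR; apply/ltP. Qed.

Lemma Re_kap w : Re (kap * w)%C = h / (2 * PI) * Im w.
Proof. by rewrite /Re /Im /=; ring. Qed.

Lemma Im_kap w : Im (kap * w)%C = - (h / (2 * PI)) * Re w.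
Proof. by rewrite /Re /Im /=; ring. Qed.

Lemma kap_pos : 0 < h / (2 * PI).
Proof. have := PI_RGT_0; have := h_pos => H1 H2; apply: Rdiv_lt_0_compat; lra. Qed.

Lemma periodic_Z (k : Z) z : 0 < Im z -> F (z + RtoC (IZR k * h))%C = F z.
Proof.
have HP : forall n z, 0 < Im z -> F (z + RtoC (INR n * h))%C = F z.
  elim=> [|n IH] w Hw; first by rewrite Rmult_0_l Cplus_0_r.
  rewrite S_INR (_ : (w + RtoC ((INR n + 1) * h))%C = (w + RtoC (INR n * h) + RtoC (INR N))%C); last first.
    by rewrite /h !RtoC_mult RtoC_plus; ring.
  by rewrite Hper ?IH // im_plus im_RtoC Rplus_0_r.
move=> Hz.
have [n [E|E]] : exists n, k = Z.of_nat n \/ k = (- Z.of_nat n)%Z by exists (Z.abs_nat k); lia.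
  by rewrite E -INR_IZR_INZ HP.
rewrite E opp_IZR -INR_IZR_INZ -(HP n (z + _)%C); last by rewrite im_plus im_RtoC Rplus_0_r.
by congr F; rewrite !RtoC_mult RtoC_opp; ring.
Qed.

Lemma Flog_Cexp w : Re w < 0 -> Flog (Cexp w) = F (kap * w)%C.
Proof.
move=> Hw; have [k Hk] := Cexp_inj (Cexp_Clog (@Cexp_neq0 w)).
rewrite /Flog Hk; have P := PI_RGT_0.
have -> : (kap * (w + Ci * RtoC (IZR k * (2 * PI))))%C = (kap * w + RtoC (IZR k * h))%C.
  apply: C_eq; rewrite /Re /Im /=; field; lra.
by apply: periodic_Z; rewrite Im_kap; have := kap_pos; nra.
Qed.

(** By [Flog_Cexp] the value of [Flog] at u may be computed from any logarithm of u with negative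
    real part, in particular from [Clog q + log1 (u / q)], which is differentiable in u at q. *)
Lemma Flog_cderiv (q : C) : q <> 0%C -> Cmod q < 1 -> exists l, cderiv Flog q l.
Proof.
move=> Hq H1; have M := Cmod_pos Hq.
have Ln : ln (Cmod q) < 0 by rewrite -ln_1; apply: ln_increasing.
have He : 0 < - ln (Cmod q) by lra.
have [d [Hd H]] := log1_small He.
have A1 : cderiv (fun u => log1 (/ q * u)%C) q (1 * (/ q * 1))%C.
  apply: (@cderiv_comp (fun u => / q * u)%C log1); first by apply: cderiv_scal; exact: cderiv_id.
  by rewrite Cinv_l //; exact: cderiv_log1.
have A2 : cderiv (fun u => kap * (Clog q + log1 (/ q * u)))%C q (kap * (0 + 1 * (/ q * 1)))%C.
  by apply: cderiv_scal; apply: cderiv_plus; [exact: cderiv_const | exact: A1].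
have Pos u : Cmod (u - q) < d * Cmod q -> 0 < Re (/ q * u)%C /\ Re (Clog q + log1 (/ q * u))%C < 0.
  move=> Hu.
  have B : Cmod (/ q * u - 1)%C < d.
    have -> : (/ q * u - 1)%C = (/ q * (u - q))%C by field.
    rewrite Cmod_mult Cmod_inv // Rmult_comm; exact: (proj2 (Rlt_div_l _ _ _ M)).
  have [R1 R2] := H _ B; split=> //.
  rewrite re_plus; have := re_le_abs (log1 (/ q * u)%C); rewrite {1}/Clog [Re (_, _)]/=; lra.
have dq : 0 < d * Cmod q by nra.
have [l Hl] : exists l, cderiv F (kap * (Clog q + log1 (/ q * q)))%C l.
  apply: HF; rewrite Im_kap.
  have [_ R] := Pos q ltac:(by rewrite Cmod_subrr); have := kap_pos; nra.
have A3 := cderiv_comp A2 Hl.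
eexists; apply: cderiv_ext_loc dq _ A3 => u Hu.
have [R1 R2] := Pos u Hu.
rewrite -Flog_Cexp // Cexp_add Cexp_Clog // Cexp_log1 //.
by congr Flog; field.
Qed.

(** With y proportional to -ln |q|, the growth is K y^p. One factor sqrt |q| absorbs y^p by
    [exp_neg_pow], and the other one tends to 0. *)
Lemma Flog_bound e : 0 < e -> exists d, 0 < d /\ forall q : C, q <> 0%C -> Cmod q < d -> Cmod q * Cmod (Flog q) <= e.
Proof.
move=> He; have P := PI_RGT_0; have Hh := h_pos; have HC := kap_pos.
set B := K * (INR p * (2 * (h / (2 * PI)))) ^ p.
have B0 : 0 <= B.
  by apply: Rmult_le_pos => //; apply: pow_le; apply: Rmult_le_pos; [exact: pos_INR | lra].
set s := e / (B + 1).
have s0 : 0 < s by apply: Rdiv_lt_0_compat; lra.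
exists (Rmin (exp (- / (h / (2 * PI)))) (s * s)); split.
  by apply: Rmin_pos; [exact: exp_pos | nra].
move=> q Hq Hd; have M := Cmod_pos Hq.
have H1 := Rlt_le_trans _ _ _ Hd (Rmin_l _ _); have H2 := Rlt_le_trans _ _ _ Hd (Rmin_r _ _).
set y := - (h / (2 * PI)) * ln (Cmod q).
have Ly : ln (Cmod q) = - (y / (h / (2 * PI))) by rewrite /y; field; lra.
have y1 : 1 <= y.
  have L : ln (Cmod q) < - / (h / (2 * PI)) by rewrite -(ln_exp (- / _)); apply: ln_increasing.
  have : (h / (2 * PI)) * ln (Cmod q) <= (h / (2 * PI)) * - / (h / (2 * PI)).
    by apply: Rmult_le_compat_l; lra.
  rewrite (_ : (h / (2 * PI)) * - / (h / (2 * PI)) = - 1); last by field; lra.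
  by rewrite /y; lra.
have G1 : Cmod (Flog q) <= K * y ^ p.
  have Iy : Im (kap * Clog q)%C = y by rewrite Im_kap.
  rewrite -Iy; apply: Hb; last by rewrite Iy.
  rewrite Re_kap Rabs_mult (Rabs_pos_eq (h / _)); last by lra.
  have A : Rabs (Im (Clog q)) <= PI by apply: Rabs_le; exact: Carg_bound.
  apply: Rle_trans (_ : h / (2 * PI) * PI <= _); first by apply: Rmult_le_compat_l; lra.
  rewrite (_ : h / (2 * PI) * PI = h / 2); last by field; lra.
  rewrite -/h; lra.
set t := exp (- (y / (2 * (h / (2 * PI))))).
have t0 : 0 < t by exact: exp_pos.
have tt : t * t = Cmod q.
  rewrite /t -exp_plus -[RHS]exp_ln // Ly; congr exp; field; lra.
have ts : t < s by nra.
have Y : t * y ^ p <= (INR p * (2 * (h / (2 * PI)))) ^ p.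
  have E : 0 < y / (2 * (h / (2 * PI))) by apply: Rdiv_lt_0_compat; lra.
  have := exp_neg_pow p E; rewrite -/t => X.
  apply: Rle_trans (_ : (INR p / (y / (2 * (h / (2 * PI))))) ^ p * y ^ p <= _).
    by apply: Rmult_le_compat_r => //; apply: pow_le; lra.
  rewrite -Rpow_mult_distr; apply: Req_le; congr pow; field; lra.
apply: Rle_trans (_ : t * B <= _).
  rewrite -tt /B Rmult_assoc; apply: Rmult_le_compat_l; first by lra.
  apply: Rle_trans (_ : t * (K * y ^ p) <= _); first by apply: Rmult_le_compat_l; lra.
  rewrite (_ : t * (K * y ^ p) = K * (t * y ^ p)); last by ring.
  by apply: Rmult_le_compat_l.
apply: Rle_trans (_ : s * (B + 1) <= _); first by apply: Rmult_le_compat; lra.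
by rewrite /s; apply: Req_le; field; lra.
Qed.

(* The factor [q^2] removes the singularity at 0, where [F] is only known to grow polynomially
   in [ln |q|]. *)
Let Fext (q : C) : C := if Ceq_dec q 0 then RtoC 0 else (q * q * Flog q)%C.

Lemma Fext_neq0 (q : C) : q <> 0%C -> Fext q = (q * q * Flog q)%C.
Proof. by rewrite /Fext => N1; case: (Ceq_dec q 0) => [E|] //=; case: N1. Qed.

Lemma Fext_0 : Fext 0 = 0%C.
Proof. by rewrite /Fext; case: (Ceq_dec 0 0) => [E|] //=. Qed.

Lemma Fext_cderiv0 : cderiv Fext 0 0.
Proof.
move=> e He; have [d [Hd H]] := Flog_bound He.
exists d; split=> // w Hw; rewrite Fext_0.
case: (Ceq_dec w 0) => [->|Nw].
  rewrite Fext_0; have -> : (0 - 0 - 0 * (0 - 0))%C = RtoC 0 by ring.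
  have -> : (0 - 0)%C = RtoC 0 by ring.
  rewrite Cmod_0; lra.
have Ew : (w - 0)%C = w by ring.
rewrite Ew in Hw *; rewrite Fext_neq0 // (_ : (_ - 0 - 0 * w)%C = (w * (w * Flog w))%C); last by ring.
rewrite !Cmod_mult [X in _ <= X]Rmult_comm; apply: Rmult_le_compat_l; first exact: Cmod_ge_0.
exact: H.
Qed.

Lemma Fext_hol : hol_disc Fext 1.
Proof.
move=> q H1; case: (Ceq_dec q 0) => [->|N1]; first by eexists; exact: Fext_cderiv0.
have [l Hl] := Flog_cderiv N1 H1; have M := Cmod_pos N1.
have A := cderiv_mult (cderiv_mult (cderiv_id q) (cderiv_id q)) Hl.
eexists; apply: cderiv_ext_loc M _ A => w Hw.
rewrite Fext_neq0 // => E; move: Hw; rewrite E Cmod_sub_sym (_ : (q - 0)%C = q); [lra | ring].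
Qed.

(** [Fext] and its derivative vanish at 0, so its Taylor series starts with q^2, and dividing by q^2
    leaves a power series for F. *)
Lemma fourier_expansion : exists c : nat -> C, forall z, 0 < Im z ->
  cser (fun n => c n * Cexp (2 * PI * Ci * INR n * z / INR N))%C (F z).
Proof.
have [c Hc] := taylor_disc Rlt_0_1 Fext_hol.
have M0 : Cmod 0 < 1 by rewrite Cmod_0; lra.
have c0 : c 0%nat = 0%C by rewrite -Fext_0; apply: cser_unique (cser_at_zero c) (Hc _ M0).
have c1 : c 1%nat = 0%C.
  have [l [D S]] := pow_series_cderiv M0 Hc.
  rewrite (cderiv_unique D Fext_cderiv0) in S.
  have := cser_unique (cser_at_zero (fun n => INR n.+1 * c n.+1)%C) S.
  by rewrite (_ : INR 1 = 1) // Cmult_1_l.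
exists (fun n => c n.+2) => z Hz.
have P := PI_RGT_0; have Hh := h_pos; have HC := kap_pos.
have hC : RtoC h <> RtoC 0 by move=> E; have := RtoC_inj _ _ E; lra.
have pC : RtoC PI <> RtoC 0 by move=> E; have := RtoC_inj _ _ E; lra.
set w := (2 * PI * Ci * z / INR N)%C.
have wE : (kap * w)%C = z.
  have -> : kap = (- Ci * RtoC (h / (2 * PI)))%C by apply: C_eq; rewrite /Re /Im /=; ring.
  rewrite /w -/h RtoC_div; last by lra.
  rewrite RtoC_mult; transitivity (- (Ci * Ci) * z)%C; first by field; repeat split.
  have -> : (Ci * Ci = - (1))%C by apply: C_eq; rewrite /Re /Im /=; ring.
  by ring.
have Rw : Re w < 0.
  have : Im (kap * w)%C > 0 by rewrite wE.
  by rewrite Im_kap; nra.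
have q1 : Cmod (Cexp w) < 1 by rewrite Cmod_Cexp -exp_0; apply: exp_increasing.
have qn := @Cexp_neq0 w.
have := Hc _ q1; rewrite Fext_neq0 // Flog_Cexp // wE => S.
have S1 := proj1 (cser_shift _ _) S.
have S2 := proj1 (cser_shift _ _) S1.
have := @cser_scal (/ (Cexp w * Cexp w))%C _ _ S2.
rewrite c0 c1 (_ : (/ (Cexp w * Cexp w) * _)%C = F z); last by field; exact: qn.
apply: cser_ext => n.
have -> : (2 * PI * Ci * INR n * z / INR N = INR n * w)%C by rewrite /w -/h; field.
rewrite -Cexp_pow !Cpow_S; field; exact: qn.
Qed.
End Cusp.

(** * Periodicity and growth of the translates by SL_2(Z) *)

Definition real_mat (g : mat2Z) : M2 := mk (IZR (ma g)) (IZR (mb g)) (IZR (mc g)) (IZR (md g)).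

Lemma det_real_mat g : SL2Z g -> det (real_mat g) = 1.
Proof. by move=> E; rewrite /det /real_mat; cbn [e11 e12 e21 e22]; rewrite -!mult_IZR -minus_IZR E. Qed.

Lemma slash_sl m g F z : SL2Z g -> slash (2 * m) g F z = sl m (real_mat g) F z.
Proof.
move=> E; rewrite /slash /sl (det_real_mat E) Cpow_1_l /mob /jfac /real_mat; cbn [e11 e12 e21 e22].
by rewrite /Cdiv Cmult_1_l.
Qed.

Section Cusps.
Variables (a : nat -> C) (M : R) (j m N : nat).
Hypothesis Ha : poly_bounded a M j.
Hypothesis N0 : (0 < N)%N.
Let f := fourier_series a.
Hypothesis Hinv : Gamma0_invariant m (Z.of_nat N) f.
Variable g : mat2Z.
Hypothesis Hg : SL2Z g.
Let G := real_mat g.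

Lemma cusp_periodic z : 0 < Im z -> sl m G f (z + RtoC (INR N))%C = sl m G f z.
Proof.
move=> Hz; have D := det_real_mat Hg.
have DG : 0 < det G by rewrite D; lra.
have -> : sl m G f (z + RtoC (INR N))%C = sl m (mk 1 (INR N) 0 1) (sl m G f) z.
  rewrite sl_affine; last by lra.
  rewrite Cpow_1_l (_ : ((z + INR N) / 1)%C = (z + RtoC (INR N))%C); last by field.
  by field.
(* The entries of g (1 N; 0 1) g^(-1) = (1 - a c N, a^2 N; -c^2 N, 1 + a c N), which lies in
   Gamma_0(N). *)
set x := (ma g * mc g * Z.of_nat N)%Z; set y := (ma g * ma g * Z.of_nat N)%Z.
set c' := (- mc g * mc g)%Z.
have E : ((1 - x) * (1 + x) - y * (Z.of_nat N * c') = 1)%Z by rewrite /x /y /c'; ring.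
set A := mk (IZR (1 - x)) (IZR y) (IZR (Z.of_nat N * c')) (IZR (1 + x)).
have DA : 0 < det A.
  rewrite /det /A; cbn [e11 e12 e21 e22]; rewrite -!mult_IZR -minus_IZR E; lra.
have DT : 0 < det (mk 1 (INR N) 0 1) by dpos.
rewrite -(sl_mul m f DG DT Hz).
have -> : mmul G (mk 1 (INR N) 0 1) = mmul A G.
  have Dr : IZR (ma g) * IZR (md g) - IZR (mb g) * IZR (mc g) = 1.
    by rewrite -!mult_IZR -minus_IZR Hg.
  rewrite /mmul /A /G /real_mat /x /y /c'; cbn [e11 e12 e21 e22].
  rewrite ?(plus_IZR, minus_IZR, mult_IZR, opp_IZR) -INR_IZR_INZ.
  move: Dr; move: (IZR (ma g)) (IZR (mb g)) (IZR (mc g)) (IZR (md g)) (INR N) => p q r s n Dr.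
  f_equal; try ring.
  - transitivity (q + p * n * (p * s - q * r)); [rewrite Dr; ring | ring].
  - transitivity (s + r * n * (p * s - q * r)); [rewrite Dr; ring | ring].
rewrite sl_mul //; apply: sl_ext => // w Hw; exact: Hinv E _ Hw.
Qed.

Lemma jfac_ge1 z : 1 <= Im z -> 1 <= Cmod (jfac G z).
Proof.
move=> Hz; have Hg' : (ma g * md g - mb g * mc g = 1)%Z := Hg.
rewrite /jfac /G /real_mat; cbn [e21 e22].
have IZ1 k : (k <> 0)%Z -> 1 <= Rabs (IZR k).
  move=> K; rewrite -abs_IZR; apply: IZR_le; lia.
have [C0|C0] := Z.eq_dec (mc g) 0.
  have D0 : (md g <> 0)%Z by move=> D; move: Hg'; rewrite D C0; lia.
  rewrite C0 (_ : (0 * z + IZR (md g))%C = RtoC (IZR (md g))); last by ring.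
  by rewrite Cmod_R; exact: IZ1.
apply: Rle_trans (im_le_Cmod _).
rewrite im_plus im_RtoC Rplus_0_r im_scal_l Rabs_mult (Rabs_pos_eq (Im z)); last by lra.
have := IZ1 _ C0; nra.
Qed.

(** f is O(y^(-p)) and g z has imaginary part Im z / J^2 with J = |c z + d|. On a strip of bounded
    real part J is at most B Im z, so f(g z) grows at most polynomially; the automorphy factor is
    harmless because J >= 1. *)
Lemma cusp_bound : exists K p, 0 <= K /\ forall z, Rabs (Re z) <= INR N -> 1 <= Im z ->
  Cmod (sl m G f z) <= K * Im z ^ p.
Proof.
have D := det_real_mat Hg; have DG : 0 < det G by rewrite D; lra.
have M0 : 0 <= M by case: Ha.
set p := (j + 2)%N; have P := PI_RGT_0.
set B := Rabs (IZR (mc g)) * (INR N + 1) + Rabs (IZR (md g)).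
have NN := pos_INR N.
have B0 : 0 <= B.
  have := Rabs_pos (IZR (md g)); have := Rabs_pos (IZR (mc g)); rewrite /B; nra.
set K := 2 * (M * (INR p / (2 * PI)) ^ p).
have K0 : 0 <= K.
  apply: Rmult_le_pos; first by lra.
  apply: Rmult_le_pos => //; apply: pow_le; apply: Rdiv_le_0_compat; [exact: pos_INR | lra].
exists (K * (B * B) ^ p), (p + p)%coq_nat; split.
  by apply: Rmult_le_pos => //; apply: pow_le; nra.
move=> z Hx Hy; have Hz : 0 < Im z by lra.
have J1 := jfac_ge1 Hy; set J := Cmod (jfac G z) in J1 *.
have JB : J <= B * Im z.
  apply: Rle_trans (Cmod_le_Re_Im _) _.
  rewrite /jfac /G /real_mat; cbn [e21 e22].
  rewrite re_plus im_plus im_RtoC re_RtoC Rplus_0_r im_scal_l re_scal_l.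
  have T := Rabs_triang (IZR (mc g) * Re z) (IZR (md g)).
  rewrite !Rabs_mult (Rabs_pos_eq (Im z)) in T *; last by lra.
  have c0 := Rabs_pos (IZR (mc g)); have d0 := Rabs_pos (IZR (md g)).
  have U : Rabs (IZR (mc g)) * Rabs (Re z) <= Rabs (IZR (mc g)) * INR N * Im z.
    rewrite Rmult_assoc; apply: Rmult_le_compat_l => //; nra.
  by rewrite /B; nra.
have Iw := Im_mob DG Hz; have Hw := mob_H DG Hz; rewrite D Rmult_1_l -/J in Iw.
rewrite /sl D Cpow_1_l Cmod_mult.
have j0 := jfac_neq0 DG Hz.
have F1 : Cmod (1 / jfac G z ^ (2 * m))%C <= 1.
  rewrite Cmod_div ?Cmod_1 ?Cmod_pow -?/J; last exact: Cpow_nz.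
  have X : 1 <= J ^ (2 * m) by apply: pow_R1_Rle.
  by apply: (proj2 (Rle_div_l _ _ _ _)); lra.
have F2 := fourier_bound Ha (leqnn _) Hw; rewrite -/p /fbound Iw in F2.
have F3 : / (Im z / (J * J)) ^ p <= (B * B) ^ p * Im z ^ (p + p)%coq_nat.
  rewrite (pow_add (Im z) p p) -!Rpow_mult_distr -pow_inv; apply: pow_incr.
  have -> : / (Im z / (J * J)) = J * J / Im z by field; lra.
  split; first by apply: Rdiv_le_0_compat; nra.
  apply: (proj2 (Rle_div_l _ _ _ Hz)).
  have : J * J <= (B * Im z) * (B * Im z) by apply: Rmult_le_compat; lra.
  have : 0 <= B * Im z by lra.
  by move=> X Y; have := Rle_0_sqr (B * Im z); rewrite /Rsqr; nra.
apply: Rle_trans (_ : 1 * Cmod (f (mob G z)) <= _).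
  by apply: Rmult_le_compat_r => //; exact: Cmod_ge_0.
rewrite Rmult_1_l; apply: Rle_trans F2 _.
rewrite -Rmult_assoc -/K Rmult_assoc; apply: Rmult_le_compat_l => //.
Qed.

Lemma cusp_holomorphic : holomorphic_at_infinity (slash (2 * m) g f).
Proof.
have DG : 0 < det G by rewrite (det_real_mat Hg); lra.
have [K [p [K0 HK]]] := cusp_bound.
have HF : holH (sl m G f) by apply: sl_hol DG _; exact: fourier_hol Ha.
have [c Hc] := fourier_expansion N0 HF cusp_periodic K0 HK.
exists N, c; split=> // z Hz.
rewrite (slash_sl m f z Hg); apply: (proj1 (cserP _ _)); exact: Hc.
Qed.

End Cusps.
Unset Implicit Arguments.

Theorem theorem2p4 (a : nat -> C) (sigma : R) (k N : nat) (Lambda : C -> C)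
  (hsigma : (0 < sigma)%R)
  (ha : exists M : R, forall n : nat, (0 < n)%N ->
          (Cmod (a n) <= M * Rpower (INR n) sigma)%R)
  (hk0 : (0 < k)%N) (hk : ~~ odd k)
  (hN : N = 18%N \/ N = 20%N \/ N = 24%N)
  (hEuler : forall s : C, (sigma + 1 < Re s)%R ->
     exists P Q : C,
       is_prime_prod (fun p => ~~ (p %| N)%N)
         (fun p => / (1 - a p * cpow (INR p) (- s)
                      + cpow (INR p) (INR k - 1 - 2 * s)))%C P /\
       is_prime_prod (fun p => (p %| N)%N && ~~ (p ^ 2 %| N)%N)
         (fun p => / (1 - cpow (INR p) (INR k / 2 - 1 - s)))%C Q /\
       dirichlet_series a s = (P * Q)%C)
  (hLambda : forall s : C, (sigma + 1 < Re s)%R ->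
     Lambda s = (GammaC s * dirichlet_series a s)%C)
  (hentire : entire Lambda)
  (hbounded : bounded_on_vertical_strips Lambda)
  (hfunc : forall s : C,
     Lambda s = ((- 1) ^ (k./2) * cpow (INR N) (INR k / 2 - s)
                 * Lambda (INR k - s))%C) :
  modular_form k (Gamma0 N) (fourier_series a).
Proof.
have [M [j [Ha Hj]]] := poly_bounded_of_power ha.
move: hk0 hEuler hfunc; set m := k./2.
(* Evenness of the weight enters here; the slash action [sl] is written in terms of m = k/2. *)
have -> : k = (2 * m)%N by rewrite /m mul2n -[LHS]odd_double_half (negbTE hk).
move=> hk0 hEuler hfunc.
have m0 : (0 < m)%N by move: hk0; rewrite mul2n double_gt0.
have N0 : (0 < N)%N by case: hN => [->|[->|->]].
have HW := hecke Ha Hj N0 hLambda hentire hbounded hfunc.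
have HE := euler_coefs Ha m0 hEuler.
have Hinv : Gamma0_invariant m (Z.of_nat N) (fourier_series a).
  apply: (Gamma0_levels Ha m0 _ HW hN) => q Hq l Hl; exact: HE.
split.
- move=> z Hz; apply: (proj2 (holoP _ _)); exact: fourier_hol Ha _ Hz.
- move=> g [Hg [c Hc]] z Hz; rewrite (slash_sl m _ z Hg) /real_mat Hc.
  rewrite Z.mul_comm; apply: Hinv Hz.
  by move: Hg; rewrite /SL2Z Hc => <-; ring.
- move=> g Hg; exact: (cusp_holomorphic Ha N0 Hinv Hg).
Qed.
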